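(* Let $0<p<1$, $q=1-p$, $\lambda=1+\frac{2}{pq}$. For $n\ge0$ let $\Delta_n$ be the discrete graph Laplacian at level $n$ of the double $pq$-model, let $|V_n|$ be the number of vertices at level $n$, and let $\det\Delta_n$ denote the product of the nonzero eigenvalues of $-\Delta_n$ counted with multiplicity. Let $\mathcal{L}=\lim_{n\to\infty}\lambda^n(-\Delta_n)$ be the Laplacian of the double $pq$-model and $\det\mathcal{L}$ its regularized determinant. Then for every $n$ $$\log\det\Delta_n=|V_n|\left(\log 2+\frac{\log(pq)}{2}\right)+n\log\frac{(1-q^2)(1-p^2)}{(pq)^2}+\log\det\mathcal{L}.$$
   Context: The $pq$-model on $[0,1]$: put $r_1=r_3=\frac{p}{1+p}$, $r_2=\frac{q}{1+p}$, $m_1=m_3=\frac{q}{1+q}$, $m_2=\frac{p}{1+q}$, and $F_i(x)=r_ix+(1-r_i)p_i$ with fixed points $p_1=0$, $p_2=\frac12$, $p_3=1$. Then $[0,1]=\bigcup_iF_i([0,1])$; the level-$0$ vertex set is $\{0,1\}$, the level-$n$ vertex set is the union of the images of the level-$(n-1)$ vertex set under $F_1,F_2,F_3$, with consecutive points adjacent. The measure $\mu$ is the unique self-similar probability measure $\mu=\sum_jm_j\,\mu\circ F_j^{-1}$. At an interior level-$n$ point $x_k$ (points listed in increasing order), the discrete Laplacian is $\Delta_nf(x_k)=2pf(x_{k-1})+2qf(x_{k+1})-2f(x_k)$ or $\Delta_nf(x_k)=2qf(x_{k-1})+2pf(x_{k+1})-2f(x_k)$; that is, $\Delta_n=2(P_n-I)$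 where $P_n$ is the nearest-neighbour random walk whose transition probabilities from $x_k$ to its two neighbours are $p,q$ in the order making them inversely proportional to the lengths of the adjacent intervals. Double $pq$-model: two copies of this model are glued at the two boundary points $0$ and $1$ (copy of $0$ with copy of $0$, copy of $1$ with copy of $1$). The level-$n$ vertex set $V_n$ then has $|V_n|=2\cdot3^n$ points arranged in a cycle; $\Delta_n$ is given by the same formulas at interior points of each copy, and at each of the two glued points $x$ by $\Delta_nf(x)=f(x')+f(x'')-2f(x)$, with $x',x''$ the neighbours of $x$ in the two copies (for $n=0$: the two glued points are each other's neighbour in both copies). The Laplacian is $\mathcal{L}=-\Delta_\mu$ with $\Delta_\mu f(x)=\lim_{n\to\infty}\lambda^n\Delta_nf(x)$; it is a non-negative self-adjoint operator with discrete spectrum, and if $0=\lambda_1(-\Delta_n)\le\lambda_2(-\Delta_n)\le\cdots$ are the eigenvalues of $-\Delta_n$ with multiplicity, then the eigenvalues of $\mathcal{L}$ with multiplicity are $\lambda_k=\lim_{n\to\infty}\lambda^n\lambda_k(-\Delta_n)$. Spectral zeta function and regularized determinant: $\zeta_{\mathcal{L}}(s)$ is the sum of $\nu^{-s}$ over all nonzero eigenvalues $\nu$ of $\mathcal{L}$ counted with multiplicity, for $\mathrm{Re}(s)$ large, and its meromorphic continuation to $\mathbb{C}$ otherwise. The regularized determinant is $\det\mathcal{L}=e^{-\zeta_{\mathcal{L}}'(0)}$. *)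

(* Defs.v *)
From HB Require Import structures.
From mathcomp Require Import all_boot all_order all_algebra.
From mathcomp Require Import polyrcf complex.
From mathcomp Require Import all_classical all_reals all_analysis.

Set Implicit Arguments.
Unset Strict Implicit.
Unset Printing Implicit Defensive.

Import Order.TTheory GRing.Theory Num.Theory numFieldNormedType.Exports.

Local Open Scope classical_set_scope.
Local Open Scope ring_scope.
Local Open Scope complex_scope.

(* p and q stay independent parameters here; they are meant for 0 < p < 1 and
   q = 1 - p. *)
Section DoublePQModel.
Variable R : realType.
Variables p q : R.

(* The maps are numbered 0, 1, 2. *)
Definition contraction_ratio (i : 'I_3) : R :=
  if i == 1%N :> nat then q / (1 + p) else p / (1 + p).

Definition fixed_point (i : 'I_3) : R := i%:R / 2.

Definition ifs_map (i : 'I_3) (x : R) : R :=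
  contraction_ratio i * x + (1 - contraction_ratio i) * fixed_point i.

(* The level-n vertices of [0,1], in increasing order. *)
Fixpoint vertices (n : nat) : seq R :=
  if n is n'.+1 then
    sort <=%R (undup (flatten
      [seq [seq ifs_map i x | x <- vertices n'] | i <- enum 'I_3]))
  else [:: 0; 1].

(* The cycle V_n is indexed by 'I_(nverts n): the indices 0, ..., 3^n run
   through the first copy of [0,1] from 0 to 1, and the remaining ones run
   through the interior vertices of the second copy from 1 back to 0.  The two
   glued points have the indices 0 and 3^n. *)
Definition nverts (n : nat) : nat := (2 * 3 ^ n)%N.

Definition vcopy n (i : 'I_(nverts n)) : bool := (3 ^ n < i)%N.

Definition vpos n (i : 'I_(nverts n)) : R :=
  nth 0 (vertices n) (if (i <= 3 ^ n)%N then i : nat else (nverts n - i)%N).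

Definition glued n (i : 'I_(nverts n)) : bool :=
  (i == 0 :> nat)%N || (i == 3 ^ n :> nat)%N.

(* At a non-glued vertex, the neighbours before and after are visited with
   probabilities (p, q) if p : q = (1 / length before) : (1 / length after),
   and with probabilities (q, p) otherwise. *)
Definition discrete_laplacian n (u : 'I_(nverts n) -> R) (i : 'I_(nverts n)) : R :=
  let before := ord_pred i in
  let after := ordS i in
  if glued i then u before + u after - 2 * u i
  else if p * `|vpos i - vpos before| == q * `|vpos after - vpos i|
  then 2 * p * u before + 2 * q * u after - 2 * u i
  else 2 * q * u before + 2 * p * u after - 2 * u i.

Definition neg_laplacian_mx n : 'M[R]_(nverts n) :=
  \matrix_(i, j) - discrete_laplacian (fun k => (k == j)%:R) i.

(* All the eigenvalues of - Delta_n are real, so that the real roots of the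
   characteristic polynomial give the whole spectrum. *)
Definition det_laplacian (n : nat) : R :=
  let chi := char_poly (neg_laplacian_mx n) in
  \prod_(x <- rootsR chi | x != 0) x ^+ mup x chi.

(* A function on the double interval is a pair of functions on [0,1], indexed by
   the copy, that agree at the endpoints; values outside [0,1] are irrelevant. *)
Definition continuous_on_double (f : bool -> R -> R) : Prop :=
  [/\ forall b, {within `[0, 1], continuous (f b)},
      f false 0 = f true 0 & f false 1 = f true 1].

Definition restrict n (f : bool -> R -> R) (i : 'I_(nverts n)) : R :=
  f (vcopy i) (vpos i).

Definition lambda : R := 1 + 2 / (p * q).

(* L f = g, for L = - Delta_mu.  As usual for Laplacians on self-similar sets,
   the limit defining Delta_mu f is uniform over the vertices and g is
   continuous (the pointwise limit alone would, e.g., vanish for a piecewise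
   linear f with kinks off the vertices when p = q). *)
Definition is_laplacian (f g : bool -> R -> R) : Prop :=
  [/\ continuous_on_double f, continuous_on_double g &
      forall e : R, 0 < e -> \forall n \near \oo, forall i : 'I_(nverts n),
        `|lambda ^+ n * - discrete_laplacian (restrict f) i - restrict g i| < e].

Definition eigenfunction (x : R) (f : bool -> R -> R) : Prop :=
  is_laplacian f (fun b t => x * f b t).

(* The space of the solutions of L f = x f has dimension m (it is 0 if x is not
   an eigenvalue). *)
Definition has_multiplicity (x : R) (m : nat) : Prop :=
  exists e : 'I_m -> bool -> R -> R,
    [/\ forall k, eigenfunction x (e k),
        forall c : 'I_m -> R,
          (forall b t, 0 <= t <= 1 -> \sum_k c k * e k b t = 0) ->
          forall k, c k = 0
      & forall f, eigenfunction x f -> exists c : 'I_m -> R,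
          forall b t, 0 <= t <= 1 -> f b t = \sum_k c k * e k b t].

(* nu lists the eigenvalues of L with multiplicity, in nondecreasing order. *)
Definition is_spectrum (nu : nat -> R) : Prop :=
  {homo nu : j k / (j <= k)%N >-> j <= k} /\
  forall x : R, exists s : seq nat,
    [/\ uniq s, forall k, k \in s <-> nu k = x & has_multiplicity x (size s)].

(* R[i]^o is R[i] seen as a normed module over itself: limits and derivatives
   are the complex ones. *)
Notation C := ((R[i])^o).

Definition cexp (z : C) : C :=
  (expR (complex.Re z))%:C * (cos (complex.Im z) +i* sin (complex.Im z)).

(* x to the power s, for x > 0 *)
Definition cpow (x : R) (s : C) : C := cexp (s * (ln x)%:C).

Definition power_series (c : nat -> C) (z : C) : nat -> C :=
  series (fun j => c j * z ^+ j).

Definition analytic_at (Z : C -> C) (a : C) : Prop :=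
  exists c : nat -> C,
    \forall s \near a, power_series c (s - a) @ \oo --> Z s.

Definition pole_at (Z : C -> C) (a : C) : Prop :=
  exists (k : nat) (c : nat -> C), [/\ (0 < k)%N, c 0%N != 0 &
    \forall s \near a^', power_series c (s - a) @ \oo --> (s - a) ^+ k * Z s].

Definition meromorphic (Z : C -> C) : Prop :=
  forall a, analytic_at Z a \/ pole_at Z a.

Definition is_spectral_zeta (Z : C -> C) : Prop :=
  meromorphic Z /\
  exists2 nu, is_spectrum nu & exists sigma : R, forall s : C,
    sigma < complex.Re s ->
    series (fun k => if nu k == 0 then 0 else cpow (nu k) (- s)) @ \oo --> Z s.

Definition is_regularized_det (D : R) : Prop :=
  exists Z : C -> C, exists2 d : C, is_spectral_zeta Z /\ is_derive (0 : C) (1 : C) Z d &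
    D%:C = cexp (- d).

End DoublePQModel.

(* Main.v *)
Require Import Defs.
From HB Require Import structures.
From mathcomp Require Import all_boot all_order all_algebra.
From mathcomp Require Import perm polyrcf complex ring lra zify.
From mathcomp Require Import all_classical all_reals all_analysis measurable_realfun.
Set Implicit Arguments.
Unset Strict Implicit.
Unset Printing Implicit Defensive.
Import Order.TTheory GRing.Theory Num.Theory numFieldNormedType.Exports.
Local Open Scope classical_set_scope.
Local Open Scope ring_scope.
Local Open Scope complex_scope.

(** Write W (w) = w (w^2 - 1 + pq) / (pq).  Eliminating the two interior vertices
    of every cell turns an eigenvalue w of the random walk of level n + 1 into the
    eigenvalue W w of the walk of level n; with multiplicities, this is the Schur
    complement det (w - P_(n+1)) = (pq)^|V_n| det (W w - P_n).  Since W 1 = 1 and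
    W' (1) = lambda, the product of the nonzero eigenvalues satisfies a recursion
    with the solution det Delta_n = 2^|V_n| lambda^n (pq)^(3^n - 1)
    (det_laplacianE).  As lambda = (1 - q^2) (1 - p^2) / (pq)^2, the formula of
    the theorem amounts to det L = 1 / (pq), that is to zeta' (0) = ln (pq)
    (regularized_detE).

    The spectrum of L.  The eigenvalues nu_k are the limits of the rescaled
    2 lambda^n (1 - s_n(k)), where s_n(k) is the k-th eigenvalue of P_n.  The
    function Phi with W (Phi (x / lambda)) = Phi x and Phi x = 1 - x / 2 + O(x^2)
    linearizes W at 1, and nu_k = x exactly when s_n(k) = Phi (x / lambda^n) for
    large n (nu_eq).  An eigenfunction f of L for x restricts to an eigenvector of
    P_n for Phi (x / lambda^n), because the errors in the limit defining
    L f vanish faster than decimation amplifies them (eigenfunction_walk).  Conversely such an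
    eigenvector extends to all finer levels; the extension is uniformly Lipschitz
    and so gives an eigenfunction (eigenfunction_extension).  Hence the
    multiplicities agree and nu is the spectrum of L (is_spectrum_nu), the only
    one (spectrum_unique).

    The zeta function.  Let phi (u) be the sum over k >= 1 of ln (1 + e^u / nu_k).
    Taking the limit of the recursion for the characteristic polynomials, the
    function Y = exp (u + phi (u)) satisfies
      Y (u + ln lambda) = Y (Y + 1 - p^2) (Y + 1 - q^2) / (pq)^2   (decimation),
    which means, with K = ln lambda + 2 ln (pq),
      phi (u + ln lambda) = 3 phi (u) + 2 u - K + epsilon (u),
    where epsilon decreases faster than every exponential.  For 1/2 < s < 1 the
    integral of e^(-su) phi (u) over the line is zeta (s) M (s), where M is the
    transform of ln (1 + e^u) and has the expansion 1 / s^2 + O(1) at 0.  The part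
    over u < 0 is a sum of simple poles at the positive integers.  The functional
    equation determines the part J over u > 0:
      J (1 - 3 lambda^(-s)) = A (s) + lambda^(-s) (2 / s^2 - K / s + E (s)),
    with A and E entire (mellin_identity).  All these functions of s are
    meromorphic on the plane and so is zeta = N / M, where N is the sum of the two
    parts; comparing the expansions at 0 gives
    zeta (s) = - 1 + ln (pq) s + O(s^2) (continuation, zeta_continuation).
    Every other meromorphic function that extends the Dirichlet series agrees with
    this one near 0 by the identity theorem.

    Analytic functions of a complex variable are handled as germs of absolutely
    convergent power series with the sums, products, inverses and the change of
    centre that the argument needs. *)

(** * Absolutely convergent complex series *)

Section ComplexSums.
Variable R : realType.
Implicit Types (z w : R[i]) (u v : nat -> R[i]) (x : nat -> nat -> R[i]).

Lemma geom_le2 (t : R) m : 0 <= t <= 2^-1 -> \sum_(k < m) t ^+ k <= 2.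
Proof.
move=> /andP[t0 t1].
have E : (1 - t) * \sum_(k < m) t ^+ k = 1 - t ^+ m.
  by rewrite -opprB -(opprB _ 1) mulNr -subrX1.
have T : 0 <= t ^+ m by apply: exprn_ge0.
have S : 0 <= \sum_(k < m) t ^+ k by apply: sumr_ge0 => k _; apply: exprn_ge0.
move: E T S; move: (\sum_(k < m) _) (_ ^+ m) => X Y; nra.
Qed.

Definition cabs z : R := ComplexField.Normc.normc z.
Arguments cabs : simpl never.

Lemma cabsE z : cabs z = Num.sqrt (complex.Re z ^+ 2 + complex.Im z ^+ 2).
Proof. by case: z. Qed.
Lemma normC_cabs (z : R[i]^o) : `|z| = (cabs z)%:C. Proof. by []. Qed.
Lemma cabs0 : cabs 0 = 0. Proof. exact: ComplexField.Normc.normc0. Qed.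
Lemma cabs1 : cabs 1 = 1. Proof. exact: ComplexField.Normc.normc1. Qed.
Lemma cabs0_eq0 z : cabs z = 0 -> z = 0.
Proof. exact: ComplexField.Normc.eq0_normc. Qed.
Lemma cabs_ge0 z : 0 <= cabs z. Proof. by rewrite cabsE sqrtr_ge0. Qed.
Lemma cabs_gt0 z : (0 < cabs z) = (z != 0).
Proof.
rewrite lt0r cabs_ge0 andbT; congr (~~ _); apply/eqP/eqP => [/cabs0_eq0//|->].
exact: cabs0.
Qed.
Lemma cabsM z w : cabs (z * w) = cabs z * cabs w.
Proof. exact: ComplexField.Normc.normcM. Qed.
Lemma cabsV z : cabs z^-1 = (cabs z)^-1.
Proof. exact: ComplexField.Normc.normcV. Qed.
Lemma cabsD z w : cabs (z + w) <= cabs z + cabs w.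
Proof. exact: le_normcD. Qed.
Lemma cabsN z : cabs (- z) = cabs z.
Proof. exact: normcN. Qed.
Lemma cabsB z w : cabs (z - w) = cabs (w - z).
Proof. by rewrite -cabsN opprB. Qed.
Lemma cabsX z n : cabs (z ^+ n) = cabs z ^+ n.
Proof. by elim: n => [|n IH]; rewrite ?expr0 ?cabs1// !exprS cabsM IH. Qed.
Lemma cabsR (r : R) : cabs r%:C = `|r|.
Proof. by rewrite cabsE /= expr0n addr0 sqrtr_sqr. Qed.
Lemma cabs_sum (I : Type) (s : seq I) (F : I -> R[i]) :
  cabs (\sum_(k <- s) F k) <= \sum_(k <- s) cabs (F k).
Proof.
elim: s => [|a s IH]; first by rewrite !big_nil cabs0.
by rewrite !big_cons (le_trans (cabsD _ _))// lerD2l.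
Qed.
Lemma cabs_triB z w t : cabs (z - t) <= cabs (z - w) + cabs (w - t).
Proof. by rewrite -[z - t](subrKA w) cabsD. Qed.
Lemma cabs_Re z : `|complex.Re z| <= cabs z.
Proof. by rewrite cabsE -sqrtr_sqr ler_wsqrtr// lerDl sqr_ge0. Qed.
Lemma cabs_Im z : `|complex.Im z| <= cabs z.
Proof. by rewrite cabsE -sqrtr_sqr ler_wsqrtr// lerDr sqr_ge0. Qed.
Lemma cabs_ReIm z : cabs z <= `|complex.Re z| + `|complex.Im z|.
Proof.
rewrite cabsE -(ler_pXn2r (n := 2)) ?nnegrE ?sqrtr_ge0 ?addr_ge0//.
rewrite sqr_sqrtr ?addr_ge0 ?sqr_ge0// sqrrD !real_normK ?num_real// -addrA.
by rewrite lerD2l lerDr mulrn_wge0// mulr_ge0.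
Qed.
Lemma cabs_le_eq0 z : (forall e : R, 0 < e -> cabs z <= e) -> z = 0.
Proof.
move=> H; apply: cabs0_eq0; apply/eqP; rewrite eq_le cabs_ge0 andbT.
by apply/ler_addgt0Pl => e /H; rewrite addr0.
Qed.

(** Convergence is phrased with real radii, which spares the partial order of
    the complex numbers. *)
Definition ccvg u (l : R[i]) :=
  forall e : R, 0 < e -> exists N, forall n, (N <= n)%N -> cabs (u n - l) <= e.

Lemma cvgC_ccvg (u : nat -> R[i]^o) (l : R[i]^o) :
  (u @ \oo --> l) <-> ccvg u l.
Proof.
split=> [/cvgrPdist_le H e e0|H].
  have e0' : (0 : R[i]) < e%:C by rewrite ltcR.
  have [N _ HN] := H _ e0'; exists N => n /HN /=.
  by rewrite normC_cabs cabsB lecR.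
apply/cvgrPdist_le => e e0; have eE : e = (complex.Re e)%:C.
  by apply/eqP; rewrite eq_complex /= eqxx; move: e0; case: (e) => a b;
     rewrite ltcE /= => /andP[].
have e0' : 0 < complex.Re e by rewrite -ltcR -eE.
have [N HN] := H _ e0'; exists N => // n /HN /=.
by rewrite normC_cabs cabsB eE lecR.
Qed.

Lemma ccvg_unique u l l' : ccvg u l -> ccvg u l' -> l = l'.
Proof.
move=> H H'; apply/eqP; rewrite -subr_eq0; apply/eqP/cabs_le_eq0 => e e0.
have e20 : 0 < e / 2 by rewrite divr_gt0.
have [N HN] := H _ e20; have [N' HN'] := H' _ e20.
have := cabs_triB l (u (maxn N N')) l'.
move/le_trans; apply; rewrite [leRHS]splitr lerD//.
  by rewrite cabsB; apply: HN; rewrite leq_maxl.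
by apply: HN'; rewrite leq_maxr.
Qed.

Lemma ccvg_ReIm u (a b : R) :
  (fun n => complex.Re (u n)) @ \oo --> a -> (fun n => complex.Im (u n)) @ \oo --> b ->
  ccvg u (a +i* b).
Proof.
move=> /cvgrPdist_le Ha /cvgrPdist_le Hb e e0.
have e20 : 0 < e / 2 by rewrite divr_gt0.
have [N _ HN] := Ha _ e20; have [N' _ HN'] := Hb _ e20.
exists (maxn N N') => n; rewrite geq_max => /andP[/HN /= h1 /HN' /= h2].
apply: le_trans (cabs_ReIm _) _; rewrite [leRHS]splitr.
rewrite raddfB [X in _ + `|X|]raddfB /= lerD//; by rewrite distrC.
Qed.

Definition absum u := exists B : R, forall n, \sum_(k < n) cabs (u k) <= B.

Definition csum u : R[i] :=
  limn (fun n => \sum_(k < n) complex.Re (u k)) +i*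
  limn (fun n => \sum_(k < n) complex.Im (u k)).
Arguments csum : simpl never.

Lemma abs_series_cvg (r : nat -> R) (B : R) :
  (forall n, \sum_(k < n) `|r k| <= B) -> cvgn (fun n => \sum_(k < n) r k).
Proof.
move=> H.
have -> : (fun n => \sum_(k < n) r k) = series r.
  by apply/funext => n; rewrite /series /= big_mkord.
apply: normed_cvg; apply: nondecreasing_is_cvgn.
  by apply: nondecreasing_series => n _ _ /=.
exists B => _ [n _ <-] /=; apply: le_trans (H n).
by rewrite /series /= -(big_mkord xpredT (fun k => `|r k|)).
Qed.

Lemma ReIm_sum n u : \sum_(k < n) u k =
  (\sum_(k < n) complex.Re (u k)) +i* (\sum_(k < n) complex.Im (u k)).
Proof.
by apply/eqP; rewrite eq_complex /=; apply/andP; split; apply/eqP;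
  [exact: raddf_sum|exact: (raddf_sum (@complex.Im R))].
Qed.

Lemma csumP u : absum u -> ccvg (fun n => \sum_(k < n) u k) (csum u).
Proof.
move=> [B HB]; apply: ccvg_ReIm.
  under eq_fun do rewrite ReIm_sum /=.
  apply: (@abs_series_cvg (fun k => complex.Re (u k)) B) => n.
  by apply: le_trans (HB n); apply: ler_sum => k _; apply: cabs_Re.
under eq_fun do rewrite ReIm_sum /=.
apply: (@abs_series_cvg (fun k => complex.Im (u k)) B) => n.
by apply: le_trans (HB n); apply: ler_sum => k _; apply: cabs_Im.
Qed.

Lemma csum_eq u l : absum u -> ccvg (fun n => \sum_(k < n) u k) l -> csum u = l.
Proof. by move=> /csumP H H'; apply: ccvg_unique H H'. Qed.

Lemma ccvg_le u l (B : R) w : ccvg u l ->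
  (exists N, forall n, (N <= n)%N -> cabs (u n - w) <= B) -> cabs (l - w) <= B.
Proof.
move=> H [N HN]; apply/ler_addgt0Pl => e /H[N' HN'].
rewrite (le_trans (cabs_triB _ (u (maxn N N')) _))// lerD//.
  by rewrite cabsB; apply: HN'; rewrite leq_maxr.
by apply: HN; rewrite leq_maxl.
Qed.

Lemma csum_le u (B : R) : (forall n, \sum_(k < n) cabs (u k) <= B) ->
  cabs (csum u) <= B.
Proof.
move=> H; rewrite -[csum u]subr0; apply: (ccvg_le (u := fun n => \sum_(k < n) u k)).
  by apply: csumP; exists B.
exists 0%N => n _; rewrite subr0 (le_trans _ (H n))//; exact: cabs_sum.
Qed.

Lemma absumD u v : absum u -> absum v -> absum (fun k => u k + v k).
Proof.
move=> [B HB] [D HD]; exists (B + D) => n.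
apply: le_trans (lerD (HB n) (HD n)); rewrite -big_split /=.
by apply: ler_sum => k _; apply: cabsD.
Qed.

Lemma absumZ a u : absum u -> absum (fun k => a * u k).
Proof.
move=> [B HB]; exists (cabs a * B) => n; under eq_bigr do rewrite cabsM.
by rewrite -mulr_sumr ler_wpM2l// cabs_ge0.
Qed.

Lemma ccvgD u v l m : ccvg u l -> ccvg v m -> ccvg (fun n => u n + v n) (l + m).
Proof.
move=> Hu Hv e e0; have e20 : 0 < e / 2 by rewrite divr_gt0.
have [N HN] := Hu _ e20; have [N' HN'] := Hv _ e20.
exists (maxn N N') => n; rewrite geq_max => /andP[/HN h1 /HN' h2].
by rewrite opprD addrACA [leRHS]splitr (le_trans (cabsD _ _))// lerD.
Qed.

Lemma ccvgZ a u l : ccvg u l -> ccvg (fun n => a * u n) (a * l).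
Proof.
move=> H e e0; have a0 : 0 < cabs a + 1 by rewrite ltr_wpDl// cabs_ge0.
have [N HN] := H _ (divr_gt0 e0 a0); exists N => n /HN h.
rewrite -mulrBr cabsM (le_trans (ler_wpM2l (cabs_ge0 a) h))//.
rewrite mulrA ler_pdivrMr// mulrC ler_wpM2l ?(ltW e0)//; by rewrite lerDl.
Qed.

Lemma csumD u v : absum u -> absum v ->
  csum (fun k => u k + v k) = csum u + csum v.
Proof.
move=> hu hv; apply: csum_eq; first exact: absumD.
under eq_fun do rewrite big_split /=.
by apply: ccvgD; apply: csumP.
Qed.

Lemma csumZ a u : absum u -> csum (fun k => a * u k) = a * csum u.
Proof.
move=> hu; apply: csum_eq; first exact: absumZ.
under eq_fun do rewrite -mulr_sumr.
by apply: ccvgZ; apply: csumP.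
Qed.

Lemma csum_finite u n : (forall k, (n <= k)%N -> u k = 0) ->
  absum u /\ csum u = \sum_(k < n) u k.
Proof.
move=> H.
have E (T : nmodType) (f : R[i] -> T) m : f 0 = 0 -> (n <= m)%N ->
    \sum_(k < m) f (u k) = \sum_(k < n) f (u k).
  move=> f0 nm; rewrite -!(big_mkord xpredT (fun k => f (u k))).
  rewrite (big_cat_nat (n := n))//= [X in _ + X](_ : _ = 0) ?addr0//.
  by rewrite big_nat_cond big1// => k /andP[/andP[/H -> _] _].
have A : absum u.
  exists (\sum_(k < n) cabs (u k)) => m; have [/(E _ cabs _ cabs0) ->//|mn] := leqP n m.
  rewrite -!(big_mkord xpredT (fun k => cabs (u k))).
  rewrite [leRHS](big_cat_nat (n := m)) ?(ltnW mn)//= lerDl.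
  by apply: sumr_ge0 => k _; exact: cabs_ge0.
split=> //; apply: csum_eq => // e e0; exists n => m nm.
by rewrite (E _ id)// subrr cabs0 ltW.
Qed.

Lemma csumS u : absum u -> absum (fun k => u k.+1) /\ csum u = u 0%N + csum (fun k => u k.+1).
Proof.
move=> A; have A' : absum (fun k => u k.+1).
  have [B HB] := A; exists B => n; apply: le_trans (HB n.+1).
  by rewrite big_ord_recl lerDr cabs_ge0.
split=> //; apply: csum_eq => // e /(csumP A')[N HN]; exists N.+1 => -[//|n] /HN.
rewrite big_ord_recl /= opprD addrACA subrr add0r.
by [].
Qed.

Lemma absum_shift u n : absum (fun k => u (k + n)%N) -> absum u.
Proof.
move=> [B HB]; exists (\sum_(k < n) cabs (u k) + B) => m.
have h : \sum_(k < m) cabs (u k) <= \sum_(k < n + m) cabs (u k).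
  rewrite -!(big_mkord xpredT (fun k => cabs (u k))).
  rewrite [leRHS](big_cat_nat (n := m)) ?leq_addl//= lerDl.
  by apply: sumr_ge0 => k _; exact: cabs_ge0.
rewrite (le_trans h)// big_split_ord /= lerD2l (le_trans _ (HB m))//.
by apply: ler_sum => k _; rewrite addnC.
Qed.

Lemma csum_rows x (B : R) :
  (forall n m, \sum_(i < n) \sum_(j < m) cabs (x i j) <= B) ->
  (forall i, absum (x i)) /\ forall n, \sum_(i < n) cabs (csum (x i)) <= B.
Proof.
move=> HB.
have rows i m : \sum_(j < m) cabs (x i j) <= B.
  apply: le_trans (HB i.+1 m); rewrite big_ord_recr /= lerDr.
  by apply: sumr_ge0 => k _; apply: sumr_ge0 => j _; exact: cabs_ge0.
have cv i : cvgn (fun m => \sum_(j < m) cabs (x i j)).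
  apply: (@abs_series_cvg (fun j => cabs (x i j)) B) => m.
  by under eq_bigr do rewrite ger0_norm ?cabs_ge0//.
have cvs n : (fun m => \sum_(i < n) \sum_(j < m) cabs (x i j)) @ \oo -->
    \sum_(i < n) limn (fun m => \sum_(j < m) cabs (x i j)).
  apply: cvg_big; first exact: add_continuous.
  by move=> i _; apply: cv.
split=> [i|n]; first by exists B; apply: rows.
apply: (@le_trans _ _ (\sum_(i < n) limn (fun m => \sum_(j < m) cabs (x i j)))).
  apply: ler_sum => i _; apply: csum_le => m; apply: nondecreasing_cvgn_le => //.
  move=> k l kl; rewrite -!(big_mkord xpredT (fun j => cabs (x i j))).
  rewrite [leRHS](big_cat_nat (n := k))//= ler_wpDr//.
  by apply: sumr_ge0 => j _; exact: cabs_ge0.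
rewrite -(cvg_lim _ (cvs n))//; apply: limr_le; last by apply: nearW => m; apply: HB.
by apply: cvgP (cvs n).
Qed.

(** Both iterated sums are within any e of a large enough rectangular partial
    sum, chosen so that its absolute values nearly exhaust the total. *)
Lemma fubini_csum x (B : R) :
  (forall n m, \sum_(i < n) \sum_(j < m) cabs (x i j) <= B) ->
  [/\ forall i, absum (x i), forall j, absum (x^~ j),
   absum (fun i => csum (x i)), absum (fun j => csum (x^~ j))
   & csum (fun i => csum (x i)) = csum (fun j => csum (x^~ j))].
Proof.
move=> HB; have [Ar Br] := csum_rows HB.
have HB' m n : \sum_(j < m) \sum_(i < n) cabs (x i j) <= B.
  by rewrite exchange_big /=; apply: HB.
have [Ac Bc] := csum_rows (x := fun j i => x i j) HB'.
have Arr : absum (fun i => csum (x i)) by exists B.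
have Acc : absum (fun j => csum (x^~ j)) by exists B.
split=> //.
pose a n m := \sum_(i < n) \sum_(j < m) cabs (x i j).
pose X n m := \sum_(i < n) \sum_(j < m) x i j.
have lim_fin n : ccvg (X n) (\sum_(i < n) csum (x i)).
  elim: n => [|n IH].
    rewrite big_ord0 => e e0; exists 0%N => m _.
    by rewrite /X big_ord0 subrr cabs0 ltW.
  rewrite big_ord_recr /=; have := ccvgD IH (csumP (Ar n)); congr ccvg.
  by apply/funext => m; rewrite /X big_ord_recr.
have lim_fin' m : ccvg (X^~ m) (\sum_(j < m) csum (x^~ j)).
  elim: m => [|m IH].
    rewrite big_ord0 => e e0; exists 0%N => n _.
    by rewrite /X big1 ?subrr ?cabs0 ?ltW// => i _; rewrite big_ord0.
  rewrite big_ord_recr /=; have := ccvgD IH (csumP (Ac m)); congr ccvg.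
  apply/funext => n; rewrite /X -big_split /=; apply: eq_bigr => i _.
  by rewrite big_ord_recr.
pose E := [set a nm.1 nm.2 | nm in [set: nat * nat]].
have supE : has_sup E.
  split; first by exists (a 0 0)%N, (0, 0)%N.
  by exists B => _ [[n m] _ <-]; apply: HB.
apply/eqP; rewrite -subr_eq0; apply/eqP/cabs_le_eq0 => e e0.
have e20 : 0 < e / 2 by rewrite divr_gt0.
have [_ [[n0 m0] _ <-] /= near_sup] := sup_adherent e20 supE.
have close n m : (n0 <= n)%N -> (m0 <= m)%N -> cabs (X n m - X n0 m0) <= e / 2.
  move=> nn mm; apply: (@le_trans _ _ (a n m - a n0 m0)).
    have dec (T : nmodType) (f : nat -> nat -> T) :
        \sum_(i < n) \sum_(j < m) f i j =
        \sum_(i < n0) \sum_(j < m0) f i j +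
        (\sum_(0 <= i < n0) \sum_(m0 <= j < m) f i j +
         \sum_(n0 <= i < n) \sum_(0 <= j < m) f i j).
      rewrite -(big_mkord xpredT (fun i => \sum_(j < m) f i j)).
      rewrite (big_cat_nat (n := n0))//= addrA; congr (_ + _); last first.
        by apply: eq_bigr => i _; rewrite big_mkord.
      rewrite -(big_mkord xpredT (fun i => \sum_(j < m0) f i j)) -big_split /=.
      apply: eq_bigr => i _; rewrite -!(big_mkord xpredT (fun j => f i j)).
      by rewrite (big_cat_nat (n := m0)).
    have K (T : zmodType) (c d : T) : c + d - c = d by rewrite addrAC subrr add0r.
    rewrite /X /a (dec _ x) (dec _ (fun i j => cabs (x i j))) !K.
    apply: le_trans (cabsD _ _) _; apply: lerD; apply: le_trans (cabs_sum _ _) _.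
      by apply: ler_sum => i _; apply: cabs_sum.
    by apply: ler_sum => i _; apply: cabs_sum.
  have : a n m <= sup E by apply: ub_le_sup; [case: supE|exists (n, m)].
  by move: near_sup; rewrite -/(a n0 m0); lra.
have h1 n : (n0 <= n)%N -> cabs (\sum_(i < n) csum (x i) - X n0 m0) <= e / 2.
  by move=> nn; apply: (ccvg_le (lim_fin n)); exists m0 => m; apply: close.
have h2 m : (m0 <= m)%N -> cabs (\sum_(j < m) csum (x^~ j) - X n0 m0) <= e / 2.
  by move=> mm; apply: (ccvg_le (lim_fin' m)); exists n0 => n nn; apply: close.
have h3 := ccvg_le (csumP Arr) (ex_intro _ n0 h1).
have h4 := ccvg_le (csumP Acc) (ex_intro _ m0 h2).
apply: (le_trans (cabs_triB _ (X n0 m0) _)); rewrite [leRHS]splitr.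
by apply: lerD => //; rewrite cabsB.
Qed.
End ComplexSums.
Arguments cabs : simpl never.
Arguments csum : simpl never.

(** * Germs of analytic and of meromorphic functions *)

Section PowerSeries.
Variable R : realType.
Implicit Types (z w s a b : R[i]) (c d : nat -> R[i]) (r B : R).

Definition psum c z : R[i] := csum (fun n => c n * z ^+ n).

(** The weighted l^1 norm of the coefficients.  It is submultiplicative for the
    Cauchy product, and bounding it is all that absolute convergence on the disc
    of radius r requires. *)
Definition norm_le c r B := forall m, \sum_(n < m) cabs (c n) * r ^+ n <= B.

Lemma norm_le_absum c r B z : norm_le c r B -> cabs z <= r ->
  absum (fun n => c n * z ^+ n).
Proof.
move=> H zr; exists B => m; apply: le_trans (H m); apply: ler_sum => n _.
by rewrite cabsM cabsX ler_wpM2l ?cabs_ge0// lerXn2r ?nnegrE ?cabs_ge0// (le_trans (cabs_ge0 z)).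
Qed.

Lemma norm_le_ge0 c r B : norm_le c r B -> 0 <= B.
Proof. by move=> /(_ 0%N); rewrite big_ord0. Qed.

Lemma norm_le_radius c r r' B : 0 <= r' <= r -> norm_le c r B -> norm_le c r' B.
Proof.
move=> /andP[r0 rr] H m; apply: le_trans (H m); apply: ler_sum => n _.
by rewrite ler_wpM2l ?cabs_ge0// lerXn2r// nnegrE// (le_trans r0).
Qed.

Lemma psum0 c : psum c 0 = c 0%N.
Proof.
have [_] := @csum_finite _ (fun n => c n * 0 ^+ n) 1%N
  (ltac:(by case=> // n _; rewrite exprS mul0r mulr0)).
by rewrite /psum => ->; rewrite big_ord1 expr0 mulr1.
Qed.

Lemma psum_family (c : nat -> nat -> R[i]) r B : 0 < r ->
  (forall n m, \sum_(i < n) \sum_(j < m) cabs (c i j) * r ^+ j <= B) ->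
  norm_le (fun j => csum (c^~ j)) r B /\
  forall z, cabs z <= r -> absum (fun i => psum (c i) z) /\
    csum (fun i => psum (c i) z) = psum (fun j => csum (c^~ j)) z.
Proof.
move=> r0 HB.
have Hz z : cabs z <= r -> forall n m,
    \sum_(i < n) \sum_(j < m) cabs (c i j * z ^+ j) <= B.
  move=> zr n m; apply: le_trans (HB n m); apply: ler_sum => i _.
  apply: ler_sum => j _; rewrite cabsM cabsX ler_wpM2l ?cabs_ge0//.
  by rewrite lerXn2r ?nnegrE ?cabs_ge0// ltW.
have Ar j : absum (c^~ j).
  exists (B / r ^+ j) => n; rewrite ler_pdivlMr ?exprn_gt0// mulr_suml.
  apply: le_trans (HB n j.+1); apply: ler_sum => i _.
  rewrite big_ord_recr /= lerDr; apply: sumr_ge0 => k _.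
  by rewrite mulr_ge0 ?cabs_ge0 ?exprn_ge0 ?(ltW r0).
have Er j z : csum (fun i => c i j * z ^+ j) = csum (c^~ j) * z ^+ j.
  by rewrite mulrC -csumZ//; congr csum; apply/funext => i; rewrite mulrC.
split=> [m|z zr].
  have rr : cabs r%:C <= r by rewrite cabsR ger0_norm// ltW.
  have HB' m' n : \sum_(j < m') \sum_(i < n) cabs (c i j * r%:C ^+ j) <= B.
    by rewrite exchange_big /=; apply: Hz.
  have [_ /(_ m)] := csum_rows (x := fun j i => c i j * r%:C ^+ j) HB'.
  apply: le_trans; apply: ler_sum => j _.
  by rewrite Er cabsM cabsX cabsR ger0_norm// ltW.
have [_ _ h1 _ h2] := fubini_csum (x := fun i j => c i j * z ^+ j) (Hz z zr); split=> //.
by rewrite /psum h2; congr csum; apply/funext => j; rewrite Er.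
Qed.

Definition cauchy_product c d n : R[i] := \sum_(i < n.+1) c i * d (n - i)%N.

Lemma cauchy_productP c d r B D : 0 < r -> norm_le c r B -> norm_le d r D ->
  norm_le (cauchy_product c d) r (B * D) /\
  forall z, cabs z <= r -> psum (cauchy_product c d) z = psum c z * psum d z.
Proof.
move=> r0 Hc Hd.
pose e i n := if (i <= n)%N then c i * d (n - i)%N else 0.
have He n m : \sum_(i < n) \sum_(j < m) cabs (e i j) * r ^+ j <= B * D.
  have D0 := norm_le_ge0 Hd.
  apply: (@le_trans _ _ (\sum_(i < n) cabs (c i) * r ^+ i * D)); last first.
    by rewrite -mulr_suml; apply: ler_wpM2r.
  apply: ler_sum => i _.
  have [mi|im] := leqP m i.
    rewrite big1 => [|j _]; first by rewrite !mulr_ge0 ?cabs_ge0 ?exprn_ge0 ?(ltW r0).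
    by rewrite /e leqNgt (leq_trans (ltn_ord j) mi) cabs0 mul0r.
  apply: (@le_trans _ _ (\sum_(j < m - i) cabs (c i) * r ^+ i * (cabs (d j) * r ^+ j))); last first.
    by rewrite -mulr_sumr ler_wpM2l// mulr_ge0 ?cabs_ge0 ?exprn_ge0 ?(ltW r0).
  rewrite -(big_mkord xpredT (fun j => cabs (e i j) * r ^+ j)).
  rewrite (big_cat_nat (n := i)) ?(ltnW im)//= big_nat_cond big1 ?add0r; last first.
    by move=> j /andP[/andP[_ ji] _]; rewrite /e leqNgt ji cabs0 mul0r.
  rewrite -{1}[X in \sum_(X <= _ < _) _](add0n (i : nat)) big_addn big_mkord.
  apply: ler_sum => j _; rewrite /e leq_addl addnK cabsM exprD.
  by rewrite le_eqVlt; apply/orP; left; apply/eqP; ring.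
have E j : csum (e^~ j) = cauchy_product c d j.
  have [|_ ->] := @csum_finite _ (e^~ j) j.+1.
    by move=> i ji; rewrite /e leqNgt ji.
  by apply: eq_bigr => i _; rewrite /e -ltnS ltn_ord.
have -> : cauchy_product c d = fun j => csum (e^~ j).
  by apply/funext => j; rewrite E.
have [h1 h2] := psum_family r0 He; split=> // z zr; have [_ <-] := h2 z zr.
have Ac := norm_le_absum Hc zr; have Ad := norm_le_absum Hd zr.
rewrite [psum c z]/psum mulrC -csumZ//; congr csum.
apply/funext => i; rewrite mulrC /psum -csumZ//.
have AS m (u : nat -> R[i]) : absum u ->
    csum (fun n => if (m <= n)%N then u (n - m)%N else 0) = csum u.
  move=> Au; elim: m => [|m IH].
    by congr csum; apply/funext => n; rewrite leq0n subn0.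
  have : absum (fun n => if (m.+1 <= n)%N then u (n - m.+1)%N else 0).
    apply: (@absum_shift _ _ m.+1); have [D' HD] := Au; exists D' => n.
    by apply: le_trans (HD n); apply: ler_sum => k _; rewrite ltn_addl//= addnK.
  by move=> /csumS[_ ->]; rewrite ltn0 add0r -IH.
rewrite -[RHS](AS i); last exact: absumZ.
congr csum; apply/funext => n; rewrite /e; case: ifP => // [h|]; last by rewrite mul0r.
by rewrite -[in z ^+ n](subnKC h) exprD; ring.
Qed.

Definition ana (G : R[i] -> R[i]) a := exists c r B,
  [/\ 0 < r, norm_le c r B & forall s, cabs (s - a) <= r -> G s = psum c (s - a)].

Definition nearC a (P : R[i] -> Prop) := exists r,
  0 < r /\ forall s, cabs (s - a) < r -> P s.

Definition pnearC a (P : R[i] -> Prop) := exists r,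
  0 < r /\ forall s, s != a -> cabs (s - a) < r -> P s.

Lemma nearC_pnearC a P : nearC a P -> pnearC a P.
Proof. by move=> [r [r0 H]]; exists r; split=> // s _ /H. Qed.

Lemma nearCI a P Q : nearC a P -> nearC a Q -> nearC a (fun s => P s /\ Q s).
Proof.
move=> [r [r0 H]] [r' [r'0 H']]; exists (Num.min r r'); split=> [|s].
  by rewrite lt_min r0.
by rewrite lt_min => /andP[/H ? /H' ?].
Qed.

Lemma pnearCI a P Q : pnearC a P -> pnearC a Q -> pnearC a (fun s => P s /\ Q s).
Proof.
move=> [r [r0 H]] [r' [r'0 H']]; exists (Num.min r r'); split=> [|s].
  by rewrite lt_min r0.
by move=> sa; rewrite lt_min => /andP[/(H _ sa) ? /(H' _ sa) ?].
Qed.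

Lemma nearC_imp a (P Q : R[i] -> Prop) : (forall s, P s -> Q s) -> nearC a P -> nearC a Q.
Proof. by move=> PQ [r [r0 H]]; exists r; split=> // s /H /PQ. Qed.

Lemma pnearC_imp a (P Q : R[i] -> Prop) :
  (forall s, s != a -> P s -> Q s) -> pnearC a P -> pnearC a Q.
Proof. by move=> PQ [r [r0 H]]; exists r; split=> // s sa /(H _ sa) /(PQ _ sa). Qed.

Lemma nearC_at a P : nearC a P -> P a.
Proof. by move=> [r [r0 H]]; apply: H; rewrite subrr cabs0. Qed.

Lemma pnearC_ex a P r : 0 < r -> pnearC a P -> exists s, [/\ s != a, cabs (s - a) < r & P s].
Proof.
move=> r0 [r' [r'0 H]]; pose e := Num.min r r' / 2.
have e0 : 0 < e by rewrite divr_gt0// lt_min r0.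
have em : e < Num.min r r' by rewrite ltr_pdivrMr// ltr_pMr ?ltr1n// lt_min r0.
have E : cabs (a + e%:C - a) = e by rewrite addrAC subrr add0r cabsR gtr0_norm.
have N : a + e%:C != a.
  by rewrite -subr_eq0 -cabs_gt0 E.
move: em; rewrite -{1}E lt_min => /andP[h1 h2].
by exists (a + e%:C); split=> //; apply: H.
Qed.

Lemma pnearC_open a P : pnearC a P -> pnearC a (fun b => nearC b P).
Proof.
move=> [r [r0 H]]; exists r; split=> // b nba ba.
have b0 : 0 < cabs (b - a) by rewrite cabs_gt0 subr_eq0.
exists (Num.min (r - cabs (b - a)) (cabs (b - a))); split.
  by rewrite lt_min subr_gt0 ba.
move=> s; rewrite lt_min ltrBrDr => /andP[h1 h2]; apply: H.
  by apply: contraTneq h2 => ->; rewrite cabsB ltxx.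
by apply: le_lt_trans h1; exact: cabs_triB.
Qed.

Lemma ana_ext a G H : nearC a (fun s => G s = H s) -> ana G a -> ana H a.
Proof.
move=> [r [r0 GH]] [c [r' [B [r'0 Hc HG]]]].
exists c, (Num.min (r / 2) r'), B.
have h0 : 0 < Num.min (r / 2) r' by rewrite lt_min divr_gt0.
split=> //.
  by apply: norm_le_radius Hc; rewrite ge_min lexx orbT ltW.
move=> s; rewrite le_min => /andP[h1 h2]; rewrite -GH ?HG//.
by rewrite (le_lt_trans h1)// ltr_pdivrMr// ltr_pMr ?ltr1n.
Qed.

Lemma ana_psum c r B a : 0 < r -> norm_le c r B -> ana (fun s => psum c (s - a)) a.
Proof. by move=> r0 H; exists c, r, B; split. Qed.

Lemma anaD G H a : ana G a -> ana H a -> ana (fun s => G s + H s) a.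
Proof.
move=> [c [r [B [r0 Hc HG]]]] [d [r' [D [r'0 Hd HH]]]].
have h0 : 0 < Num.min r r' by rewrite lt_min r0.
have h1 : norm_le c (Num.min r r') B.
  by apply: norm_le_radius Hc; rewrite ge_min lexx ltW.
have h2 : norm_le d (Num.min r r') D.
  by apply: norm_le_radius Hd; rewrite ge_min lexx orbT ltW.
exists (fun n => c n + d n), (Num.min r r'), (B + D); split=> //.
  move=> m; apply: le_trans (lerD (h1 m) (h2 m)); rewrite -big_split /=.
  by apply: ler_sum => n _; rewrite -mulrDl ler_wpM2r ?exprn_ge0 ?(ltW h0)// cabsD.
move=> s hs; rewrite /psum; under [X in csum X]funext do rewrite mulrDl.
rewrite csumD; [|exact: norm_le_absum h1 hs|exact: norm_le_absum h2 hs].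
by move: hs; rewrite le_min => /andP[/HG -> /HH ->].
Qed.

Lemma anaM G H a : ana G a -> ana H a -> ana (fun s => G s * H s) a.
Proof.
move=> [c [r [B [r0 Hc HG]]]] [d [r' [D [r'0 Hd HH]]]].
have h0 : 0 < Num.min r r' by rewrite lt_min r0.
have h1 : norm_le c (Num.min r r') B.
  by apply: norm_le_radius Hc; rewrite ge_min lexx ltW.
have h2 : norm_le d (Num.min r r') D.
  by apply: norm_le_radius Hd; rewrite ge_min lexx orbT ltW.
have [h3 h4] := cauchy_productP h0 h1 h2.
exists (cauchy_product c d), (Num.min r r'), (B * D); split=> //.
move=> s hs; rewrite h4//.
by move: hs; rewrite le_min => /andP[/HG -> /HH ->].
Qed.

Lemma ana_poly n (c : nat -> R[i]) a G : (forall k, (n <= k)%N -> c k = 0) ->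
  (forall s, G s = \sum_(k < n) c k * (s - a) ^+ k) -> ana G a.
Proof.
move=> H HG; exists c, 1, (\sum_(k < n) cabs (c k)); split=> //.
  move=> m; have [nm|mn] := leqP m n.
    rewrite -!(big_mkord xpredT (fun k => cabs (c k) * 1 ^+ k)).
    rewrite -!(big_mkord xpredT (fun k => cabs (c k))).
    rewrite [leRHS](big_cat_nat (n := m))//= ler_wpDr//.
      by apply: sumr_ge0 => k _; exact: cabs_ge0.
    by apply: ler_sum => k _; rewrite expr1n mulr1.
  rewrite -!(big_mkord xpredT (fun k => cabs (c k) * 1 ^+ k)).
  rewrite (big_cat_nat (n := n)) ?(ltnW mn)//= [X in _ + X](_ : _ = 0) ?addr0.
    by rewrite big_mkord; apply: ler_sum => k _; rewrite expr1n mulr1.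
  by rewrite big_nat_cond big1// => k /andP[/andP[/H -> _] _]; rewrite cabs0 mul0r.
move=> s _; rewrite HG /psum.
by have [|_ ->] := @csum_finite _ (fun k => c k * (s - a) ^+ k) n; first by move=> k /H ->; rewrite mul0r.
Qed.

Lemma ana_cst z a : ana (fun=> z) a.
Proof.
apply: (@ana_poly 1 (fun k => if k == 0%N then z else 0)); first by case.
by move=> s; rewrite big_ord1 expr0 mulr1.
Qed.

Lemma ana_id a : ana id a.
Proof.
apply: (@ana_poly 2 (fun k => if k == 0%N then a else if k == 1%N then 1 else 0)).
  by case=> // -[].
by move=> s; rewrite !big_ord_recl big_ord0 /= expr0 expr1; ring.
Qed.

Lemma anaX G a n : ana G a -> ana (fun s => G s ^+ n) a.
Proof.
move=> HG; elim: n => [|n IH]; first exact: ana_cst.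
by apply: ana_ext (anaM HG IH); exists 1; split=> // s _; rewrite exprS.
Qed.

Lemma anaN G a : ana G a -> ana (fun s => - G s) a.
Proof.
move=> HG; apply: ana_ext (anaM (ana_cst (-1) a) HG).
by exists 1; split=> // s _; rewrite mulN1r.
Qed.

Lemma anaB G H a : ana G a -> ana H a -> ana (fun s => G s - H s) a.
Proof. by move=> HG HH; apply: anaD HG (anaN HH). Qed.

Lemma ana_pow b n a : ana (fun s => (s - b) ^+ n) a.
Proof. by apply: anaX; apply: anaB; [exact: ana_id|exact: ana_cst]. Qed.

(** Expanding each power of s - a = (b - a) + (s - b) by the binomial formula
    gives a doubly summable family. *)
Lemma ana_disc G a c r B b : norm_le c r B ->
  (forall s, cabs (s - a) <= r -> G s = psum c (s - a)) -> cabs (b - a) < r -> ana G b.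
Proof.
move=> Hc HG ba; have r0 : 0 < r := le_lt_trans (cabs_ge0 _) ba.
pose rho := (r - cabs (b - a)) / 2.
have rho0 : 0 < rho by rewrite divr_gt0// subr_gt0.
have rhor : cabs (b - a) + rho <= r.
  by rewrite /rho; move: ba; move: (cabs _) => x; lra.
pose e i n := if (n <= i)%N then c i * (b - a) ^+ (i - n) *+ 'C(i, n) else 0.
have He n m : \sum_(i < n) \sum_(j < m) cabs (e i j) * rho ^+ j <= B.
  apply: le_trans (Hc n); apply: ler_sum => i _.
  apply: (@le_trans _ _ (cabs (c i) * (cabs (b - a) + rho) ^+ i)); last first.
    rewrite ler_wpM2l ?cabs_ge0// lerXn2r// nnegrE ?(ltW r0)//.
    by rewrite addr_ge0 ?cabs_ge0 ?ltW.
  rewrite exprDn mulr_sumr.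
  have eE (j : nat) : (j <= i)%N -> cabs (e i j) * rho ^+ j <=
      cabs (c i) * (cabs (b - a) ^+ (i - j) * rho ^+ j *+ 'C(i, j)).
    move=> ji; rewrite /e ji -mulr_natr cabsM cabsM cabsX.
    rewrite -(rmorph_nat (real_complex R)) cabsR ger0_norm// -mulr_natr.
    by rewrite le_eqVlt; apply/orP; left; apply/eqP; ring.
  have t0 (j : nat) : 0 <= cabs (c i) * (cabs (b - a) ^+ (i - j) * rho ^+ j *+ 'C(i, j)).
    by rewrite mulr_ge0 ?cabs_ge0// mulrn_wge0// mulr_ge0// exprn_ge0 ?cabs_ge0 ?(ltW rho0).
  have [mi|im] := leqP m i.+1.
    rewrite -(big_mkord xpredT (fun j => cabs (e i j) * rho ^+ j)).
    rewrite -(big_mkord xpredT (fun j => cabs (c i) * (cabs (b - a) ^+ (i - j) * rho ^+ j *+ 'C(i, j)))).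
    rewrite [leRHS](big_cat_nat (n := m))//= ler_wpDr//; first exact: sumr_ge0.
    rewrite big_nat_cond [leRHS]big_nat_cond; apply: ler_sum => j /andP[/andP[_ jm] _].
    by apply: eE; rewrite -ltnS (leq_trans jm).
  rewrite -(big_mkord xpredT (fun j => cabs (e i j) * rho ^+ j)).
  rewrite (big_cat_nat (n := i.+1)) ?(ltnW im)//= [X in _ + X](_ : _ = 0) ?addr0.
    by rewrite big_mkord; apply: ler_sum => j _; apply: eE; rewrite -ltnS.
  rewrite big_nat_cond big1// => j /andP[/andP[ij _] _].
  by rewrite /e leqNgt ij cabs0 mul0r.
have [h1 h2] := psum_family rho0 He.
exists (fun j => csum (e^~ j)), rho, B; split=> // s sb.
have [_ <-] := h2 _ sb; rewrite HG; last first.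
  by apply: le_trans rhor; rewrite (le_trans (cabs_triB _ b _))// addrC lerD2l.
congr csum; apply/funext => i; rewrite /psum.
have [|_ ->] := @csum_finite _ (fun n => e i n * (s - b) ^+ n) i.+1.
  by move=> k ik; rewrite /e leqNgt ik mul0r.
have -> : s - a = (b - a) + (s - b) by ring.
rewrite exprDn mulr_sumr; apply: eq_bigr => j _.
by rewrite /e -ltnS ltn_ord mulrnAl mulrnAr mulrA.
Qed.

Lemma ana_open G a : ana G a -> nearC a (ana G).
Proof.
move=> [c [r [B [r0 Hc HG]]]]; exists r; split=> // b; exact: ana_disc Hc HG.
Qed.

Lemma ana_entire c b : (forall r, 0 < r -> exists B, norm_le c r B) -> ana (psum c) b.
Proof.
move=> H; have r0 : 0 < cabs b + 1 by rewrite ltr_wpDl ?cabs_ge0.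
have [B Hc] := H _ r0; apply: (ana_disc (a := 0) Hc); last by rewrite subr0 ltrDl.
by move=> s _; rewrite subr0.
Qed.

Lemma ana_lipschitz G a : ana G a -> exists r C, 0 < r /\
  forall s, cabs (s - a) <= r -> cabs (G s - G a) <= C * cabs (s - a).
Proof.
move=> [c [r [B [r0 Hc HG]]]]; exists r, (B / r); split=> // s sa.
rewrite [G a]HG ?subrr ?cabs0 ?(ltW r0)// psum0 HG//.
have A := norm_le_absum Hc sa; have [A' E] := csumS A.
rewrite /psum E expr0 mulr1 addrAC subrr add0r; apply: csum_le => n.
apply: (@le_trans _ _ (\sum_(k < n) (cabs (c k.+1) * r ^+ k.+1) * (cabs (s - a) / r))).
  apply: ler_sum => k _; rewrite cabsM cabsX -mulrA ler_wpM2l ?cabs_ge0//.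
  rewrite exprSr exprSr -mulrA; rewrite (mulrCA r) mulfV ?gt_eqF// mulr1.
  rewrite ler_wpM2r ?cabs_ge0//.
  by rewrite lerXn2r ?nnegrE ?cabs_ge0// ltW.
have -> : B / r * cabs (s - a) = B * (cabs (s - a) / r) by ring.
rewrite -mulr_suml.
rewrite ler_wpM2r ?divr_ge0 ?cabs_ge0 ?(ltW r0)//.
apply: le_trans (Hc n.+1); rewrite big_ord_recl /= lerDr.
by rewrite mulr_ge0 ?cabs_ge0.
Qed.

Lemma ana_neq0 G a : ana G a -> G a != 0 -> nearC a (fun s => G s != 0).
Proof.
move=> /ana_lipschitz[r [C [r0 H]]] Ga.
have g0 : 0 < cabs (G a) by rewrite cabs_gt0.
have C0 : 0 < `|C| + 1 by rewrite ltr_wpDl.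
exists (Num.min r (cabs (G a) / (`|C| + 1))); split.
  by rewrite lt_min r0 divr_gt0.
move=> s; rewrite lt_min ltr_pdivlMr// => /andP[/ltW/H h1 h2].
apply/eqP => Gs; move: h1; rewrite Gs sub0r cabsN; apply/negP; rewrite -ltNge.
apply: le_lt_trans h2; rewrite mulrC ler_wpM2l ?cabs_ge0//.
by rewrite (le_trans (ler_norm _))// lerDl.
Qed.

(** Geometric series in 1 - G/G(a), whose coefficients have norm at most 1/2 on
    a small disc. *)
Lemma ana_inv G a : ana G a -> G a != 0 -> ana (fun s => (G s)^-1) a.
Proof.
move=> AG Ga; have := anaB (ana_cst 1 a) (anaM (ana_cst (G a)^-1 a) AG).
move=> [h [r0 [B [r00 Hh HG]]]].
have h0 : h 0%N = 0.
  by have := HG a; rewrite subrr cabs0 psum0 mulVf// subrr => <-//; rewrite ltW.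
have B0 := norm_le_ge0 Hh.
pose r := r0 / (2 * (B + 1)).
have B1 : 0 < 2 * (B + 1) by lra.
have r_gt0 : 0 < r by rewrite divr_gt0.
have rr0 : r <= r0 by rewrite ler_pdivrMr// ler_pMr//; lra.
have rB : r / r0 * B <= 2^-1.
  have -> : r / r0 * B = B / (2 * (B + 1)) by rewrite /r; field; lra.
  rewrite ler_pdivrMr//; lra.
have Hh2 : norm_le h r (2^-1).
  move=> [|m]; first by rewrite big_ord0; lra.
  apply: le_trans rB; rewrite big_ord_recl h0 cabs0 mul0r add0r.
  apply: (@le_trans _ _ (\sum_(k < m) (cabs (h k.+1) * r0 ^+ k.+1) * (r / r0))).
    apply: ler_sum => k _; rewrite -mulrA ler_wpM2l ?cabs_ge0//= /bump /=.
    rewrite exprSr exprSr -mulrA (mulrCA r0) mulfV ?gt_eqF// mulr1.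
    by rewrite ler_wpM2r ?(ltW r_gt0)// lerXn2r// nnegrE ltW.
  rewrite -mulr_suml (mulrC (\sum_(_ < _) _)) ler_wpM2l//.
    by rewrite divr_ge0 ?ltW.
  by apply: le_trans (Hh m.+1); rewrite big_ord_recl h0 cabs0 mul0r add0r.
pose pw := fix pw i := if i is i'.+1 then cauchy_product h (pw i')
                       else (fun k => if k == 0%N then 1 else 0 : R[i]).
have pwP i : norm_le (pw i) r (2^-1 ^+ i) /\
    forall z, cabs z <= r -> psum (pw i) z = psum h z ^+ i.
  elim: i => [|i [IH1 IH2]].
    split=> [m|z _]; rewrite expr0.
      case: m => [|m]; first by rewrite big_ord0.
      rewrite big_ord_recl /= cabs1 expr0 mul1r big1 ?addr0// => k _.
      by rewrite cabs0 mul0r.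
    have [|_] := @csum_finite _ (fun n => pw 0%N n * z ^+ n) 1.
      by case=> // k _; rewrite mul0r.
    by rewrite /psum => ->; rewrite big_ord1 expr0 mulr1.
  have [h1 h2] := cauchy_productP r_gt0 Hh2 IH1; rewrite exprS; split=> // z zr.
  by rewrite exprS -IH2// -h2.
have He n m : \sum_(i < n) \sum_(j < m) cabs (pw i j) * r ^+ j <= 2.
  apply: (@le_trans _ _ (\sum_(i < n) 2^-1 ^+ i)).
    by apply: ler_sum => i _; have [] := pwP i.
  by apply: geom_le2; lra.
have [h1 h2] := psum_family r_gt0 He.
apply: ana_ext (anaM (ana_cst (G a)^-1 a) (ana_psum a r_gt0 h1)).
exists r; split=> // s /ltW sr; have [A <-] := h2 _ sr.
have E := HG s (le_trans sr rr0).
under [X in csum X]funext => i do rewrite (pwP i).2//.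
set H := psum h (s - a) in E *.
have AH : absum (fun i => H ^+ i).
  by move: A; congr absum; apply/funext => i; rewrite (pwP i).2.
have [_] := csumS AH; rewrite expr0.
under [X in _ = _ + csum X]funext => i do rewrite exprS.
rewrite csumZ// => ES.
have {}ES : (1 - H) * csum (fun i => H ^+ i) = 1.
  by rewrite mulrBl mul1r {1}ES addrK.
move: ES; rewrite -E opprB addrCA subrr addr0.
move=> ES; have Gs : G s != 0.
  by apply/eqP => G0; move: ES; rewrite G0 mulr0 mul0r => /esym/eqP; rewrite oner_eq0.
apply: (mulfI Gs); rewrite mulfV// -[RHS]ES; ring.
Qed.

End PowerSeries.

Section Laurent.
Variable R : realType.
Implicit Types (z w s a b : R[i]) (U V G H : R[i] -> R[i]).

(** U is meromorphic at a, whatever its value at the point a itself. *)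
Definition lau U a := exists (k : nat) G, ana G a /\
  pnearC a (fun s => (s - a) ^+ k * U s = G s).

Lemma pnear_eq0_near a G : ana G a -> pnearC a (fun s => G s = 0) -> nearC a (fun s => G s = 0).
Proof.
move=> AG H.
have Ga : G a = 0.
  apply/eqP/negPn/negP => Ga; have [r [r0 Hr]] := ana_neq0 AG Ga.
  have [s [_ /Hr/eqP Gs Gs']] := pnearC_ex r0 H; exact: Gs.
have [r [r0 Hr]] := H; exists r; split=> // s.
by have [->//|sa] := eqVneq s a; apply: Hr.
Qed.

Lemma ana_pnear_near a G H : ana G a -> ana H a -> pnearC a (fun s => G s = H s) ->
  nearC a (fun s => G s = H s).
Proof.
move=> AG AH E; have := pnear_eq0_near (anaB AG AH).
move=> /(_ (pnearC_imp _ E))[s _ -> |]; first by rewrite subrr.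
by move=> r [r0 Hr]; exists r; split=> // s /Hr /eqP; rewrite subr_eq0 => /eqP.
Qed.

Lemma ana_factor G a : ana G a -> nearC a (fun s => G s = 0) \/
  exists m H, [/\ ana H a, H a != 0 & nearC a (fun s => G s = (s - a) ^+ m * H s)].
Proof.
move=> [c [r [B [r0 Hc HG]]]].
have near_r (P : R[i] -> Prop) : (forall s, cabs (s - a) <= r -> P s) -> nearC a P.
  by move=> h; exists r; split=> // s /ltW /h.
have [c0|/existsNP cn0] := pselect (forall n, c n = 0).
  left; apply: near_r => s /HG ->; rewrite /psum.
  have [|_ ->] := @csum_finite _ (fun n => c n * (s - a) ^+ n) 0; last by rewrite big_ord0.
  by move=> k _; rewrite c0 mul0r.
have ex : exists n, c n != 0 by have [n /eqP] := cn0; exists n.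
have [m cm mmin] := ex_minnP ex; right.
have c0 n : (n < m)%N -> c n = 0.
  by move=> nm; apply/eqP; apply: contraTT nm => /mmin; rewrite -leqNgt.
have Hd : norm_le (fun n => c (n + m)%N) r (B / r ^+ m).
  move=> n; rewrite ler_pdivlMr ?exprn_gt0// mulr_suml.
  apply: le_trans (Hc (m + n)%N); rewrite big_split_ord /= ler_wpDl//.
    by apply: sumr_ge0 => k _; rewrite mulr_ge0 ?cabs_ge0 ?exprn_ge0 ?(ltW r0).
  by apply: ler_sum => k _; rewrite exprD -mulrA addnC (mulrC (r ^+ m)).
exists m, (fun s => psum (fun n => c (n + m)%N) (s - a)); split.
- exact: ana_psum r0 Hd.
- by rewrite subrr psum0 add0n.
apply: near_r => s sr; rewrite HG// /psum -csumZ; last exact: norm_le_absum Hd sr.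
have {}c0 : forall n, (n < m)%N -> c n * (s - a) ^+ n = 0.
  by move=> n /c0 ->; rewrite mul0r.
have -> : (fun n => (s - a) ^+ m * (c (n + m)%N * (s - a) ^+ n)) =
          (fun n => c (n + m)%N * (s - a) ^+ (n + m)).
  by apply/funext => n; rewrite exprD; ring.
have Ac : absum (fun n => c n * (s - a) ^+ n) := norm_le_absum Hc sr.
suff H (k : nat) (u : nat -> R[i]) : (forall n, (n < k)%N -> u n = 0) -> absum u ->
  csum u = csum (fun n => u (n + k)%N).
  exact: (H m (fun n => c n * (s - a) ^+ n)).
elim: k u => [|k IH] u u0 Au.
  by congr csum; apply/funext => n; rewrite addn0.
have [Au' ->] := csumS Au; rewrite u0// add0r (IH (fun n => u n.+1))//.
  by congr csum; apply/funext => n; rewrite addnS.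
by move=> n nk; apply: u0.
Qed.

Lemma sub_exp_neq0 s a k : s != a -> (s - a) ^+ k != 0.
Proof. by move=> sa; rewrite expf_neq0// subr_eq0. Qed.

Lemma lau_ext U V a : pnearC a (fun s => U s = V s) -> lau U a -> lau V a.
Proof.
move=> E [k [G [AG HG]]]; exists k, G; split=> //.
by apply: pnearC_imp (pnearCI E HG) => s _ [-> ].
Qed.

Lemma ana_lau G a : ana G a -> lau G a.
Proof.
by move=> AG; exists 0%N, G; split=> //; exists 1; split=> // s _ _; rewrite expr0 mul1r.
Qed.

Lemma lauD U V a : lau U a -> lau V a -> lau (fun s => U s + V s) a.
Proof.
move=> [k [G [AG HG]]] [l [H [AH HH]]].
exists (k + l)%N, (fun s => (s - a) ^+ l * G s + (s - a) ^+ k * H s); split.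
  by apply: anaD; apply: anaM => //; apply: ana_pow.
by apply: pnearC_imp (pnearCI HG HH) => s _ [<- <-]; rewrite exprD; ring.
Qed.

Lemma lauM U V a : lau U a -> lau V a -> lau (fun s => U s * V s) a.
Proof.
move=> [k [G [AG HG]]] [l [H [AH HH]]].
exists (k + l)%N, (fun s => G s * H s); split; first exact: anaM.
by apply: pnearC_imp (pnearCI HG HH) => s _ [<- <-]; rewrite exprD; ring.
Qed.

Lemma lauB U V a : lau U a -> lau V a -> lau (fun s => U s - V s) a.
Proof.
move=> LU LV; apply: lauD => //; apply: lau_ext (lauM (ana_lau (ana_cst (-1) a)) LV).
by exists 1; split=> // s _ _; rewrite mulN1r.
Qed.

Lemma lau_dichotomy U a : lau U a -> pnearC a (fun s => U s = 0) \/
  exists k m H, [/\ ana H a, H a != 0, pnearC a (fun s => (s - a) ^+ k * U s = (s - a) ^+ m * H s)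
   & pnearC a (fun s => H s != 0 /\ U s != 0)].
Proof.
move=> [k [G [AG HG]]]; have [G0|[m [H [AH Ha HH]]]] := ana_factor AG.
  left; apply: pnearC_imp (pnearCI HG (nearC_pnearC G0)) => s sa [<-] /eqP.
  by rewrite mulf_eq0 (negPf (sub_exp_neq0 _ sa)) => /eqP.
right; exists k, m, H.
have E : pnearC a (fun s => (s - a) ^+ k * U s = (s - a) ^+ m * H s).
  by apply: pnearC_imp (pnearCI HG (nearC_pnearC HH)) => s _ [-> ].
split=> //; apply: pnearC_imp (pnearCI E (nearC_pnearC (ana_neq0 AH Ha))) => s sa [e Hs].
split=> //; apply: contra_eq_neq e => ->.
by rewrite mulr0 eq_sym mulf_neq0// sub_exp_neq0.
Qed.

Lemma lau_inv U a : lau U a -> ~ pnearC a (fun s => U s = 0) -> lau (fun s => (U s)^-1) a.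
Proof.
move=> /lau_dichotomy[//|[k [m [H [AH Ha E E']]]] _].
exists m, (fun s => (s - a) ^+ k * (H s)^-1); split.
  by apply: anaM (ana_pow _ _ _) (ana_inv AH Ha).
apply: pnearC_imp (pnearCI E E') => s sa [e [Hs Us]].
by apply: (mulIf Us); apply: (mulIf Hs); rewrite mulfVK// mulrAC mulfVK// -e.
Qed.

Lemma lau_open U a : lau U a -> pnearC a (ana U).
Proof.
move=> [k [G [AG HG]]].
have := pnearCI (pnearC_open HG) (nearC_pnearC (ana_open AG)).
apply: pnearC_imp => b ba [near_b AGb].
have Apow : ana (fun s => ((s - a) ^+ k)^-1) b.
  by apply: ana_inv (ana_pow _ _ _) _; apply: sub_exp_neq0.
apply: ana_ext (anaM Apow AGb).
have nba : nearC b (fun s => (s - a) ^+ k != 0).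
  by apply: ana_neq0 (ana_pow _ _ _) _; apply: sub_exp_neq0.
by apply: nearC_imp (nearCI near_b nba) => s [<- h]; rewrite mulKf.
Qed.

Definition segment_point a b (t : R) := a + t%:C * (b - a).

(** The parameters up to which U vanishes identically form an interval that is
    open because vanishing spreads, and closed by the dichotomy at its end. *)
Lemma identity_theorem U a b :
  (forall t : R, 0 <= t <= 1 -> lau U (segment_point a b t)) ->
  pnearC a (fun s => U s = 0) -> pnearC b (fun s => U s = 0).
Proof.
move=> LU Ua; pose g := segment_point a b; pose Q t := pnearC (g t) (fun s => U s = 0).
have [<-//|nab] := eqVneq a b.
have d0 : 0 < cabs (b - a) by rewrite cabs_gt0 subr_eq0 eq_sym.
have gB t t' : cabs (g t - g t') = `|t - t'| * cabs (b - a).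
  by rewrite /g /segment_point opprD addrACA subrr add0r -mulrBl -rmorphB cabsM cabsR.
have g0 : g 0 = a by rewrite /g /segment_point rmorph0 mul0r addr0.
have g1 : g 1 = b by rewrite /g /segment_point rmorph1 mul1r addrCA subrr addr0.
pose E := [set t | 0 <= t <= 1 /\ forall t', 0 <= t' <= t -> Q t'].
have E0 : E 0.
  split=> [|t' /andP[h1 h2]]; first by rewrite lexx ler01.
  have -> : t' = 0 by apply/eqP; rewrite eq_le h1 h2.
  by rewrite /Q g0.
have supE : has_sup E by split; [exists 0|exists 1 => t [/andP[]]].
pose T := sup E.
have T0 : 0 <= T by apply: ub_le_sup => //; case: supE.
have T1 : T <= 1 by apply: ge_sup => [|t [/andP[]]]; [exists 0|].
have belowQ t : 0 <= t < T -> Q t.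
  move=> /andP[t0 tT]; have [u [_ Hu] tu] := sup_gt (ex_intro _ _ E0) tT.
  by apply: Hu; rewrite t0 ltW.
have QT : Q T.
  have [//|[k [m [H [_ _ _ nz]]]]] := lau_dichotomy (LU T (introT andP (conj T0 T1))).
  have [Te|Tn] := eqVneq T 0; first by rewrite /Q Te g0.
  have T_gt0 : 0 < T by rewrite lt0r Tn.
  have [r [r0 Hr]] := nz.
  pose e := Num.min (T / 2) (r / 2 / cabs (b - a)).
  have e0 : 0 < e by rewrite lt_min !divr_gt0.
  have eT : e < T by rewrite gt_min ltr_pdivrMr// ltr_pMr ?ltr1n.
  have QTe : Q (T - e) by apply: belowQ; rewrite subr_ge0 ltW//= ltrBlDr ltrDl.
  have gd : cabs (g (T - e) - g T) <= r / 2.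
    rewrite gB addrAC subrr add0r normrN gtr0_norm// -ler_pdivlMr//.
    by rewrite ge_min lexx orbT.
  have gd0 : 0 < cabs (g (T - e) - g T).
    by rewrite gB addrAC subrr add0r normrN gtr0_norm// mulr_gt0.
  have rho0 : 0 < Num.min (r / 2) (cabs (g (T - e) - g T)).
    by rewrite lt_min gd0 divr_gt0.
  have [s [_ sd Us]] := pnearC_ex rho0 QTe.
  move: sd; rewrite lt_min => /andP[sd1 sd2].
  have [] := Hr s.
  - apply/eqP => sT; move: sd2; rewrite sT cabsB ltxx; by [].
  - apply: le_lt_trans (cabs_triB _ (g (T - e)) _) _.
    by rewrite [ltRHS]splitr ltr_leD.
  by move=> _; rewrite Us eqxx.
have [r [r0 Hr]] := pnearC_open QT.
have nbr t : `|t - T| * cabs (b - a) < r -> Q t.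
  have [->//|tT] := eqVneq t T; move=> h; apply: nearC_pnearC; apply: Hr; last by rewrite gB.
  by rewrite -subr_eq0 -cabs_gt0 gB mulr_gt0// normr_gt0 subr_eq0.
have [Te1|Tn1] := eqVneq T 1; first by move: QT; rewrite /Q Te1 g1.
have T_lt1 : T < 1 by rewrite lt_neqAle Tn1.
pose e := Num.min (1 - T) (r / 2 / cabs (b - a)).
have e0 : 0 < e by rewrite lt_min subr_gt0 T_lt1 !divr_gt0.
have ETe : E (T + e).
  split=> [|t /andP[t0 tTe]].
    by rewrite addr_ge0 ?(ltW e0)//= -lerBrDl ge_min lexx.
  have [tT|Tt] := ltP t T; first by apply: belowQ; rewrite t0.
  apply: nbr; rewrite ger0_norm ?subr_ge0//.
  rewrite -ltr_pdivlMr// (le_lt_trans (y := e)) ?lerBlDl//.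
  rewrite gt_min; apply/orP; right.
  by rewrite ltr_pdivrMr// mulfVK ?gt_eqF// ltr_pdivrMr// ltr_pMr ?ltr1n.
have : T + e <= T by apply: ub_le_sup => //; case: supE.
by rewrite gerDl leNgt e0.
Qed.

(** The function that agrees with U where U is analytic and takes the limit
    value at removable singularities. *)
Definition regularize U s : R[i] :=
  if pselect (exists G, ana G s /\ pnearC s (fun t => U t = G t)) is left e
  then (projT1 (cid e)) s else 0.

Lemma regularizeE U G s : ana G s -> pnearC s (fun t => U t = G t) -> regularize U s = G s.
Proof.
move=> AG E; rewrite /regularize; case: pselect => [e|[]]; last by exists G.
case: (cid e) => H [AH EH] /=.
have := ana_pnear_near AH AG; move=> /(_ _)/nearC_at; apply.
by apply: pnearC_imp (pnearCI EH E) => t _ [<- <-].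
Qed.

Lemma regularize_ana U a : ana U a -> nearC a (fun s => regularize U s = U s).
Proof.
move=> AU; apply: nearC_imp (ana_open AU) => s As; apply: regularizeE => //.
by exists 1.
Qed.

Lemma regularize_pnear U a : lau U a -> pnearC a (fun s => regularize U s = U s).
Proof.
move=> /lau_open; apply: pnearC_imp => s _ As; apply: regularizeE => //.
by exists 1.
Qed.

Lemma regularize_merom U a : lau U a -> ana (regularize U) a \/
  exists k H, [/\ (0 < k)%N, ana H a, H a != 0 &
    pnearC a (fun s => (s - a) ^+ k * regularize U s = H s)].
Proof.
move=> LU; have RU := regularize_pnear LU.
have reg G : ana G a -> pnearC a (fun s => U s = G s) -> ana (regularize U) a.
  move=> AG E; apply: ana_ext (AG).
  have [r [r0 Hr]] := pnearCI RU E; exists r; split=> // s.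
  have [-> _|sa /(Hr _ sa)[-> ->]//] := eqVneq s a.
  by rewrite (regularizeE AG).
have [U0|[k [m [H [AH Ha E E']]]]] := lau_dichotomy LU.
  by left; apply: (reg (fun=> 0)) => //; exact: ana_cst.
have [km|mk] := leqP k m.
  left; apply: (reg (fun s => (s - a) ^+ (m - k) * H s)).
    by apply: anaM AH; apply: ana_pow.
  apply: pnearC_imp E => s sa e; apply: (mulfI (sub_exp_neq0 k sa)).
  by rewrite e mulrA -exprD subnKC.
right; exists (k - m)%N, H; split=> //; first by rewrite subn_gt0.
apply: pnearC_imp (pnearCI RU E) => s sa [-> e].
by apply: (mulfI (sub_exp_neq0 m sa)); rewrite mulrA -exprD subnKC ?(ltnW mk).
Qed.

End Laurent.

Section Jets.
Variable R : realType.
Implicit Types (z w s a b : R[i]) (U V G H : R[i] -> R[i]).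

(** G is analytic at a with the first-order Taylor expansion x + y (s - a). *)
Definition jet G a x y := exists H, [/\ ana H a, H a = y &
  nearC a (fun s => G s = x + (s - a) * H s)].

Lemma ana_jet G a : ana G a -> exists y, jet G a (G a) y.
Proof.
move=> AG; have A0 := anaB AG (ana_cst (G a) a).
have [z|[m [H [AH Ha E]]]] := ana_factor A0.
  exists 0, (fun=> 0); split=> //; first exact: ana_cst.
  by apply: nearC_imp z => s /eqP; rewrite subr_eq0 => /eqP ->; rewrite mulr0 addr0.
case: m E => [|m] E.
  by have := nearC_at E; rewrite subrr expr0 mul1r => H0; rewrite -H0 eqxx in Ha.
exists ((a - a) ^+ m * H a), (fun s => (s - a) ^+ m * H s); split=> //.
  by apply: anaM AH; apply: ana_pow.
apply: nearC_imp E => s /eqP; rewrite subr_eq => /eqP ->.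
by rewrite addrC exprS mulrA.
Qed.

Lemma jet_ana G a x y : jet G a x y -> ana G a.
Proof.
move=> [H [AH _ [r [r0 E]]]].
apply: (@ana_ext _ a (fun s => x + (s - a) * H s)).
  by exists r; split=> // s /E ->.
apply: anaD; first exact: ana_cst.
by apply: anaM AH; apply: anaB; [exact: ana_id|exact: ana_cst].
Qed.

Lemma jet_val G a x y : jet G a x y -> G a = x.
Proof. by move=> [H [_ _ /nearC_at ->]]; rewrite subrr mul0r addr0. Qed.

Lemma jet_ext G H a x y : nearC a (fun s => G s = H s) -> jet G a x y -> jet H a x y.
Proof.
move=> E [K [AK Ka EK]]; exists K; split=> //.
by apply: nearC_imp (nearCI E EK) => s [<-].
Qed.

Lemma jet_unique G a x y x' y' : jet G a x y -> jet G a x' y' -> x = x' /\ y = y'.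
Proof.
move=> J J'; have xx : x = x' by rewrite -(jet_val J) -(jet_val J').
split=> //; move: J J' => [H [AH Ha E]] [H' [AH' Ha' E']].
rewrite -Ha -Ha'; have := ana_pnear_near AH AH'; move=> /(_ _)/nearC_at; apply.
apply: pnearC_imp (pnearCI (nearC_pnearC E) (nearC_pnearC E')) => s sa [-> ].
by rewrite xx => /addrI; apply: mulfI; rewrite subr_eq0.
Qed.

Lemma jetD G H a x y x' y' : jet G a x y -> jet H a x' y' ->
  jet (fun s => G s + H s) a (x + x') (y + y').
Proof.
move=> [K [AK Ka E]] [K' [AK' Ka' E']]; exists (fun s => K s + K' s); split.
- exact: anaD.
- by rewrite Ka Ka'.
by apply: nearC_imp (nearCI E E') => s [-> ->]; ring.
Qed.

Lemma jetM G H a x y x' y' : jet G a x y -> jet H a x' y' ->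
  jet (fun s => G s * H s) a (x * x') (x * y' + y * x').
Proof.
move=> J J'; have AH := jet_ana J'.
move: J J' => [K [AK Ka E]] [K' [AK' Ka' E']].
exists (fun s => x * K' s + K s * H s); split.
- by apply: anaD; apply: anaM => //; apply: ana_cst.
- by rewrite Ka Ka' (nearC_at E') subrr mul0r addr0.
by apply: nearC_imp (nearCI E E') => s [-> ->]; ring.
Qed.

Lemma jet_cst z a : jet (fun=> z) a z 0.
Proof.
exists (fun=> 0); split=> //; first exact: ana_cst.
by exists 1; split=> // s _; rewrite mulr0 addr0.
Qed.

Lemma jet_id a : jet id a a 1.
Proof.
exists (fun=> 1); split=> //; first exact: ana_cst.
by exists 1; split=> // s _; ring.
Qed.

Lemma jet_psum (c : nat -> R[i]) r B : 0 < r -> norm_le c r B ->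
  jet (psum c) 0 (c 0%N) (c 1%N).
Proof.
move=> r0 Hc; have Hd : norm_le (fun n => c n.+1) r (B / r).
  move=> n; rewrite ler_pdivlMr// mulr_suml; apply: le_trans (Hc n.+1).
  rewrite big_ord_recl ler_wpDl ?mulr_ge0 ?cabs_ge0//.
  by apply: ler_sum => k _; rewrite -mulrA -exprSr.
exists (fun s => psum (fun n => c n.+1) (s - 0)); split.
- exact: ana_psum r0 Hd.
- by rewrite subrr psum0.
exists r; split=> // s; rewrite subr0 => /ltW sr.
have [_ E] := csumS (norm_le_absum Hc sr).
rewrite /psum E expr0 mulr1 -csumZ; last exact: norm_le_absum Hd sr.
by congr (_ + csum _); apply/funext => n; rewrite exprS; ring.
Qed.

(** ** Analyticity, poles and derivatives *)

Lemma posC (e : R[i]) : 0 < e -> exists2 r : R, 0 < r & e = r%:C.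
Proof.
move=> e0; have eE : e = (complex.Re e)%:C.
  by apply/eqP; rewrite eq_complex /= eqxx; move: e0; case: (e) => x y;
     rewrite ltcE /= => /andP[].
by exists (complex.Re e) => //; rewrite -ltcR -eE.
Qed.

Lemma nearCP (a : R[i]^o) (P : R[i]^o -> Prop) :
  (\forall s \near a, P s) <-> nearC a P.
Proof.
split=> [/nbhs_ballP[e /posC[r r0 ->] H]|[r [r0 H]]].
  exists r; split=> // s sa; apply: H.
  by rewrite -ball_normE /= normC_cabs ltcR cabsB.
apply/nbhs_ballP; exists r%:C; first by rewrite /= ltcR.
by move=> s; rewrite -ball_normE /= normC_cabs ltcR cabsB => /H.
Qed.

Lemma pnearCP (a : R[i]^o) (P : R[i]^o -> Prop) :
  (\forall s \near a^', P s) <-> pnearC a P.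
Proof.
apply: (iff_trans (nearCP a (fun s => s != a -> P s))).
split=> -[r [r0 H]]; exists r; split=> //.
  by move=> s sa /H; exact.
by move=> s h sa; exact: H.
Qed.

Lemma power_series_cvg (c : nat -> R[i]^o) (z l : R[i]^o) r B : norm_le c r B ->
  cabs z <= r -> (power_series c z @ \oo --> l) <-> l = psum c z.
Proof.
move=> Hc zr; have E : ccvg (power_series c z) (psum c z).
  have := csumP (norm_le_absum Hc zr); congr ccvg.
  by apply/funext => n; rewrite /power_series /series /= big_mkord.
by rewrite cvgC_ccvg; split=> [H|->//]; apply: ccvg_unique H E.
Qed.

(** A power series that converges on a disc has bounded terms at a point of the
    disc, hence converges absolutely on half that radius. *)
Lemma power_series_ana (c : nat -> R[i]^o) (r : R) : 0 < r ->
  (forall z : R[i]^o, z != 0 -> cabs z < r -> cvg (power_series c z @ \oo)) ->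
  exists r' B, 0 < r' /\ norm_le c r' B.
Proof.
move=> r0 H; pose e := r / 2; have e0 : 0 < e by rewrite divr_gt0.
have eC : cabs e%:C = e by rewrite cabsR gtr0_norm.
have /cvg_ex[l /cvgC_ccvg Hl] : cvg (power_series c e%:C @ \oo).
  apply: H; first by rewrite -cabs_gt0 eC.
  by rewrite eC /e ltr_pdivrMr// ltr_pMr ?ltr1n.
have [N HN] := Hl 1 ltr01.
have bd : exists B : R, 0 <= B /\ forall n, cabs (c n) * e ^+ n <= B.
  exists (2 + \sum_(k < N) cabs (c k) * e ^+ k); split.
    by rewrite addr_ge0// sumr_ge0// => k _; rewrite mulr_ge0 ?cabs_ge0 ?exprn_ge0 ?ltW.
  move=> n; have [nN|Nn] := ltnP n N.
    rewrite (bigD1 (Ordinal nN))//= addrCA lerDl addr_ge0// sumr_ge0// => k _.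
    by rewrite mulr_ge0 ?cabs_ge0 ?exprn_ge0 ?ltW.
  rewrite ler_wpDr//.
    by rewrite sumr_ge0// => k _; rewrite mulr_ge0 ?cabs_ge0 ?exprn_ge0 ?ltW.
  have h1 := HN _ Nn; have h2 := HN _ (leqW Nn).
  have -> : cabs (c n) * e ^+ n = cabs (power_series c e%:C n.+1 - power_series c e%:C n).
    rewrite /power_series /series /= big_nat_recr //= addrAC subrr add0r.
    by rewrite cabsM cabsX eC.
  by apply: le_trans (cabs_triB _ l _) _; rewrite (cabsB l); lra.
have [B [B0 HB]] := bd; exists (e / 2), (2 * B); split; first by rewrite divr_gt0.
move=> m; apply: (@le_trans _ _ (\sum_(n < m) B * 2^-1 ^+ n)).
  apply: ler_sum => n _; rewrite expr_div_n mulrA exprVn ler_wpM2r ?invr_ge0 ?exprn_ge0//.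
rewrite -mulr_sumr mulrC ler_wpM2r//.
by apply: geom_le2; lra.
Qed.

Lemma analytic_atP (Z : R[i]^o -> R[i]^o) (a : R[i]^o) : analytic_at Z a <-> ana Z a.
Proof.
split=> [[c /nearCP[r [r0 H]]]|[c [r [B [r0 Hc HZ]]]]]; last first.
  exists c; apply/nearCP; exists r; split=> // s /ltW sr.
  by apply/(power_series_cvg _ Hc sr); apply: HZ.
have [|r' [B [r'0 Hc]]] := @power_series_ana c r r0.
  move=> z _ zr; have := H (z + a); rewrite addrK => /(_ zr) h.
  by apply/cvg_ex; exists (Z (z + a)).
exists c, (Num.min r' (r / 2)), B.
have m0 : 0 < Num.min r' (r / 2) by rewrite lt_min r'0 divr_gt0.
split=> //; first by apply: norm_le_radius Hc; rewrite (ltW m0) ge_min lexx.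
move=> s; rewrite le_min => /andP[h1 h2].
apply/(power_series_cvg _ Hc h1); apply: H; apply: le_lt_trans h2 _.
by rewrite ltr_pdivrMr// ltr_pMr ?ltr1n.
Qed.

Lemma pole_lau (Z : R[i]^o -> R[i]^o) (a : R[i]^o) : pole_at Z a -> lau Z a.
Proof.
move=> [k [c [k0 c0 /pnearCP[r [r0 H]]]]].
have [|r' [B [r'0 Hc]]] := @power_series_ana c r r0.
  move=> z z0 zr; have := H (z + a); rewrite addrK => /(_ _ zr) h.
  apply/cvg_ex; exists (z ^+ k * Z (z + a)); apply: h.
  by rewrite -subr_eq0 addrK.
exists k, (fun s => psum c (s - a)); split; first exact: ana_psum r'0 Hc.
exists (Num.min r r'); split; first by rewrite lt_min r0.
move=> s sa; rewrite lt_min => /andP[h1 /ltW h2].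
by apply/(power_series_cvg _ Hc h2); apply: H.
Qed.

Lemma pole_atI (Z : R[i]^o -> R[i]^o) (a : R[i]^o) k H : (0 < k)%N -> ana H a ->
  H a != 0 -> pnearC a (fun s => (s - a) ^+ k * Z s = H s) -> pole_at Z a.
Proof.
move=> k0 [c [r [B [r0 Hc HH]]]] Ha [r' [r'0 E]]; exists k, c; split=> //.
  by move: Ha; rewrite HH subrr ?cabs0 ?(ltW r0)// psum0.
apply/pnearCP; exists (Num.min r r'); split; first by rewrite lt_min r0.
move=> s sa; rewrite lt_min => /andP[/ltW h1 h2].
by apply/(power_series_cvg _ Hc h1); rewrite E// HH.
Qed.

Lemma meromorphic_lau (Z : R[i]^o -> R[i]^o) : meromorphic Z -> forall a, lau Z a.
Proof. by move=> H a; have [/analytic_atP/ana_lau|/pole_lau] := H a. Qed.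

Lemma regularize_meromorphic (U : R[i]^o -> R[i]^o) : (forall a, lau U a) ->
  meromorphic (regularize U).
Proof.
move=> LU a; have [A|[k [H [k0 AH Ha E]]]] := regularize_merom (LU a).
  by left; apply/analytic_atP.
by right; apply: pole_atI k0 AH Ha E.
Qed.

Lemma is_derive_diff (Z : R[i]^o -> R[i]^o) (d : R[i]^o) :
  is_derive (0 : R[i]^o) (1 : R[i]^o) Z d <->
  (forall e : R, 0 < e -> pnearC 0 (fun h => cabs ((Z h - Z 0) / h - d) <= e)).
Proof.
have E (h : R[i]^o) : h^-1 *: ((Z \o shift (0 : R[i]^o)) (h *: (1 : R[i]^o)) - Z 0) = (Z h - Z 0) / h.
  by rewrite /= addr0 [h *: 1]mulr1 [_ *: _]mulrC.
split=> [[dZ <-] e e0|H].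
  move: dZ => /cvgrPdist_le/(_ e%:C); rewrite ltcR => /(_ e0) /pnearCP.
  apply: pnearC_imp => h h0; rewrite E normC_cabs lecR cabsB.
  by rewrite -[lim _]/('D_1 Z (0 : R[i]^o)).
have C : (fun h : R[i]^o => h^-1 *: ((Z \o shift (0 : R[i]^o)) (h *: (1 : R[i]^o)) - Z 0)) @ (0 : R[i]^o)^' --> d.
  apply/cvgrPdist_le => _ /posC[e e0 ->]; apply/pnearCP.
  by apply: pnearC_imp (H e e0) => h h0; rewrite E normC_cabs lecR cabsB.
by split; [apply: cvgP C | apply/cvg_lim].
Qed.

Lemma jet_is_derive (Z : R[i]^o -> R[i]^o) x y : jet Z 0 x y ->
  is_derive (0 : R[i]^o) (1 : R[i]^o) Z y.
Proof.
move=> J; have Z0 := jet_val J; move: J => [H [AH H0 E]].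
apply/is_derive_diff => e e0.
have [r [C [r0 HL]]] := ana_lipschitz AH.
have [r' [r'0 E']] := E.
have C0 : 0 < `|C| + 1 by rewrite ltr_wpDl.
exists (Num.min (Num.min r r') (e / (`|C| + 1))); split.
  by rewrite !lt_min r0 r'0 divr_gt0.
move=> h h0; rewrite !lt_min => /andP[/andP[/ltW h1 h2] h3].
have -> : (Z h - Z 0) / h - y = H h - H 0.
  rewrite E'// Z0 H0 subr0 addrAC subrr add0r mulrAC mulfV// mul1r.
  by [].
apply: le_trans (HL h h1) _; apply: ltW; move: h3; rewrite ltr_pdivlMr//.
apply: le_lt_trans; rewrite mulrC ler_wpM2l ?cabs_ge0//.
by rewrite (le_trans (ler_norm _))// lerDl.
Qed.

(** Differentiability at 0 makes Z continuous there, so that Z has the value of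
    the analytic function that it equals around 0. *)
Lemma is_derive_jet (Z G : R[i]^o -> R[i]^o) (d : R[i]^o) x y :
  is_derive (0 : R[i]^o) (1 : R[i]^o) Z d -> jet G 0 x y ->
  pnearC 0 (fun s => Z s = G s) -> d = y.
Proof.
move=> /is_derive_diff D J E.
have G0 := jet_val J; have /is_derive_diff DG := jet_is_derive J.
have Z0 : Z 0 = G 0.
  apply/eqP; rewrite -subr_eq0; apply/eqP/cabs_le_eq0 => e e0.
  have e3 : 0 < e / 3 by rewrite divr_gt0.
  have := pnearCI E (pnearCI (D _ ltr01) (DG _ ltr01)).
  pose m := Num.min 1 (e / 4 / (2 + cabs d + cabs y)).
  have den0 : 0 < 2 + cabs d + cabs y by have := cabs_ge0 d; have := cabs_ge0 y; lra.
  have m0 : 0 < m by rewrite lt_min ltr01 !divr_gt0.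
  move=> /(pnearC_ex m0)[s [s0]]; rewrite subr0 => sm [Es [h1 h2]].
  have lin (F : R[i]^o -> R[i]^o) v : cabs ((F s - F 0) / s - v) <= 1 ->
      cabs (F 0 - F s) <= (1 + cabs v) * cabs s.
    move=> h; have -> : F 0 - F s = - ((F s - F 0) / s) * s.
      by rewrite mulNr mulfVK// opprB.
    rewrite cabsM cabsN ler_wpM2r ?cabs_ge0//.
    by rewrite -[X in cabs X](subrK v) (le_trans (cabsD _ _))// lerD2r.
  have l1 := lin _ _ h1; have l2 := lin _ _ h2.
  apply: le_trans (cabs_triB _ (Z s) _) _; rewrite {2}Es (cabsB (G s)).
  apply: le_trans (lerD l1 l2) _; rewrite -mulrDl.
  have -> : 1 + cabs d + (1 + cabs y) = 2 + cabs d + cabs y by ring.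
  have : cabs s * (2 + cabs d + cabs y) <= e / 4.
    by rewrite -ler_pdivlMr// ltW// (lt_le_trans sm)// ge_min lexx orbT.
  by rewrite mulrC; lra.
apply/eqP; rewrite -subr_eq0; apply/eqP/cabs_le_eq0 => e e0.
have e2 : 0 < e / 2 by rewrite divr_gt0.
have [s [_ _ [Es [h1 h2]]]] := pnearC_ex ltr01 (pnearCI E (pnearCI (D _ e2) (DG _ e2))).
move: h1; rewrite Es Z0 => h1.
apply: le_trans (cabs_triB _ ((G s - G 0) / s) _) _; rewrite [leRHS]splitr lerD//.
by rewrite cabsB.
Qed.

End Jets.

(** * Exponentials and Dirichlet series *)

Section Exponential.
Variable R : realType.
Implicit Types (z w s a b : R[i]).

Lemma cexpD z w : cexp (z + w) = cexp z * cexp w.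
Proof.
case: z w => x y [x' y']; rewrite /cexp /= expRD cosD sinD.
by apply/eqP; rewrite eq_complex /=; apply/andP; split; apply/eqP; ring.
Qed.

Lemma cexpR (x : R) : cexp x%:C = (expR x)%:C.
Proof. by rewrite /cexp /= cos0 sin0 mulr1. Qed.

Lemma cabs_cexp z : cabs (cexp z) = expR (complex.Re z).
Proof.
case: z => x y; rewrite /cexp cabsM cabsR ger0_norm ?expR_ge0//=.
by rewrite cabsE /= cos2Dsin2 sqrtr1 mulr1.
Qed.

Definition exp_coef n : R[i] := (n`!%:R)^-1.

Lemma exp_partial (x : R) n : 0 <= x -> \sum_(k < n) x ^+ k / k`!%:R <= expR x.
Proof.
move=> x0; have -> : \sum_(k < n) x ^+ k / k`!%:R = series (exp_coeff x) n.
  by rewrite /series /= big_mkord.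
apply: nondecreasing_cvgn_le; last exact: is_cvg_series_exp_coeff.
by apply: nondecreasing_series => k _ _; exact: exp_coeff_ge0.
Qed.

Lemma cabs_exp_coef n : cabs (exp_coef n) = (n`!%:R)^-1.
Proof.
by rewrite /exp_coef cabsV -(rmorph_nat (real_complex R)) cabsR ger0_norm.
Qed.

Lemma norm_exp (l : R[i]) (r : R) : 0 <= r ->
  norm_le (fun n => exp_coef n * l ^+ n) r (expR (cabs l * r)).
Proof.
move=> r0 m; apply: le_trans (exp_partial m _); last by rewrite mulr_ge0 ?cabs_ge0.
apply: ler_sum => k _; rewrite cabsM cabsX cabs_exp_coef exprMn.
by rewrite le_eqVlt; apply/orP; left; apply/eqP; ring.
Qed.

Definition cE z := psum exp_coef z.

Lemma cE_norm r : 0 <= r -> norm_le exp_coef r (expR r).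
Proof.
move=> r0 m; apply: le_trans (exp_partial m r0); apply: ler_sum => k _.
by rewrite cabs_exp_coef mulrC.
Qed.

Lemma cED z w : cE (z + w) = cE z * cE w.
Proof.
have E v : cE v = psum (fun n => exp_coef n * v ^+ n) 1.
  by congr csum; apply/funext => n; rewrite expr1n mulr1.
rewrite (E z) (E w).
have c1 : cabs (1 : R[i]) <= 1 by rewrite cabs1.
have [_ /(_ 1 c1) <-] := cauchy_productP ltr01 (norm_exp z ler01) (norm_exp w ler01).
congr csum; apply/funext => n; rewrite expr1n mulr1 /cauchy_product addrC exprDn mulr_sumr.
apply: eq_bigr => i _; have il : (i <= n)%N by rewrite -ltnS.
have f0 m : (m`!%:R : R[i]) != 0 by rewrite pnatr_eq0 -lt0n fact_gt0.
rewrite -mulr_natr /exp_coef -(bin_fact il) !natrM !invfM.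
rewrite [LHS](_ : _ = ('C(n, i)%:R^-1 * 'C(n, i)%:R) * ((i`!%:R^-1 * (n - i)`!%:R^-1) * (w ^+ (n - i) * z ^+ i))); last by ring.
rewrite mulVf ?mul1r; first by ring.
by rewrite pnatr_eq0 -lt0n bin_gt0.
Qed.

Lemma cexp_psum z : cexp z = psum exp_coef z.
Proof.
have Ac v : absum (fun n => exp_coef n * v ^+ n).
  by apply: norm_le_absum (cE_norm (cabs_ge0 v)) _.
have real (x : R) : cE x%:C = (expR x)%:C.
  apply: csum_eq; first exact: Ac.
  have -> : (expR x)%:C = expR x +i* 0 by [].
  apply: ccvg_ReIm.
    suff -> : (fun n => complex.Re (\sum_(k < n) exp_coef k * x%:C ^+ k)) =
        series (exp_coeff x) by exact: is_cvg_series_exp_coeff.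
    apply/funext => n; rewrite /series /= big_mkord raddf_sum; apply: eq_bigr => k _.
    by rewrite /exp_coef -rmorphXn -(rmorph_nat (real_complex R)) -fmorphV -rmorphM mulrC.
  have -> : (fun n => complex.Im (\sum_(k < n) exp_coef k * x%:C ^+ k)) = fun=> 0.
    apply/funext => n; rewrite (raddf_sum (@complex.Im R)) big1// => k _.
    by rewrite /exp_coef -rmorphXn -(rmorph_nat (real_complex R)) -fmorphV -rmorphM.
  exact: cvg_cst.
have pow (y : R) n : exp_coef n * ('i * y%:C) ^+ n =
    (cos_coeff y n) +i* (sin_coeff y n).
  rewrite /exp_coef -(rmorph_nat (real_complex R)) -fmorphV exprMn -rmorphXn.
  rewrite -[in 'i ^+ n](odd_double_half n) exprD -muln2 mulnC exprM sqr_i.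
  rewrite /cos_coeff /sin_coeff /=.
  have -> : ((-1) ^ n./2 : R) = (-1) ^+ n./2 by [].
  have -> : (-1 : R[i]) ^+ n./2 = ((-1) ^+ n./2 : R)%:C by rewrite rmorphXn rmorphN1.
  case on : (odd n) => /=; last first.
    rewrite expr0 mul1r -!rmorphM /= !mul0r !mul1r.
    apply/eqP; rewrite eq_complex /= eqxx andbT; apply/eqP; ring.
  have -> : (n.-1./2 = n./2)%N by rewrite -[in LHS](odd_double_half n) on add1n /= doubleK.
  rewrite expr1 !mul0r !mul1r.
  by apply/eqP; rewrite eq_complex /=; apply/andP; split; apply/eqP; ring.
have imag (y : R) : cE ('i * y%:C) = cos y +i* sin y.
  apply: csum_eq; first exact: Ac.
  apply: ccvg_ReIm.
    rewrite cos.unlock; suff -> : (fun n => complex.Re (\sum_(k < n) exp_coef k * ('i * y%:C) ^+ k)) =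
        series (cos_coeff y) by exact: is_cvg_series_cos_coeff.
    by apply/funext => n; rewrite raddf_sum /series /= big_mkord; apply: eq_bigr => k _; rewrite pow.
  rewrite sin.unlock; suff -> : (fun n => complex.Im (\sum_(k < n) exp_coef k * ('i * y%:C) ^+ k)) =
      series (sin_coeff y) by exact: is_cvg_series_sin_coeff.
  by apply/funext => n; rewrite (raddf_sum (@complex.Im R)) /series /= big_mkord; apply: eq_bigr => k _; rewrite pow.
have -> : psum exp_coef z = cE ((complex.Re z)%:C + 'i * (complex.Im z)%:C).
  by rewrite /cE -complexE.
by rewrite cED real imag.
Qed.

Lemma cexpM_psum (l : R[i]) z : cexp (l * z) = psum (fun n => exp_coef n * l ^+ n) z.
Proof.
by rewrite cexp_psum; congr csum; apply/funext => n; rewrite exprMn mulrA.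
Qed.

Lemma ana_cexpM (l : R[i]) b : ana (fun s => cexp (l * s)) b.
Proof.
apply: (@ana_ext _ b (psum (fun n => exp_coef n * l ^+ n))).
  by exists 1; split=> // s _; rewrite cexpM_psum.
by apply: ana_entire => r r0; exists (expR (cabs l * r)); apply: norm_exp; rewrite ltW.
Qed.

Lemma jet_cexpM (l : R[i]) : jet (fun s => cexp (l * s)) 0 1 l.
Proof.
have := jet_psum ltr01 (norm_exp l ler01).
rewrite /exp_coef fact0 invr1 expr0 mul1r expr1 mul1r; apply: jet_ext.
by exists 1; split=> // s _; rewrite cexpM_psum.
Qed.

Lemma dirichlet_ana (l : nat -> R) (sigma B : R) b :
  (forall k, 0 <= l k) -> (forall n, \sum_(k < n) expR (- sigma * l k) <= B) ->
  sigma < complex.Re b ->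
  absum (fun k => cexp (- b * (l k)%:C)) /\
  ana (fun s => csum (fun k => cexp (- s * (l k)%:C))) b.
Proof.
move=> l0 HB sb; pose r := complex.Re b - sigma.
have r0 : 0 < r by rewrite subr_gt0.
have ReM (s : R[i]) (x : R) : complex.Re (- s * x%:C) = - complex.Re s * x.
  by case: s => u v /=; rewrite mulr0 subr0.
pose c k n := cexp (- b * (l k)%:C) * (exp_coef n * (- (l k)%:C) ^+ n).
have Hc n m : \sum_(k < n) \sum_(j < m) cabs (c k j) * r ^+ j <= B.
  apply: le_trans (HB n); apply: ler_sum => k _.
  have -> : expR (- sigma * l k) = cabs (cexp (- b * (l k)%:C)) * expR (cabs (- (l k)%:C) * r).
    rewrite cabs_cexp ReM cabsN cabsR ger0_norm// -expRD; congr expR.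
    by rewrite /r; ring.
  under eq_bigr do rewrite /c cabsM -mulrA.
  rewrite -mulr_sumr ler_wpM2l ?cabs_ge0//.
  exact: (norm_exp _ (ltW r0)).
have [h1 h2] := psum_family r0 Hc.
have E k s : cexp (- s * (l k)%:C) = psum (c k) (s - b).
  rewrite /psum /c; under [X in csum X]funext => n do rewrite -mulrA.
  rewrite csumZ; last by apply: norm_le_absum (norm_exp _ (cabs_ge0 _)) _.
  rewrite -/(psum _ _) -cexpM_psum -cexpD; congr cexp; ring.
split.
  have [|A _] := h2 (b - b); first by rewrite subrr cabs0 ltW.
  by move: A; congr absum; apply/funext => k; rewrite E.
exists (fun j => csum (c^~ j)), r, B; split=> // s sr.
have [_ <-] := h2 _ sr; congr csum; apply/funext => k; exact: E.
Qed.

End Exponential.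

(** * Meromorphic continuation of the zeta function *)

Section Continuation.
Variable R : realType.
Implicit Types (z w s b : R[i]).

Definition pole_sum (a : nat -> R) s : R[i] :=
  csum (fun j => (a j)%:C / (j.+1%:R - s)).

Lemma natC n : (n%:R : R[i]) = (n%:R : R)%:C.
Proof. by rewrite rmorph_nat. Qed.

Lemma pole_tail_ana (a : nat -> R) (B : R) n0 b :
  (forall n, \sum_(j < n) `|a j| / j.+1%:R <= B) ->
  (forall j, (n0 <= j)%N -> j.+1%:R / 2 <= cabs (j.+1%:R - b)) ->
  absum (fun j => (a (j + n0)%N)%:C / ((j + n0).+1%:R - b)) /\
  ana (fun s => csum (fun j => (a (j + n0)%N)%:C / ((j + n0).+1%:R - s))) b.
Proof.
move=> HB Hb; pose d j := (j + n0).+1%:R - b.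
pose c j n := (a (j + n0)%N)%:C / d j * (d j)^-1 ^+ n.
pose r : R := 4^-1; have r0 : 0 < r by rewrite invr_gt0.
have dj j : (j + n0).+1%:R / 2 <= cabs (d j) by apply: Hb; rewrite leq_addl.
have dj2 j : 2^-1 <= cabs (d j).
  by apply: le_trans (dj j); rewrite ler_pMl// ler1n.
have d0 j : 0 < cabs (d j) by apply: lt_le_trans (dj2 j).
have dn0 j : d j != 0 by rewrite -cabs_gt0.
have Hc n m : \sum_(j < n) \sum_(k < m) cabs (c j k) * r ^+ k <= 4 * B.
  apply: (@le_trans _ _ (\sum_(j < n) 4 * (`|a (j + n0)%N| / (j + n0).+1%:R))).
    apply: ler_sum => j _.
    apply: (@le_trans _ _ (\sum_(k < m) `|a (j + n0)%N| / cabs (d j) * 2^-1 ^+ k)).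
      apply: ler_sum => k _; rewrite /c cabsM cabsM cabsV cabsX cabsV cabsR.
      rewrite -mulrA ler_wpM2l ?divr_ge0 ?cabs_ge0//.
      rewrite -exprMn lerXn2r ?nnegrE ?mulr_ge0 ?invr_ge0 ?cabs_ge0 ?(ltW r0)//.
      rewrite mulrC ler_pdivrMr//; have := dj2 j; rewrite /r; lra.
    rewrite -mulr_sumr.
    have h1 : `|a (j + n0)%N| / cabs (d j) <= 2 * (`|a (j + n0)%N| / (j + n0).+1%:R).
      rewrite mulrCA ler_wpM2l// -[leRHS]invrK lef_pV2 ?posrE ?invr_gt0 ?mulr_gt0 ?invr_gt0//.
      by rewrite invfM invrK mulrC.
    have E : (1 - 2^-1 : R) * \sum_(i < m) 2^-1 ^+ i = 1 - 2^-1 ^+ m.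
      by rewrite -opprB -(opprB _ 1) mulNr -subrX1.
    have h2 : \sum_(i < m) 2^-1 ^+ i <= (2 : R).
      have : 0 <= (2^-1 : R) ^+ m by apply: exprn_ge0; lra.
      move: E; move: (\sum_(i < m) _) (_ ^+ m) => X Y; lra.
    apply: (@le_trans _ _ (2 * (`|a (j + n0)%N| / (j + n0).+1%:R) * 2)); last first.
      by rewrite le_eqVlt; apply/orP; left; apply/eqP; ring.
    apply: ler_pM => //; first by rewrite divr_ge0 ?cabs_ge0.
    by apply: sumr_ge0 => k _; apply: exprn_ge0; lra.
  rewrite -mulr_sumr ler_pM2l//; apply: le_trans (HB (n0 + n)%N).
  rewrite big_split_ord /= ler_wpDl//.
    by apply: sumr_ge0 => k _; rewrite divr_ge0.
  by apply: ler_sum => k _; rewrite addnC.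
have [h1 h2] := psum_family r0 Hc.
have E j s : cabs (s - b) <= r -> (a (j + n0)%N)%:C / ((j + n0).+1%:R - s) = psum (c j) (s - b).
  move=> sr; pose x := (d j)^-1 * (s - b).
  have x2 : cabs x <= 2^-1.
    rewrite cabsM cabsV mulrC ler_pdivrMr//; have := dj2 j; move: sr; rewrite /r; lra.
  have Ax : absum (fun n => x ^+ n).
    exists 2 => m; apply: (@le_trans _ _ (\sum_(i < m) 2^-1 ^+ i)).
      by apply: ler_sum => k _; rewrite cabsX lerXn2r ?nnegrE ?cabs_ge0//; lra.
    by apply: geom_le2; lra.
  have G : (1 - x) * csum (fun n => x ^+ n) = 1.
    have [_ E] := csumS Ax; rewrite mulrBl mul1r {1}E expr0.
    under [X in _ + csum X - _]funext do rewrite exprS.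
    by rewrite csumZ// addrK.
  have -> : psum (c j) (s - b) = (a (j + n0)%N)%:C / d j * csum (fun n => x ^+ n).
    rewrite -(csumZ ((a (j + n0)%N)%:C / d j) Ax) /psum; congr csum; apply/funext => n.
    by rewrite /c /x exprMn mulrA.
  have dx : (j + n0).+1%:R - s = d j * (1 - x).
    by rewrite mulrBr mulr1 /x mulrA mulfV// mul1r /d; ring.
  have x1 : 1 - x != 0.
    by apply/eqP => x1; move: G; rewrite x1 mul0r => /esym/eqP; rewrite oner_eq0.
  rewrite dx invfM mulrA; congr (_ * _).
  by apply: (mulfI x1); rewrite mulfV// G.
split.
  have [|A _] := h2 (b - b); first by rewrite subrr cabs0 ltW.
  by move: A; congr absum; apply/funext => k; rewrite E// subrr cabs0 ltW.
exists (fun j => csum (c^~ j)), r, (4 * B); split=> // s sr.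
have [_ <-] := h2 _ sr; congr csum; apply/funext => k; exact: E.
Qed.

Lemma pole_sum_ana0 (a : nat -> R) (B : R) :
  (forall n, \sum_(j < n) `|a j| / j.+1%:R <= B) -> ana (pole_sum a) 0.
Proof.
move=> HB; have [|_] := pole_tail_ana (n0 := 0) (b := 0) HB.
  by move=> j _; rewrite subr0 natC cabsR ger0_norm// ler_pdivrMr// ler_pMr ?ler1n.
apply: ana_ext; exists 1; split=> // s _; congr csum; apply/funext => j.
by rewrite addn0.
Qed.

Lemma absum_pole (a : nat -> R) (B : R) b :
  (forall n, \sum_(j < n) `|a j| / j.+1%:R <= B) ->
  exists2 n0, (forall j, (n0 <= j)%N -> j.+1%:R / 2 <= cabs (j.+1%:R - b)) &
   absum (fun j => (a j)%:C / (j.+1%:R - b)).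
Proof.
move=> HB; have [n0 Hn0] : exists n0, forall j, (n0 <= j)%N -> j.+1%:R / 2 <= cabs (j.+1%:R - b).
  exists (Num.truncn (2 * cabs b)) => j hj.
  have h : 2 * cabs b <= j.+1%:R.
    apply: ltW; apply: lt_le_trans (truncnS_gt _) _.
    by rewrite ler_nat ltnS.
  have := cabs_triB j.+1%:R b 0; rewrite !subr0 natC cabsR ger0_norm//; lra.
exists n0 => //; have [A _] := pole_tail_ana HB Hn0.
exact: absum_shift A.
Qed.

Lemma pole_sum_lau (a : nat -> R) (B : R) b :
  (forall n, \sum_(j < n) `|a j| / j.+1%:R <= B) -> lau (pole_sum a) b.
Proof.
move=> HB; have [n0 Hn0 _] := absum_pole b HB.
have [_ At] := pole_tail_ana HB Hn0.
have Lf : lau (fun s => \sum_(j < n0) (a j)%:C / (j.+1%:R - s)) b.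
  elim: (n0) => [|n IH].
    apply: (@lau_ext _ (fun=> 0)); last by apply: ana_lau; exact: ana_cst.
    by exists 1; split=> // s _ _; rewrite big_ord0.
  apply: (@lau_ext _ (fun s => \sum_(j < n) (a j)%:C / (j.+1%:R - s) + (a n)%:C * (n.+1%:R - s)^-1)).
    by exists 1; split=> // s _ _; rewrite big_ord_recr.
  apply: lauD => //; apply: lauM; first by apply: ana_lau; exact: ana_cst.
  have A : ana (fun s => n.+1%:R - s) b by apply: anaB; [exact: ana_cst|exact: ana_id].
  apply: lau_inv (ana_lau A) _ => z.
  have Z := pnear_eq0_near A z; have [y J] := ana_jet A.
  have J0 : jet (fun s => n.+1%:R - s) b 0 0.
    apply: jet_ext (jet_cst 0 b); apply: nearC_imp Z => s ->; by [].
  have J1 : jet (fun s => n.+1%:R - s) b (n.+1%:R + - 1 * b) (0 + (-1 * 1 + 0 * b)).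
    apply: jet_ext (jetD (jet_cst n.+1%:R b) (jetM (jet_cst (-1) b) (jet_id b))).
    by exists 1; split=> // s _; rewrite mulN1r.
  have [_ /eqP] := jet_unique J0 J1.
  by rewrite mul0r addr0 add0r mulr1 eq_sym oppr_eq0 oner_eq0.
apply: lau_ext (lauD Lf (ana_lau At)); exists 1; split=> // s _ _.
have [_ _ As] := absum_pole s HB; rewrite /pole_sum.
elim: (n0) => [|n IH].
  by rewrite big_ord0 add0r; congr csum; apply/funext => j; rewrite addn0.
rewrite -IH big_ord_recr /= -addrA; congr (_ + _).
have An : absum (fun j => (a (j + n)%N)%:C / ((j + n).+1%:R - s)).
  have [C HC] := As; exists C => m; apply: le_trans (HC (n + m)%N).
  rewrite big_split_ord /= ler_wpDl//.
    by apply: sumr_ge0 => k _; exact: cabs_ge0.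
  by apply: ler_sum => k _; rewrite addnC.
have [_ ->] := csumS An; rewrite add0n; congr (_ + csum _).
by apply/funext => j; rewrite addnS.
Qed.

Lemma not_pnear0 (U : R[i] -> R[i]) b G x y : (forall a, lau U a) -> jet G 0 x y ->
  x != 0 -> (exists V, ana V 0 /\ pnearC 0 (fun s => V s * U s = G s)) ->
  ~ pnearC b (fun s => U s = 0).
Proof.
move=> LU J x0 [V [AV E]] Ub.
have U0 : pnearC 0 (fun s => U s = 0) by apply: identity_theorem Ub => t _; apply: LU.
have G0 : pnearC 0 (fun s => G s = 0).
  by apply: pnearC_imp (pnearCI U0 E) => s _ [-> <-]; rewrite mulr0.
have := nearC_at (pnear_eq0_near (jet_ana J) G0); rewrite (jet_val J) => x00.
by rewrite x00 eqxx in x0.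
Qed.

Variables (l : nat -> R) (a h : nat -> R) (A E : nat -> R[i]) (L K BA : R).
Hypothesis l0 : forall k, 0 <= l k.
Hypothesis l_sum : forall sigma, 2^-1 < sigma ->
  exists B, forall n, \sum_(k < n) expR (- sigma * l k) <= B.
Hypothesis a_sum : forall n, \sum_(j < n) `|a j| / j.+1%:R <= BA.
Hypothesis h_sum : forall n, \sum_(j < n) `|h j| / j.+1%:R <= BA.
Hypothesis A_ent : forall r, 0 < r -> exists B, norm_le A r B.
Hypothesis E_ent : forall r, 0 < r -> exists B, norm_le E r B.

Definition zetaC s := csum (fun k => cexp (- s * (l k)%:C)).
Definition mellinM s := s^-1 ^+ 2 + (pole_sum a s + pole_sum a (- s)).
Definition scaleC s := cexp (- L%:C * s).
Definition mellinN s := pole_sum h s +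
  (psum A s + scaleC s * (2 * s^-1 ^+ 2 - K%:C * s^-1 + psum E s)) * (1 - 3 * scaleC s)^-1.

Hypothesis real_id : forall s : R, 2^-1 < s < 1 ->
  zetaC s%:C * mellinM s%:C = mellinN s%:C.

Lemma lau_invs b : lau (fun s => s^-1) b.
Proof.
apply: lau_inv (ana_lau (ana_id b)) _ => z.
have J0 : jet id b 0 0.
  apply: jet_ext (jet_cst 0 b); have [r [r0 H]] := pnear_eq0_near (ana_id b) z.
  by exists r; split=> // s /H ->.
by have [_ /eqP] := jet_unique J0 (jet_id b); rewrite eq_sym oner_eq0.
Qed.

Lemma lau_poleN b : lau (fun s => pole_sum a (- s)) b.
Proof.
have [k [G [[c [r [B [r0 Hc HG]]]] EG]]] := pole_sum_lau (- b) a_sum.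
exists k, (fun s => (-1) ^+ k * G (- s)); split.
  apply: anaM; first exact: ana_cst.
  exists (fun n => (-1) ^+ n * c n), r, B; split=> //.
    move=> m; apply: le_trans (Hc m); apply: ler_sum => n _.
    by rewrite cabsM cabsX cabsN cabs1 expr1n mul1r.
  move=> s sr; rewrite HG; last by rewrite -opprD cabsN.
  congr csum; apply/funext => n; have -> : - s - - b = -1 * (s - b) by rewrite mulN1r opprD.
  rewrite exprMn; ring.
have [r' [r'0 H]] := EG; exists r'; split=> // s sb sr.
rewrite -H ?eqr_opp//; last by rewrite -opprD cabsN.
by rewrite mulrA -exprMn mulN1r -opprD opprK.
Qed.

Lemma ana_poleN : ana (fun s => pole_sum a (- s)) 0.
Proof.
have [c [r [B [r0 Hc HG]]]] := pole_sum_ana0 a_sum.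
exists (fun n => (-1) ^+ n * c n), r, B; split=> //.
  move=> m; apply: le_trans (Hc m); apply: ler_sum => n _.
  by rewrite cabsM cabsX cabsN cabs1 expr1n mul1r.
move=> s sr; rewrite HG; last by rewrite subr0 cabsN -[s]subr0.
congr csum; apply/funext => n; rewrite !subr0 -[- s]mulN1r exprMn; ring.
Qed.

Lemma lau_mellinM b : lau mellinM b.
Proof.
apply: lauD; last by apply: lauD; [exact: pole_sum_lau a_sum|exact: lau_poleN].
apply: (@lau_ext _ (fun s => s^-1 * s^-1)); last by apply: lauM; exact: lau_invs.
by exists 1; split=> // s _ _; rewrite expr2.
Qed.

Lemma ana_scale b : ana scaleC b. Proof. exact: ana_cexpM. Qed.

Lemma ana_scale1 b : ana (fun s => 1 - 3 * scaleC s) b.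
Proof.
by apply: anaB; [exact: ana_cst|apply: anaM; [exact: ana_cst|exact: ana_scale]].
Qed.

Lemma jet_scale1 : jet (fun s => 1 - 3 * scaleC s) 0 (- 2) (3 * L%:C).
Proof.
have := jetD (jet_cst 1 0) (jetM (jet_cst (- 3) 0) (jet_cexpM (- L%:C))).
have -> : (1 + - 3 * 1 : R[i]) = - 2 by ring.
have -> : 0 + (- 3 * - L%:C + 0 * 1) = 3 * L%:C by ring.
by apply: jet_ext; exists 1; split=> // s _; rewrite mulNr.
Qed.

Lemma lau_mellinN b : lau mellinN b.
Proof.
apply: lauD; first exact: pole_sum_lau h_sum.
apply: lauM; last first.
  apply: lau_inv (ana_lau (ana_scale1 b)) _.
  apply: not_pnear0 jet_scale1 _ _; first by move=> ?; apply: ana_lau; exact: ana_scale1.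
    by rewrite oppr_eq0 pnatr_eq0.
  exists (fun=> 1); split; first exact: ana_cst.
  by exists 1; split=> // s _ _; rewrite mul1r.
apply: lauD; first by apply: ana_lau; exact: ana_entire.
apply: lauM; first by apply: ana_lau; exact: ana_scale.
apply: lauD; last by apply: ana_lau; exact: ana_entire.
apply: lauB.
  apply: lauM; first by apply: ana_lau; exact: ana_cst.
  apply: (@lau_ext _ (fun s => s^-1 * s^-1)); last by apply: lauM; exact: lau_invs.
  by exists 1; split=> // s _ _; rewrite expr2.
by apply: lauM; [apply: ana_lau; exact: ana_cst|exact: lau_invs].
Qed.

Lemma jet_sq : jet (fun s : R[i] => s ^+ 2) 0 0 0.
Proof.
have := jetM (jet_id (0 : R[i])) (jet_id 0).
by rewrite mul0r mulr1 mul1r addr0; apply: jet_ext; exists 1.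
Qed.

Lemma jet_mellinM : exists G, jet G 0 1 0 /\ pnearC 0 (fun s => s ^+ 2 * mellinM s = G s).
Proof.
have [y J1] := ana_jet (pole_sum_ana0 a_sum); have [y' J2] := ana_jet ana_poleN.
have := jetD (jet_cst 1 0) (jetM jet_sq (jetD J1 J2)).
rewrite !mul0r !addr0 => J; eexists; split; first exact: J.
exists 1; split=> // s s0 _.
by rewrite mulrDr -exprMn mulfV// expr1n.
Qed.

Lemma mellinM_not0 b : ~ pnearC b (fun s => mellinM s = 0).
Proof.
have [G [J E0]] := jet_mellinM; apply: not_pnear0 J _ _.
- exact: lau_mellinM.
- exact: oner_neq0.
by exists (fun s => s ^+ 2); split=> //; apply: jet_ana jet_sq.
Qed.

Lemma zetaC_ana b : 2^-1 < complex.Re b ->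
  absum (fun k => cexp (- b * (l k)%:C)) /\ ana zetaC b.
Proof.
move=> hb; pose sigma := (2^-1 + complex.Re b) / 2.
have h1 : 2^-1 < sigma by rewrite /sigma; lra.
have [B HB] := l_sum h1.
by apply: dirichlet_ana HB _ => //; rewrite /sigma; lra.
Qed.

Lemma Re_segment (x y : R[i]) (t : R) :
  complex.Re (segment_point x y t) = complex.Re x + t * (complex.Re y - complex.Re x).
Proof.
by case: x y => u v [u' v']; rewrite /segment_point /= mul0r subr0.
Qed.

(** The difference is analytic on the strip and vanishes on a real segment, so
    that its zeros accumulate; the identity theorem spreads them. *)
Lemma strip_id b : 2^-1 < complex.Re b < 1 ->
  pnearC b (fun s => zetaC s * mellinM s - mellinN s = 0).
Proof.
move=> /andP[hb1 hb2].
pose F s := zetaC s * mellinM s - mellinN s; pose c0 : R[i] := (3 / 4)%:C.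
have LF c : 2^-1 < complex.Re c -> lau F c.
  move=> hc; apply: lauB (lau_mellinN c); apply: lauM (lau_mellinM c).
  by apply: ana_lau; have [] := zetaC_ana hc.
have Rc0 : complex.Re c0 = 3 / 4 by [].
apply: (@identity_theorem _ F c0).
  move=> t /andP[t0 t1]; apply: LF; rewrite Re_segment Rc0; nra.
have [//|[k [m [H [_ _ _ nz]]]]] := lau_dichotomy (LF c0 ltac:(rewrite Rc0; lra)).
have [r [r0 Hr]] := nz.
pose e := Num.min (r / 2) 8^-1.
have e0 : 0 < e by rewrite lt_min divr_gt0//= invr_gt0.
have e8 : e <= 8^-1 by rewrite ge_min lexx orbT.
have er : e < r by rewrite gt_min ltr_pdivrMr// ltr_pMr ?ltr1n.
have dE : cabs ((3 / 4 + e)%:C - c0) = e.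
  by rewrite -rmorphB addrAC subrr add0r cabsR gtr0_norm.
have [] := Hr (3 / 4 + e)%:C; [|by rewrite dE|].
  by rewrite -subr_eq0 -cabs_gt0 dE.
move=> _ /eqP[]; rewrite /F real_id ?subrr//; lra.
Qed.

(** N / M continues zeta to the left of the half-plane of convergence.  Near
    0, with the double poles cleared, s^2 N = - 1 + (K - L) / 2 s + O(s^2)
    and s^2 M = 1 + O(s^2). *)
Theorem continuation : exists Z : R[i] -> R[i],
  [/\ meromorphic (Z : R[i]^o -> R[i]^o),
   forall s, 3 / 4 < complex.Re s -> Z s = zetaC s
   & jet Z 0 (-1) (((K - L) / 2)%:C)].
Proof.
pose U s := if 3 / 4 < complex.Re s then zetaC s else mellinN s * (mellinM s)^-1.
have LQ b : lau (fun s => mellinN s * (mellinM s)^-1) b.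
  apply: lauM (lau_mellinN b) _; apply: lau_inv (lau_mellinM b) _; exact: mellinM_not0.
have Re_near (b : R[i]) : nearC b (fun s => `|complex.Re s - complex.Re b| < `|complex.Re b - 3 / 4| + (complex.Re b == 3 / 4)%:R).
  exists (`|complex.Re b - 3 / 4| + (complex.Re b == 3 / 4)%:R); split.
    have [->|n] := eqVneq (complex.Re b) (3 / 4).
      by rewrite subrr normr0 add0r.
    by rewrite addr0 normr_gt0 subr_eq0.
  move=> s; apply: le_lt_trans; have := cabs_Re (s - b).
  by rewrite raddfB.
have Uhi b : 3 / 4 < complex.Re b -> nearC b (fun s => zetaC s = U s).
  move=> hb; apply: nearC_imp (Re_near b) => s; rewrite gt_eqF// addr0 /U => hs.
  rewrite ifT//; move: hs; rewrite [X in _ < X]gtr0_norm ?subr_gt0//.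
  rewrite ltr_norml => /andP[]; lra.
have Ulo b : complex.Re b < 3 / 4 -> nearC b (fun s => mellinN s * (mellinM s)^-1 = U s).
  move=> hb; apply: nearC_imp (Re_near b) => s; rewrite lt_eqF// addr0 /U => hs.
  rewrite ifF//; apply/negbTE; rewrite -leNgt; move: hs.
  rewrite [X in _ < X]ltr0_norm ?subr_lt0// ltr_norml => /andP[]; lra.
have ZA b : 3 / 4 < complex.Re b -> ana zetaC b.
  by move=> hb; have [] := @zetaC_ana b ltac:(lra).
have LU b : lau U b.
  have [hb|hb|hb] := ltgtP (complex.Re b) (3 / 4).
  - apply: lau_ext (LQ b); exact: nearC_pnearC (Ulo b hb).
  - apply: lau_ext (ana_lau (ZA b hb)); exact: nearC_pnearC (Uhi b hb).
  apply: lau_ext (LQ b).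
  have S : pnearC b (fun s => zetaC s * mellinM s - mellinN s = 0).
    by apply: strip_id; rewrite hb; lra.
  have [//|[k [m [H [_ _ _ nz]]]]] := lau_dichotomy (lau_mellinM b).
    by move=> z; have := mellinM_not0 z.
  apply: pnearC_imp (pnearCI S nz) => s _ [e [_ Ms]]; rewrite /U; case: ifP => // _.
  by apply: (mulIf Ms); rewrite mulfVK//; move/eqP: e; rewrite subr_eq0 => /eqP.
exists (regularize U); split.
- exact: regularize_meromorphic.
- move=> s hs; have AU : ana U s := ana_ext (Uhi s hs) (ZA s hs).
  rewrite (nearC_at (regularize_ana AU)).
  by rewrite /U hs.
have [G [JG EG]] := jet_mellinM.
pose T s := s ^+ 2 * pole_sum h s * (1 - 3 * scaleC s) +
   (s ^+ 2 * psum A s + scaleC s * (2 + - K%:C * s + s ^+ 2 * psum E s)).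
have [hy Jh] := ana_jet (pole_sum_ana0 h_sum).
have [Ay JA] := ana_jet (ana_entire 0 A_ent).
have [Ey JE] := ana_jet (ana_entire 0 E_ent).
have JT : jet T 0 2 (- K%:C - 2 * L%:C).
  have := jetD (jetM (jetM jet_sq Jh) jet_scale1) (jetD (jetM jet_sq JA)
    (jetM (jet_cexpM (- L%:C)) (jetD (jetD (jet_cst 2 0) (jetM (jet_cst (- K%:C) 0) (jet_id 0)))
      (jetM jet_sq JE)))).
  rewrite !(mul0r, mulr0, add0r, addr0, mul1r, mulr1).
  by have -> : - K%:C + - L%:C * 2 = - K%:C - 2 * L%:C by ring.
have G0 : G 0 != 0 by rewrite (jet_val JG) oner_neq0.
have S0 : (1 - 3 * scaleC 0 : R[i]) != 0.
  by rewrite (jet_val jet_scale1) oppr_eq0 pnatr_eq0.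
pose Q s := T s * ((G s)^-1 * (1 - 3 * scaleC s)^-1).
have AQ : ana Q 0.
  apply: anaM (jet_ana JT) _; apply: anaM; apply: ana_inv => //.
  - exact: jet_ana JG.
  - exact: ana_scale1.
have nzG := ana_neq0 (jet_ana JG) G0; have nzS := ana_neq0 (ana_scale1 0) S0.
have UQ : pnearC 0 (fun s => U s = Q s).
  have lo : nearC (0 : R[i]) (fun s => mellinN s * (mellinM s)^-1 = U s).
    by apply: Ulo => /=; lra.
  have := pnearCI (nearC_pnearC (nearCI lo (nearCI nzG nzS))) EG.
  apply: pnearC_imp => s s0 [[<- [gs ss]] eG].
  have s20 : s ^+ 2 != 0 by rewrite expf_neq0.
  have Ms : mellinM s != 0.
    by apply/eqP => M0; move: gs; rewrite -eG M0 mulr0 eqxx.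
  apply: (mulIf Ms); rewrite mulfVK//.
  have -> : Q s * mellinM s = T s / s ^+ 2 / (1 - 3 * scaleC s).
    rewrite /Q -eG invfM; field; by rewrite ss Ms s0.
  rewrite /T /mellinN exprVn; field; by rewrite ss s0.
have RQ : nearC 0 (fun s => Q s = regularize U s).
  have [r [r0 Hr]] := pnearCI (regularize_pnear (LU 0)) UQ.
  exists r; split=> // s; have [-> _|s0 /(Hr _ s0)[-> ->]//] := eqVneq s 0.
  by rewrite (regularizeE AQ UQ).
have [y JQ] := ana_jet AQ.
suff [-> ->] : -1 = Q 0 /\ ((K - L) / 2)%:C = y by apply: jet_ext RQ JQ.
have P := jetM JQ (jetM JG jet_scale1).
have [e1 e2] : 2 = Q 0 * (1 * - 2) /\
   - K%:C - 2 * L%:C = Q 0 * (1 * (3 * L%:C) + 0 * - 2) + y * (1 * - 2).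
  apply: jet_unique JT _; apply: jet_ext P.
  apply: nearC_imp (nearCI nzG nzS) => s [gs ss]; rewrite /Q; field; by rewrite gs ss.
have e3 : Q 0 = -1.
  apply: (@mulIf _ (1 * - 2)); first by rewrite mul1r oppr_eq0 pnatr_eq0.
  by rewrite -e1; ring.
split; first by rewrite e3.
apply: (@mulIf _ (1 * - 2)); first by rewrite mul1r oppr_eq0 pnatr_eq0.
have -> : y * (1 * - 2) = - K%:C - 2 * L%:C + 3 * L%:C by rewrite e2 e3; ring.
rewrite rmorphM rmorphB fmorphV (rmorph_nat (real_complex R)); field.
by [].
Qed.

End Continuation.

(** * Spectral decimation on the real line *)

Section Decimation.
Variable R : realType.
Variables p q : R.
Hypothesis hp : 0 < p < 1.
Hypothesis hq : q = 1 - p.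
Implicit Types (w c u x : R).

Lemma bounded_product (a : nat -> R) (C theta : R) : (forall n, 0 <= a n) -> 0 <= C ->
  0 <= theta < 1 -> (forall n, a n.+1 <= a n * (1 + C * theta ^+ n)) ->
  forall n, a n <= a 0%N * expR (C / (1 - theta)).
Proof.
move=> a0 C0 /andP[t0 t1] H n.
have t1' : 0 < 1 - theta by rewrite subr_gt0.
apply: (@le_trans _ _ (a 0%N * expR (C * \sum_(k < n) theta ^+ k))).
  elim: n => [|n IH]; first by rewrite big_ord0 mulr0 expR0 mulr1.
  apply: le_trans (H n) _; rewrite big_ord_recr /= [C * (_ + _)]mulrDr expRD mulrA.
  apply: ler_pM => //; last exact: expR_ge1Dx.
  by rewrite addr_ge0// mulr_ge0// exprn_ge0.
rewrite ler_wpM2l// ler_expR ler_wpM2l// -[leRHS]div1r ler_pdivlMr// mulrC.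
have -> : (1 - theta) * \sum_(k < n) theta ^+ k = 1 - theta ^+ n.
  by rewrite -opprB -(opprB _ 1) mulNr -subrX1.
by rewrite gerBl exprn_ge0.
Qed.

Lemma p0 : 0 < p. Proof. by case/andP: hp. Qed.
Lemma p1 : p < 1. Proof. by case/andP: hp. Qed.
Lemma q0 : 0 < q. Proof. by rewrite hq subr_gt0 p1. Qed.
Lemma pq0 : 0 < p * q. Proof. by rewrite mulr_gt0 ?p0 ?q0. Qed.
Lemma pq4 : p * q <= 4^-1.
Proof. rewrite hq; have := sqr_ge0 (p - 2^-1); rewrite expr2; nra. Qed.

Let lam := lambda p q.

Lemma lamE : lam = (2 + p * q) / (p * q).
Proof. by rewrite /lam /lambda; field; have := p0; have := q0; lra. Qed.
Lemma lam_pq : lam * (p * q) = 2 + p * q.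
Proof. by rewrite lamE mulfVK// gt_eqF ?pq0. Qed.
Lemma lam9 : 9 <= lam.
Proof. by rewrite lamE ler_pdivlMr ?pq0//; have := pq4; lra. Qed.
Lemma lam_gt0 : 0 < lam. Proof. have := lam9; lra. Qed.

Definition Wmap w := w * (w ^+ 2 - 1 + p * q) / (p * q).

Let M := Num.max p q.

Lemma M_facts : [/\ 2^-1 <= M, M < 1, (1 - M) * M = p * q & M = p \/ M = q].
Proof.
have := p0; have := p1; rewrite /M hq; case: (lerP p (1 - p)) => h h1 h2.
  by split; [lra|lra|ring|right].
by split; [lra|lra|ring|left].
Qed.

Lemma W_factor w : Wmap w - 1 = (w - 1) * (w + p) * (w + q) / (p * q).
Proof. by rewrite /Wmap hq; field; have := p0; have := p1; lra. Qed.
Lemma W_factor_m1 w : Wmap w + 1 = (w + 1) * (w - p) * (w - q) / (p * q).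
Proof. by rewrite /Wmap hq; field; have := p0; have := p1; lra. Qed.

Lemma W1 : Wmap 1 = 1.
Proof. by apply/eqP; rewrite -subr_eq0 W_factor subrr !mul0r. Qed.
Lemma WM : Wmap M = - 1.
Proof.
apply/eqP; rewrite -subr_eq0 opprK W_factor_m1.
by have [_ _ _ [->|->]] := M_facts; rewrite subrr ?mulr0 !mul0r.
Qed.
Lemma W_diff w v : Wmap w - Wmap v = (w - v) * (w ^+ 2 + w * v + v ^+ 2 - 1 + p * q) / (p * q).
Proof. rewrite /Wmap; ring. Qed.
Lemma W_lt w v : M <= v -> v < w -> Wmap v < Wmap w.
Proof.
move=> Mv vw; rewrite -subr_gt0 W_diff divr_gt0 ?pq0// mulr_gt0 ?subr_gt0//.
have [M2 _ E _] := M_facts; rewrite -E; nra.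
Qed.

Lemma W_continuous : continuous Wmap.
Proof.
move=> w; rewrite /Wmap; apply: cvgM; last exact: cvg_cst.
apply: cvgM; first exact: cvg_id.
apply: cvgD; last exact: cvg_cst; apply: cvgD; last exact: cvg_cst.
exact: exprn_continuous.
Qed.

Lemma preimage_ex c : -1 <= c <= 1 -> exists w, M <= w <= 1 /\ Wmap w = c.
Proof.
move=> cb; have [_ M1 _ _] := M_facts.
have [| |w wI Ww] := @IVT _ Wmap M 1 c (ltW M1).
- by apply: continuous_subspaceT; exact: W_continuous.
- rewrite WM W1; have -> : Num.min (-1) (1 : R) = -1 by apply/min_idPl; lra.
  by have -> : Num.max (-1) (1 : R) = 1 by apply/max_idPr; lra.
by exists w; split=> //; move: wI; rewrite in_itv.
Qed.

(** The inverse branch of W that fixes 1.  As W is odd and its three preimages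
    of c add up to 0, the two other branches are expressed with this one. *)
Definition gmap c := xget 1 [set w | M <= w <= 1 /\ Wmap w = c].
Definition gmid c := gmap (- c) - gmap c.
Definition glow c := - gmap (- c).

Lemma gmapP c : -1 <= c <= 1 -> M <= gmap c <= 1 /\ Wmap (gmap c) = c.
Proof.
move=> /preimage_ex[w Hw].
exact: (xgetPex 1 (ex_intro (fun w => M <= w <= 1 /\ Wmap w = c) w Hw)).
Qed.

Lemma W_inj w v : M <= w -> M <= v -> Wmap w = Wmap v -> w = v.
Proof.
move=> Mw Mv E; have [h|h|//] := ltgtP w v.
- by have := W_lt Mw h; rewrite E ltxx.
- by have := W_lt Mv h; rewrite E ltxx.
Qed.

Lemma gmapK w : M <= w <= 1 -> gmap (Wmap w) = w.
Proof.
move=> /andP[Mw w1].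
have [|/andP[Mg _] E] := @gmapP (Wmap w); last exact: W_inj Mg Mw E.
apply/andP; split.
- by rewrite -WM; move: Mw; rewrite le_eqVlt => /predU1P[->//|/W_lt-/(_ (lexx _))/ltW].
- by rewrite -[leRHS]W1; move: w1; rewrite le_eqVlt => /predU1P[->//|/W_lt-/(_ Mw)/ltW].
Qed.

Lemma gmap_mono c c' : -1 <= c -> c <= c' -> c' <= 1 -> gmap c <= gmap c'.
Proof.
move=> c1 cc c1'; have [|/andP[Mg _] Eg] := @gmapP c; first lra.
have [|/andP[Mg' _] Eg'] := @gmapP c'; first lra.
rewrite leNgt; apply/negP => h; have := W_lt Mg' h; lra.
Qed.

Lemma g1 : gmap 1 = 1.
Proof. by rewrite -{1}W1 gmapK// lexx andbT; have [_ /ltW] := M_facts. Qed.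
Lemma gm1 : gmap (-1) = M.
Proof. by rewrite -WM gmapK// lexx /=; have [_ /ltW] := M_facts. Qed.

Lemma branches_range c : -1 <= c <= 1 ->
  [/\ M <= gmap c <= 1, - (1 - M) <= gmid c <= 1 - M & -1 <= glow c <= - M].
Proof.
move=> hc; have [h _] := gmapP hc.
have [|h' _] := @gmapP (- c); first by lra.
by rewrite /gmid /glow; split=> //; lra.
Qed.

Lemma branches_prod c w : -1 <= c <= 1 ->
  (w - gmap c) * (w - gmid c) * (w - glow c) = p * q * (Wmap w - c).
Proof.
move=> hc; have [/andP[Mg g1'] E] := gmapP hc.
have hc' : -1 <= - c <= 1 by lra.
have [/andP[Mg' g1''] E'] := gmapP hc'.
have [M2 _ EM _] := M_facts.
move: E E'; rewrite /gmid /glow; move: (gmap c) (gmap (- c)) Mg g1' Mg' g1'' => x y hx1 hx2 hy1 hy2 Ex Ey.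
have ex : x * (x ^+ 2 - 1 + p * q) = p * q * c.
  by rewrite -Ex /Wmap; field; have := p0; have := q0; lra.
have ey : y * (y ^+ 2 - 1 + p * q) = - (p * q * c).
  by rewrite -mulrN -Ey /Wmap; field; have := p0; have := q0; lra.
have e1 : x ^+ 2 - x * y + y ^+ 2 = 1 - p * q.
  have h : (x + y) * (x ^+ 2 - x * y + y ^+ 2 - (1 - p * q)) = 0.
    have -> : (x + y) * (x ^+ 2 - x * y + y ^+ 2 - (1 - p * q)) =
      x * (x ^+ 2 - 1 + p * q) + y * (y ^+ 2 - 1 + p * q) by ring.
    by rewrite ex ey subrr.
  move/eqP: h; rewrite mulf_eq0 => /orP[/eqP|/eqP]; lra.
have -> : (w - x) * (w - (y - x)) * (w - - y) =
   w ^+ 3 - w * (x ^+ 2 - x * y + y ^+ 2) + x * y * (y - x) by ring.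
have -> : x * y * (y - x) = - (p * q * c).
  rewrite -ex; have -> : p * q = 1 - (x ^+ 2 - x * y + y ^+ 2) by rewrite e1; ring.
  ring.
by rewrite e1 /Wmap; field; have := p0; have := q0; lra.
Qed.

(** The spectrum of the random walk on level n, in decreasing order. *)
Fixpoint spec n : seq R :=
  if n is n'.+1 then
    map gmap (spec n') ++ rev (map gmid (spec n')) ++ map glow (spec n')
  else [:: 1; -1].

Definition nv n := (2 * 3 ^ n)%N.

Lemma size_spec n : size (spec n) = nv n.
Proof.
elim: n => [//|n IH]; rewrite /= !size_cat size_rev !size_map IH /nv expnS; clear; lia.
Qed.

Lemma spec_range n s : s \in spec n -> -1 <= s <= 1.
Proof.
elim: n s => [|n IH] s.
  by rewrite !inE => /orP[]/eqP ->; lra.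
rewrite /= !mem_cat mem_rev; have [M2 M1 _ _] := M_facts.
by case/or3P => /mapP[c /IH/branches_range[h1 h2 h3] ->]; lra.
Qed.

Lemma spec_sorted n : pairwise >=%R (spec n).
Proof.
have hm c c' : -1 <= c' -> c' <= c -> c <= 1 -> gmid c <= gmid c'.
  by move=> h1 h2 h3; rewrite /gmid lerB// gmap_mono//; lra.
elim: n => [|n IH]; first by rewrite /= !andbT; lra.
have R1 := @spec_range n; have [M2 M1 _ _] := M_facts.
have pw (r : rel R) : (forall c c', -1 <= c <= 1 -> -1 <= c' <= 1 -> c' <= c -> r c c') ->
    pairwise r (spec n).
  move=> H; apply: (@sub_in_pairwise _ (mem (spec n)) _ _ _ _ _ IH); last exact/allP.
  by move=> c c' /R1 h1 /R1 h2; apply: H.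
rewrite /= !pairwise_cat allrel_catr !pairwise_map.
apply/and3P; split.
- apply/andP; split; apply/allrelP => x y /mapP[c /R1/branches_range[h _ _] ->];
    rewrite ?mem_rev => /mapP[c' /R1/branches_range[_ h' h''] ->] /=; lra.
- apply: pw => c c' h1 h2 /= h3; apply: gmap_mono; lra.
apply/and3P; split.
- apply/allrelP => x y; rewrite mem_rev => /mapP[c /R1/branches_range[_ h _] ->].
  by move=> /mapP[c' /R1/branches_range[_ _ h'] ->] /=; lra.
- rewrite -(sorted_pairwise ge_trans) rev_sorted (sorted_pairwise le_trans) pairwise_map.
  by apply: pw => c c' h1 h2 /= h3; apply: hm; lra.
apply: pw => c c' h1 h2 /= h3.
by rewrite /glow lerN2 gmap_mono//; lra.
Qed.

Lemma spec_cons n : exists T, spec n = 1 :: T /\ forall t, t \in T -> t < 1.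
Proof.
elim: n => [|n [T [E H]]].
  by exists [:: -1]; split=> // t; rewrite inE => /eqP ->; lra.
rewrite /= {1}E /= g1; eexists; split; first by [].
move=> t; have [M2 M1 _ _] := M_facts; have R1 := @spec_range n.
rewrite !mem_cat mem_rev => /or3P[] /mapP[c cI ->].
- have hc : -1 <= c <= 1 by apply: R1; rewrite E inE cI orbT.
  have [/andP[Mg g1'] Wg] := gmapP hc.
  rewrite lt_neqAle g1' andbT; apply/eqP => g11; move: Wg; rewrite g11 W1.
  by have := H _ cI; lra.
- by have [_ h _] := branches_range (R1 _ cI); lra.
by have [_ _ h] := branches_range (R1 _ cI); lra.
Qed.

Lemma prod_spec n w :
  \prod_(s <- spec n.+1) (w - s) = (p * q) ^+ nv n * \prod_(c <- spec n) (Wmap w - c).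
Proof.
rewrite /= !big_cat /= (perm_big _ (permEl (perm_rev _))) /= !big_map -!big_split /=.
rewrite -size_spec; have := @spec_range n.
elim: (spec n) => [|c s IH] R1; first by rewrite !big_nil expr0 mulr1.
rewrite !big_cons IH => [|x xs]; last by apply: R1; rewrite inE xs orbT.
rewrite mulrA branches_prod; last by apply: R1; rewrite inE eqxx.
by rewrite /= exprS; ring.
Qed.

(** By W w - 1 = (w - 1) (w + p) (w + q) / (pq), the factor w - 1 being
    removed on both sides, the recursion multiplies the product by W' (1) =
    lam and by the powers of pq. *)
Lemma prod_behead_spec n :
  \prod_(s <- behead (spec n)) (1 - s) = 2 * lam ^+ n * (p * q) ^+ (3 ^ n).-1.
Proof.
elim: n => [|n IH].
  by rewrite /= big_cons big_nil /= mulr1 expr0 mulr1 expr0 mulr1; ring.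
have [T [E _]] := spec_cons n.
have [M2 M1 EM _] := M_facts.
rewrite /= E /= big_cat /= big_cat /= rev_cons -cats1 big_cat /= big_seq1.
rewrite (perm_big _ (permEl (perm_rev _))) /= big_cons !big_map.
have -> : \prod_(j <- T) (1 - gmap j) * (\prod_(j <- T) (1 - gmid j) * (1 - gmid 1) *
     ((1 - glow 1) * \prod_(j <- T) (1 - glow j))) =
   (1 - gmid 1) * (1 - glow 1) * (\prod_(j <- T) (1 - gmap j) *
     \prod_(j <- T) (1 - gmid j) * \prod_(j <- T) (1 - glow j)) by ring.
rewrite -!big_split /=.
have -> : (1 - gmid 1) * (1 - glow 1) = lam * (p * q).
  by rewrite /gmid /glow g1 gm1 lam_pq -EM; ring.
have -> : \prod_(j <- T) ((1 - gmap j) * (1 - gmid j) * (1 - glow j)) =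
    \prod_(j <- T) (p * q * (1 - j)).
  rewrite big_seq [RHS]big_seq; apply: eq_bigr => c cT.
  rewrite branches_prod ?W1//; apply: (@spec_range n); by rewrite E inE cT orbT.
have -> : \prod_(j <- T) (p * q * (1 - j)) = (p * q) ^+ size T * \prod_(j <- T) (1 - j).
  elim: (T) => [|c s IHs]; first by rewrite !big_nil expr0 mulr1.
  by rewrite !big_cons IHs /= exprS; ring.
move: IH; rewrite E /= => ->.
have sT : (size T = (2 * 3 ^ n).-1)%N by have := size_spec n; rewrite E /= /nv; lia.
have -> : ((3 ^ n.+1).-1 = 1 + size T + (3 ^ n).-1)%N.
  by rewrite sT expnS; have := expn_gt0 3 n; lia.
by rewrite !exprD expr1 exprS; ring.
Qed.

End Decimation.

(** * The limit eigenvalues *)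

Section LimitSpectrum.
Variable R : realType.
Variables p q : R.
Hypothesis hp : 0 < p < 1.
Hypothesis hq : q = 1 - p.
Let lam := lambda p q.
Local Notation g := (gmap p q).
Local Notation M := (Num.max p q).

Definition sn n k := nth 0 (spec p q n) k.
(** The eigenvalues of - Delta_n on the scale of L. *)
Definition nuN n k := 2 * lam ^+ n * (1 - sn n k).

Lemma nvS n : nv n.+1 = (3 * nv n)%N. Proof. by rewrite /nv expnS; clear; lia. Qed.
Lemma nv_gt n : (n < nv n)%N.
Proof. elim: n => [//|n IH]; rewrite nvS; clear -IH; lia. Qed.
Lemma nv_mono n n' : (n <= n')%N -> (nv n <= nv n')%N.
Proof. by move=> h; rewrite /nv leq_mul2l leq_exp2l. Qed.
Lemma lamn0 n : 0 < lam ^+ n. Proof. by rewrite exprn_gt0// lam_gt0. Qed.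

Lemma sn_in n k : (k < nv n)%N -> sn n k \in spec p q n.
Proof. by move=> h; rewrite mem_nth// size_spec. Qed.

Lemma sn_range n k : (k < nv n)%N -> -1 <= sn n k <= 1.
Proof. by move=> /sn_in /(spec_range hp hq). Qed.

Lemma snS n k : (k < nv n)%N -> sn n.+1 k = g (sn n k).
Proof.
by move=> h; rewrite /sn /= nth_cat size_map size_spec h (nth_map 0)// size_spec.
Qed.

Lemma sn_mono n i j : (i <= j)%N -> (j < nv n)%N -> sn n j <= sn n i.
Proof.
rewrite leq_eqVlt => /predU1P[->//|ij] jn.
have /(pairwiseP 0) H := spec_sorted hp hq n.
by apply: H; rewrite // inE size_spec// (ltn_trans ij).
Qed.

Lemma sn0 n : sn n 0 = 1.
Proof. by have [T [E _]] := spec_cons hp hq n; rewrite /sn E. Qed.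

Lemma W_lam_le w : 0 <= w <= 1 -> 1 - Wmap p q w <= lam * (1 - w).
Proof.
move=> hw; have a0 := pq0 hp hq; have e := lam_pq hp hq.
have -> : 1 - Wmap p q w = (1 - w) * ((w + p) * (w + q)) / (p * q).
  by rewrite -opprB (W_factor hp hq); ring.
rewrite ler_pdivrMr// mulrAC e mulrC ler_wpM2r//; first lra.
rewrite hq; nra.
Qed.


Lemma sn_step n k : (k < nv n)%N ->
  [/\ 0 <= 1 - sn n.+1 k <= (1 - sn n k) / 4,
     1 - sn n k <= lam * (1 - sn n.+1 k) &
     lam * (1 - sn n.+1 k) <= (1 - sn n k) * (1 + 4 * (1 - sn n.+1 k))].
Proof.
move=> kn; rewrite snS//; have sr := sn_range kn.
have [/andP[Mg g1] E] := gmapP hp hq sr; have [M2 _ _ _] := M_facts hp hq.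
set w := g (sn n k) in Mg g1 E *.
have a0 := pq0 hp hq; have a4 := pq4 hq; have e := lam_pq hp hq.
have F : (1 - sn n k) * (p * q) = (1 - w) * ((w + p) * (w + q)).
  by rewrite -E -opprB (W_factor hp hq); field; have := p0 hp; have := q0 hp hq; lra.
have F2 : (w + p) * (w + q) = w ^+ 2 + w + p * q by rewrite hq; ring.
split.
- rewrite subr_ge0 g1 /= ler_pdivlMr//.
  have w2 : 4^-1 <= w ^+ 2 by rewrite expr2; nra.
  have : 0 <= (1 - w) * (w ^+ 2 + w + p * q - 4 * (p * q)) by rewrite mulr_ge0; lra.
  move=> h; have : (1 - w) * 4 * (p * q) <= (1 - sn n k) * (p * q).
    by rewrite F F2; move: h; move: (p * q) (w ^+ 2) => a b; lra.
  by rewrite ler_pM2r.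
- by rewrite -{1}E; apply: W_lam_le; lra.
rewrite -(ler_pM2r a0) [leLHS]mulrAC e [leRHS]mulrAC.
rewrite F F2.
have w2 : 4^-1 <= w ^+ 2 by rewrite expr2; nra.
suff : 0 <= (1 - w) * ((w ^+ 2 + w + p * q) * (1 + 4 * (1 - w)) - (2 + p * q)) by lra.
rewrite mulr_ge0 ?subr_ge0//; nra.
Qed.

Lemma nuN_incr n k : (k < nv n)%N -> nuN n k <= nuN n.+1 k.
Proof.
move=> kn; have [_ h _] := sn_step kn; rewrite /nuN exprSr.
rewrite -!mulrA ler_pM2l// ler_pM2l ?lamn0//.
Qed.

Lemma nuN_ge0 n k : (k < nv n)%N -> 0 <= nuN n k.
Proof.
by move=> /sn_range h; rewrite /nuN !mulr_ge0// ?(ltW (lamn0 _))//; lra.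
Qed.

Lemma nuN_nondecr n n' k : (k < nv n)%N -> (n <= n')%N -> nuN n k <= nuN n' k.
Proof.
move=> kn /subnK <-; elim: (n' - n)%N => [//|j IH]; apply: le_trans IH _.
by apply: nuN_incr; apply: leq_trans kn _; apply: nv_mono; rewrite leq_addl.
Qed.

(** The ratio of consecutive terms is 1 + O(1 - s) with 1 - s decreasing
    geometrically. *)
Lemma nuN_bounded n k : (k < nv n)%N -> exists B, forall j, nuN (j + n) k <= B.
Proof.
move=> kn; have kj j : (k < nv (j + n))%N.
  by apply: leq_trans kn _; apply: nv_mono; rewrite leq_addl.
have dec j : 1 - sn (j + n) k <= 2 * 4^-1 ^+ j.
  elim: j => [|j IH]; first by rewrite expr0 add0n; have := sn_range kn; lra.
  have [/andP[_ h] _ _] := sn_step (kj j); rewrite addSn exprSr; lra.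
have H := @bounded_product _ (fun j => nuN (j + n) k) 8 4^-1.
eexists; apply: H => [j|||j]; [exact: nuN_ge0|by []|lra|].
have [/andP[h1 h2] _ h3] := sn_step (kj j).
rewrite addSn /nuN exprSr -!mulrA ler_pM2l// ler_pM2l ?lamn0//.
apply: le_trans h3 _; rewrite ler_wpM2l//; first by have := sn_range (kj j); lra.
by have := dec j; lra.
Qed.

Definition nu k := limn (nuN^~ k).

Lemma nuN_cvg k : nuN^~ k @ \oo --> nu k.
Proof.
have [B HB] := nuN_bounded (nv_gt k).
suff : cvgn (fun j => nuN (j + k) k).
  move=> /cvg_ex[l Hl]; apply: (cvgP l).
  by rewrite -(cvg_shiftn k).
apply: nondecreasing_is_cvgn; last by exists B => _ [j _ <-].
move=> j j' jj; apply: nuN_nondecr; last by rewrite leq_add2r.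
by apply: leq_trans (nv_gt k) _; apply: nv_mono; rewrite leq_addl.
Qed.

Lemma nuN_cvg_shift k n : (fun j => nuN (j + n) k) @ \oo --> nu k.
Proof. by rewrite (cvg_shiftn n (nuN^~ k)); exact: nuN_cvg. Qed.

Lemma nu_ge (B : R) k n : (forall j, nuN (j + n) k <= B) -> nu k <= B.
Proof.
move=> H; have h := @nuN_cvg_shift k n.
rewrite -(cvg_lim _ h)//; apply: limr_le; first exact: cvgP h.
by apply: nearW => j /=; apply: H.
Qed.

Lemma nuN_le n k : (k < nv n)%N -> nuN n k <= nu k.
Proof.
move=> kn; have h : (fun j => nuN (j + n) k) @ \oo --> nu k by exact: nuN_cvg_shift.
rewrite -(cvg_lim _ h)//; apply: limr_ge; first exact: cvgP h.
by apply: nearW => j /=; apply: nuN_nondecr => //; rewrite leq_addl.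
Qed.

Lemma nu_mono i j : (i <= j)%N -> nu i <= nu j.
Proof.
move=> ij; apply: (@nu_ge _ _ j) => n; apply: (@le_trans _ _ (nuN (n + j) j)).
  rewrite /nuN ler_wpM2l//; first by rewrite mulr_ge0 ?(ltW (lamn0 _)).
  rewrite lerD2l lerN2; apply: sn_mono => //.
  by apply: leq_trans (nv_gt j) _; apply: nv_mono; rewrite leq_addl.
by apply: nuN_le; apply: leq_trans (nv_gt j) _; apply: nv_mono; rewrite leq_addl.
Qed.

Lemma nu0 : nu 0 = 0.
Proof.
apply/eqP; rewrite eq_le; apply/andP; split.
  by apply: (@nu_ge _ _ 0) => j; rewrite /nuN sn0 subrr mulr0.
by apply: le_trans (@nuN_le 0 0 isT); exact: nuN_ge0.
Qed.

Lemma nuN_ge4 n k : (0 < k)%N -> (k < nv n)%N -> 4 <= nuN n k.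
Proof.
move=> k0 kn; have h1 : nuN 0 1 = 4.
  by rewrite /nuN /sn /= expr0; ring.
rewrite -h1; apply: (@le_trans _ _ (nuN n 1)).
  by apply: nuN_nondecr.
rewrite /nuN ler_wpM2l//; first by rewrite mulr_ge0 ?(ltW (lamn0 _)).
by rewrite lerD2l lerN2; apply: sn_mono.
Qed.

Lemma nu_ge4 k : (0 < k)%N -> 4 <= nu k.
Proof. by move=> k0; apply: le_trans (nuN_le (nv_gt k)); apply: nuN_ge4 (nv_gt k). Qed.

(** Past the first nv m indices the decimation has taken one of the two branches
    away from 1, so that 1 - s is at least 1/2 at level m + 1. *)
Lemma nuN_shell n m k : (nv m <= k)%N -> (k < nv n)%N -> lam ^+ m.+1 <= nuN n k.
Proof.
move=> mk kn; have mn : (m < n)%N.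
  by rewrite ltnNge; apply/negP => /nv_mono; rewrite leqNgt (leq_ltn_trans mk).
have [M2 M1 _ _] := M_facts hp hq.
suff h : sn m.+1 (nv m) <= 2^-1.
  have hm : (nv m < nv m.+1)%N by rewrite nvS; have := nv_gt m; lia.
  apply: (@le_trans _ _ (nuN m.+1 (nv m))).
    by rewrite /nuN mulrAC ler_peMl ?(ltW (lamn0 _))//; lra.
  apply: (@le_trans _ _ (nuN n (nv m))); first exact: nuN_nondecr.
  rewrite /nuN ler_wpM2l//; first by rewrite mulr_ge0 ?(ltW (lamn0 _)).
  by rewrite lerD2l lerN2; apply: sn_mono.
rewrite /sn /= nth_cat size_map size_spec ltnn subnn.
have : (0 < nv m)%N by apply: leq_ltn_trans (nv_gt m).
move=> v0; rewrite nth_cat size_rev size_map size_spec v0.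
have : (rev [seq gmid p q i | i <- spec p q m])`_0 \in rev [seq gmid p q i | i <- spec p q m].
  by rewrite mem_nth// size_rev size_map size_spec; apply: leq_ltn_trans (nv_gt m).
rewrite mem_rev => /mapP[c /(spec_range hp hq) cr ->].
by have [_ h _] := branches_range hp hq cr; lra.
Qed.

Lemma nu_shell m k : (nv m <= k)%N -> lam ^+ m.+1 <= nu k.
Proof.
by move=> mk; apply: le_trans (nuN_le (nv_gt k)); apply: nuN_shell mk (nv_gt k).
Qed.

Lemma shell_sum (F y : nat -> R) b a :
  (forall m k, (nv m <= k)%N -> (k < nv m.+1)%N -> F k <= y m) ->
  \sum_(nv a <= k < nv (a + b)) F k <= \sum_(j < b) (nv (a + j)).*2%:R * y (a + j)%N.
Proof.
move=> H; elim: b => [|b IH]; first by rewrite addn0 big_geq// big_ord0.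
rewrite (big_cat_nat (n := nv (a + b))) ?nv_mono ?leq_addr ?addnS ?leqnSn//=.
rewrite big_ord_recr /= lerD//.
apply: (@le_trans _ _ (\sum_(nv (a + b) <= k < nv (a + b).+1) y (a + b)%N)).
  by rewrite big_nat_cond [leRHS]big_nat_cond; apply: ler_sum => k /andP[/andP[h1 h2] _]; apply: H.
rewrite big_const_nat iter_addr addr0 nvS.
have -> : (3 * nv (a + b) - nv (a + b) = (nv (a + b)).*2)%N by clear; lia.
by rewrite mulr_natl.
Qed.

End LimitSpectrum.

(** * The vertices and the random walk *)

Section Vertices.
Variable R : realType.
Variables p q : R.
Hypothesis hp : 0 < p < 1.
Hypothesis hq : q = 1 - p.
Local Notation F := (ifs_map p q).

Lemma ratio_pos (i : 'I_3) : 0 < contraction_ratio p q i.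
Proof.
have h1 := p0 hp; have h2 := q0 hp hq.
by rewrite /contraction_ratio; case: ifP => _; rewrite divr_gt0//; lra.
Qed.

Lemma F0 (i : 'I_3) x : i = 0%N :> nat -> F i x = p / (1 + p) * x.
Proof.
by move=> h; rewrite /ifs_map /contraction_ratio /fixed_point h /= mul0r mulr0 addr0.
Qed.
Lemma F1 (i : 'I_3) x : i = 1%N :> nat -> F i x = (p + q * x) / (1 + p).
Proof.
move=> h; rewrite /ifs_map /contraction_ratio /fixed_point h /= hq; have := p0 hp.
by move: h => _ h1; field; lra.
Qed.
Lemma F2 (i : 'I_3) x : i = 2%N :> nat -> F i x = (1 + p * x) / (1 + p).
Proof.
move=> h; rewrite /ifs_map /contraction_ratio /fixed_point h /=; have := p0 hp.
by move: h => _ h1; field; lra.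
Qed.

Lemma F_lt (i : 'I_3) x y : (F i x < F i y) = (x < y).
Proof. by rewrite /ifs_map ltrD2r ltr_pM2l ?ratio_pos. Qed.

Lemma enum3 : enum 'I_3 = [:: @Ordinal 3 0 isT; @Ordinal 3 1 isT; @Ordinal 3 2 isT].
Proof.
by apply: (inj_map val_inj); rewrite val_enum_ord.
Qed.

Let f0 := F (@Ordinal 3 0 isT).
Let f1 := F (@Ordinal 3 1 isT).
Let f2 := F (@Ordinal 3 2 isT).

Lemma f_glue : [/\ f0 0 = 0, f0 1 = f1 0, f1 1 = f2 0 & f2 1 = 1].
Proof.
have h1 := p0 hp; split.
- by rewrite /f0 F0// mulr0.
- by rewrite /f0 /f1 F0// F1// mulr1 mulr0 addr0.
- by rewrite /f1 /f2 F1// F2// mulr0 mulr1 addr0 hq addrC subrK.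
by rewrite /f2 F2// mulr1 mulfV//; lra.
Qed.

(** Consecutive cells share an endpoint, listed once. *)
Lemma vertices_cat n : exists v, [/\ vertices p q n = 0 :: v, last 0 v = 1,
   size v = (3 ^ n)%N, path <%R 0 v &
   vertices p q n.+1 = map f0 (0 :: v) ++ map f1 v ++ map f2 v].
Proof.
have [g0 g1 g2 g3] := f_glue.
have main v : last 0 v = 1 -> path <%R 0 v ->
    sort <=%R (undup (flatten [seq [seq F i x | x <- 0 :: v] | i <- enum 'I_3])) =
    map f0 (0 :: v) ++ map f1 v ++ map f2 v /\
    path <%R 0 (map f0 v ++ map f1 v ++ map f2 v) /\
    last 0 (map f0 v ++ map f1 v ++ map f2 v) = 1.
  move=> lv pv.
  have P : path <%R 0 (map f0 v ++ map f1 v ++ map f2 v).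
    have pm i : path <%R (F i 0) (map (F i) v).
      rewrite path_map; by apply: sub_path pv => x y; rewrite /= F_lt.
    have la : last 0 (map f0 v) = f1 0 by rewrite -{1}g0 last_map lv.
    have lb : last (f1 0) (map f1 v) = f2 0 by rewrite last_map lv.
    by rewrite !cat_path la lb !pm -{1}g0 pm.
  have vn : v != [::] by apply/eqP => ve; move: lv; rewrite ve /= => /eqP; rewrite eq_sym oner_eq0.
  split; last split=> //; last first.
    rewrite !last_cat; case: (v) lv vn => [//|x s] /= lv _.
    by rewrite last_map lv.
  apply: lt_sorted_eq.
  - by rewrite lt_sorted_uniq_le sort_uniq undup_uniq sort_sorted//; exact: le_total.
  - by rewrite /= g0.
  have m1 : 1 \in v by rewrite -lv; case: (v) vn => // x s _; rewrite /= mem_last.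
  move=> x; rewrite mem_sort mem_undup enum3 /= !(mem_cat, inE) ?in_nil ?orbF.
  rewrite -/f0 -/f1 -/f2 -g1 -g2.
  have e1 : f0 1 \in map f0 v by apply: map_f.
  have e2 : f1 1 \in map f1 v by apply: map_f.
  case: (x =P f0 1) => [->|_]; first by rewrite e1 !orbT.
  case: (x =P f1 1) => [->|_]; first by rewrite e2 !orbT.
  by rewrite !orFb.
suff [v [E lv sv pv]] : exists v, [/\ vertices p q n = 0 :: v, last 0 v = 1, size v = (3 ^ n)%N & path <%R 0 v].
  by exists v; split=> //; have [h _] := main v lv pv; rewrite -h -E.
elim: (n) => [|m [v [E lv sv pv]]].
  by exists [:: 1]; split=> //=; rewrite ltr01.
have [h1 [h2 h3]] := main v lv pv.
exists (map f0 v ++ map f1 v ++ map f2 v); split=> //.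
  by rewrite [LHS]/= E h1 /= g0.
by rewrite !size_cat !size_map sv expnS; clear; lia.
Qed.

Definition X (n k : nat) : R := nth 0 (vertices p q n) k.

Lemma X0 n : X n 0 = 0.
Proof. by have [v [E _ _ _ _]] := vertices_cat n; rewrite /X E. Qed.

Lemma X_cat n i k (hi : (i < 3)%N) : (k <= 3 ^ n)%N ->
  X n.+1 (i * 3 ^ n + k) = F (Ordinal hi) (X n k).
Proof.
move=> kn; have [v [E lv sv pv Ec]] := vertices_cat n.
have [g0 g1 g2 g3] := f_glue.
have lE : (0 :: v)`_(3 ^ n) = 1 by rewrite -sv nth_last.
have Fi (j : 'I_3) x : F j x = F (Ordinal (ltn_ord j)) x by congr F; apply: val_inj.
have Xl : X n (3 ^ n) = 1 by rewrite /X E.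
have sE : size (map f0 (0 :: v)) = (3 ^ n).+1 by rewrite size_map /= sv.
have A0 m : (m <= 3 ^ n)%N -> X n.+1 m = f0 (X n m).
  by move=> mn; rewrite /X Ec E nth_cat sE ltnS mn (nth_map 0)// -(size_map f0) sE ltnS.
have A1 m : (m <= 3 ^ n)%N -> X n.+1 (3 ^ n + m) = f1 (X n m).
  case: m => [|m] mn; first by rewrite addn0 A0// Xl X0.
  rewrite /X Ec E nth_cat sE ltnS addnS ltnNge leq_addr /= subSS addnC addnK.
  by rewrite nth_cat size_map sv mn (nth_map 0) ?sv.
have A2 m : (m <= 3 ^ n)%N -> X n.+1 (2 * 3 ^ n + m) = f2 (X n m).
  case: m => [|m] mn; first by rewrite addn0 mul2n -addnn A1// Xl X0.
  rewrite /X Ec E nth_cat sE ifF; last by apply/negbTE; rewrite -leqNgt; clear; lia.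
  have -> : (2 * 3 ^ n + m.+1 - (3 ^ n).+1 = 3 ^ n + m)%N by clear; lia.
  rewrite nth_cat size_map sv ltnNge leq_addr /= addnC addnK.
  by rewrite (nth_map 0) ?sv.
move: hi; case: i => [|[|[|//]]] hi.
- by rewrite mul0n add0n A0//; congr F; apply: val_inj.
- by rewrite mul1n A1//; congr F; apply: val_inj.
by rewrite A2//; congr F; apply: val_inj.
Qed.

Definition cut r : R := if r is 0%N then 0 else if r is 1%N then p / (1 + p)
  else if r is 2%N then (1 + p)^-1 else 1.

Lemma X_refine n k r : (k < 3 ^ n)%N -> (r <= 3)%N ->
  X n.+1 (3 * k + r) = X n k + cut r * (X n k.+1 - X n k).
Proof.
elim: n k r => [|n IH] k r kn r3.
  have -> : (k = 0)%N by move: kn; rewrite expn0; clear; lia.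
  have X01 : X 0 1 = 1 by [].
  rewrite muln0 add0n X0 X01 subr0 mulr1 add0r.
  have h1 := p0 hp.
  case: r r3 => [|[|[|[|//]]]] _; first exact: X0.
  - have := @X_cat 0 1 0 isT isT; rewrite expn0 mul1n addn0 => ->.
    by rewrite F1// X0 mulr0 addr0.
  - have := @X_cat 0 2 0 isT isT; rewrite expn0 muln1 addn0 => ->.
    by rewrite F2// X0 mulr0 addr0 mul1r.
  have := @X_cat 0 2 1 isT isT; rewrite expn0 muln1 => ->.
  by rewrite F2// X01 mulr1 mulfV//; apply/eqP => h; lra.
have [i [k' [hi k'n ->]]] : exists i k', [/\ (i < 3)%N, (k' < 3 ^ n)%N & k = (i * 3 ^ n + k')%N].
  exists (k %/ 3 ^ n)%N, (k %% 3 ^ n)%N; rewrite -divn_eq ltn_pmod ?expn_gt0//.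
  by split=> //; rewrite ltn_divLR ?expn_gt0// -expnS.
have -> : (3 * (i * 3 ^ n + k') + r = i * 3 ^ n.+1 + (3 * k' + r))%N.
  by rewrite expnS; clear; lia.
rewrite X_cat; last by rewrite expnS; move: k'n r3; clear; lia.
rewrite -addnS !(@X_cat n i _ hi) ?(ltnW k'n)// IH// /ifs_map; ring.
Qed.

(** The second copy is traversed backwards, from 1 to 0. *)
Definition fold (n i : nat) : nat := if (i <= 3 ^ n)%N then i else (nv n - i)%N.
Definition Y (n i : nat) : R := X n (fold n i).

Fixpoint len (n i : nat) : R := if n is n'.+1 then
  (if i %% 3 == 1 then q else p)%N / (1 + p) * len n' (i %/ 3)%N else 1.

Lemma len_gt0 n i : 0 < len n i.
Proof.
have h1 := p0 hp; have h2 := q0 hp hq; elim: n i => [//|n IH] i /=.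
by rewrite mulr_gt0// divr_gt0//; [case: ifP|lra].
Qed.

Lemma Y_refine n j r : (j < nv n)%N -> (r <= 3)%N -> Y n.+1 (3 * j + r) =
  if (j < 3 ^ n)%N then Y n j + cut r * (Y n j.+1 - Y n j)
  else Y n j.+1 + cut (3 - r) * (Y n j - Y n j.+1).
Proof.
move=> jn r3; rewrite /Y /fold.
have [jl|jg] := ltnP j (3 ^ n).
  rewrite /= (ltnW jl) ifT; last by rewrite expnS; move: jl r3; clear; lia.
  exact: X_refine.
have k0 : (nv n - j.+1 < 3 ^ n)%N by move: jg jn; rewrite /nv; clear; lia.
have e2 : (if (j <= 3 ^ n)%N then j else nv n - j)%N = (nv n - j.+1).+1.
  by case: ifP => h; move: jg jn h; rewrite /nv; clear; lia.
have e3 : (if (3 * j + r <= 3 ^ n.+1)%N then 3 * j + r else nv n.+1 - (3 * j + r))%N =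
    (3 * (nv n - j.+1) + (3 - r))%N.
  by case: ifP => h; move: jg jn h r3; rewrite /nv expnS; clear; lia.
by rewrite /= e2 e3 X_refine// leq_subr.
Qed.

Lemma Y_step n j : (j < nv n)%N ->
  Y n j.+1 - Y n j = (if (j < 3 ^ n)%N then 1 else -1) * len n j.
Proof.
have h1 := p0 hp; have h2 := q0 hp hq.
elim: n j => [|n IH] j jn.
  by case: j jn => [|[|//]] _; rewrite /Y /fold /X /= mulr1 ?subr0 ?sub0r.
have [k [r [kn r3 jE]]] : exists k r, [/\ (k < nv n)%N, (r < 3)%N & j = (3 * k + r)%N].
  exists (j %/ 3)%N, (j %% 3)%N; rewrite ltn_pmod// mulnC -divn_eq; split=> //.
  by rewrite ltn_divLR// mulnC -nvS.
have side : (j < 3 ^ n.+1)%N = (k < 3 ^ n)%N.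
  by rewrite jE expnS; apply/idP/idP; move: r3; clear; lia.
have := IH _ kn; rewrite side {jn side}jE.
rewrite -addnS !Y_refine ?(ltnW r3)// [len n.+1 _]/=.
rewrite [(3 * k)%N]mulnC modnMDl divnMDl// (modn_small r3) (divn_small r3) addn0.
set y := Y n k; set y' := Y n k.+1 => e.
have cutD : cut r.+1 - cut r = (if r == 1 then q else p)%N / (1 + p) /\
    cut (3 - r) - cut (3 - r.+1) = (if r == 1 then q else p)%N / (1 + p).
  case: r r3 => [|[|[|//]]] _ /=; rewrite ?hq; split; field; lra.
rewrite [RHS]mulrCA -e; case: ifP => _.
  by rewrite -cutD.1; ring.
by rewrite -cutD.2; ring.
Qed.

Lemma Y_len n j : (j < nv n)%N -> `|Y n j.+1 - Y n j| = len n j.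
Proof.
move=> jn; rewrite Y_step// normrM (gtr0_norm (len_gt0 _ _)).
by case: ifP; rewrite ?normrN normr1 mul1r.
Qed.

(** Recursive in the level because a refinement does not change the ratio of the
    two intervals at an old vertex. *)
Fixpoint back (n i : nat) : R := if n is n'.+1 then
  (if i %% 3 == 0 then back n' (i %/ 3)%N else if i %% 3 == 1 then q else p)%N else 2^-1.

Definition prevn (n i : nat) : nat := (if i == 0 then (nv n).-1 else i.-1)%N.

(** The walk steps with probabilities inversely proportional to the lengths
    of the adjacent intervals: refinement scales both lengths at a vertex by
    the same ratio. *)
Lemma back_balance n i : (i < nv n)%N ->
  (1 - back n i) * len n i = back n i * len n (prevn n i).
Proof.
have h1 := p0 hp.
elim: n i => [|n IH] i iN; first by rewrite /= /prevn; lra.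
have [k [r [kn r3 ->]]] : exists k r, [/\ (k < nv n)%N, (r < 3)%N & i = (3 * k + r)%N].
  exists (i %/ 3)%N, (i %% 3)%N; rewrite ltn_pmod// mulnC -divn_eq; split=> //.
  by rewrite ltn_divLR// mulnC -nvS.
case: r r3 => [|[|[|//]]] _ /=.
- have -> : prevn n.+1 (3 * k + 0) = (prevn n k * 3 + 2)%N.
    rewrite addn0 /prevn muln_eq0 /=; case: eqP => k0; last by move: k0; clear; lia.
    by rewrite nvS; have := nv_gt n; clear; lia.
  by rewrite mulnC !modnMDl !divnMDl//= !addn0 mulrCA IH// mulrCA.
- have -> : prevn n.+1 (3 * k + 1) = (k * 3 + 0)%N.
    by rewrite /prevn; case: eqP; clear; lia.
  rewrite mulnC !modnMDl !divnMDl//= !addn0 hq; ring.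
have -> : prevn n.+1 (3 * k + 2) = (k * 3 + 1)%N.
  by rewrite /prevn; case: eqP; clear; lia.
rewrite mulnC !modnMDl !divnMDl//= !addn0 hq; ring.
Qed.

Lemma back_range n i : 0 < back n i < 1.
Proof.
have h1 := p0 hp; have h2 := p1 hp; elim: n i => [|n IH] i /=; first lra.
by case: ifP => // _; case: ifP => _; rewrite ?hq; lra.
Qed.

Lemma back_glued n i : (i == 0)%N || (i == 3 ^ n)%N -> back n i = 2^-1.
Proof.
elim: n i => [//|n IH] i /=.
move=> /orP[/eqP->|/eqP->]; first by rewrite mod0n div0n IH.
by rewrite expnS modnMr mulKn// IH// eqxx orbT.
Qed.

Lemma back_free n i : (i < nv n)%N -> i != 0%N -> i != (3 ^ n)%N ->
  back n i = if p * len n i.-1 == q * len n i then p else q.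
Proof.
have h1 := p0 hp; have h2 := q0 hp hq.
elim: n i => [|n IH] i iN; first by case: i iN => [|[|]].
have [k [r [kn r3 ->]]] : exists k r, [/\ (k < nv n)%N, (r < 3)%N & i = (3 * k + r)%N].
  exists (i %/ 3)%N, (i %% 3)%N; rewrite ltn_pmod// mulnC -divn_eq; split=> //.
  by rewrite ltn_divLR// mulnC -nvS.
have L := len_gt0 n k; have c0 : 0 < 1 + p by lra.
case: r r3 => [|[|[|//]]] _ hi hi' /=.
- have k0 : k != 0%N by move: hi; apply: contraNneq => ->.
  have k3 : k != (3 ^ n)%N by move: hi'; apply: contraNneq => ->; rewrite addn0 expnS.
  have -> : ((3 * k + 0).-1 = k.-1 * 3 + 2)%N by move: k0; clear; lia.
  rewrite mulnC !modnMDl !divnMDl//= !addn0 IH//.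
  rewrite [p * (_ * _)]mulrCA [q * (_ * _)]mulrCA.
  rewrite (inj_eq (mulfI _))// gt_eqF// divr_gt0//; lra.
- have -> : ((3 * k + 1).-1 = k * 3 + 0)%N by clear; lia.
  rewrite mulnC !modnMDl !divnMDl//= !addn0.
  case: eqP => // h.
  have e : (p - q) * ((p + q) * (len n k / (1 + p))) = 0.
    have -> : (p - q) * ((p + q) * (len n k / (1 + p))) =
      p * (p / (1 + p) * len n k) - q * (q / (1 + p) * len n k) by ring.
    by rewrite h subrr.
  move/eqP: e; rewrite mulf_eq0 subr_eq0 => /orP[/eqP->//|].
  by rewrite gt_eqF// mulr_gt0 ?divr_gt0//; lra.
have -> : ((3 * k + 2).-1 = k * 3 + 1)%N by clear; lia.
rewrite mulnC !modnMDl !divnMDl//= !addn0 ifT//; apply/eqP; ring.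
Qed.

End Vertices.

(** * The characteristic polynomial *)

Arguments back : simpl never.

Section Walk.
Variable R : realType.
Variables p q : R.
Hypothesis hp : 0 < p < 1.
Hypothesis hq : q = 1 - p.
Let lam := lambda p q.
Local Notation back := (back p q).

Definition walk n (u : 'I_(nv n) -> R) (i : 'I_(nv n)) : R :=
  back n i * u (ord_pred i) + (1 - back n i) * u (ordS i).

Lemma val_ord_pred n (i : 'I_(nv n)) : ord_pred i = prevn n i :> nat.
Proof.
have iN := ltn_ord i; have N0 : (0 < nv n)%N := leq_ltn_trans (leq0n _) (nv_gt n).
rewrite /= /prevn; case: eqP => [->|i0]; first by rewrite add0n modn_small// prednK.
rewrite -[in LHS](prednK (n := i)) ?lt0n; last exact/eqP.
by rewrite addSn /= modnDr modn_small// (leq_ltn_trans (leq_pred _)).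
Qed.

Lemma Y_pred n (i : 'I_(nv n)) : (i : nat) != 0%N -> Y p q n (ord_pred i) = Y p q n i.-1.
Proof. by rewrite val_ord_pred /prevn => /negPf ->. Qed.

Lemma val_ordS n (i : 'I_(nv n)) : ordS i = (if i.+1 == nv n then 0 else i.+1)%N :> nat.
Proof.
rewrite /=; case: eqP => [->|/eqP iN]; first exact: modnn.
by rewrite modn_small// ltn_neqAle iN (ltn_ord i).
Qed.

Lemma Y_ordS n (i : 'I_(nv n)) : Y p q n (ordS i) = Y p q n i.+1.
Proof.
rewrite val_ordS; case: eqP => // ->; rewrite /Y /fold leq0n subnn ifF//.
by apply/negbTE; rewrite -ltnNge /nv; have := expn_gt0 3 n; clear; lia.
Qed.

Lemma laplacianE n (u : 'I_(nv n) -> R) i :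
  discrete_laplacian p q (n := n) u i = 2 * (walk u i - u i).
Proof.
rewrite /discrete_laplacian /walk; have iN := ltn_ord i.
have [gl|ngl] := boolP (glued (n := n) i).
  by rewrite (back_glued p q gl); field.
move: ngl; rewrite /glued negb_or => /andP[i0 i3].
rewrite (back_free hp hq iN i0 i3).
have e1 : `|vpos p q i - vpos p q (ord_pred i)| = len p q n i.-1.
  rewrite -(Y_len hp hq); last by rewrite (leq_ltn_trans (leq_pred _)).
  by rewrite prednK ?lt0n// -Y_pred.
have e2 : `|vpos p q (ordS i) - vpos p q i| = len p q n i.
  by rewrite -(Y_len hp hq)// -Y_ordS.
rewrite e1 e2; case: ifP => _; rewrite ?hq; ring.
Qed.

Definition walk_mx n : 'M[R]_(nv n) :=
  \matrix_(i, j) (back n i * (j == ord_pred i)%:R + (1 - back n i) * (j == ordS i)%:R).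

Lemma walk_mxE n (u : 'cV[R]_(nv n)) i : (walk_mx n *m u) i 0 = walk (fun k => u k 0) i.
Proof.
rewrite mxE; under eq_bigr do rewrite mxE mulrDl -!mulrA.
rewrite big_split /= -!mulr_sumr /walk.
have H (k : 'I_(nv n)) : \sum_j (j == k)%:R * u j 0 = u k 0.
  rewrite (bigD1 k)//= eqxx mul1r big1 ?addr0// => j jk.
  by rewrite (negPf jk) mul0r.
by rewrite !H.
Qed.

Lemma neg_laplacian_mxE n : neg_laplacian_mx p q n = 2 *: (1%:M - walk_mx n).
Proof.
apply/matrixP => i j; rewrite !mxE laplacianE /walk [in RHS]eq_sym.
rewrite (eq_sym (ord_pred i)) (eq_sym (ordS i)) (eq_sym i j); ring.
Qed.

Lemma det_reindex (m n : nat) (f : 'I_m -> 'I_n) (A : 'M[R]_n) : m = n -> injective f ->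
  \det (mxsub f f A) = \det A.
Proof.
move=> mn; case: n / mn f A => f A fI; pose s := perm fI.
have -> : mxsub f f A = row_perm s (col_perm s A).
  by apply/matrixP => i j; rewrite !mxE !permE.
rewrite row_permE col_permE !det_mulmx !det_perm odd_permV mulrCA.
by rewrite -expr2 sqrr_sign mulr1.
Qed.

Lemma backS n i : back n.+1 i =
  (if i %% 3 == 0 then back n (i %/ 3)%N else if i %% 3 == 1 then q else p)%N.
Proof. by []. Qed.

Section Schur.
Variable n : nat.
Let N := nv n.

Lemma cell_ord_proof (i : 'I_N) r : (r < 3)%N -> (3 * i + r < nv n.+1)%N.
Proof. by move=> r3; rewrite nvS; have := ltn_ord i; rewrite /N; move: r3; clear; lia. Qed.

Definition cell_ord (i : 'I_N) r (h : (r < 3)%N) : 'I_(nv n.+1) := Ordinal (cell_ord_proof i h).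

Definition cell_index (k : 'I_(N + (N + N))) : 'I_(nv n.+1) :=
  match fintype.split k with
  | inl i => cell_ord i (isT : 0 < 3)%N
  | inr k' => match fintype.split k' with
    | inl i => cell_ord i (isT : 1 < 3)%N
    | inr i => cell_ord i (isT : 2 < 3)%N end end.

Lemma cell_index_inj : injective cell_index.
Proof.
move=> k l; rewrite /cell_index.
have s1 := fintype.splitK k; have s2 := fintype.splitK l.
have aux (a b : 'I_N) r r' (h : (r < 3)%N) (h' : (r' < 3)%N) :
    cell_ord a h = cell_ord b h' -> a = b /\ r = r'.
  move/(congr1 val) => /= E.
  have e2 : r = r' by move: E h h'; clear; lia.
  by split=> //; apply: val_inj => /=; move: E; rewrite e2; clear; lia.
case: (fintype.split k) s1 => [a|k'] <-; case: (fintype.split l) s2 => [b|l'] <- /=.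
- by move/aux => [-> _].
- by case: fintype.split => c /aux[].
- by case: fintype.split => c /aux[].
have t1 := fintype.splitK k'; have t2 := fintype.splitK l'.
case: (fintype.split k') t1 => [a|a] <-; case: (fintype.split l') t2 => [b|b] <- /= /aux[]//.
- by move=> -> _.
by move=> -> _.
Qed.

Let Sh : 'M[R]_N := \matrix_(i, j) (j == ordS i)%:R.
Let DP : 'M[R]_N := \matrix_(i, j) (back n i * (j == ord_pred i)%:R).
Let Dm : 'M[R]_N := diag_mx (\row_i (1 - back n i)).

Lemma block_walk w :
  mxsub cell_index cell_index (w%:M - walk_mx n.+1) =
  block_mx w%:M (row_mx (- Dm) (- DP))
   (col_mx (- q%:M) (- (q *: Sh))) (block_mx w%:M (- p%:M) (- p%:M) w%:M).
Proof.
have pS (i : 'I_N) : prevn n.+1 (3 * i + 0) = (3 * ord_pred i + 2)%N.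
  rewrite val_ord_pred /prevn addn0 muln_eq0 /=; case: eqP => i0.
    by rewrite nvS; have := nv_gt n; clear; lia.
  have : (0 < i)%N by rewrite lt0n; apply/eqP.
  by case: (nat_of_ord i) => [//|m] _; clear; lia.
have p1S (i : 'I_N) : prevn n.+1 (3 * i + 1) = (3 * i + 0)%N.
  by rewrite /prevn; case: eqP; clear; lia.
have p2S (i : 'I_N) : prevn n.+1 (3 * i + 2) = (3 * i + 1)%N.
  by rewrite /prevn; case: eqP; clear; lia.
have n2S (i : 'I_N) : (if (3 * i + 2).+1 == nv n.+1 then 0 else (3 * i + 2).+1)%N = (3 * ordS i + 0)%N.
  have -> : ((3 * i + 2).+1 = 3 * i.+1)%N by clear; lia.
  by rewrite val_ordS nvS eqn_pmul2l// addn0; case: eqP.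
have nS (i : 'I_N) r : (r < 2)%N -> (if (3 * i + r).+1 == nv n.+1 then 0 else (3 * i + r).+1)%N = (3 * i + r.+1)%N.
  move=> r2; case: eqP => [|_]; last by clear; lia.
  by rewrite nvS; have := ltn_ord i; rewrite /N; move: r2; clear; lia.
have E0 (i : 'I_N) : back n.+1 (3 * i + 0) = back n i.
  by rewrite backS mulnC modnMDl divnMDl//= addn0.
have E1 (i : 'I_N) : back n.+1 (3 * i + 1) = q by rewrite backS mulnC modnMDl.
have E2 (i : 'I_N) : back n.+1 (3 * i + 2) = p by rewrite backS mulnC modnMDl.
have C (a b : 'I_N) r r' : (r < 3)%N -> (r' < 3)%N ->
    (3 * a + r == 3 * b + r')%N = (a == b) && (r == r').
  move=> h h'; apply/eqP/andP => [E|[/eqP-> /eqP->]//].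
  by split; apply/eqP; first apply: val_inj => /=; move: E h h'; clear; lia.
have vE (a b : 'I_(nv n.+1)) : (a == b) = (a == b :> nat) by [].
have q1 : 1 - q = p by rewrite hq; ring.
have q2 : 1 - p = q by rewrite hq.
apply/matrixP => k l; rewrite !mxE /cell_index.
case: (fintype.split k) => [i|k']; rewrite !mxE;
  case: (fintype.split l) => [j|l']; rewrite !mxE;
  try (case: (fintype.split k') => i; rewrite ?mxE);
  try (case: (fintype.split l') => j);
  rewrite ?mxE !vE val_ord_pred val_ordS /=
    ?pS ?p1S ?p2S ?n2S ?nS// ?E0 ?E1 ?E2 !C// ?andbT ?andbF /= ?mulr0n;
  by rewrite ?q1 ?(eq_sym j i) ?mulr_natr ?mulr0 ?(mulrb, addr0, add0r, sub0r, subr0) ?mulrN ?q2.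
Qed.

(** Ordering the vertices by their position in the cell gives a block matrix
    whose last blocks commute; multiplying by a block column that
    annihilates the lower left part leaves the Schur complement. *)
Lemma schur w : w != 0 -> w ^+ 2 != p ^+ 2 ->
  \det (w%:M - walk_mx n.+1) = (p * q) ^+ N * \det ((Wmap p q w)%:M - walk_mx n).
Proof.
move=> w0 wp; pose delta := w ^+ 2 - p ^+ 2.
have d0 : delta != 0 by rewrite subr_eq0.
have card : (N + (N + N) = nv n.+1)%N by rewrite nvS /N; clear; lia.
rewrite -(det_reindex _ card cell_index_inj) block_walk.
set B := row_mx _ _; set C := col_mx _ _; set D := block_mx w%:M (- p%:M) _ _.
pose E : 'M[R]_(N + N, N) := col_mx ((q * w)%:M + (q * p) *: Sh) ((q * p)%:M + (q * w) *: Sh).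
have DE : C *m delta%:M + D *m E = 0.
  rewrite mul_col_mx mul_block_col add_col_mx -[0]col_mx0.
  congr col_mx; rewrite ?mulmxDr ?mulNmx ?mul_scalar_mx ?mul_mx_scalar ?scalerDr ?scalerN ?scalerA
     -?scalar_mxM; apply/matrixP => i j; rewrite !mxE /delta; ring.
have BE : delta *: w%:M + B *m E = (p * q) *: ((Wmap p q w)%:M - walk_mx n).
  have PS : DP *m Sh = diag_mx (\row_i back n i).
    apply/matrixP => i j; rewrite !mxE (bigD1 (ord_pred i))//= !mxE eqxx mulr1.
    rewrite big1 ?addr0 => [|k ki]; last by rewrite !mxE (negPf ki) mulr0 mul0r.
    by rewrite ord_predK (eq_sym i); case: (j == i); rewrite ?mulr1 ?mulr0.
  rewrite mul_row_col !mulNmx !mulmxDr -!scalemxAr !mul_mx_scalar PS.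
  have DmSh : Dm *m Sh = \matrix_(i, j) ((1 - back n i) * (j == ordS i)%:R).
    by apply/matrixP => i j; rewrite mul_diag_mx !mxE.
  rewrite DmSh; apply/matrixP => i j; rewrite !mxE /delta /Wmap (eq_sym i j) hq.
  case: (j == i); case: (j == ord_pred i); case: (j == ordS i);
    rewrite ?mulr1n ?mulr0n /=; field; have := p0 hp; have := p1 hp; lra.
have detD : \det D = delta ^+ N.
  have wN : w ^+ N != 0 by rewrite expf_neq0.
  apply: (mulIf wN).
  have -> : w ^+ N = \det (block_mx w%:M 0 p%:M 1%:M : 'M[R]_(N + N)).
    by rewrite det_lblock det_scalar det1 mulr1.
  rewrite -det_mulmx mulmx_block !mulmx0 !mulmx1 !add0r ?addr0 -!scalar_mxM.
  rewrite !mulNmx -!scalar_mxM (mulrC p w) addNr det_ublock det_scalar.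
  by rewrite -raddfN -raddfD /= det_scalar det_lblock det_scalar det1 mulr1 /delta !expr2.
have dN : delta ^+ N != 0 by rewrite expf_neq0.
apply: (mulIf dN).
have -> : \det (block_mx w%:M B C D) * delta ^+ N =
    \det (block_mx w%:M B C D *m block_mx delta%:M 0 E 1%:M).
  by rewrite det_mulmx det_lblock det_scalar det1 mulr1.
rewrite mulmx_block DE !mulmx0 !mulmx1 !add0r det_ublock detD; congr (_ * _).
by rewrite mul_mx_scalar BE detZ.
Qed.
End Schur.
End Walk.

Section Spectrum.
Variable R : realType.
Variables p q : R.
Hypothesis hp : 0 < p < 1.
Hypothesis hq : q = 1 - p.
Let lam := lambda p q.
Local Notation back := (back p q).
Local Notation len := (len p q).

Lemma horner_char_poly m (A : 'M[R]_m) w : (char_poly A).[w] = \det (w%:M - A).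
Proof.
rewrite /char_poly -[LHS]/(horner_eval w _) -det_map_mx; congr (\det _).
apply/matrixP => i j.
rewrite /char_poly_mx !mxE -[LHS]/(('X *+ (i == j) - (A i j)%:P).[w]) hornerD hornerN hornerC hornerMn hornerX.
by [].
Qed.

Lemma poly_eq0_cofinite (f : {poly R}) (s : seq R) :
  (forall w, w \notin s -> f.[w] = 0) -> f = 0.
Proof.
move=> H; pose g := f * \prod_(a <- s) ('X - a%:P).
have g0 : g = 0.
  pose rs := [seq (i%:R : R) | i <- iota 0 (size g)].
  apply: (@roots_geq_poly_eq0 _ g rs).
  - apply/allP => _ /mapP[i _ ->]; rewrite /root /g hornerM.
    have [is_|ns] := boolP ((i%:R : R) \in s); last by rewrite H// mul0r.
    rewrite horner_prod (big_rem _ is_) /= hornerXsubC subrr mul0r mulr0.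
    by [].
  - rewrite map_inj_uniq ?iota_uniq// => i j /eqP; by rewrite eqr_nat => /eqP.
  by rewrite size_map size_iota.
move/eqP: g0; rewrite mulf_eq0 => /orP[/eqP//|].
by rewrite (negPf (monic_neq0 (monic_prod_XsubC _ _ _))).
Qed.

Lemma det_2x2 (A : 'M[R]_2) :
  let a := @Ordinal 2 0 isT in let b := @Ordinal 2 1 isT in
  \det A = A a a * A b b - A a b * A b a.
Proof.
move=> a b; rewrite (expand_det_row _ a) (bigD1 a)//= (bigD1 b)//= big1 ?addr0; last first.
  by move=> [[|[|//]]] //= ?.
rewrite /cofactor !det_mx11 !mxE /= expr0 expr1 mul1r mulN1r mulrN.
by congr (_ * A _ _ - _ * A _ _); apply: val_inj.
Qed.

Lemma char_walk n : char_poly (walk_mx p q n) = \prod_(s <- spec p q n) ('X - s%:P).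
Proof.
have prodE m w : (\prod_(s <- spec p q m) ('X - s%:P)).[w] = \prod_(s <- spec p q m) (w - s).
  by rewrite horner_prod; apply: eq_bigr => s _; rewrite hornerXsubC.
elim: n => [|n IH]; apply/eqP; rewrite -subr_eq0; apply/eqP.
  apply: (@poly_eq0_cofinite _ [::]) => w _; rewrite hornerD hornerN prodE.
  rewrite horner_char_poly /= !big_cons big_nil.
  rewrite (det_2x2 (w%:M - walk_mx p q 0)) !mxE.
  have oE (a b : 'I_(nv 0)) : (a == b) = (a == b :> nat) by [].
  rewrite !oE !val_ord_pred !val_ordS /prevn /nv -[(2 * 3 ^ 0)%N]/2%N /= ?mulr1n ?mulr0n.
  field; by rewrite ?pnatr_eq0.
apply: (@poly_eq0_cofinite _ [:: 0; p; - p]) => w; rewrite !inE !negb_or => /and3P[w0 wp wp'].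
rewrite hornerD hornerN prodE horner_char_poly (schur hp hq)//; last first.
  by rewrite eqf_sqr negb_or wp.
by rewrite (prod_spec hp hq) -horner_char_poly IH prodE subrr.
Qed.

Section SelfAdjoint.
Variable m : nat.
Variables (A : 'M[R]_m.+1) (d : 'rV[R]_m.+1).
Hypothesis d_gt0 : forall i, 0 < d 0 i.
Hypothesis Ad : A^T *m diag_mx d = diag_mx d *m A.

Lemma selfadj_horner f : (horner_mx A f)^T *m diag_mx d = diag_mx d *m horner_mx A f.
Proof.
elim/poly_ind: f => [|f c IH].
  by rewrite rmorph0 trmx0 mul0mx mulmx0.
rewrite rmorphD rmorphM /= horner_mx_X horner_mx_C linearD /= trmx_mul tr_scalar_mx.
rewrite mulmxDl mulmxDr -mulmxA IH mulmxA Ad -mulmxA; congr (_ + _).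
  by rewrite -(comm_horner_mx _ (comm_mx_refl A)).
by rewrite mul_scalar_mx mul_mx_scalar.
Qed.

Lemma selfadj_sq0 f : horner_mx A f *m horner_mx A f = 0 -> horner_mx A f = 0.
Proof.
set B := horner_mx A f => B2; apply/matrixP => i j; rewrite mxE.
have : (B^T *m diag_mx d *m B) j j = 0.
  by rewrite selfadj_horner -mulmxA B2 mulmx0 mxE.
rewrite mxE; under eq_bigr do rewrite mul_mx_diag !mxE.
move/eqP; rewrite psumr_eq0 => [/allP/(_ i (mem_index_enum _))/=|k _].
  by rewrite mulrAC !mulf_eq0 (gt_eqF (d_gt0 i)) orbF orbb => /eqP.
by rewrite mulrAC mulr_ge0 ?(ltW (d_gt0 k))// -expr2 sqr_ge0.
Qed.

(** A nilpotent self-adjoint matrix vanishes, so the minimal polynomial has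
    simple roots. *)
Lemma selfadj_diagonalizable (rs : seq R) :
  char_poly A = \prod_(s <- rs) ('X - s%:P) -> diagonalizable A.
Proof.
move=> chiA; apply/diagonalizableP; exists (undup rs); first exact: undup_uniq.
pose f : {poly R} := \prod_(s <- undup rs) ('X - s%:P); rewrite -/f.
apply/mxminpoly_minP.
have fk : horner_mx A (f ^+ size rs) = 0.
  apply/mxminpoly_minP; apply: dvdp_trans (mxminpoly_dvd_char A) _; rewrite chiA.
  suff H (t : seq R) : {subset t <= rs} -> \prod_(s <- t) ('X - s%:P) %| f ^+ size t by apply: H.
  elim: t => [|s t IH] sub; first by rewrite big_nil expr0 dvd1p.
  rewrite big_cons /= exprS dvdp_mul//; last by apply: IH => x xt; apply: sub; rewrite inE xt orbT.
  by rewrite dvdp_XsubCl root_prod_XsubC mem_undup; apply: sub; rewrite inE eqxx.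
have f2 : horner_mx A (f ^+ (2 ^ size rs)) = 0.
  have le : (size rs <= 2 ^ size rs)%N by rewrite ltnW// ltn_expl.
  by rewrite -(subnK le) exprD rmorphM /= fk mulr0.
elim: (size rs) f2 => [|k IH]; first by rewrite expn0 expr1.
rewrite expnS mul2n -addnn exprD rmorphM /= => h; apply: IH.
exact: selfadj_sq0.
Qed.

Lemma eigenbasis_of (rs : seq R) w :
  char_poly A = \prod_(s <- rs) ('X - s%:P) ->
  exists e : 'I_(count_mem w rs) -> 'cV[R]_m.+1,
  [/\ forall k, A *m e k = w *: e k,
      forall c : 'I_(count_mem w rs) -> R, \sum_k c k *: e k = 0 -> forall k, c k = 0
    & forall v, A *m v = w *: v -> exists c : 'I_(count_mem w rs) -> R, v = \sum_k c k *: e k].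
Proof.
move=> chiA; have [P Pu /(diagonalizable_forLR Pu)[D]] := selfadj_diagonalizable chiA.
rewrite mxpoly.conjumx ?unitmx_inv// invmxK => AE.
have PA : P *m A = diag_mx D *m P by rewrite AE !mulmxA mulmxV// mul1mx.
have chi2 : char_poly A = \prod_(s <- [seq D 0 i | i <- enum 'I_m.+1]) ('X - s%:P).
  rewrite big_map big_enum /=.
  have -> : \prod_(i < m.+1) ('X - (D 0 i)%:P) = char_poly (diag_mx D).
    rewrite char_poly_trig ?diag_mx_is_trig//; apply: eq_bigr => i _.
    by rewrite mxE eqxx mulr1n.
  apply/eqP; rewrite -subr_eq0; apply/eqP; apply: (@poly_eq0_cofinite _ [::]) => x _.
  rewrite hornerD hornerN !horner_char_poly.
  have -> : x%:M - A = invmx P *m (x%:M - diag_mx D) *m P.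
    by rewrite mulmxBr mulmxBl -AE mul_mx_scalar -scalemxAl mulVmx// scalemx1.
  rewrite !det_mulmx mulrAC -det_mulmx mulVmx// det1 mul1r subrr.
  by [].
have cnt : count_mem w rs = #|[pred i | D 0 i == w]|.
  rewrite -mu_prod_XsubC -chiA chi2 mu_prod_XsubC count_map cardE -size_filter.
  by rewrite enumT.
pose e k : 'cV[R]_m.+1 := col (enum_val (cast_ord cnt k)) (invmx P).
have eE k : e k = invmx P *m delta_mx (enum_val (cast_ord cnt k)) 0.
  by rewrite /e colE.
exists e; split.
- move=> k; apply: (can_inj (mulKmx Pu)); rewrite mulmxA PA -mulmxA eE mulKVmx//.
  rewrite -scalemxAr mulKVmx//; apply/matrixP => i j; rewrite mul_diag_mx !mxE.
  case: eqP => [->|_]; last by rewrite !mulr0.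
  by have := enum_valP (cast_ord cnt k); rewrite inE => /eqP ->.
- move=> c c0 k; have : P *m \sum_k c k *: e k = 0 by rewrite c0 mulmx0.
  rewrite mulmx_sumr; move/matrixP/(_ (enum_val (cast_ord cnt k)) 0).
  rewrite summxE (bigD1 k)//= big1 ?addr0 => [|l lk].
    by rewrite -scalemxAr eE mulKVmx// !mxE !eqxx mulr1.
  rewrite -scalemxAr eE mulKVmx// !mxE.
  case: eqP => [/enum_val_inj/cast_ord_inj kl|_]; last by rewrite mulr0.
  by rewrite kl eqxx in lk.
move=> v Av; have [u uE] : exists u, u = P *m v by exists (P *m v).
have Du : diag_mx D *m u = w *: u by rewrite uE mulmxA -PA -mulmxA Av -scalemxAr.
have u0 i : D 0 i != w -> u i 0 = 0.
  move=> Di; move/matrixP: Du => /(_ i 0); rewrite mul_diag_mx !mxE => /eqP.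
  by rewrite -subr_eq0 -mulrBl mulf_eq0 subr_eq0 (negPf Di) => /eqP.
exists (fun k => u (enum_val (cast_ord cnt k)) 0).
apply: (can_inj (mulKmx Pu)); rewrite -uE.
apply/matrixP => i j; rewrite ord1 {j} mulmx_sumr summxE.
have [Di|Di] := eqVneq (D 0 i) w; last first.
  rewrite u0// big1// => k _; rewrite -scalemxAr eE mulKVmx// !mxE.
  case: eqP => [ik|_]; last by rewrite mulr0.
  by have := enum_valP (cast_ord cnt k); rewrite inE -ik (negPf Di).
have iP : i \in [pred i | D 0 i == w] by rewrite inE Di.
pose k0 := cast_ord (esym cnt) (enum_rank_in iP i).
have k0E : enum_val (cast_ord cnt k0) = i by rewrite cast_ordKV enum_rankK_in.
rewrite (bigD1 k0)//= big1 ?addr0 => [|l lk].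
  by rewrite -scalemxAr eE mulKVmx// [in RHS]mxE [in RHS]mxE k0E !eqxx mulr1.
rewrite -scalemxAr eE mulKVmx// !mxE; case: eqP => [il|_]; last by rewrite mulr0.
by move/negP: lk; case; apply/eqP/(@cast_ord_inj _ _ cnt)/enum_val_inj; rewrite k0E.
Qed.

End SelfAdjoint.

(** The walk is reversible with respect to the conductances 1 / length,
    hence diagonalizable, so that the multiplicities of the roots are
    dimensions of eigenspaces. *)
Lemma eigenbasis n w : exists e : 'I_(count_mem w (spec p q n)) -> 'I_(nv n) -> R,
  [/\ forall k i, walk p q (e k) i = w * e k i,
      forall c : 'I_(count_mem w (spec p q n)) -> R,
        (forall i, \sum_k c k * e k i = 0) -> forall k, c k = 0
    & forall v : 'I_(nv n) -> R, (forall i, walk p q v i = w * v i) ->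
        exists c : 'I_(count_mem w (spec p q n)) -> R, forall i, v i = \sum_k c k * e k i].
Proof.
pose pi (i : 'I_(nv n)) := (len n i)^-1 + (len n (ord_pred i))^-1.
have L i : 0 < len n i by apply: len_gt0.
have pi0 i : 0 < pi i by rewrite addr_gt0 ?invr_gt0.
have Ln0 i : len n i != 0 by rewrite gt_eqF.
have bal (i : 'I_(nv n)) : pi i * back n i = (len n (ord_pred i))^-1 /\
    pi i * (1 - back n i) = (len n i)^-1.
  have := back_balance hp hq (ltn_ord i); rewrite -val_ord_pred /pi.
  have Li := L i; have Lj := L (ord_pred i).
  move: (back n i) => b E; have bE : b = len n i / (len n i + len n (ord_pred i)).
    have s0 : len n i + len n (ord_pred i) != 0 by rewrite gt_eqF ?addr_gt0.
    by apply: (mulIf s0); rewrite mulfVK//; lra.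
  by rewrite bE; split; field; rewrite ?gt_eqF ?addr_gt0//; lra.
have sym : (walk_mx p q n)^T *m diag_mx (\row_i pi i) = diag_mx (\row_i pi i) *m walk_mx p q n.
  apply/matrixP => i j; rewrite mul_mx_diag mul_diag_mx !mxE.
  have [bi bi'] := bal i; have [bj bj'] := bal j.
  rewrite [LHS](_ : _ = (pi j * back n j) * (i == ord_pred j)%:R +
    (pi j * (1 - back n j)) * (i == ordS j)%:R); last by ring.
  rewrite [RHS](_ : _ = (pi i * back n i) * (j == ord_pred i)%:R +
    (pi i * (1 - back n i)) * (j == ordS i)%:R); last by ring.
  rewrite bi bi' bj bj'.
  have -> : (i == ordS j) = (j == ord_pred i).
    by apply/eqP/eqP => [->|->]; rewrite ?ordSK ?ord_predK.
  have -> : (i == ord_pred j) = (j == ordS i).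
    by apply/eqP/eqP => [->|->]; rewrite ?ordSK ?ord_predK.
  rewrite addrC; congr (_ + _).
    by case: eqP => [->|_]; rewrite ?mulr1 ?mulr0.
  by case: eqP => [->|_]; rewrite ?mulr1 ?mulr0 ?ordSK.
have chi := char_walk n; have WE := @walk_mxE _ p q n.
have [m nvm] : exists m, nv n = m.+1.
  by exists (nv n).-1; rewrite prednK// (leq_ltn_trans (leq0n _) (nv_gt n)).
move: (walk_mx p q n) (@walk _ p q n) pi pi0 sym chi WE {bal L Ln0}; rewrite nvm => A wk pi pi0 sym chi WE.
have pi0' i : 0 < (\row_i pi i) 0 i by rewrite mxE.
have [e [e1 e2 e3]] := eigenbasis_of pi0' sym w chi.
exists (fun k i => e k i 0); split.
- by move=> k i; rewrite -WE e1 mxE.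
- move=> c H; apply: e2; apply/matrixP => i j; rewrite ord1 summxE mxE -[RHS](H i).
  by apply: eq_bigr => k _; rewrite mxE.
move=> v Hv; have [|c Hc] := e3 (\col_i v i).
  apply/matrixP => i j; rewrite ord1 WE !mxE -Hv; congr wk.
  by apply/funext => k; rewrite mxE.
exists c => i; move/matrixP/(_ i 0): Hc; rewrite mxE summxE => ->.
by apply: eq_bigr => k _; rewrite mxE.
Qed.

(** The coefficient of the characteristic polynomial at the simple root 0 is
    computed from the recursion of the spectra. *)
Lemma det_laplacianE n :
  det_laplacian p q n = 2 ^+ nv n * lam ^+ n * (p * q) ^+ (3 ^ n).-1.
Proof.
pose zs := [seq 2 * (1 - s) | s <- spec p q n].
have chi : char_poly (neg_laplacian_mx p q n) = \prod_(z <- zs) ('X - z%:P).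
  apply/eqP; rewrite -subr_eq0; apply/eqP; apply: (@poly_eq0_cofinite _ [::]) => w _.
  rewrite hornerD hornerN horner_char_poly (neg_laplacian_mxE hp hq) horner_prod.
  have -> : w%:M - 2 *: (1%:M - walk_mx p q n) = - 2 *: ((1 - w / 2)%:M - walk_mx p q n).
    by apply/matrixP => i j; rewrite !mxE; case: (i == j); rewrite ?mulr1n ?mulr0n; field.
  rewrite detZ -horner_char_poly char_walk horner_prod big_map.
  have -> : nverts n = size (spec p q n) by rewrite size_spec.
  elim: (spec p q n) => [|s t IH]; first by rewrite !big_nil expr0 mulr1 subrr.
  move/eqP: IH; rewrite subr_eq0 => /eqP IH; rewrite !big_cons exprS mulrACA IH.
  rewrite !hornerXsubC -mulrBl; apply/eqP; rewrite mulf_eq0; apply/orP; left.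
  by apply/eqP; field.
rewrite /det_laplacian chi.
set f := \prod_(z <- zs) _; have f0 : f != 0 by rewrite monic_neq0// monic_prod_XsubC.
have pe : perm_eq (rootsR f) (undup zs).
  apply: uniq_perm; rewrite ?undup_uniq ?uniq_roots// => x.
  by rewrite -(roots_on_rootsR f0) mem_undup root_prod_XsubC in_itv.
rewrite (perm_big _ pe) /=; under eq_bigr do rewrite mu_prod_XsubC.
rewrite GRing.prodr_undup_exp_count big_map.
have [T [E HT]] := spec_cons hp hq n.
have := prod_behead_spec hp hq n; have := size_spec p q n.
rewrite E /= big_cons subrr mulr0 eqxx /= => <- PE.
rewrite big_seq_cond (eq_bigl (fun s => s \in T)); last first.
  move=> s; case sT : (s \in T) => //=; rewrite mulf_neq0// subr_eq0.
  by have := HT _ sT; rewrite eq_sym => /lt_eqF ->.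
rewrite -big_seq exprS -mulrA mulrCA -/lam in PE *.
have -> : \prod_(s <- T) (2 * (1 - s)) = 2 ^+ size T * \prod_(s <- T) (1 - s).
  elim: (T) => [|s t IH]; first by rewrite !big_nil expr0 mulr1.
  by rewrite !big_cons /= IH exprS; ring.
by rewrite PE /lam; ring.
Qed.

End Spectrum.

(** * The Poincare function of W *)

Section Poincare.
Variable R : realType.
Variables p q : R.
Hypothesis hp : 0 < p < 1.
Hypothesis hq : q = 1 - p.
Let lam := lambda p q.
Local Notation W := (Wmap p q).
Local Notation M := (Num.max p q).
Implicit Types (u v x y w : R).

Let l9 : 9 <= lam. Proof. exact: lam9 hp hq. Qed.
Let lam0 : 0 < lam. Proof. by have := l9; lra. Qed.
Let lam1 : 1 <= lam. Proof. by have := l9; lra. Qed.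

Lemma W_lip u v : `|u| <= 1 -> `|v| <= 1 ->
  `|W (1 - u) - W (1 - v)| <= lam * `|u - v| * (1 + 3 * (`|u| + `|v|)).
Proof.
move=> u1 v1; have a0 := pq0 hp hq; have e := lam_pq hp hq.
have -> : W (1 - u) - W (1 - v) =
    - ((u - v) * (lam - (3 * (u + v) - (u ^+ 2 + u * v + v ^+ 2)) / (p * q))).
  by rewrite /lam lamE// /Wmap; field; have := p0 hp; have := q0 hp hq; lra.
rewrite normrN normrM [lam * _]mulrC -[leRHS]mulrA ler_wpM2l//.
apply: le_trans (ler_normB _ _) _; rewrite gtr0_norm// [leRHS]mulrDr mulr1 lerD2l.
rewrite normrM normfV (gtr0_norm a0) ler_pdivrMr//.
have -> : lam * (3 * (`|u| + `|v|)) * (p * q) = (2 + p * q) * (3 * (`|u| + `|v|)).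
  by rewrite -e /lam; ring.
have h : `|3 * (u + v) - (u ^+ 2 + u * v + v ^+ 2)| <= 3 * (`|u| + `|v|) + (`|u| + `|v|) ^+ 2.
  apply: le_trans (ler_normB _ _) _; apply: lerD.
    by rewrite normrM ger0_norm// ler_wpM2l// ler_normD.
  apply: le_trans (ler_normD _ _) _; apply: le_trans (lerD (ler_normD _ _) (lexx _)) _.
  rewrite !normrX normrM; have := normr_ge0 u; have := normr_ge0 v; nra.
apply: le_trans h _; have := normr_ge0 u; have := normr_ge0 v; nra.
Qed.

Definition Wn m w := iter m W w.

(** On the scale lam^-k the first k iterates are linear up to the summable
    factors 1 + t, with t = lam^(j-k); the induction closes because
    (1 + t)^2 <= 1 + lam t. *)
Lemma Wn_lip k u v j : `|u| <= lam ^- k / 12 -> `|v| <= lam ^- k / 12 -> (j <= k)%N ->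
  [/\ `|1 - Wn j (1 - u)| <= lam ^+ j * lam ^- k / 12 * (1 + lam ^+ j * lam ^- k),
      `|1 - Wn j (1 - v)| <= lam ^+ j * lam ^- k / 12 * (1 + lam ^+ j * lam ^- k)
    & `|Wn j (1 - u) - Wn j (1 - v)| <= lam ^+ j * `|u - v| * (1 + lam ^+ j * lam ^- k)].
Proof.
move=> hu hv; have lk0 : 0 < lam ^- k by rewrite invr_gt0 exprn_gt0.
elim: j => [_|j IH jk].
  rewrite /Wn /= expr0 !mul1r !subKr (_ : 1 - u - (1 - v) = - (u - v)) ?normrN; last by ring.
  by split; [apply: le_trans hu _|apply: le_trans hv _|]; rewrite ler_peMr//; lra.
have [IHu IHv IHd] := IH (ltnW jk).
have : lam ^+ j.+1 * lam ^- k <= 1.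
  rewrite -(subnK jk) exprD invfM mulrCA mulfV ?expf_neq0 ?gt_eqF// mulr1.
  by rewrite invf_le1 ?exprn_gt0// exprn_ege1.
rewrite exprS; have := l9; move=> l9'; move: (lam ^+ j) (lam ^- k) lk0 IHu IHv IHd (exprn_gt0 j lam0)=> L t lk0 IHu IHv IHd L0.
set s := L * t in IHu IHv IHd *; have -> : lam * L * t = lam * s by rewrite /s mulrA.
move=> ls1.
have s0 : 0 < s by rewrite mulr_gt0.
clearbody s.
have s9 : 0 <= (lam - 9) * s by rewrite mulr_ge0 ?subr_ge0// ltW.
have s1 : s <= 9^-1 by lra.
have E w : Wn j.+1 w = W (Wn j w) by [].
rewrite !E; set wu := Wn j (1 - u) in IHu IHd *; set wv := Wn j (1 - v) in IHv IHd *.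
have b0 a : `|1 - a| <= s / 12 * (1 + s) -> `|1 - a| <= s / 6 by nra.
have bu := b0 _ IHu; have bv := b0 _ IHv.
have one a : `|1 - a| <= s / 12 * (1 + s) -> `|1 - W a| <= lam * s / 12 * (1 + lam * s).
  move=> ha; have hb := b0 _ ha.
  have := @W_lip 0 (1 - a); rewrite normr0 subr0 subKr sub0r normrN (W1 hp hq).
  move=> /(_ ler01 (le_trans hb _)) h; apply: le_trans (h _) _; first by lra.
  rewrite -mulrA -[lam * s / 12]mulrA -[leRHS]mulrA ler_pM2l//; have := normr_ge0 (1 - a); move: (`|1 - a|) ha hb => A ha hb A0.
  apply: (@le_trans _ _ (s / 12 * (1 + s) * (1 + s / 2))).
    by apply: ler_pM => //; lra.
  rewrite -[leLHS]mulrA ler_pM2l; last by lra.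
  have h9 : 9 * s <= lam * s by lra.
  have s2 : s * s <= 9^-1 * s by rewrite ler_wpM2r// ltW.
  have -> : (1 + s) * (1 + s / 2) = 1 + 3 / 2 * s + s * s / 2 by field.
  by move: h9 s2 s0; move: (lam * s) (s * s) => b c; lra.
split; [exact: one|exact: one|].
have := @W_lip (1 - wu) (1 - wv); rewrite !subKr => /(_ _ _) h.
apply: le_trans (h _ _) _; [lra|lra|].
have -> : `|1 - wu - (1 - wv)| = `|wu - wv| by rewrite opprB addrC addrA subrK distrC.
rewrite -!mulrA ler_pM2l//; move: (normr_ge0 (wu - wv)) IHd => D0.
move: (`|wu - wv|) D0 => D D0 IHd.
have N0 := normr_ge0 (1 - wu); have N1 := normr_ge0 (1 - wv).
apply: (@le_trans _ _ (D * (1 + s))); first by rewrite ler_wpM2l//; lra.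
have := normr_ge0 (u - v); move: IHd; rewrite -mulrA; move: (`|u - v|) => d IHd d0.
apply: (@le_trans _ _ (L * (d * (1 + s)) * (1 + s))); first by rewrite ler_wpM2r//; lra.
by rewrite -!mulrA ler_pM2l// ler_wpM2l//; nra.
Qed.

(** Phi is the linearization of W at its repelling fixed point 1, normalized by
    the slope - 1/2 at 0. *)
Definition Phin m x := Wn m (1 - x / 2 * lam ^- m).
Definition Phi x := limn (Phin^~ x).

Lemma small_scale m x : `|x| <= 6^-1 -> `|x / 2 * lam ^- m| <= lam ^- m / 12.
Proof.
move=> hx; have l0 : 0 < lam ^- m by rewrite invr_gt0 exprn_gt0.
by rewrite normrM (gtr0_norm l0) normrM (gtr0_norm (_ : 0 < 2^-1)) ?invr_gt0//; nra.
Qed.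

Lemma Phin_step m x : `|x| <= 12^-1 -> `|Phin m.+1 x - Phin m x| <= x ^+ 2 * 9^-1 ^+ m.
Proof.
move=> hx; pose u := x / 2 * lam ^- m.+1.
have l0 k : 0 < lam ^- k by rewrite invr_gt0 exprn_gt0.
have lS : lam ^- m = lam * lam ^- m.+1.
  by rewrite exprS invfM mulrA mulfV ?mul1r// gt_eqF.
have a0 := pq0 hp hq; have e := lam_pq hp hq.
have uB : `|u| <= lam ^- m.+1 / 24.
  rewrite /u normrM (gtr0_norm (l0 _)) normrM (gtr0_norm (_ : 0 < 2^-1)) ?invr_gt0//.
  by have := l0 m.+1; nra.
have lm1 k : lam ^- k <= 1 by rewrite invf_le1 ?exprn_gt0// exprn_ege1.
have u1 : `|u| <= 24^-1 by apply: le_trans uB _; have := lm1 m.+1; lra.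
pose v := 1 - W (1 - u).
have hv : `|v| <= lam ^- m / 12.
  have := @W_lip 0 u; rewrite normr0 subr0 sub0r normrN (W1 hp hq) => h.
  apply: le_trans (h _ _) _; [by rewrite ler01|lra|].
  rewrite lS; have := normr_ge0 u; move: (`|u|) uB u1 => U uB u1 U0.
  rewrite -!mulrA ler_pM2l//; nra.
have hvu : `|v - lam * u| <= 2 * lam * u ^+ 2.
  have -> : v - lam * u = - (u ^+ 2 * ((3 - u) / (p * q))).
    by rewrite /v /lam lamE// /Wmap; field; have := p0 hp; have := q0 hp hq; lra.
  rewrite normrN normrM ger0_norm ?sqr_ge0// mulrC ler_wpM2r ?sqr_ge0//.
  rewrite normrM normfV (gtr0_norm a0) ler_pdivrMr// -mulrA e.
  by move: u1; rewrite ler_norml => /andP[h1 h2]; rewrite ger0_norm; lra.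
have -> : Phin m.+1 x = Wn m (1 - v) by rewrite /Phin /Wn iterSr /v subKr.
have -> : Phin m x = Wn m (1 - lam * u).
  by rewrite /Phin /u lS; congr (Wn m (1 - _)); ring.
have hlu : `|lam * u| <= lam ^- m / 12.
  by rewrite lS normrM gtr0_norm// -mulrA ler_pM2l//; have := l0 m.+1; lra.
have [_ _ h] := Wn_lip hv hlu (leqnn m); apply: le_trans h _.
rewrite mulfV ?expf_neq0 ?gt_eqF//.
apply: (@le_trans _ _ (lam ^+ m * (2 * lam * u ^+ 2) * (1 + 1))).
  by rewrite ler_wpM2r// ler_wpM2l// exprn_ge0// ltW.
have -> : lam ^+ m * (2 * lam * u ^+ 2) * (1 + 1) = x ^+ 2 * lam ^- m.+1.
  have Ln : lam ^+ m != 0 by rewrite expf_neq0// gt_eqF.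
  have l0n : lam != 0 by rewrite gt_eqF.
  rewrite /u [lam ^+ m.+1]exprS; move: (lam ^+ m) (lam) Ln l0n => Lm l Ln l0n.
  by field; rewrite Ln l0n.
rewrite ler_wpM2l ?sqr_ge0// -exprVn [lam^-1 ^+ _]exprS.
apply: (@le_trans _ _ (1 * lam^-1 ^+ m)).
  by rewrite ler_wpM2r ?exprn_ge0 ?invr_ge0 ?(ltW lam0)// invf_le1.
rewrite mul1r lerXn2r ?nnegrE ?invr_ge0 ?(ltW lam0)//.
by rewrite lef_pV2 ?posrE.
Qed.

Lemma Phi_cvg x : `|x| <= 12^-1 -> Phin^~ x @ \oo --> Phi x.
Proof.
move=> hx; suff : cvgn (Phin^~ x) by [].
have S m : \sum_(k < m) `|Phin k.+1 x - Phin k x| <= x ^+ 2 * 2.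
  apply: (@le_trans _ _ (\sum_(k < m) x ^+ 2 * 9^-1 ^+ k)).
    by apply: ler_sum => k _; apply: Phin_step.
  rewrite -mulr_sumr ler_wpM2l ?sqr_ge0//.
  by apply: geom_le2; lra.
have /cvg_ex[l Hl] := abs_series_cvg (r := fun k => Phin k.+1 x - Phin k x) S; apply: (cvgP (Phin 0 x + l)).
have -> : Phin^~ x = (fun m => Phin 0 x + \sum_(k < m) (Phin k.+1 x - Phin k x)).
  apply/funext => m; elim: m => [|m IH]; first by rewrite big_ord0 addr0.
  by rewrite big_ord_recr /= addrA -IH addrC subrK.
by apply: cvgD => //; exact: cvg_cst.
Qed.

Lemma lim_le_dist (a : nat -> R) l c B : a @ \oo --> l -> (forall m, `|a m - c| <= B) -> `|l - c| <= B.
Proof.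
move=> al H; rewrite -(cvg_lim _ (_ : (fun m => `|a m - c|) @ \oo --> `|l - c|))//; last first.
  by apply: cvg_norm; apply: cvgB => //; exact: cvg_cst.
apply: limr_le; last by apply: nearW => m; exact: H.
by apply: (cvgP `|l - c|); apply: cvg_norm; apply: cvgB => //; exact: cvg_cst.
Qed.

Lemma Phi_quad x : `|x| <= 12^-1 -> `|Phi x - (1 - x / 2)| <= 2 * x ^+ 2.
Proof.
move=> hx; apply: lim_le_dist (Phi_cvg hx) _ => m.
have -> : 1 - x / 2 = Phin 0 x by rewrite /Phin expr0 invr1 mulr1.
have -> : Phin m x - Phin 0 x = \sum_(k < m) (Phin k.+1 x - Phin k x).
  elim: m => [|m IH]; first by rewrite big_ord0 subrr.
  by rewrite big_ord_recr /= -IH addrC subrKA.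
apply: le_trans (ler_norm_sum _ _ _) _.
apply: (@le_trans _ _ (\sum_(k < m) x ^+ 2 * 9^-1 ^+ k)).
  by apply: ler_sum => k _; apply: Phin_step.
rewrite -mulr_sumr mulrC ler_wpM2r ?sqr_ge0//.
by apply: geom_le2; lra.
Qed.

Lemma Phi_close x : `|x| <= 12^-1 -> `|1 - Phi x| <= `|x|.
Proof.
move=> hx; have h := Phi_quad hx.
have -> : 1 - Phi x = x / 2 - (Phi x - (1 - x / 2)) by field.
apply: le_trans (ler_normB _ _) _; rewrite normrM (gtr0_norm (_ : 0 < 2^-1)) ?invr_gt0//.
have : x ^+ 2 <= `|x| / 12.
  by rewrite -real_normK ?num_real// expr2 ler_wpM2l.
by move: h (normr_ge0 x); move: (x ^+ 2) (`|_ - _|) => a b; lra.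
Qed.

Lemma Phi_scale x : `|x| <= 12^-1 -> W (Phi (x / lam)) = Phi x.
Proof.
move=> hx; have hx' : `|x / lam| <= 12^-1.
  by apply: le_trans hx; rewrite normrM normfV (gtr0_norm lam0) ler_pdivrMr// ler_peMr.
have h1 : (fun m => W (Phin m (x / lam))) @ \oo --> W (Phi (x / lam)).
  by apply: continuous_cvg; [exact: W_continuous|exact: Phi_cvg].
have h2 : (fun m => W (Phin m (x / lam))) @ \oo --> Phi x.
  have -> : (fun m => W (Phin m (x / lam))) = (fun m => Phin m.+1 x).
    apply/funext => m; rewrite /Phin /= exprS invfM; congr (W (Wn m (1 - _))); ring.
  by rewrite (cvg_shiftS (Phin^~ x)); exact: Phi_cvg.
by rewrite -(cvg_lim _ h1)// (cvg_lim _ h2).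
Qed.

Lemma lam_pow_big (B : R) : exists n0, forall n, (n0 <= n)%N -> B < lam ^+ n.
Proof.
exists (Num.truncn `|B|).+1 => n hn.
apply: le_lt_trans (ler_norm B) _; apply: lt_le_trans (Num.Theory.truncnS_gt _) _.
apply: (@le_trans _ _ (n%:R)); first by rewrite ler_nat.
have := ltn_expl n (isT : (1 < 2)%N); rewrite -(ltr_nat R) natrX => /ltW h; apply: le_trans h _.
by rewrite lerXn2r ?nnegrE ?(ltW lam0)//; have := l9; lra.
Qed.

Lemma scale_ev x (e : R) : 0 < e -> exists n0, forall n, (n0 <= n)%N -> `|x / lam ^+ n| <= e.
Proof.
move=> e0; have [n0 H] := lam_pow_big (`|x| / e); exists n0 => n /H h.
rewrite normrM normfV (gtr0_norm (exprn_gt0 n lam0)) ler_pdivrMr ?exprn_gt0//.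
by rewrite mulrC -ler_pdivrMr// ltW.
Qed.

Lemma Phi_lim x : (fun n => 2 * lam ^+ n * (1 - Phi (x / lam ^+ n))) @ \oo --> x.
Proof.
apply/cvgrPdist_le => e e0.
have i12 : (0 : R) < 12^-1 by rewrite invr_gt0.
have [n0 H0] := scale_ev x i12.
have [n1 H1] := lam_pow_big (4 * x ^+ 2 / e).
exists (maxn n0 n1) => // n /=; rewrite geq_max => /andP[/H0 h0 /H1 h1].
have L := exprn_gt0 n lam0; have := Phi_quad h0.
set y := x / lam ^+ n; have xE : x = lam ^+ n * y by rewrite /y mulrCA mulfV ?mulr1// gt_eqF.
move=> h; have -> : x - 2 * lam ^+ n * (1 - Phi y) = 2 * lam ^+ n * (Phi y - (1 - y / 2)).
  by rewrite {1}xE; field.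
rewrite normrM gtr0_norm ?mulr_gt0//.
apply: (@le_trans _ _ (2 * lam ^+ n * (2 * y ^+ 2))).
  by rewrite ler_wpM2l// mulr_ge0 ?ltW.
have -> : 2 * lam ^+ n * (2 * y ^+ 2) = 4 * x ^+ 2 / lam ^+ n.
  by rewrite /y; field; rewrite gt_eqF.
by rewrite ler_pdivrMr// [e * _]mulrC -ler_pdivrMr// ltW.
Qed.

Lemma Phi_neg x : - 12^-1 <= x < 0 -> 1 < Phi x.
Proof.
move=> hx; have h : `|x| <= 12^-1 by rewrite ler_norml; lra.
have := Phi_quad h; rewrite ler_norml => /andP[]; nra.
Qed.

Lemma Phi_le1 x : 0 <= x <= 12^-1 -> Phi x <= 1.
Proof.
move=> hx; have h : `|x| <= 12^-1 by rewrite ler_norml; lra.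
have := Phi_quad h; rewrite ler_norml => /andP[]; nra.
Qed.

Lemma scaleS x n : x / lam ^+ n.+1 = x / lam ^+ n / lam.
Proof. by rewrite exprSr invfM mulrA. Qed.

(** Both sides are orbits of the branch of the inverse of W that fixes 1.  Orbits
    approach 1 at the rate lam^-n and W expands distances by about lam there, so
    that two orbits coincide as soon as their rescaled limits do. *)
Lemma nu_eq x : exists n0, forall n, (n0 <= n)%N -> forall k,
  nu p q k = x <-> ((k < nv n)%N /\ sn p q n k = Phi (x / lam ^+ n)).
Proof.
have [M2 M1 _ _] := M_facts hp hq.
have d0 : 0 < Num.min 24^-1 (1 - M) by rewrite lt_min subr_gt0 M1 invr_gt0 ltr0n.
have [n0 H0] := scale_ev x d0; have [n1 H1] := lam_pow_big x.
exists (maxn n0 n1) => n; rewrite geq_max => /andP[hn0 hn1] k.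
have small j : `|x / lam ^+ (n + j)| <= Num.min 24^-1 (1 - M).
  by apply: H0; rewrite (leq_trans hn0)// leq_addr.
have small12 j : `|x / lam ^+ (n + j)| <= 12^-1.
  by apply: le_trans (small j) _; rewrite ge_min; apply/orP; left; lra.
have L m : 0 < lam ^+ m by rewrite exprn_gt0.
have nv_add j : (k < nv n)%N -> (k < nv (n + j))%N.
  by move=> h; apply: leq_trans h _; apply: nv_mono; rewrite leq_addr.
split=> [nux|[kn sx]].
  have kn : (k < nv n)%N.
    rewrite ltnNge; apply/negP => /(nu_shell hp hq); rewrite nux leNgt.
    by rewrite H1// (leq_trans hn1).
  split=> //; pose y := x / lam ^+ n; pose u j := 1 - sn p q (n + j) k.
  have uN j : 2 * lam ^+ (n + j) * u j = nuN p q (n + j) k by [].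
  have back_iter j : Wn j (sn p q (n + j) k) = sn p q n k.
    elim: j => [|j IH]; first by rewrite addn0.
    rewrite addnS snS ?nv_add// /Wn iterSr.
    by have [_ ->] := gmapP hp hq (sn_range hp hq (nv_add j kn)).
  have u0 j : 0 <= u j by have := sn_range hp hq (nv_add j kn); rewrite /u; lra.
  have yE j : y / 2 * lam ^- j = x / 2 / lam ^+ (n + j).
    by rewrite /y exprD; field; rewrite !gt_eqF.
  have uy j : u j <= y / 2 * lam ^- j.
    rewrite yE ler_pdivlMr// ler_pdivlMr// -[leRHS]nux.
    apply: le_trans (nuN_le hp hq (nv_add j kn)).
    by rewrite -uN le_eqVlt; apply/orP; left; apply/eqP; ring.
  have ysm : `|y| <= 6^-1.
    have := small 0; rewrite addn0 le_min => /andP[h _]; apply: le_trans h _; lra.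
  have usm j : `|u j| <= lam ^- j / 12.
    by rewrite ger0_norm//; apply: le_trans (uy j) _; apply: le_trans (ler_norm _) _; apply: small_scale.
  have h1 : Phin^~ y @ \oo --> Phi y.
    by apply: Phi_cvg; have := small12 0; rewrite addn0.
  have h2 : Phin^~ y @ \oo --> sn p q n k.
    apply/cvgrPdist_le => e e0.
    have /cvgrPdist_le/(_ (lam ^+ n * e)) := @nuN_cvg_shift _ _ _ hp hq k n.
    rewrite mulr_gt0// => /(_ isT)[N _ HN]; exists N => // j /HN /=; rewrite addnC nux => hj.
    have [_ _] := Wn_lip (usm j) (small_scale j ysm) (leqnn j).
    rewrite {1}/u subKr back_iter mulfV ?gt_eqF// => h; apply: le_trans h _.
    have -> : lam ^+ j * `|u j - y / 2 * lam ^- j| * (1 + 1) = lam ^- n * `|x - nuN p q (n + j) k|.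
      rewrite distrC yE -uN.
      have -> : x / 2 / lam ^+ (n + j) - u j = (x - 2 * lam ^+ (n + j) * u j) * (2^-1 / lam ^+ (n + j)).
        by field; rewrite gt_eqF.
      have pos : 0 < 2^-1 / lam ^+ (n + j) by rewrite divr_gt0// invr_gt0.
      by rewrite normrM (gtr0_norm pos) exprD; field; rewrite !gt_eqF.
    by rewrite mulrC ler_pdivrMr// mulrC.
  by rewrite -(cvg_lim _ h1)// (cvg_lim _ h2).
have x0 : 0 <= x.
  rewrite leNgt; apply/negP => xn.
  have := small12 0; rewrite addn0 ler_norml => /andP[h _].
  have := @Phi_neg (x / lam ^+ n); rewrite h /= pmulr_llt0 ?invr_gt0// => /(_ xn).
  by rewrite -sx ltNge; have := sn_range hp hq kn => /andP[_ ->].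
have snj j : sn p q (n + j) k = Phi (x / lam ^+ (n + j)).
  elim: j => [|j IH]; first by rewrite addn0.
  rewrite addnS snS ?nv_add// IH -Phi_scale// -scaleS -addnS gmapK//.
  have x0' : 0 <= x / lam ^+ (n + j.+1) by rewrite divr_ge0 ?(ltW (L _)).
  have := Phi_close (small12 j.+1); have := small j.+1; have := small12 j.+1.
  rewrite le_min !(ger0_norm x0') => h12 /andP[_ h3]; rewrite ler_norml => /andP[_ h4].
  apply/andP; split; first lra.
  by apply: Phi_le1; rewrite x0'.
have h1 := @nuN_cvg_shift _ _ _ hp hq k n.
have h2 : (fun j => nuN p q (j + n) k) @ \oo --> x.
  suff -> : (fun j => nuN p q (j + n) k) =
      (fun j => 2 * lam ^+ (j + n) * (1 - Phi (x / lam ^+ (j + n)))).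
    by rewrite (cvg_shiftn n (fun m => 2 * lam ^+ m * (1 - Phi (x / lam ^+ m)))); exact: Phi_lim.
  by apply/funext => j /=; rewrite /nuN addnC snj.
by rewrite -(cvg_lim _ h1)// (cvg_lim _ h2).
Qed.

End Poincare.

(** * Eigenfunctions of the Laplacian *)

Section Cells.
Variable R : realType.
Variables p q : R.
Hypothesis hp : 0 < p < 1.
Hypothesis hq : q = 1 - p.
Let lam := lambda p q.
Local Notation back := (back p q).

Definition cell0 n (i : 'I_(nv n)) : 'I_(nv n.+1) := cell_ord i (isT : 0 < 3)%N.
Definition cell1 n (i : 'I_(nv n)) : 'I_(nv n.+1) := cell_ord i (isT : 1 < 3)%N.
Definition cell2 n (i : 'I_(nv n)) : 'I_(nv n.+1) := cell_ord i (isT : 2 < 3)%N.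

Lemma cellP n (k : 'I_(nv n.+1)) : exists i : 'I_(nv n), [\/ k = cell0 i, k = cell1 i | k = cell2 i].
Proof.
have kn : (k %/ 3 < nv n)%N by rewrite ltn_divLR// mulnC -nvS.
exists (Ordinal kn); have E := divn_eq k 3; have r3 := ltn_pmod k (isT : 0 < 3)%N.
case: (k %% 3)%N E r3 => [|[|[|//]]] E _;
  [constructor 1|constructor 2|constructor 3]; apply: val_inj; by rewrite /= [LHS]E mulnC.
Qed.

Lemma cell_nbrs n (i : 'I_(nv n)) :
  [/\ ord_pred (cell0 i) = cell2 (ord_pred i), ordS (cell0 i) = cell1 i,
      ord_pred (cell1 i) = cell0 i & ordS (cell1 i) = cell2 i] /\
  ord_pred (cell2 i) = cell1 i /\ ordS (cell2 i) = cell0 (ordS i).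
Proof.
have iN := ltn_ord i.
have S r : (r < 2)%N -> (if (3 * i + r).+1 == nv n.+1 then 0 else (3 * i + r).+1)%N = (3 * i + r.+1)%N.
  by move=> r2; case: eqP; rewrite nvS; move: iN r2; clear; lia.
split; first split; last split; apply: ord_inj.
- have -> : nat_of_ord (cell2 (ord_pred i)) = (3 * nat_of_ord (ord_pred i) + 2)%N by [].
  rewrite !val_ord_pred /prevn (_ : nat_of_ord (cell0 i) = 3 * i + 0)%N// addn0 muln_eq0 /=; case: eqP => i0.
    by rewrite nvS; have := nv_gt n; clear; lia.
  have : (0 < i)%N by rewrite lt0n; apply/eqP.
  by case: (nat_of_ord i) => [//|m] _; clear; lia.
- by rewrite val_ordS; exact: (S 0%N).
- by rewrite val_ord_pred /prevn /=; case: eqP; clear; lia.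
- by rewrite val_ordS; exact: (S 1%N).
- by rewrite val_ord_pred /prevn /=; case: eqP; clear; lia.
rewrite val_ordS (_ : nat_of_ord (cell2 i) = 3 * i + 2)%N//.
have -> : nat_of_ord (cell0 (ordS i)) = (3 * nat_of_ord (ordS i) + 0)%N by [].
rewrite val_ordS.
have -> : ((3 * i + 2).+1 = 3 * i.+1)%N by clear; lia.
by rewrite nvS eqn_pmul2l// addn0; case: eqP.
Qed.

Lemma walk_cells n (u : 'I_(nv n.+1) -> R) i :
  [/\ walk p q u (cell0 i) = back n i * u (cell2 (ord_pred i)) + (1 - back n i) * u (cell1 i),
      walk p q u (cell1 i) = q * u (cell0 i) + p * u (cell2 i)
    & walk p q u (cell2 i) = p * u (cell1 i) + q * u (cell0 (ordS i))].
Proof.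
have [[e1 e2 e3 e4] [e5 e6]] := cell_nbrs i.
rewrite /walk e1 e2 e3 e4 e5 e6 !backS /=; split.
- by rewrite mulnC modnMDl divnMDl//= addn0.
- by rewrite mulnC modnMDl/= hq; congr (_ + _ * _); ring.
by rewrite mulnC modnMDl/= hq.
Qed.

(** Decimation with errors: eliminating the interior vertices of the cells turns
    the eigenvalue w into W w, and near w = 1 the error grows by a factor lam. *)
Lemma descend n (u : 'I_(nv n.+1) -> R) w E :
  (forall k, `|walk p q u k - w * u k| <= E) ->
  forall i, `|walk p q (fun k => u (cell0 k)) i - Wmap p q w * u (cell0 i)| <=
    E * (`|w ^+ 2 - p ^+ 2| + `|w| + p) / (p * q).
Proof.
move=> H i; have a0 := pq0 hp hq; have h1 := p0 hp.
have [c0 _ _] := walk_cells u i; have [_ c1 c2] := walk_cells u (ord_pred i).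
have [_ c3 c4] := walk_cells u i; rewrite ord_predK in c2.
have b01 := back_range hp hq n i.
have := H (cell0 i); have := H (cell1 (ord_pred i)); have := H (cell2 (ord_pred i)).
have := H (cell1 i); have := H (cell2 i).
rewrite c0 c1 c2 c3 c4 /walk.
set dr2 := _ - w * u (cell2 i); set dr1 := _ - w * u (cell1 i).
set dl2 := _ - w * u (cell2 (ord_pred i)); set dl1 := _ - w * u (cell1 (ord_pred i)).
set d0 := _ - w * u (cell0 i) => h5 h4 h3 h2 h0.
rewrite ler_pdivlMr//.
have -> : forall T, `|T| * (p * q) = `|T * (p * q)|.
  by move=> T; rewrite [RHS]normrM (gtr0_norm a0).
set b := back n i in b01 d0 h0 *.
have -> : (b * u (cell0 (ord_pred i)) + (1 - b) * u (cell0 (ordS i)) - Wmap p q w * u (cell0 i)) * (p * q) =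
   (w ^+ 2 - p ^+ 2) * d0 + (w * (b * dl2 + (1 - b) * dr1) + p * (b * dl1 + (1 - b) * dr2)).
  rewrite /d0 /dl1 /dl2 /dr1 /dr2 /Wmap hq; field; have := p1 hp; lra.
have conv x y : `|x| <= E -> `|y| <= E -> `|b * x + (1 - b) * y| <= E.
  move=> hx hy; apply: le_trans (ler_normD _ _) _; rewrite !normrM.
  rewrite (gtr0_norm (_ : 0 < b)); last by lra.
  rewrite (gtr0_norm (_ : 0 < 1 - b)); last by lra.
  by have := normr_ge0 x; have := normr_ge0 y; nra.
have m1 := conv _ _ h3 h4; have m2 := conv _ _ h2 h5.
apply: le_trans (ler_normD _ _) _.
apply: le_trans (lerD (lexx _) (ler_normD _ _)) _; rewrite !normrM (gtr0_norm h1).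
have := lerD (ler_wpM2l (normr_ge0 (w ^+ 2 - p ^+ 2)) h0)
  (lerD (ler_wpM2l (normr_ge0 w) m1) (ler_wpM2l (ltW h1) m2)).
by move=> B; apply: le_trans B _; rewrite le_eqVlt; apply/orP; left; apply/eqP; ring.
Qed.

(** The formulas solve the two eigenvalue equations inside each cell; the
    equations at its ends are those of the coarse level. *)
Lemma extend n (g : 'I_(nv n) -> R) (h : 'I_(nv n.+1) -> R) w : w ^+ 2 - p ^+ 2 != 0 ->
  (forall i, [/\ h (cell0 i) = g i,
     h (cell1 i) = (q * w * g i + p * q * g (ordS i)) / (w ^+ 2 - p ^+ 2) &
     h (cell2 i) = (p * q * g i + q * w * g (ordS i)) / (w ^+ 2 - p ^+ 2)]) ->
  (forall i, walk p q g i = Wmap p q w * g i) -> forall k, walk p q h k = w * h k.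
Proof.
move=> w0 H Hg k; have [i [->|->|->]] := cellP k; have [c0 c1 c2] := walk_cells h i.
- rewrite c0; have [-> -> _] := H i; have [_ _ ->] := H (ord_pred i); rewrite ord_predK.
  have := Hg i; rewrite /walk => e.
  apply: (mulIf w0).
  rewrite [LHS](_ : _ = q * w * g i + p * q * (back n i * g (ord_pred i) + (1 - back n i) * g (ordS i))).
    rewrite e /Wmap hq; field; have := p1 hp; have := p0 hp; lra.
  by field.
- by rewrite c1; have [-> -> ->] := H i; rewrite hq; field.
by rewrite c2; have [_ -> ->] := H i; have [-> _ _] := H (ordS i); rewrite hq; field.
Qed.

(** Two linear equations with the determinant w^2 - p^2. *)
Lemma interior_unique n (u : 'I_(nv n.+1) -> R) w : w ^+ 2 - p ^+ 2 != 0 ->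
  (forall k, walk p q u k = w * u k) -> forall i,
     u (cell1 i) = (q * w * u (cell0 i) + p * q * u (cell0 (ordS i))) / (w ^+ 2 - p ^+ 2) /\
     u (cell2 i) = (p * q * u (cell0 i) + q * w * u (cell0 (ordS i))) / (w ^+ 2 - p ^+ 2).
Proof.
move=> w0 H i; have [_ c1 c2] := walk_cells u i.
have e1 := H (cell1 i); have e2 := H (cell2 i); rewrite c1 in e1; rewrite c2 in e2.
split; apply: (mulIf w0); rewrite mulfVK//.
  have -> : u (cell1 i) * (w ^+ 2 - p ^+ 2) = w * (w * u (cell1 i)) - p * (p * u (cell1 i)) by ring.
  have -> : p * u (cell1 i) = w * u (cell2 i) - q * u (cell0 (ordS i)) by rewrite -e2; ring.
  rewrite -e1; ring.
have -> : u (cell2 i) * (w ^+ 2 - p ^+ 2) = w * (w * u (cell2 i)) - p * (p * u (cell2 i)) by ring.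
have -> : p * u (cell2 i) = w * u (cell1 i) - q * u (cell0 i) by rewrite -e1; ring.
rewrite -e2; ring.
Qed.

Definition rs n (f : bool -> R -> R) : 'I_(nv n) -> R := Defs.restrict p q (n := n) f.

Lemma rsE n f (i : 'I_(nv n)) : rs f i = f (3 ^ n < i)%N (Y p q n i).
Proof. by []. Qed.

Lemma Y_cell0 n i : (i < nv n)%N -> Y p q n.+1 (3 * i) = Y p q n i.
Proof.
move=> iN; have := Y_refine hp hq iN (isT : 0 <= 3)%N; rewrite addn0 => ->.
by case: ifP => _; rewrite /cut /= ?mul0r ?mul1r ?addr0// addrC subrK.
Qed.

Lemma rs_cell0 n f (i : 'I_(nv n)) : rs f (cell0 i) = rs f i.
Proof.
rewrite !rsE /= addn0 Y_cell0//; congr (f _ _).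
by rewrite expnS ltn_pmul2l.
Qed.

Let l9 : 9 <= lam. Proof. exact: lam9 hp hq. Qed.
Let lam0 : 0 < lam. Proof. by have := l9; lra. Qed.

(** Far down, at the level n + k, the equation L f = x f says that f is an
    approximate eigenvector with an error of o(lam^-(n + k)).  Going up k
    levels multiplies the error by about lam^k, so that it disappears as k
    grows. *)
Lemma eigenfunction_walk x f : eigenfunction p q x f ->
  forall n, `|x / lam ^+ n| <= 24^-1 ->
  forall i : 'I_(nv n), walk p q (rs f) i = Phi p q (x / lam ^+ n) * rs f i.
Proof.
move=> [_ _ Hlim] n; set y := x / lam ^+ n => yB i.
have a0 := pq0 hp hq; have le_pq := lam_pq hp hq; have h1 := p0 hp; have h2 := p1 hp.
have L m : 0 < lam ^+ m by rewrite exprn_gt0.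
have chain k E0 : 0 <= E0 ->
    (forall i : 'I_(nv (n + k)), `|walk p q (rs f) i - (1 - y / 2 * lam ^- k) * rs f i| <= E0) ->
    forall j m, (m + j)%N = (n + k)%N -> (j <= k)%N -> forall i : 'I_(nv m),
    `|walk p q (rs f) i - Wn p q j (1 - y / 2 * lam ^- k) * rs f i| <=
       E0 * (lam ^+ j * (1 + lam ^+ j * lam ^- k)).
  move=> E00 HE; elim=> [|j IH] m mE jk.
    rewrite addn0 in mE; rewrite mE => i'; apply: le_trans (HE i') _.
    by rewrite expr0 !mul1r ler_peMr// lerDl invr_ge0 ltW.
  move=> i'; have IHm := IH m.+1; rewrite addSnnS in IHm.
  have {IHm}IHm := IHm mE (ltnW jk).
  have ub : `|y / 2 * lam ^- k| <= lam ^- k / 12 by apply: small_scale => //; lra.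
  have [hw _ _] := Wn_lip hp hq ub ub (ltnW jk).
  have := descend IHm i'; set w := Wn p q j _ in hw *.
  have -> : walk p q (fun k => rs f (cell0 k)) i' = walk p q (rs f) i'.
    by rewrite /walk !rs_cell0.
  rewrite rs_cell0 => D; apply: le_trans D _; rewrite ler_pdivrMr//.
  have : lam * (lam ^+ j * lam ^- k) <= 1.
    rewrite mulrA -exprS -(subnK jk) exprD invfM mulrCA mulfV ?gt_eqF// mulr1.
    by rewrite invf_le1// exprn_ege1//; have := l9; lra.
  rewrite [lam ^+ j.+1]exprS; have L0 := L j; move: (lam ^+ j) L0 (lam ^+ k) (L k) hw => l l0 lk lk0 hw.
  set s := l / lk in hw *; have s0 : 0 < s by rewrite divr_gt0.
  have -> : lam * l / lk = lam * s by rewrite /s mulrA.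
  move=> ls1; have h9 : 9 * s <= lam * s by rewrite ler_wpM2r ?(ltW s0)//; exact: l9.
  clearbody s.
  have s9 : s <= 9^-1 by lra.
  have s2 : s * s <= 9^-1 * s by rewrite ler_wpM2r// ltW.
  have a6 : `|1 - w| <= s / 6.
    apply: le_trans hw _; have -> : s / 12 * (1 + s) = s / 12 + s * s / 12 by field.
    by move: s2 s0; move: (s * s) => c; lra.
  have K : `|w ^+ 2 - p ^+ 2| + `|w| + p <= lam * (p * q) * (1 + s).
    have e1 : `|w| <= 1 + s / 6.
      rewrite -[w](subKr 1); apply: le_trans (ler_normB _ _) _; rewrite normr1; lra.
    have e2 : `|w ^+ 2 - p ^+ 2| <= (1 - p ^+ 2) + s / 2.
      have -> : w ^+ 2 - p ^+ 2 = (1 - p ^+ 2) - (1 - w) * (2 - (1 - w)) by ring.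
      apply: le_trans (ler_normB _ _) _; rewrite ger0_norm; last by rewrite expr2; nra.
      rewrite lerD2l normrM; have e3 : `|2 - (1 - w)| <= 3.
        by apply: le_trans (ler_normB _ _) _; rewrite ger0_norm//; lra.
      by have := normr_ge0 (1 - w); have := normr_ge0 (2 - (1 - w)); nra.
    rewrite le_pq; have e4 : p - p ^+ 2 = p * q by rewrite hq expr2; ring.
    have e5 : 0 <= p * q * s by rewrite mulr_ge0 ?ltW.
    move: e1 e2 e4 e5; rewrite mulrDr mulr1 mulrDl.
    move: (p ^+ 2) (p * q) (`|w ^+ 2 - _|) (`|w|) => a b c d; lra.
  apply: (@le_trans _ _ (E0 * (l * (1 + s)) * (lam * (p * q) * (1 + s)))).
    by apply: ler_wpM2l => //; rewrite !mulr_ge0//; lra.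
  have -> : E0 * (l * (1 + s)) * (lam * (p * q) * (1 + s)) =
     E0 * l * lam * (p * q) * ((1 + s) * (1 + s)) by ring.
  have -> : E0 * (lam * l * (1 + lam * s)) * (p * q) = E0 * l * lam * (p * q) * (1 + lam * s) by ring.
  apply: ler_wpM2l; first by rewrite (mulr_ge0 _ (ltW a0))// (mulr_ge0 _ (ltW lam0))// (mulr_ge0 E00 (ltW l0)).
  have -> : (1 + s) * (1 + s) = 1 + 2 * s + s * s by ring.
  by move: h9 s2 s0; move: (lam * s) (s * s) => b c; lra.
apply/eqP; rewrite -subr_eq0; apply/eqP/normr0_eq0/eqP; rewrite eq_le normr_ge0 andbT.
apply/ler_addgt0Pl => e e0; rewrite addr0.
have [m0 _ Hm0] := Hlim e e0.
have y12 : `|y| <= 12^-1 by lra.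
have P : (fun k => Phin p q (k + m0) y * rs f i) @ \oo --> Phi p q y * rs f i.
  apply: cvgM; last exact: cvg_cst.
  by rewrite (cvg_shiftn m0 (fun k => Phin p q k y)); exact: Phi_cvg.
rewrite distrC; apply: lim_le_dist P _ => k; rewrite distrC.
have k0 : (m0 <= n + (k + m0))%N by rewrite addnA leq_addl.
have := chain (k + m0)%N (e / (2 * lam ^+ (n + (k + m0)))).
have den0 : 0 < 2 * lam ^+ (n + (k + m0)) by rewrite mulr_gt0.
move=> /(_ (ltW (divr_gt0 e0 den0))) C.
have /C/(_ (k + m0)%N n erefl (leqnn _) i) : forall i : 'I_(nv (n + (k + m0))),
   `|walk p q (rs f) i - (1 - y / 2 * lam ^- (k + m0)) * rs f i| <= e / (2 * lam ^+ (n + (k + m0))).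
  move=> i'; have := Hm0 _ k0 i'; rewrite laplacianE// -/lam -/(rs f) => /ltW h.
  rewrite ler_pdivlMr//.
  have -> : forall T, `|T| * (2 * lam ^+ (n + (k + m0))) = `|- (T * (2 * lam ^+ (n + (k + m0))))|.
    by move=> T; rewrite normrN [RHS]normrM (gtr0_norm den0).
  apply: le_trans h; rewrite le_eqVlt; apply/orP; left; apply/eqP; congr `|_|.
  have -> : Defs.restrict p q (n := n + (k + m0)) (fun b t => x * f b t) i' = x * rs f i' by [].
  by rewrite /y (exprD lam n); field; rewrite !gt_eqF.
move=> h; apply: le_trans h _.
rewrite mulfV ?gt_eqF// (exprD lam n).
have -> : e / (2 * (lam ^+ n * lam ^+ (k + m0))) * (lam ^+ (k + m0) * (1 + 1)) = e / lam ^+ n.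
  by field; rewrite !gt_eqF.
by rewrite ler_pdivrMr// ler_peMr ?(ltW e0)// exprn_ege1//; have := l9; lra.
Qed.

End Cells.

Section Extension.
Variable R : realType.
Variables p q : R.
Hypothesis hp : 0 < p < 1.
Hypothesis hq : q = 1 - p.
Let lam := lambda p q.
Local Notation Y := (Y p q).
Local Notation len := (len p q).

Let l9 : 9 <= lam. Proof. exact: lam9 hp hq. Qed.
Let lam0 : 0 < lam. Proof. by have := l9; lra. Qed.

(** The extension is the infimum of the cones g i + K |t - y i|. *)
Lemma mcshane (I : Type) (P : set I) (y g : I -> R) (K : R) i0 : P i0 -> 0 <= K ->
  (forall i j, P i -> P j -> `|g i - g j| <= K * `|y i - y j|) ->
  exists F : R -> R, (forall t s, `|F t - F s| <= K * `|t - s|) /\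
    forall i, P i -> F (y i) = g i.
Proof.
move=> P0 K0 H; pose S t := [set g i + K * `|t - y i| | i in P].
have lbS t : lbound (S t) (g i0 - K * `|t - y i0|).
  move=> _ [i Pi <-]; have := H i i0 Pi P0; rewrite ler_norml => /andP[h _].
  have : K * `|y i - y i0| <= K * (`|t - y i| + `|t - y i0|).
    apply: ler_wpM2l => //; rewrite (_ : y i - y i0 = - (t - y i) + (t - y i0)); last by ring.
    by apply: le_trans (ler_normD _ _) _; rewrite normrN.
  by rewrite mulrDr; lra.
have hS t : has_inf (S t).
  by split; [exists (g i0 + K * `|t - y i0|); exists i0|exists (g i0 - K * `|t - y i0|)].
have one t s : inf (S t) <= inf (S s) + K * `|t - s|.
  rewrite -lerBlDr; apply: lb_le_inf; first exact: (hS s).1.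
  move=> _ [i Pi <-]; rewrite lerBlDr.
  apply: le_trans (ge_inf (hS t).2 (_ : S t (g i + K * `|t - y i|))) _; first by exists i.
  rewrite -addrA lerD2l -mulrDr; apply: ler_wpM2l => //.
  by rewrite [leRHS]addrC (_ : t - y i = (t - s) + (s - y i)); [exact: ler_normD|ring].
exists (fun t => inf (S t)); split=> [t s|i Pi].
  by have := one t s; have := one s t; rewrite (distrC s t) ler_norml => h1 h2; apply/andP; split; lra.
apply/eqP; rewrite eq_le; apply/andP; split.
  apply: le_trans (ge_inf (hS _).2 (_ : S (y i) (g i + K * `|y i - y i|))) _; first by exists i.
  by rewrite subrr normr0 mulr0 addr0.
apply: lb_le_inf; first exact: (hS _).1.
move=> _ [j Pj <-]; have := H i j Pi Pj; rewrite ler_norml => /andP[_ h]; lra.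
Qed.

(** The cells shrink more slowly than the time scale lam^-n: this is what makes
    the extended eigenvectors Lipschitz. *)
Definition theta := (1 + p) / (2 + p * q).

Lemma theta_range : 0 < theta < 1.
Proof.
have h1 := p0 hp; have h2 := p1 hp; have a0 := pq0 hp hq.
by rewrite /theta divr_gt0 ?ltr_pdivrMr//=; lra.
Qed.

Lemma scale_len m i : lam ^- m <= theta ^+ m * len m i.
Proof.
have h1 := p0 hp; have h2 := p1 hp; have h3 := q0 hp hq; have a0 := pq0 hp hq.
elim: m i => [|m IH] i; first by rewrite !expr0 invr1 mul1r.
set r := (if (i %% 3 == 1)%N then q else p) / (1 + p).
have -> : len m.+1 i = r * len m (i %/ 3)%N by [].
have r0 : 0 < r by rewrite divr_gt0//; [case: ifP|lra].
have hr : lam^-1 <= theta * r.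
  have -> : lam^-1 = (p * q) / (2 + p * q).
    by apply: (mulfI (lt0r_neq0 lam0)); rewrite mulfV ?gt_eqF// mulrA /lam lam_pq// mulfV// gt_eqF//; lra.
  have -> : theta * r = (if (i %% 3 == 1)%N then q else p) / (2 + p * q).
    by rewrite /theta /r; field; rewrite !gt_eqF//; lra.
  rewrite ler_pM2r ?invr_gt0; last lra.
  by case: ifP => _; rewrite ?[p * q]mulrC ?ler_piMr ?ler_piMl// ?(ltW h3) ?(ltW h1)//; rewrite ?hq; lra.
have -> : theta ^+ m.+1 * (r * len m (i %/ 3)) = (theta * r) * (theta ^+ m * len m (i %/ 3)).
  by rewrite exprS; ring.
rewrite exprS invfM; apply: ler_pM => //; rewrite ?invr_ge0 ?exprn_ge0 ?(ltW lam0)//.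
Qed.

Lemma len_small m i : len m i <= (1 + p)^-1 ^+ m.
Proof.
have h1 := p0 hp; have h2 := p1 hp; have h3 := q0 hp hq.
elim: m i => [//|m IH] i; rewrite exprS; apply: ler_pM => //.
- by rewrite divr_ge0//; [case: ifP => _; apply: ltW|lra].
- exact: ltW (len_gt0 hp hq _ _).
by rewrite ler_piMl ?invr_ge0//; [lra|case: ifP => _; rewrite ?hq; lra].
Qed.

Variables (x : R) (n : nat) (v : nat -> R).
Let w j := Phi p q (x / lam ^+ (j + n)).
Hypothesis small : `|x / lam ^+ n| <= Num.min 24^-1 (q / 2).
Hypothesis v_cycle : v (nv n) = v 0%N.
Hypothesis v_eigen : forall i : 'I_(nv n), walk p q v i = w 0 * v i.

(** Extension of the vector v of level n to the level j + n, indexed along the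
    cycle; the index nv (j + n) stands for the starting point. *)
Fixpoint G (j i : nat) : R := if j is j'.+1 then
  let a := G j' (i %/ 3)%N in let b := G j' (i %/ 3).+1 in
  (if i %% 3 == 0 then a
   else if i %% 3 == 1 then (q * w j * a + p * q * b) / (w j ^+ 2 - p ^+ 2)
   else (p * q * a + q * w j * b) / (w j ^+ 2 - p ^+ 2))%N
  else v i.

Lemma G_cell j i : [/\ G j.+1 (3 * i) = G j i,
  G j.+1 (3 * i + 1) = (q * w j.+1 * G j i + p * q * G j i.+1) / (w j.+1 ^+ 2 - p ^+ 2)
  & G j.+1 (3 * i + 2) = (p * q * G j i + q * w j.+1 * G j i.+1) / (w j.+1 ^+ 2 - p ^+ 2)].
Proof.
by split=> /=; rewrite mulnC ?modnMl ?mulnK//= modnMDl divnMDl//= addn0.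
Qed.

Lemma G_cycle j : G j (nv (j + n)) = G j 0.
Proof.
elim: j => [|j IH]; first exact: v_cycle.
rewrite addSn nvS; have [-> _ _] := G_cell j (nv (j + n)).
by have [-> _ _] := G_cell j 0; rewrite IH.
Qed.

Lemma G_ordS j (i : 'I_(nv (j + n))) : G j (ordS i) = G j i.+1.
Proof. by rewrite val_ordS; case: eqP => // ->; rewrite G_cycle. Qed.

Let scaled j : `|x / lam ^+ (j + n)| <= `|x / lam ^+ n| * lam ^- j.
Proof.
rewrite addnC exprD invfM mulrA [leLHS]normrM [`|lam ^- j|]ger0_norm//.
by rewrite invr_ge0 exprn_ge0// ltW.
Qed.

Let scaled1 j : `|x / lam ^+ (j + n)| <= `|x / lam ^+ n|.
Proof.
apply: le_trans (scaled j) _; rewrite ler_piMr// invf_le1 ?exprn_gt0//.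
by rewrite exprn_ege1//; have := l9; lra.
Qed.

Lemma w_close j : `|1 - w j| <= `|x / lam ^+ (j + n)|.
Proof.
apply: Phi_close => //; apply: le_trans (scaled1 j) _.
by move: small; rewrite le_min => /andP[]; lra.
Qed.

Lemma w_closeq j : `|1 - w j| <= q / 2.
Proof.
apply: le_trans (w_close j) _; apply: le_trans (scaled1 j) _.
by move: small; rewrite le_min => /andP[].
Qed.

Lemma w_scale j : Wmap p q (w j.+1) = w j.
Proof.
rewrite /w addSn scaleS Phi_scale//; apply: le_trans (scaled1 j) _.
by move: small; rewrite le_min => /andP[]; lra.
Qed.

Lemma w_pos j : [/\ 0 < w j - p, 0 < w j & 0 < w j ^+ 2 - p ^+ 2].
Proof.
have h1 := p0 hp; have h3 := q0 hp hq.
have := w_closeq j; rewrite ler_norml => /andP[_ h].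
have e : 0 < w j - p by move: h h3; rewrite hq; lra.
have e1 : 0 < w j by lra.
by split=> //; rewrite subr_sqr mulr_gt0// addr_gt0.
Qed.

Lemma G_eigen j (i : 'I_(nv (j + n))) : walk p q (G j) i = w j * G j i.
Proof.
elim: j i => [|j IH] i; first exact: v_eigen.
have [_ _ w0] := w_pos j.+1.
move: i; rewrite addSn => i.
apply: (@extend _ _ _ hp hq (j + n) (G j)) => //; first by rewrite gt_eqF.
  move=> k; have [e0 e1 e2] := G_cell j k.
  by split; rewrite ?G_ordS; [exact: etrans (congr1 (G j.+1) (addn0 _)) e0|exact: e1|exact: e2].
by move=> k; rewrite w_scale IH.
Qed.

Let u j := `|1 - w j.+1|.

Let u_ge0 j : 0 <= u j. Proof. exact: normr_ge0. Qed.

(** At w = 1 the three coefficients are exactly 1; w is at a distance of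
    order lam^-j from 1, which makes the errors summable over the levels. *)
Lemma G_factors j : [/\ q / (w j - p) <= 1 + 2 / q * `|1 - w j|,
  q * (1 + p) / (w j ^+ 2 - p ^+ 2) <= 1 + 6 / q * `|1 - w j|
  & (1 + p) / (w j + p) <= 1 + 6 / q * `|1 - w j|].
Proof.
have h1 := p0 hp; have h2 := p1 hp; have h3 := q0 hp hq.
have q1 : q < 1 by rewrite hq; lra.
have := w_closeq j; have [b1 b2 b3] := w_pos j.
set d := `|1 - w j|; have : 1 - w j <= d by exact: ler_norm.
have d0 : 0 <= d by exact: normr_ge0. clearbody d; move: (w j) b1 b2 b3 => W b1 b2 b3 hW dq.
have r1 : q / (W - p) <= 1 + 2 / q * d.
  rewrite ler_pdivrMr//; apply: (@le_trans _ _ ((1 + 2 / q * d) * (q - d))).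
    have -> : (1 + 2 / q * d) * (q - d) = q + d * (q - 2 * d) / q by field; rewrite gt_eqF.
    by rewrite lerDl divr_ge0 ?mulr_ge0 ?(ltW h3)//; lra.
  apply: ler_wpM2l; last by move: hW; rewrite hq; lra.
  by rewrite addr_ge0 ?mulr_ge0 ?invr_ge0 ?(ltW h3).
have r3' : (1 + p) / (W + p) <= 1 + 2 * d.
  rewrite ler_pdivrMr; last by lra.
  apply: (@le_trans _ _ ((1 + 2 * d) * (1 + p - d))); last by apply: ler_wpM2l; lra.
  have : 0 <= d * (1 - 2 * d) by rewrite mulr_ge0//; lra.
  have : 0 <= d * p by rewrite mulr_ge0// ltW.
  by nra.
have dq0 : d <= d / q by rewrite ler_pdivlMr// ler_piMr//; lra.
have ddq : d * (d / q) <= d / q / 2.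
  by rewrite mulrC ler_wpM2l ?divr_ge0 ?(ltW h3)//; lra.
have -> : 2 / q * d = 2 * (d / q) by ring.
have -> : 6 / q * d = 6 * (d / q) by ring.
have dd0 : 0 <= d / q by rewrite divr_ge0// ltW.
split; first by move: r1; rewrite (_ : 2 / q * d = 2 * (d / q)); [|ring].
  have -> : q * (1 + p) / (W ^+ 2 - p ^+ 2) = (q / (W - p)) * ((1 + p) / (W + p)).
    by rewrite subr_sqr; field; rewrite !gt_eqF//; lra.
  have n1 : 0 <= q / (W - p) by rewrite divr_ge0// ltW.
  have n2 : 0 <= (1 + p) / (W + p) by rewrite divr_ge0; lra.
  apply: le_trans (ler_pM n1 n2 r1 r3') _.
  rewrite (_ : 2 / q * d = 2 * (d / q)); last ring.
  have -> : (1 + 2 * (d / q)) * (1 + 2 * d) = 1 + 2 * (d / q) + 2 * d + 4 * (d * (d / q)) by ring.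
  by move: ddq dq0 dd0; move: (d * (d / q)) (d / q) => a b; lra.
by apply: le_trans r3' _; lra.
Qed.

Let u_lam j : u j <= lam^-1 ^+ j.
Proof.
apply: le_trans (w_close j.+1) _; apply: le_trans (scaled j.+1) _.
have L0 : 0 <= lam^-1 by rewrite invr_ge0 ltW.
have xs : `|x / lam ^+ n| <= 1 by move: small; rewrite le_min => /andP[]; lra.
rewrite -(exprVn lam j.+1); apply: le_trans (ler_piMl (exprn_ge0 _ L0) xs) _.
rewrite exprS ler_piMl ?exprn_ge0// invf_le1//; have := l9; lra.
Qed.

Lemma lam_theta m : lam^-1 ^+ m <= theta ^+ m.
Proof.
have h1 := p0 hp; rewrite exprVn; apply: le_trans (scale_len m 0) _.
have [t0 _] := andP theta_range; rewrite ler_piMr ?exprn_ge0 ?(ltW t0)//.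
apply: le_trans (len_small m 0) _; apply: exprn_ile1; rewrite ?invr_ge0 ?invf_le1; lra.
Qed.

Let u_len j k : u j <= `|x| * theta ^+ j * len (j + n) k.
Proof.
have [t0 t1] := andP theta_range; have xx := normr_ge0 x.
apply: le_trans (w_close j.+1) _; rewrite addSn normrM normfV (gtr0_norm (exprn_gt0 _ lam0)) -mulrA.
apply: ler_wpM2l => //; apply: (@le_trans _ _ (lam ^- (j + n))).
  rewrite exprS invfM ler_piMl// ?invr_ge0 ?exprn_ge0 ?(ltW lam0)// invf_le1//.
  by have := l9; lra.
apply: le_trans (scale_len _ k) _.
rewrite ler_wpM2r ?(ltW (len_gt0 hp hq _ _))// exprD ler_piMr ?exprn_ge0 ?(ltW t0)//.
by rewrite exprn_ile1 ?(ltW t0) ?(ltW t1).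
Qed.

(** Each level multiplies the supremum by at most 1 + O(lam^-j). *)
Lemma G_bound : exists A : R, 0 <= A /\ forall j i, (i <= nv (j + n))%N -> `|G j i| <= A.
Proof.
have h1 := p0 hp; have h2 := p1 hp; have h3 := q0 hp hq; have a0 := pq0 hp hq.
pose A0 := \sum_(i < (nv n).+1) `|v i|.
have A00 : 0 <= A0 by apply: sumr_ge0.
pose S j := A0 * \prod_(k < j) (1 + 2 / q * u k).
have c0 : 0 <= 2 / q by rewrite divr_ge0 ?(ltW h3).
have S0 j : 0 <= S j.
  by rewrite mulr_ge0// prodr_ge0// => k _; rewrite addr_ge0// mulr_ge0// u_ge0.
have bnd j i : (i <= nv (j + n))%N -> `|G j i| <= S j.
  elim: j i => [|j IH] i hi.
    rewrite /S big_ord0 mulr1 /A0 (bigD1 (Ordinal (hi : (i < (nv n).+1)%N)))//= lerDl.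
    exact: sumr_ge0.
  have SS : S j.+1 = S j * (1 + 2 / q * u j) by rewrite /S big_ord_recr /= mulrA.
  have up : S j <= S j.+1 by rewrite SS ler_peMr// lerDl mulr_ge0// u_ge0.
  have [k [r [kn r3 iE]]] : exists k r, [/\ (k <= nv (j + n))%N, (r < 3)%N & i = (3 * k + r)%N].
    exists (i %/ 3)%N, (i %% 3)%N; rewrite ltn_pmod// mulnC -divn_eq; split=> //.
    by rewrite -(mulnK (nv (j + n)) (isT : 0 < 3)%N) leq_div2r// mulnC -nvS.
  have r0k : (r != 0)%N -> (k < nv (j + n))%N.
    by move=> rn; move: hi; rewrite addSn nvS iE; move: rn; clear; lia.
  have [e0 e1 e2] := G_cell j k; have [W1 W2 W3] := w_pos j.+1.
  have mix a b : `|a| <= S j -> `|b| <= S j ->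
     `|(q * w j.+1 * a + p * q * b) / (w j.+1 ^+ 2 - p ^+ 2)| <= S j.+1 /\
     `|(p * q * a + q * w j.+1 * b) / (w j.+1 ^+ 2 - p ^+ 2)| <= S j.+1.
    move=> ha hb; have [F1 _ _] := G_factors j.+1.
    have E : S j.+1 >= (q * w j.+1 + p * q) * S j / (w j.+1 ^+ 2 - p ^+ 2).
      rewrite SS [leRHS]mulrC; have -> : (q * w j.+1 + p * q) * S j / (w j.+1 ^+ 2 - p ^+ 2) =
        q / (w j.+1 - p) * S j by rewrite subr_sqr; field; rewrite !gt_eqF//; lra.
      exact: ler_wpM2r.
    have qw : 0 < q * w j.+1 by rewrite mulr_gt0.
    rewrite !normrM !normfV (gtr0_norm W3); split; apply: le_trans E;
      rewrite ler_pM2r ?invr_gt0//; apply: le_trans (ler_normD _ _) _;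
      rewrite ![`|_ * a|]normrM ![`|_ * b|]normrM (gtr0_norm qw) (gtr0_norm a0);
      by move: (ler_wpM2l (ltW qw) ha) (ler_wpM2l (ltW qw) hb) (ler_wpM2l (ltW a0) ha)
        (ler_wpM2l (ltW a0) hb); rewrite mulrDl; lra.
  rewrite iE; case: r r3 iE r0k => [|[|[|//]]] _ _ r0k.
  - by rewrite addn0 e0; apply: le_trans (IH _ kn) up.
  - by rewrite e1; apply: (mix _ _ _ _).1; apply: IH => //; exact: r0k.
  by rewrite e2; apply: (mix _ _ _ _).2; apply: IH => //; exact: r0k.
exists (S 0%N * expR (2 / q / (1 - lam^-1))); split; first by rewrite mulr_ge0// expR_ge0.
move=> j i /bnd h; apply: le_trans h _.
apply: (bounded_product S0 c0).
  by rewrite invr_ge0 (ltW lam0) invf_lt1//; have := l9; lra.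
move=> m; rewrite /S big_ord_recr /= mulrA; apply: ler_wpM2l; first exact: S0.
by rewrite lerD2l ler_wpM2l.
Qed.

(** On the outer thirds of a cell the slope is changed by the factor 1 +
    O(lam^-j), plus a term of the size of (1 - w) times the value over the
    length of the cell; by scale_len this term is O(theta^j), hence
    summable. *)
Lemma G_slope : exists K : R, 0 <= K /\ forall j i, (i < nv (j + n))%N ->
  `|G j i.+1 - G j i| <= K * len (j + n) i.
Proof.
have h1 := p0 hp; have h2 := p1 hp; have h3 := q0 hp hq; have a0 := pq0 hp hq.
have [A [A0 HA]] := G_bound; have [t0 t1] := andP theta_range.
pose C := 6 / q + 2 * A * `|x| * (1 + p) / (p * q).
have C0 : 0 <= C.
  rewrite addr_ge0//; first by rewrite divr_ge0// ltW.
  by rewrite divr_ge0 ?(ltW a0)// !mulr_ge0//; lra.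
pose T0 := 1 + \sum_(i < nv n) `|v i.+1 - v i| / len n i.
pose T j := T0 * \prod_(k < j) (1 + C * theta ^+ k).
have f1 k : 1 <= 1 + C * theta ^+ k by rewrite lerDl mulr_ge0 ?exprn_ge0 ?(ltW t0).
have T01 : 1 <= T0.
  by rewrite lerDl sumr_ge0// => i _; rewrite divr_ge0// ltW// len_gt0.
have TS j : T j.+1 = T j * (1 + C * theta ^+ j) by rewrite /T big_ord_recr /= mulrA.
have T1 j : 1 <= T j.
  elim: j => [|j IH]; first by rewrite /T big_ord0 mulr1.
  by rewrite TS; apply: le_trans (IH) _; rewrite ler_peMr//; lra.
have bnd j i : (i < nv (j + n))%N -> `|G j i.+1 - G j i| <= T j * len (j + n) i.
  elim: j i => [|j IH] i hi.
    rewrite /T big_ord0 mulr1 -ler_pdivrMr ?len_gt0// /T0 (bigD1 (Ordinal hi))//=.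
    rewrite addrCA lerDl addr_ge0// sumr_ge0// => k _.
    by rewrite divr_ge0// ltW// len_gt0.
  have [k [r [kn r3 iE]]] : exists k r, [/\ (k < nv (j + n))%N, (r < 3)%N & i = (3 * k + r)%N].
    exists (i %/ 3)%N, (i %% 3)%N; rewrite ltn_pmod// mulnC -divn_eq; split=> //.
    by rewrite ltn_divLR// mulnC -nvS.
  have [e0 e1 e2] := G_cell j k; have [W1 W2 W3] := w_pos j.+1.
  have [e3 _ _] := G_cell j k.+1; have [F1 F2 F3] := G_factors j.+1.
  rewrite -/(u j) in F1 F2 F3.
  have := IH k kn; have := HA j k (ltnW kn); have := HA j k.+1 kn.
  have Lk := len_gt0 hp hq (j + n) k; have uL := u_len j k.
  have uT : u j <= theta ^+ j := le_trans (u_lam j) (lam_theta j).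
  have lE : len (j.+1 + n) i = (if (r == 1)%N then q else p) / (1 + p) * len (j + n) k.
    by rewrite iE mulnC addSn /= modnMDl divnMDl// (modn_small r3) (divn_small r3) addn0.
  rewrite {}lE {hi}iE TS.
  move: (G j k) (G j k.+1) e0 e1 e2 e3 => a b e0 e1 e2 e3 hb ha hD.
  have u0 : 0 <= u j by exact: normr_ge0.
  set D := b - a in hD; have Tj := T1 j.
  move: (len (j + n) k) Lk uL hD => l l0 uL hD; set W := w j.+1 in W1 W2 W3 e1 e2 F1 F2 F3.
  have th0 : 0 <= theta ^+ j by rewrite exprn_ge0// ltW.
  have six : 1 + 6 / q * u j <= 1 + C * theta ^+ j.
    rewrite lerD2l; apply: ler_pM => //; first by rewrite divr_ge0 ?(ltW h3).
    by rewrite lerDl !mulr_ge0 ?invr_ge0 ?(ltW a0)//; lra.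
  have pr : 0 < p / (1 + p) by rewrite divr_gt0//; lra.
  have qr : 0 < q / (1 + p) by rewrite divr_gt0//; lra.
  (* the two outer thirds of a cell *)
  have outer z : `|z| <= A ->
      `|(1 - W) / (W - p) * z + p * q / (W ^+ 2 - p ^+ 2) * D| <=
      T j * (1 + C * theta ^+ j) * (p / (1 + p) * l) /\
      `|p * q / (W ^+ 2 - p ^+ 2) * D - (1 - W) / (W - p) * z| <=
      T j * (1 + C * theta ^+ j) * (p / (1 + p) * l).
    move=> hz.
    have b1 : `|(1 - W) / (W - p) * z| <= 2 / q * u j * A.
      rewrite normrM; apply: ler_pM => //; rewrite normrM normfV (gtr0_norm W1) -/(u j) mulrC.
      apply: ler_wpM2r => //; rewrite ler_pdivlMr// mulrC ler_pdivrMr//.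
      have := w_closeq j.+1; rewrite ler_norml => /andP[_]; rewrite -/W; move: W1; rewrite hq; lra.
    have b2 : `|p * q / (W ^+ 2 - p ^+ 2) * D| <= p / (1 + p) * (1 + 6 / q * u j) * (T j * l).
      rewrite normrM; apply: ler_pM => //; rewrite gtr0_norm ?divr_gt0//.
      have -> : p * q / (W ^+ 2 - p ^+ 2) = p / (1 + p) * (q * (1 + p) / (W ^+ 2 - p ^+ 2)).
        by field; rewrite !gt_eqF//; lra.
      by rewrite ler_wpM2l// ltW.
    have main : 2 / q * u j * A + p / (1 + p) * (1 + 6 / q * u j) * (T j * l) <=
        T j * (1 + C * theta ^+ j) * (p / (1 + p) * l).
      have i1 : 2 / q * u j * A <= (2 * A * `|x| * (1 + p) / (p * q)) * theta ^+ j * (p / (1 + p) * l).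
        have -> : (2 * A * `|x| * (1 + p) / (p * q)) * theta ^+ j * (p / (1 + p) * l) =
           2 / q * (`|x| * theta ^+ j * l) * A by field; rewrite !gt_eqF//; lra.
        by rewrite ler_wpM2r// ler_wpM2l// divr_ge0 ?(ltW h3).
      have i2 : p / (1 + p) * (1 + 6 / q * u j) * (T j * l) <=
          T j * (1 + 6 / q * theta ^+ j) * (p / (1 + p) * l).
        have -> : p / (1 + p) * (1 + 6 / q * u j) * (T j * l) =
          T j * (1 + 6 / q * u j) * (p / (1 + p) * l) by ring.
        apply: ler_wpM2r; [exact: ltW (mulr_gt0 pr l0)|apply: ler_wpM2l; first lra].
        by rewrite lerD2l ler_wpM2l// divr_ge0 ?(ltW h3).
      have i3 : (2 * A * `|x| * (1 + p) / (p * q)) * theta ^+ j * (p / (1 + p) * l) <=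
         T j * ((2 * A * `|x| * (1 + p) / (p * q)) * theta ^+ j * (p / (1 + p) * l)).
        by rewrite ler_peMl// (mulr_ge0 _ (ltW (mulr_gt0 pr l0)))// mulr_ge0// divr_ge0 ?(ltW a0)// !mulr_ge0//; lra.
      have -> : T j * (1 + C * theta ^+ j) * (p / (1 + p) * l) =
        T j * ((2 * A * `|x| * (1 + p) / (p * q)) * theta ^+ j * (p / (1 + p) * l)) +
        T j * (1 + 6 / q * theta ^+ j) * (p / (1 + p) * l) by rewrite /C; ring.
      by apply: lerD i2; apply: le_trans i1 i3.
    by split; [apply: le_trans (ler_normD _ _) _|apply: le_trans (ler_normB _ _) _; rewrite addrC];
      apply: le_trans (lerD b1 b2) main.
  case: r r3 => [|[|[|//]]] _.
  - rewrite addn0 e0 -[(3 * k).+1]addn1 e1 /=.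
    have -> : (q * W * a + p * q * b) / (W ^+ 2 - p ^+ 2) - a =
       (1 - W) / (W - p) * a + p * q / (W ^+ 2 - p ^+ 2) * D.
      by rewrite /D subr_sqr hq; field; rewrite !gt_eqF//; lra.
    exact: (outer a ha).1.
  - rewrite -addnS e1 e2 /=.
    have -> : (p * q * a + q * W * b) / (W ^+ 2 - p ^+ 2) - (q * W * a + p * q * b) / (W ^+ 2 - p ^+ 2) =
       q / (1 + p) * ((1 + p) / (W + p)) * D.
      by rewrite /D subr_sqr; field; rewrite !gt_eqF//; lra.
    have Wp : 0 <= (1 + p) / (W + p) by rewrite divr_ge0; lra.
    rewrite normrM ger0_norm; last by rewrite mulr_ge0// ltW.
    have -> : T j * (1 + C * theta ^+ j) * (q / (1 + p) * l) =
      q / (1 + p) * (1 + C * theta ^+ j) * (T j * l) by ring.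
    apply: ler_pM => //; first by rewrite mulr_ge0// ltW.
    by rewrite ler_wpM2l ?(ltW qr)//; apply: le_trans F3 six.
  have -> : (3 * k + 2).+1 = (3 * k.+1)%N by clear; lia.
  rewrite e3 e2 /=.
  have -> : b - (p * q * a + q * W * b) / (W ^+ 2 - p ^+ 2) =
       p * q / (W ^+ 2 - p ^+ 2) * D - (1 - W) / (W - p) * b.
    by rewrite /D subr_sqr hq; field; rewrite !gt_eqF//; lra.
  exact: (outer b hb).2.
have T00 j : 0 <= T j by have := T1 j; lra.
exists (T 0%N * expR (C / (1 - theta))); split; first by rewrite mulr_ge0// expR_ge0.
move=> j i /bnd h; apply: le_trans h _; apply: ler_wpM2r; first by rewrite ltW// len_gt0.
by apply: (bounded_product T00 C0); [rewrite (ltW t0) t1|move=> m; rewrite TS].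
Qed.
End Extension.

Section Multiplicity.
Variable R : realType.
Variables p q : R.
Hypothesis hp : 0 < p < 1.
Hypothesis hq : q = 1 - p.
Let lam := lambda p q.
Local Notation Y := (Y p q).
Local Notation len := (len p q).

Let l9 : 9 <= lam. Proof. exact: lam9 hp hq. Qed.
Let lam0 : 0 < lam. Proof. by have := l9; lra. Qed.

Lemma Y_0 m : Y m 0 = 0.
Proof. by rewrite /Y /fold leq0n (X0 hp hq). Qed.

Lemma Y_one m : Y m (3 ^ m) = 1.
Proof.
elim: m => [|m IH]; first by [].
rewrite expnS Y_cell0//; rewrite /nv; have := expn_gt0 3 m; clear; lia.
Qed.

Lemma Y_end m : Y m (nv m) = 0.
Proof.
rewrite /Y /fold ifF ?subnn ?(X0 hp hq)//; rewrite /nv; have := expn_gt0 3 m; clear; lia.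
Qed.

Lemma Y_ge0 m k : (k <= 3 ^ m)%N -> 0 <= Y m k.
Proof.
elim: k => [|k IH] km; first by rewrite Y_0.
have kv : (k < nv m)%N by move: km; rewrite /nv; clear; lia.
have := Y_step hp hq kv; rewrite km mul1r => e.
by have := IH (ltnW km); have := len_gt0 hp hq m k; rewrite -e; lra.
Qed.

Lemma Y_lift k m i : (i <= nv m)%N -> Y (k + m) (3 ^ k * i) = Y m i.
Proof.
move=> im; elim: k => [|k IH]; first by rewrite mul1n.
have bnd : (3 ^ k * i <= nv (k + m))%N.
  by rewrite /nv expnD mulnCA leq_mul2l im orbT.
move: bnd; rewrite leq_eqVlt expnS -mulnA => /orP[/eqP e|lt].
  by rewrite e addSn -nvS Y_end -IH e Y_end.
by rewrite addSn Y_cell0.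
Qed.

(** The vertices of the fine levels are dense. *)
Lemma continuous_vanish (h : bool -> R -> R) n : continuous_on_double h ->
  (forall m, (n <= m)%N -> forall i : 'I_(nv m), rs p q h i = 0) ->
  forall b t, 0 <= t <= 1 -> h b t = 0.
Proof.
move=> [hc h0 h1] H b t ht; have p1' := p0 hp.
have vert m k : (n <= m)%N -> (k <= 3 ^ m)%N -> h b (Y m k) = 0.
  move=> nm km; have m0 := expn_gt0 3 m.
  have km' : (k < nv m)%N by move: km m0; rewrite /nv; clear; lia.
  have F : h false (Y m k) = 0.
    have := H m nm (Ordinal km'); rewrite rsE /= ltnNge km /=; exact.
  case: b; last exact: F.
  have [k0|k0] := posnP k.
    by move: F; rewrite k0 Y_0 h0.
  have [k3|k3] := eqVneq k (3 ^ m)%N.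
    by move: F; rewrite k3 Y_one h1.
  have km2 : (nv m - k < nv m)%N by move: km' k0; clear; lia.
  have b1 : (3 ^ m < nv m - k)%N by move: km k3 km' k0; rewrite /nv; clear; lia.
  have := H m nm (Ordinal km2); rewrite rsE /= b1.
  suff -> : Y m (nv m - k) = Y m k by [].
  rewrite /Y /fold km ifF; last first.
    by apply/negbTE; rewrite -ltnNge; move: km k3 km' k0; rewrite /nv; clear; lia.
  by rewrite subKn// ltnW.
apply/eqP; rewrite -normr_eq0 eq_le normr_ge0 andbT; apply/ler_addgt0Pl => e e0; rewrite addr0.
have := (subspace_continuousP _ _).1 (hc b) t; rewrite /= in_itv /= ht => /(_ isT).
move=> /cvgrPdist_le /(_ e e0) /nbhs_ballP[d /= d0 Hd].
have r1 : `|(1 + p)^-1| < 1 by rewrite ger0_norm ?invr_ge0 ?invf_lt1; lra.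
have [m0 _ Hm] : \forall m \near \oo, `|(1 + p)^-1 ^+ m| < d.
  by have /cvgr0Pnorm_lt := cvg_expr r1; apply.
pose m := maxn m0 n.
have [k [km hk1 hk2]] : exists k, [/\ (k < 3 ^ m)%N, Y m k <= t & t <= Y m k.+1].
  have : (0 < 3 ^ m)%N by rewrite expn_gt0.
  have : t <= Y m (3 ^ m) by rewrite Y_one; case/andP: ht.
  elim: (3 ^ m)%N => [//|N IH] hN _; have [tN|tN] := leP t (Y m N).
    case: N IH tN hN => [|N] IH tN hN; first by exists 0%N; split=> //; rewrite Y_0; case/andP: ht.
    by have [k [kN a c]] := IH tN isT; exists k; split=> //; apply: ltnW.
  by exists N; split=> //; apply: ltW.
have kv : (k < nv m)%N by move: km; rewrite /nv; clear; lia.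
have L : `|t - Y m k| < d.
  have := Hm m (leq_maxl _ _); rewrite ger0_norm ?exprn_ge0 ?invr_ge0//; last lra.
  move=> dd; apply: le_lt_trans dd; apply: le_trans (len_small hp hq m k).
  have := Y_step hp hq kv; rewrite km mul1r => <-.
  by rewrite ger0_norm ?subr_ge0// lerD2r.
have Y01 := Y_ge0 (ltnW km).
have Yin : [set` `[0, 1]] (Y m k).
  by rewrite /= in_itv /= Y01 (le_trans hk1)//; case/andP: ht.
have : `|h b t - h b (Y m k)| <= e by exact: Hd L Yin.
by rewrite vert ?leq_maxr ?(ltnW km)// subr0.
Qed.

Section Extend.
Variables (x : R) (n : nat) (v : 'I_(nv n) -> R).
Hypothesis small : `|x / lam ^+ n| <= Num.min 24^-1 (q / 2).
Hypothesis v_eigen : forall i, walk p q v i = Phi p q (x / lam ^+ n) * v i.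

Let nv0 m : (0 < nv m)%N. Proof. by rewrite muln_gt0 expn_gt0. Qed.
Let v' i := v (Ordinal (ltn_pmod i (nv0 n))).
Let v'E (i : 'I_(nv n)) : v' i = v i.
Proof. by congr v; apply: val_inj; rewrite /= modn_small. Qed.
Let v'_cycle : v' (nv n) = v' 0%N.
Proof. by congr v; apply: val_inj; rewrite /= modnn mod0n. Qed.
Let v'_eigen (i : 'I_(nv n)) : walk p q (fun k : 'I_(nv n) => v' k) i = Phi p q (x / lam ^+ (0 + n)) * v' i.
Proof. by rewrite v'E add0n -v_eigen /walk !v'E. Qed.
Local Notation G := (G p q x n v').

Let copy b (ji : nat * nat) := let: (j, i) := ji in
  if b then (3 ^ (j + n) <= i)%N && (i <= nv (j + n))%N else (i <= 3 ^ (j + n))%N.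
Let pos (ji : nat * nat) := Y (ji.1 + n) ji.2.
Let val (ji : nat * nat) := G ji.1 ji.2.

Let copy_le b j i : copy b (j, i) -> (i <= nv (j + n))%N.
Proof. by rewrite /copy; case: b => [/andP[]//|h]; rewrite /nv; move: h; clear; lia. Qed.

Lemma G_lift k j i : G (k + j) (3 ^ k * i) = G j i.
Proof.
elim: k => [|k IH]; first by rewrite mul1n.
by rewrite addSn expnS -mulnA; have [-> _ _] := G_cell p q x n v' (k + j) (3 ^ k * i).
Qed.

(** The bounds on the slopes add up along a copy, on which the position is
    monotone in the index. *)
Lemma G_lipschitz : exists K : R, 0 <= K /\ forall b s t, copy b s -> copy b t ->
  `|val s - val t| <= K * `|pos s - pos t|.
Proof.
have [K [K0 HK]] := G_slope hp hq v' small; exists K; split=> //.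
have mono b j i i' : copy b (j, i) -> copy b (j, i') -> (i <= i')%N ->
    `|G j i - G j i'| <= K * `|Y (j + n) i - Y (j + n) i'|.
  move=> ci ci' ii'.
  pose sg := if b then -1 else 1 : R.
  suff /(_ i')[]// : forall k, (i <= k <= i')%N ->
      `|G j i - G j k| <= K * (sg * (Y (j + n) k - Y (j + n) i)) /\ 0 <= sg * (Y (j + n) k - Y (j + n) i).
    - by rewrite ii' leqnn.
    move=> h s0; apply: le_trans h _; apply: ler_wpM2l => //.
    rewrite distrC -[leLHS]ger0_norm// normrM /sg; case: (b); by rewrite ?normrN normr1 mul1r.
  elim=> [|k IH]; first by rewrite leqn0 => /andP[/eqP-> _]; rewrite !subrr mulr0 mulr0 normr0.
  move=> /andP[]; rewrite leq_eqVlt => /orP[/eqP-> _|ik ki']; first by rewrite !subrr mulr0 mulr0 normr0.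
  have [|h1 h2] := IH; first by rewrite -ltnS ik ltnW.
  have kN : (k < nv (j + n))%N by apply: leq_trans ki' (copy_le ci').
  have Ls : sg * (Y (j + n) k.+1 - Y (j + n) k) = len (j + n) k.
    rewrite Y_step// /sg; move: ci ci'; rewrite /copy; case: (b) => [/andP[c1 _] _|_ c2].
      by rewrite ifF ?mulrA ?mulrNN ?mulr1 ?mul1r//; apply/negbTE; rewrite -leqNgt (leq_trans c1).
    by rewrite ifT ?mul1r ?mulr1//; apply: leq_trans ki' c2.
  have E : sg * (Y (j + n) k.+1 - Y (j + n) i) = sg * (Y (j + n) k - Y (j + n) i) + len (j + n) k.
    by rewrite -Ls; ring.
  rewrite E mulrDr; split; last by rewrite addr_ge0// ltW// len_gt0.
  rewrite (_ : G j i - G j k.+1 = (G j i - G j k) - (G j k.+1 - G j k)); last by ring.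
  by apply: le_trans (ler_normB _ _) _; apply: lerD => //; exact: HK.
have same b j i i' : copy b (j, i) -> copy b (j, i') ->
    `|G j i - G j i'| <= K * `|Y (j + n) i - Y (j + n) i'|.
  move=> ci ci'; have [h|/ltnW h] := leqP i i'; first exact: mono ci ci' h.
  by rewrite distrC [`|Y _ _ - _|]distrC; exact: mono ci' ci h.
have clift b k j i : copy b (j, i) -> copy b ((k + j)%N, (3 ^ k * i)%N).
  rewrite /copy -addnA [(3 ^ (k + _))%N]expnD.
  rewrite (_ : nv (k + (j + n)) = 3 ^ k * nv (j + n))%N; last by rewrite /nv expnD mulnCA.
  by rewrite !leq_mul2l; case: b => [/andP[-> ->]|->]; rewrite !orbT.
move=> b [j i] [j' i'] c c'; rewrite /val /pos /=.
rewrite -(G_lift j' j i) -(G_lift j j' i') -(Y_lift j' (copy_le c)) -(Y_lift j (copy_le c')).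
rewrite !addnA [(j + j')%N]addnC; apply: (same b); first exact: clift.
by have := clift _ j _ _ c'; rewrite [(j + j')%N]addnC.
Qed.

(** The infimum of cones extends the values at the vertices to a Lipschitz
    function on each copy, and the eigenvalue equations P f = Phi (x /
    lam^n) f become L f = x f in the limit. *)
Lemma eigenfunction_extension : exists f, eigenfunction p q x f /\ forall i : 'I_(nv n), rs p q f i = v i.
Proof.
have [K [K0 HK]] := G_lipschitz; have [A [A0 HA]] := G_bound hp hq v' small.
have base b : copy b (0, 3 ^ n)%N.
  by rewrite /copy add0n; case: b; rewrite leqnn// /nv; clear; lia.
have ext b : exists F : R -> R, (forall t s, `|F t - F s| <= K * `|t - s|) /\
    forall s, copy b s -> F (pos s) = val s.
  exact: (@mcshane R _ [set s | copy b s] pos val K _ (base b) K0 (HK b)).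
have [F1 [L1 V1]] := ext true; have [F0 [L0 V0]] := ext false.
pose f (b : bool) := if b then F1 else F0.
have rsf j (i : 'I_(nv (j + n))) : rs p q f i = G j i.
  rewrite rsE /f; case: ifP => h.
    by have := V1 (j, nat_of_ord i); apply; rewrite /copy (ltnW h) ltnW.
  by have := V0 (j, nat_of_ord i); apply; rewrite /copy leqNgt h.
have c0 : copy true (0, nv n)%N by rewrite /copy add0n leqnn andbT /nv; clear; lia.
have f0 : f false 0 = f true 0.
  rewrite /f -{1}(Y_0 (0 + n)) -(Y_end (0 + n)).
  have -> : F1 (Y (0 + n) (nv (0 + n))) = val (0, nv n)%N by exact: V1 c0.
  have -> : F0 (Y (0 + n) 0) = val (0, 0)%N by exact: V0 (0, 0)%N isT.
  by rewrite /val /= v'_cycle.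
have f1 : f false 1 = f true 1.
  rewrite /f -(Y_one (0 + n)).
  have -> : F1 (Y (0 + n) (3 ^ (0 + n))) = val (0, 3 ^ n)%N by exact: V1 (base true).
  by exact: V0 (base false).
have fc b : continuous (f b).
  have Lf t s : `|f b t - f b s| <= K * `|t - s| by rewrite /f; case: (b).
  move=> t; apply/cvgrPdist_le => e e0.
  have K1 : 0 < K + 1 by rewrite ltr_wpDl.
  near=> s; apply: le_trans (Lf t s) _.
  apply: (@le_trans _ _ ((K + 1) * `|t - s|)); first by rewrite ler_wpM2r// lerDl.
  rewrite -ler_pdivlMl// mulrC; near: s; apply: cvgr_dist_le; first exact: cvg_id.
  by rewrite divr_gt0.
have fd : continuous_on_double f by split=> // b; apply: continuous_subspaceT; exact: fc.
exists f; split; last by move=> i; rewrite (rsf 0%N i) /= v'E.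
split=> //.
  split=> [b||]; rewrite ?f0 ?f1//; apply: continuous_subspaceT => t.
  by apply: cvgM; [exact: cvg_cst|exact: fc].
move=> e e0; have A1 : 0 < A + 1 by rewrite ltr_wpDl.
have [n1 _ H1] := (cvgrPdist_lt _ _).1 (@Phi_lim _ _ _ hp hq x) _ (divr_gt0 e0 A1).
exists (maxn n n1) => // m /= hm i.
have nm : (n <= m)%N by apply: leq_trans hm; rewrite leq_maxl.
have := H1 m (leq_trans (leq_maxr _ _) hm); rewrite -/lam.
move: i; rewrite -(subnK nm); move: (m - n)%N => j i.
rewrite ltr_pdivlMr// => Hj; apply: le_lt_trans Hj.
rewrite laplacianE// -/lam.
have -> : Defs.restrict p q (n := j + n) (fun b t => x * f b t) i = x * rs p q f i by [].
rewrite -/(rs p q f).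
have -> : walk p q (rs p q f) i = Phi p q (x / lam ^+ (j + n)) * rs p q f i.
  rewrite rsf -(G_eigen hp hq small v'_cycle v'_eigen) /walk !rsf//.
rewrite rsf (_ : _ - _ = - ((x - 2 * lam ^+ (j + n) * (1 - Phi p q (x / lam ^+ (j + n)))) * G j i)); last ring.
rewrite normrN normrM; apply: ler_wpM2l => //.
by apply: le_trans (HA j i (ltnW (ltn_ord i))) _; rewrite lerDl.
Unshelve. all: by end_near.
Qed.
End Extend.
End Multiplicity.

Section Spectrum.
Variable R : realType.
Variables p q : R.
Hypothesis hp : 0 < p < 1.
Hypothesis hq : q = 1 - p.
Let lam := lambda p q.
Local Notation Y := (Y p q).

Lemma Y_range m i : (i <= nv m)%N -> 0 <= Y m i <= 1.
Proof.
have up j : (j <= 3 ^ m)%N -> Y m j <= 1.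
  move=> jm; rewrite -(Y_one hp hq m) -(subnKC jm).
  have : (j + (3 ^ m - j) <= 3 ^ m)%N by rewrite subnKC.
  elim: (3 ^ m - j)%N => [|d IH] dm; first by rewrite addn0.
  rewrite addnS in dm *; have dv : (j + d < nv m)%N by move: dm; rewrite /nv; clear; lia.
  have := Y_step hp hq dv; rewrite dm mul1r => e.
  by have := IH (ltnW dm); have := len_gt0 hp hq m (j + d); rewrite -e; lra.
move=> iv; have [h|h] := leqP i (3 ^ m); first by rewrite (Y_ge0 hp hq h) up.
have h' : (nv m - i <= 3 ^ m)%N by move: h; rewrite /nv; clear; lia.
have -> : Y m i = Y m (nv m - i) by rewrite /Y /fold leqNgt h /= h'.
by rewrite (Y_ge0 hp hq h') up.
Qed.

(** Eigenfunctions for x correspond to eigenvectors of the walk of a fine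
    level: restriction is injective because the vertices are dense and the
    interior values of the cells are forced. *)
Lemma multiplicityE x n : `|x / lam ^+ n| <= Num.min 24^-1 (q / 2) ->
  has_multiplicity p q x (count_mem (Phi p q (x / lam ^+ n)) (spec p q n)).
Proof.
move=> small; set w := Phi p q (x / lam ^+ n).
have [e [e1 e2 e3]] := eigenbasis hp hq n w.
have [F HF] := choice (fun k => eigenfunction_extension hp hq small (e1 k)).
have small24 m : `|x / lam ^+ (m + n)| <= 24^-1.
  apply: (@le_trans _ _ `|x / lam ^+ n|); last by move: small; rewrite le_min => /andP[].
  rewrite addnC exprD invfM mulrA [leLHS]normrM ler_piMr//.
  have l9 := lam9 hp hq; have m1 : 1 <= lam ^+ m by rewrite exprn_ege1//; move: l9; rewrite -/lam; lra.
  by rewrite ger0_norm ?invr_ge0 ?invf_le1//; lra.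
exists F; split=> [k|c H k|f Hf]; first exact: (HF k).1.
- apply: e2 => i; rewrite -[RHS](H (3 ^ n < i)%N (Y n i)); last exact: Y_range (ltnW (ltn_ord i)).
  by apply: eq_bigr => l _; rewrite -(HF l).2.
have Hw0 : forall i : 'I_(nv n), walk p q (rs p q f) i = w * rs p q f i.
  by have T := eigenfunction_walk hp hq Hf (small24 0%N); exact: T.
have [c Hc] := e3 _ Hw0; exists c => b t ht.
pose h b t := f b t - \sum_k c k * F k b t.
have [fd _ _] := Hf; have Fd k : continuous_on_double (F k) by have [[]] := HF k.
suff : h b t = 0 by move/eqP; rewrite subr_eq0 => /eqP.
have rsh m (i : 'I_(nv m)) : rs p q h i = rs p q f i - \sum_k c k * rs p q (F k) i by [].
apply: (@continuous_vanish R p q hp hq h n) => //.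
  split=> [b'||]; rewrite /h.
  - move=> s; apply: cvgB; first by have [fc _ _] := fd; exact: fc.
    apply: cvg_big => [|k _]; first by move=> ?; exact: add_continuous.
    apply: cvgM; first exact: cvg_cst.
    by have [Fc _ _] := Fd k; exact: Fc.
  - have [_ -> _] := fd; congr (_ - _); apply: eq_bigr => k _.
    by have [_ -> _] := Fd k.
  have [_ _ ->] := fd; congr (_ - _); apply: eq_bigr => k _.
  by have [_ _ ->] := Fd k.
have wh m (i : 'I_(nv (m + n))) : walk p q (rs p q h) i = Phi p q (x / lam ^+ (m + n)) * rs p q h i.
  have fw := eigenfunction_walk hp hq Hf (small24 m) i.
  have Fw k := eigenfunction_walk hp hq (HF k).1 (small24 m) i.
  transitivity (walk p q (rs p q f) i - \sum_k c k * walk p q (rs p q (F k)) i).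
    rewrite /walk !rsh [in RHS](eq_bigr (fun k => back p q (m + n) i * (c k * rs p q (F k) (ord_pred i)) +
      (1 - back p q (m + n) i) * (c k * rs p q (F k) (ordS i)))); last by move=> k _; ring.
    by rewrite big_split /= -!mulr_sumr; ring.
  rewrite rsh mulrBr -fw mulr_sumr; congr (_ - _).
  by apply: eq_bigr => k _; rewrite Fw mulrCA.
move=> m nm; rewrite -(subnK nm); elim: (m - n)%N => [|d IH] i.
  by rewrite rsh Hc; apply/eqP; rewrite subr_eq0; apply/eqP/eq_bigr => k _; rewrite (HF k).2.
have [_ _ w0] := w_pos hp hq small d.+1.
have [k [->|->|->]] := cellP i; first by rewrite (rs_cell0 hp hq).
  have [-> _] := interior_unique hq (lt0r_neq0 w0) (wh d.+1) k.
  by rewrite !(rs_cell0 hp hq) !IH !mulr0 addr0 mul0r.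
have [_ ->] := interior_unique hq (lt0r_neq0 w0) (wh d.+1) k.
by rewrite !(rs_cell0 hp hq) !IH !mulr0 addr0 mul0r.
Qed.

Theorem is_spectrum_nu : is_spectrum p q (nu p q).
Proof.
split=> [i j|x]; first exact: nu_mono.
have [n0 H0] := nu_eq hp hq x.
have q2 : 0 < Num.min 24^-1 (q / 2) by rewrite lt_min invr_gt0 ltr0n divr_gt0// (q0 hp hq).
have [n1 H1] := scale_ev hp hq x q2.
pose n := maxn n0 n1; pose w := Phi p q (x / lam ^+ n).
exists [seq k <- iota 0 (nv n) | sn p q n k == w]; split.
- by rewrite filter_uniq// iota_uniq.
- move=> k; rewrite mem_filter mem_iota /=; rewrite (H0 n (leq_maxl _ _)).
  by split=> [/andP[/eqP ? ?]|[-> ->]]; rewrite ?eqxx.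
rewrite size_filter; have := multiplicityE (H1 n (leq_maxr _ _)); congr has_multiplicity.
rewrite -[in LHS](mkseq_nth 0 (spec p q n)) count_map size_spec.
by apply: eq_count => k.
Qed.

(** The coordinates of one family in the other form a matrix with
    independent rows. *)
Lemma multiplicity_le x m m' : has_multiplicity p q x m -> has_multiplicity p q x m' -> (m <= m')%N.
Proof.
move=> [e [e1 e2 e3]] [e' [e1' e2' e3']].
have [A HA] := choice (fun k => e3' _ (e1 k)).
pose M : 'M[R]_(m, m') := \matrix_(k, j) A k j.
suff : row_free M by move/eqP <-; exact: rank_leq_col.
apply: inj_row_free => c cM; apply/rowP => k; rewrite mxE; move: k; apply: e2 => b t ht.
transitivity (\sum_j (c *m M) 0 j * e' j b t).
  under [RHS]eq_bigr do rewrite mxE mulr_suml.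
  rewrite exchange_big /=; apply: eq_bigr => k _; rewrite HA// mulr_sumr.
  by apply: eq_bigr => j _; rewrite mxE mulrA.
by rewrite cM big1// => j _; rewrite mxE mul0r.
Qed.

(** At the first index where the sequences differ, the smaller of the two
    values would occur more often in one list than in the other. *)
Lemma spectrum_unique mu mu' : is_spectrum p q mu -> is_spectrum p q mu' -> mu =1 mu'.
Proof.
have aux nu1 nu2 k : is_spectrum p q nu1 -> is_spectrum p q nu2 ->
    (forall j, (j < k)%N -> nu1 j = nu2 j) -> nu2 k <= nu1 k.
  move=> [_ s1] [m2 s2] H; rewrite leNgt; apply/negP => lt.
  have [a [ua Ha Ma]] := s1 (nu1 k); have [b [ub Hb Mb]] := s2 (nu1 k).
  have bk j : j \in b -> (j < k)%N.
    by move/Hb => e; rewrite ltnNge; apply/negP => /m2; rewrite e leNgt lt.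
  have : (size (k :: b) <= size a)%N.
    apply: uniq_leq_size => [|j]; first by rewrite /= ub andbT; apply/negP => /bk; rewrite ltnn.
    rewrite inE => /orP[/eqP->|jb]; first exact/Ha.
    by apply/Ha; rewrite H ?bk//; apply/Hb.
  by rewrite ltnNge (multiplicity_le Ma Mb).
move=> s1 s2; elim/ltn_ind => k IH; apply/eqP; rewrite eq_le.
by rewrite !aux// => j /IH.
Qed.
End Spectrum.

(** * The functional equation of the spectral determinant *)

Section Functional.
Variable R : realType.
Variables p q : R.
Hypothesis hp : 0 < p < 1.
Hypothesis hq : q = 1 - p.
Let lam := lambda p q.
Local Notation nuS k := (nu p q k.+1).
Local Notation nuN := (nuN p q).

Let l9 : 9 <= lam. Proof. exact: lam9 hp hq. Qed.
Let lam0 : 0 < lam. Proof. by have := l9; lra. Qed.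

Lemma geom_le (r : R) b : 0 <= r < 1 -> \sum_(j < b) r ^+ j <= (1 - r)^-1.
Proof.
move=> /andP[r0 r1]; have r1' : 0 < 1 - r by rewrite subr_gt0.
rewrite -[leRHS]mul1r ler_pdivlMr// mulrC.
have -> : (1 - r) * \sum_(j < b) r ^+ j = 1 - r ^+ b by rewrite -opprB mulNr -subrX1 opprB.
by rewrite gerBl exprn_ge0.
Qed.

(** Dominated convergence for sums with a growing number of terms. *)
Lemma tannery (c : nat -> nat -> R) (c' b : nat -> R) (N : nat -> nat) (B : R) :
  (forall n, \sum_(k < n) b k <= B) -> (forall k, 0 <= b k) -> (forall n, (n <= N n)%N) ->
  (forall n k, (k < N n)%N -> `|c n k| <= b k) -> (forall k, c^~ k @ \oo --> c' k) ->
  (fun n => \sum_(k < N n) c n k) @ \oo --> limn (fun n => \sum_(k < n) c' k).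
Proof.
move=> HB b0 HN Hc cc'.
have c'b k : `|c' k| <= b k.
  rewrite -[c' k]subr0; apply: (@lim_le_dist R (fun n => c (n + k.+1)%N k)).
    by rewrite (cvg_shiftn k.+1 (c^~ k)).
  by move=> m; rewrite subr0 Hc// (leq_trans _ (HN _))// addnS ltnS leq_addl.
have cvb : cvgn (fun n => \sum_(k < n) b k).
  by apply: (@abs_series_cvg R b B) => n; under eq_bigr do rewrite ger0_norm//.
have cvc : cvgn (fun n => \sum_(k < n) c' k).
  by apply: (@abs_series_cvg R c' B) => n; apply: le_trans (HB n); apply: ler_sum.
apply/cvgrPdist_le => e e0; have e3 : 0 < e / 3 by rewrite divr_gt0.
have [m _ Hm] := (cvgrPdist_le _ _).1 (cvb : _ --> _) _ e3.
set Sb := limn _ in Hm.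
have mono : {homo (fun n => \sum_(k < n) b k) : i j / (i <= j)%N >-> i <= j}.
  move=> i j ij; rewrite -(subnKC ij) big_split_ord /= lerDl sumr_ge0//.
have tail n : (m <= n)%N -> \sum_(m <= k < n) b k <= e / 3.
  move=> mn; have := Hm m (leqnn m); have le : \sum_(k < n) b k <= Sb.
    by apply: nondecreasing_cvgn_le.
  rewrite -!(big_mkord xpredT) in le *; rewrite (big_cat_nat (leq0n m) mn)//= in le.
  by rewrite ler_norml => /andP[_ h]; lra.
have tail' (d : nat -> R) n : (m <= n)%N -> (forall k, (k < n)%N -> `|d k| <= b k) ->
    `|\sum_(k < n) d k - \sum_(k < m) d k| <= e / 3.
  move=> mn Hd; rewrite -!(big_mkord xpredT d) (big_cat_nat (leq0n m) mn)//= addrAC subrr add0r.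
  apply: le_trans (tail n mn); apply: le_trans (ler_norm_sum _ _ _) _.
  by apply: ler_sum_nat => k /andP[_ kn]; exact: Hd.
have fin : (fun n => \sum_(k < m) c n k) @ \oo --> \sum_(k < m) c' k.
  by apply: cvg_big => [|k _]; [move=> ?; exact: add_continuous|exact: cc'].
have [n1 _ H1] := (cvgrPdist_le _ _).1 fin _ e3.
exists (maxn m n1) => // n /= hn.
have mn : (m <= n)%N by apply: leq_trans hn; rewrite leq_maxl.
have h1 := H1 n (leq_trans (leq_maxr _ _) hn).
have h2 := tail' _ (N n) (leq_trans mn (HN n)) (Hc n).
have h3 : `|limn (fun n => \sum_(k < n) c' k) - \sum_(k < m) c' k| <= e / 3.
  apply: (@lim_le_dist R (fun n => \sum_(k < n + m) c' k)).
    by rewrite (cvg_shiftn m (fun n => \sum_(k < n) c' k)).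
  by move=> j; apply: tail' => //; rewrite leq_addl.
set A := limn _ in h3 *; set A1 := \sum_(k < m) c' k in h1 h3; set A2 := \sum_(k < m) c n k in h1 h2.
rewrite (_ : A - _ = (A - A1) + (A1 - A2) - (\sum_(k < N n) c n k - A2)); last by ring.
apply: le_trans (ler_normB _ _) _; have := ler_normD (A - A1) (A1 - A2); lra.
Qed.

Lemma nuS_gt0 k : 0 < nuS k.
Proof. by have := nu_ge4 hp hq (ltn0Sn k); lra. Qed.

Let ln9 : 2 * ln 3 <= ln lam :> R.
Proof.
have -> : 2 * ln 3 = ln 9 :> R.
  have -> : 9 = 3 * 3 :> R by ring.
  by rewrite lnM ?posrE//; ring.
by rewrite ler_ln ?posrE.
Qed.

(** A shell has 4 * 3^m eigenvalues above lam^(m+1), and lam^sigma > 3. *)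
Lemma shell_bound (sigma : R) (F : nat -> R) : 2^-1 < sigma -> (forall k, 0 <= F k) ->
  (forall m k, (nv m <= k)%N -> F k <= expR (- sigma * ln lam) ^+ m.+1) ->
  exists B, forall n, \sum_(k < n) F k.+1 <= B.
Proof.
move=> hs F0 HF; pose r := expR (- sigma * ln lam).
have l3 : (0 : R) < ln 3 by rewrite ln_gt0 // ltr1n.
have r3 : 3 * r < 1.
  have e3 : expR (ln 3) = 3 :> R by rewrite lnK ?posrE.
  rewrite -[X in X * r]e3 /r -expRD -[ltRHS]expR0 ltr_expR.
  have : 0 < (sigma - 2^-1) * ln lam by rewrite mulr_gt0 ?subr_gt0//; have := ln9; lra.
  by rewrite mulrBl; have := ln9; lra.
have r0 : 0 < r := expR_gt0 _.
exists (F 1%N + 4 * r * (1 - 3 * r)^-1) => n.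
have sub : \sum_(k < n) F k.+1 <= F 1%N + \sum_(nv 0 <= k < nv (0 + n)) F k.
  have -> : \sum_(k < n) F k.+1 = \sum_(1 <= k < n.+1) F k by rewrite big_add1 big_mkord.
  have hn : (n.+1 <= nv n)%N by exact: nv_gt.
  apply: (@le_trans _ _ (\sum_(1 <= k < nv n) F k)).
    by rewrite (big_cat_nat (ltn0Sn n) hn)//= lerDl sumr_ge0.
  have n2 : (1 < nv n)%N by rewrite /nv; have := expn_gt0 3 n; clear; lia.
  by rewrite big_ltn.
apply: le_trans sub _; rewrite lerD2l.
apply: le_trans (shell_sum n 0 (fun m k h _ => HF m k h)) _.
rewrite -/r; have -> : \sum_(j < n) (nv (0 + j)).*2%:R * r ^+ (0 + j).+1 = 4 * r * \sum_(j < n) (3 * r) ^+ j.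
  rewrite mulr_sumr; apply: eq_bigr => j _; rewrite add0n /nv -mul2n !natrM natrX exprMn exprS; ring.
by rewrite ler_pM2l; [apply: geom_le; rewrite mulr_ge0 ?(ltW r0)//|rewrite mulr_gt0].
Qed.

Lemma nu_dirichlet (sigma : R) : 2^-1 < sigma ->
  exists B, forall n, \sum_(k < n) expR (- sigma * ln (nuS k)) <= B.
Proof.
move=> hs; apply: (@shell_bound sigma (fun k => expR (- sigma * ln (nu p q k)))) => // m k mk.
have k0 : (0 < k)%N by apply: leq_trans mk; rewrite muln_gt0 expn_gt0.
rewrite -expRM_natl ler_expR.
have L : m.+1%:R * ln lam <= ln (nu p q k).
  have := nu_shell hp hq mk; rewrite -ler_ln ?posrE ?exprn_gt0 ?lnXn// ?mulr_natl//.
  by have := nu_ge4 hp hq k0; lra.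
have s0 : 0 <= sigma by lra.
by have := ler_wpM2l s0 L; rewrite mulrCA mulrA !mulNr mulrN mulrA; lra.
Qed.

Definition logdet (t : R) := limn (fun n => \sum_(k < n) ln (1 + t / nuS k)).

Lemma nu_inv : exists B, forall n, \sum_(k < n) (nuS k)^-1 <= B.
Proof.
have [|B HB] := @nu_dirichlet 1; first lra.
by exists B => n; apply: le_trans (HB n); apply: ler_sum => k _; rewrite mulN1r expRN lnK ?posrE ?nuS_gt0.
Qed.

Lemma ln1_le (x : R) : 0 <= x -> 0 <= ln (1 + x) <= x.
Proof. by move=> x0; rewrite ln_ge0 ?lerDl//= le_ln1Dx//; lra. Qed.

Lemma logdet_cvg t : 0 <= t -> (fun n => \sum_(k < n) ln (1 + t / nuS k)) @ \oo --> logdet t.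
Proof.
move=> t0; have [B HB] := nu_inv.
suff : cvgn (fun n => \sum_(k < n) ln (1 + t / nuS k)) by [].
apply: (@abs_series_cvg R (fun k => ln (1 + t / nuS k)) (t * B)) => n; apply: le_trans (ler_wpM2l t0 (HB n)).
rewrite mulr_sumr; apply: ler_sum => k _.
have /ln1_le/andP[h1 h2] : 0 <= t / nuS k by rewrite divr_ge0// ltW// nuS_gt0.
by rewrite ger0_norm.
Qed.

Lemma logdet_ge t n : 0 <= t -> \sum_(k < n) ln (1 + t / nuS k) <= logdet t.
Proof.
move=> t0; have cv := cvgP _ (logdet_cvg t0).
suff nd : {homo (fun n => \sum_(k < n) ln (1 + t / nuS k)) : i j / (i <= j)%N >-> i <= j}.
  exact: (nondecreasing_cvgn_le nd cv n).
move=> i j ij.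
 rewrite -(subnKC ij) big_split_ord /= lerDl sumr_ge0// => k _.
by have /ln1_le/andP[] : 0 <= t / nuS (i + k)%N by rewrite divr_ge0// ltW// nuS_gt0.
Qed.

Definition logdetN n t := \sum_(k < (nv n).-1) ln (1 + t / nuN n k.+1).

(** The terms are dominated because nuN n k increases with n, from the first
    level at which the index k occurs. *)
Lemma logdetN_cvg t : 0 <= t -> logdetN^~ t @ \oo --> logdet t.
Proof.
move=> t0.
have ex k : exists n, (k < nv n)%N by exists k; exact: nv_gt.
pose n0 k := ex_minn (ex k).
have n0P k : (k < nv (n0 k))%N by rewrite /n0; case: ex_minnP.
have n0m k n : (k < nv n)%N -> (n0 k <= n)%N by rewrite /n0; case: ex_minnP => m _; apply.
have pos k n : (0 < k)%N -> (k < nv n)%N -> 0 < nuN n k by move=> k0 kn; have := nuN_ge4 hp hq k0 kn; lra.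
have [||m k mk|B HB] := @shell_bound 1 (fun k => if (0 < k)%N then (nuN (n0 k) k)^-1 else 0).
- lra.
- by move=> k; case: ifP => // k0; rewrite invr_ge0 ltW// pos.
- have k0 : (0 < k)%N by apply: leq_trans mk; rewrite muln_gt0 expn_gt0.
  rewrite k0 mulN1r expRN lnK ?posrE// exprVn lef_pV2 ?posrE ?exprn_gt0 ?pos//.
  exact: nuN_shell mk (n0P k).
apply: (@tannery (fun n k => ln (1 + t / nuN n k.+1)) (fun k => ln (1 + t / nuS k))
  (fun k => t / nuN (n0 k.+1) k.+1) (fun n => (nv n).-1) (t * B)) => [n|k|n|n k kn|k].
- by rewrite -mulr_sumr; apply: ler_wpM2l => //; exact: HB.
- by rewrite divr_ge0// ltW// pos.
- by have := nv_gt n; clear; lia.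
- have kn' : (k.+1 < nv n)%N by move: kn; clear; lia.
  have /ln1_le/andP[h1 h2] : 0 <= t / nuN n k.+1 by rewrite divr_ge0// ltW// pos.
  rewrite ger0_norm//; apply: le_trans h2 _; apply: ler_wpM2l => //.
  by rewrite lef_pV2 ?posrE ?pos//; apply: nuN_nondecr => //; exact: n0m.
have c1 : (fun n => t / nuN n k.+1) @ \oo --> t / nuS k.
  apply: cvgM; first exact: cvg_cst.
  by apply: cvgV; [rewrite gt_eqF// nuS_gt0|exact: nuN_cvg].
apply: (@continuous_cvg _ _ _ _ _ _ (fun x : R => ln (1 + x)) _ _ c1).
have h : 0 < 1 + t / nuS k by rewrite ltr_wpDr// divr_ge0// ltW// nuS_gt0.
apply: (@continuous_comp _ _ _ (fun x : R => 1 + x) (@ln R)); last exact: continuous_ln.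
by apply: cvgD; [exact: cvg_cst|exact: cvg_id].
Qed.

Let Qn n (a : R) := (\prod_(s <- spec p q n) (a - s)) / (p * q) ^+ (3 ^ n).-1.

Let QnE n a : Qn n a = Wn p q n a ^+ 2 - 1.
Proof.
have a0 := pq0 hp hq; elim: n a => [|n IH] a.
  by rewrite /Qn /= !big_cons big_nil divr1 expr2; ring.
rewrite /Wn iterSr -/(Wn p q n _) -IH /Qn prod_spec//.
have -> : ((3 ^ n.+1).-1 = nv n + (3 ^ n).-1)%N.
  by rewrite /nv expnS; have := expn_gt0 3 n; clear; lia.
by rewrite exprD; field; rewrite !expf_neq0// gt_eqF.
Qed.

(** The product is a ratio of values of the characteristic polynomial of the
    walk, at 1 + t / (2 lam^n) and at 1. *)
Let logdetN_Q n t : 0 < t -> t * expR (logdetN n t) = Qn n (1 + t / (2 * lam ^+ n)).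
Proof.
move=> t0; have a0 := pq0 hp hq; have L0 := exprn_gt0 n lam0.
have [T [E HT]] := spec_cons hp hq n.
have sT : size T = (nv n).-1 by rewrite -(size_spec p q n) E.
have pB := prod_behead_spec hp hq n; rewrite E /= -/lam in pB.
have D : (p * q) ^+ (3 ^ n).-1 = (\prod_(s <- T) (1 - s)) / (2 * lam ^+ n).
  by rewrite pB mulrAC mulfV ?mul1r// mulf_neq0// gt_eqF.
have Ts s : s \in T -> 0 < 1 - s by move/HT; lra.
rewrite /Qn E big_cons D.
have P0 : 0 < \prod_(s <- T) (1 - s) by rewrite big_seq prodr_gt0// => s; exact: Ts.
set P := \prod_(s <- T) (1 - s) in P0 *.
have -> : (1 + t / (2 * lam ^+ n) - 1) * \prod_(s <- T) (1 + t / (2 * lam ^+ n) - s) / (P / (2 * lam ^+ n)) =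
   t * ((\prod_(s <- T) (1 + t / (2 * lam ^+ n) - s)) / P).
  by field; rewrite !gt_eqF.
congr (_ * _); rewrite /P -prodf_div.
rewrite /logdetN expR_sum -sT (big_nth 0) big_mkord; apply: eq_bigr => k _.
have h := Ts _ (mem_nth 0 (ltn_ord k)).
have nE : nuN n k.+1 = 2 * lam ^+ n * (1 - nth 0 T k) by rewrite /nuN /sn E.
have n0 : 0 < nuN n k.+1 by rewrite nE !mulr_gt0.
rewrite lnK ?posrE ?nE; first by field; rewrite !gt_eqF.
by rewrite -nE ltr_wpDr// divr_ge0 ?ltW.
Qed.

(** The logarithm of t times the product of all 1 + t / nu_k, at t = e^u. *)
Definition logY (u : R) := u + logdet (expR u).
Definition epsilon (u : R) := logdet (expR (u + ln lam)) - 3 * logdet (expR u) - 2 * u + (ln lam + 2 * ln (p * q)).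

(** Spectral decimation in the limit: W^2 - 1 factors through w^2 - 1. *)
Lemma decimation u : let Y := expR (logY u) in
  expR (logY (u + ln lam)) = Y * (Y + (1 - p ^+ 2)) * (Y + (1 - q ^+ 2)) / (p * q) ^+ 2.
Proof.
move=> Yv; have a0 := pq0 hp hq; set t := expR u; have t0 : 0 < t := expR_gt0 _.
have tl : expR (u + ln lam) = lam * t by rewrite expRD lnK ?posrE// mulrC.
have cv s : 0 < s -> (fun n => s * expR (logdetN n s)) @ \oo --> s * expR (logdet s).
  move=> s0; apply: cvgM; first exact: cvg_cst.
  by apply: (@continuous_cvg _ _ _ _ _ _ expR _ _ (logdetN_cvg (ltW s0))); exact: continuous_expR.
have YE : Yv = t * expR (logdet t) by rewrite /Yv /logY expRD.
have -> : expR (logY (u + ln lam)) = (lam * t) * expR (logdet (lam * t)) by rewrite /logY expRD tl.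
have lt0 : 0 < lam * t by rewrite mulr_gt0.
have c1 : (fun n => lam * t * expR (logdetN (n + 1) (lam * t))) @ \oo --> lam * t * expR (logdet (lam * t)).
  by rewrite (cvg_shiftn 1 (fun n => lam * t * expR (logdetN n (lam * t)))); exact: cv.
have c2 := cv _ t0; rewrite -YE in c2.
have c3 : (fun n => let y := t * expR (logdetN n t) in
    y * (y + (1 - p ^+ 2)) * (y + (1 - q ^+ 2)) / (p * q) ^+ 2) @ \oo -->
    Yv * (Yv + (1 - p ^+ 2)) * (Yv + (1 - q ^+ 2)) / (p * q) ^+ 2.
  apply: cvgM; last exact: cvg_cst.
  apply: cvgM; [apply: cvgM; [exact: c2|]|]; by apply: cvgD; [exact: c2|exact: cvg_cst].
apply: (cvg_unique _ c1); first exact: Rhausdorff.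
suff -> : (fun n => lam * t * expR (logdetN (n + 1) (lam * t))) = (fun n => let y := t * expR (logdetN n t) in
    y * (y + (1 - p ^+ 2)) * (y + (1 - q ^+ 2)) / (p * q) ^+ 2) by [].
apply/funext => n /=; rewrite addn1 !logdetN_Q// !QnE (_ : Wn p q n.+1 _ = Wmap p q (Wn p q n (1 + lam * t / (2 * lam ^+ n.+1))))//.
have -> : lam * t / (2 * lam ^+ n.+1) = t / (2 * lam ^+ n).
  by rewrite exprS; field; rewrite !gt_eqF// exprn_gt0.
rewrite /Wmap hq; field; have := p0 hp; have := p1 hp; lra.
Qed.

Lemma logY_ge K u : (K.+1)%:R * u - \sum_(k < K) ln (nuS k) <= logY u.
Proof.
have := logdet_ge K (expR_ge0 u); rewrite /logY => h; apply: le_trans (lerD (lexx u) h).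
rewrite -natr1 mulrDl mul1r addrAC addrC lerD2l.
have -> : K%:R * u = \sum_(k < K) u by rewrite sumr_const card_ord mulr_natl.
rewrite -sumrB; apply: ler_sum => k _; have n0 := nuS_gt0 k; have e0 := expR_gt0 u.
rewrite -{1}(expRK u) -lnV ?posrE// -lnM ?posrE ?invr_gt0// ler_ln ?posrE ?divr_gt0//.
  by rewrite lerDr.
by rewrite addr_gt0// divr_gt0.
Qed.

(** epsilon is ln (1 + (1 - p^2) / Y) + ln (1 + (1 - q^2) / Y), and Y grows
    faster than every exponential because each factor 1 + e^u / nu_k
    contributes e^u. *)
Lemma epsilon_range K u : 0 <= epsilon u <= 2 * expR (\sum_(k < K) ln (nuS k) - K.+1%:R * u).
Proof.
have h1 := p0 hp; have h2 := p1 hp; have h3 := q0 hp hq; have a0 := pq0 hp hq.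
have := decimation u; set Yv := expR (logY u); have Y0 : 0 < Yv := expR_gt0 _.
move=> /(congr1 (@ln R)); rewrite expRK.
have x1 : 0 < (1 - p ^+ 2) / Yv by rewrite divr_gt0// expr2; nra.
have x2 : 0 < (1 - q ^+ 2) / Yv by rewrite divr_gt0// hq expr2; nra.
have -> : Yv * (Yv + (1 - p ^+ 2)) * (Yv + (1 - q ^+ 2)) / (p * q) ^+ 2 =
   Yv ^+ 3 * (1 + (1 - p ^+ 2) / Yv) * (1 + (1 - q ^+ 2) / Yv) / (p * q) ^+ 2.
  by field; rewrite !gt_eqF.
have y1 : 0 < 1 + (1 - p ^+ 2) / Yv by lra.
have y2 : 0 < 1 + (1 - q ^+ 2) / Yv by lra.
rewrite lnM ?posrE ?invr_gt0 ?exprn_gt0//; last by rewrite !mulr_gt0// exprn_gt0.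
rewrite lnM ?posrE ?mulr_gt0 ?exprn_gt0// lnM ?posrE ?exprn_gt0// lnV ?posrE ?exprn_gt0//.
rewrite !lnXn// /Yv expRK -/Yv.
have /andP[g1 g2] := ln1_le (ltW x1); have /andP[g3 g4] := ln1_le (ltW x2).
move=> H; have E : epsilon u = ln (1 + (1 - p ^+ 2) / Yv) + ln (1 + (1 - q ^+ 2) / Yv).
  by move: H; rewrite /epsilon /logY; lra.
rewrite E addr_ge0//=; apply: (@le_trans _ _ (2 / Yv)).
  have -> : 2 / Yv = (1 - p ^+ 2) / Yv + (1 - q ^+ 2) / Yv + (p ^+ 2 + q ^+ 2) / Yv by ring.
  have : 0 <= (p ^+ 2 + q ^+ 2) / Yv by rewrite divr_ge0 ?(ltW Y0)// addr_ge0// sqr_ge0.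
  by move: g2 g4; lra.
rewrite ler_pM2l// -expRN ler_expR; have := logY_ge K u; lra.
Qed.
End Functional.

(** * Integrals on the line *)

Section Integrals.
Variable R : realType.
Notation mu := (@lebesgue_measure R).
Notation T := (measurableTypeR R).
Implicit Types (D : set T) (g h : T -> R).

(** A real value together with integrability, so that sums and multiples need no
    finiteness conditions. *)
Definition isint D g (I : R) := [/\ measurable_fun setT g, mu.-integrable D (EFin \o g)
  & \int[mu]_(x in D) (g x)%:E = I%:E]%E.

Lemma isint_uniq D g I J : isint D g I -> isint D g J -> I = J.
Proof. by move=> [_ _ e] [_ _]; rewrite e => -[]. Qed.

Lemma meas_E D g : measurable_fun setT g -> measurable_fun D (EFin \o g).
Proof. by move=> mg; apply: measurable_funTS; apply/measurable_EFinP. Qed.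

Lemma isint_ext D g h I : measurable D -> measurable_fun setT h -> (forall x, D x -> g x = h x) ->
  isint D g I -> isint D h I.
Proof.
move=> mD mh gh [mg ig eg]; split=> //.
  by apply: eq_integrable ig => // x; rewrite inE /= => /gh ->.
by rewrite -eg; apply: eq_integral => x; rewrite inE => /gh ->.
Qed.

Lemma isint_ge0 D g (I : R) : measurable D -> measurable_fun setT g -> (forall x, D x -> 0 <= g x) ->
  (\int[mu]_(x in D) (g x)%:E = I%:E)%E -> isint D g I.
Proof.
move=> mD mg g0 e; split=> //; apply/integrableP; split; first exact: meas_E.
have -> : (\int[mu]_(x in D) `|(EFin \o g) x| = I%:E)%E; last exact: ltry.
by rewrite -e; apply: eq_integral => x; rewrite inE /= => /g0 h; rewrite ger0_norm.
Qed.

Lemma isintZ D g I c : measurable D -> isint D g I -> isint D (fun x => c * g x) (c * I).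
Proof.
move=> mD [mg ig e]; split; first exact: measurable_funM.
  by apply: eq_integrable (integrableZl mD c ig) => // x _ /=; rewrite EFinM.
by rewrite EFinM -e -integralZl//; apply: eq_integral => x _; rewrite EFinM.
Qed.

Lemma isintD D g h I J : measurable D -> isint D g I -> isint D h J ->
  isint D (fun x => g x + h x) (I + J).
Proof.
move=> mD [mg ig eg] [mh ih eh]; split; first exact: measurable_funD.
  by apply: eq_integrable (integrableD mD ig ih) => // x _ /=; rewrite EFinD.
by rewrite EFinD -eg -eh -integralD_EFin.
Qed.

Lemma isint_sum D (t : nat -> T -> R) (I : nat -> R) n : measurable D ->
  (forall k, isint D (t k) (I k)) -> isint D (fun x => \sum_(k < n) t k x) (\sum_(k < n) I k).
Proof.
move=> mD H; elim: n => [|n IH].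
  rewrite big_ord0; apply: (@isint_ext D (fun _ => 0)) => // [|x _|]; rewrite ?big_ord0//.
    by under eq_fun do rewrite big_ord0; exact: measurable_cst.
  apply: isint_ge0 => //; by rewrite integral0.
rewrite big_ord_recr /=; under eq_fun do rewrite big_ord_recr /=.
exact: isintD.
Qed.

Lemma isint_le D g h J : measurable D -> measurable_fun setT g ->
  (forall x, D x -> `|g x| <= h x) -> isint D h J -> exists I, isint D g I.
Proof.
move=> mD mg gh [mh ih _]; have ig : mu.-integrable D (EFin \o g).
  apply: le_integrable ih => //; first exact: meas_E.
  move=> x Dx /=; rewrite lee_fin; apply: le_trans (gh x Dx) _; exact: ler_norm.
exists (fine (\int[mu]_(x in D) (g x)%:E)%E); split=> //.
by rewrite fineK//; apply: integrable_fin_num.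
Qed.

Lemma isint_mono D g h I J : measurable D -> (forall x, D x -> g x <= h x) ->
  isint D g I -> isint D h J -> I <= J.
Proof.
move=> mD gh [mg ig eg] [mh ih eh]; rewrite -lee_fin -eg -eh.
by apply: le_integral => // x; rewrite inE => /gh; rewrite lee_fin.
Qed.

Lemma isint_sub D D' g I : measurable D -> measurable D' -> D' `<=` D -> isint D g I ->
  exists I', isint D' g I'.
Proof.
move=> mD mD' sub [mg ig _]; have ig' : mu.-integrable D' (EFin \o g) by apply: integrableS ig.
exists (fine (\int[mu]_(x in D') (g x)%:E)%E); split=> //.
by rewrite fineK//; apply: integrable_fin_num.
Qed.

Lemma isint_split (a c : itv_bound R) b g I J : measurable_fun setT g -> (forall x, 0 <= g x) ->
  (a <= BLeft b)%O -> (BLeft b <= c)%O ->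
  isint [set` Interval a (BRight b)] g I -> isint [set` Interval (BLeft b) c] g J ->
  isint [set` Interval a c] g (I + J).
Proof.
move=> mg g0 ab bc [_ _ e1] [_ _ e2]; apply: isint_ge0 => //.
rewrite (itv_bndbnd_setU ab bc) ge0_integral_setU//=.
- rewrite integral_itv_bndo_bndc ?e1 ?e2//; exact: meas_E.
- exact: meas_E.
- by move=> x _; rewrite lee_fin.
apply/disj_setPS => x [] /=; rewrite !in_itv /= => /andP[_ h1] /andP[h2 _].
by move: h1; rewrite ltNge h2.
Qed.

(** Monotone convergence. *)
Lemma int_series D (t : nat -> T -> R) g : measurable D -> (forall k, measurable_fun setT (t k)) ->
  (forall k x, 0 <= t k x) -> (forall x, D x -> (fun n => \sum_(k < n) t k x) @ \oo --> g x) ->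
  (\int[mu]_(x in D) (g x)%:E = \sum_(k <oo) \int[mu]_(x in D) (t k x)%:E)%E.
Proof.
move=> mD mt t0 H; rewrite -integral_nneseries//; first last.
- by move=> k x _; rewrite lee_fin.
- by move=> k; exact: meas_E.
apply: eq_integral => x; rewrite inE => /H cx; apply/esym/cvg_lim => //.
under eq_fun do rewrite sumEFin big_mkord.
by apply: cvg_EFin cx; apply: nearW.
Qed.

Lemma isint_series D (t : nat -> T -> R) g (I : nat -> R) (J : R) : measurable D ->
  (forall k x, 0 <= t k x) -> (forall x, D x -> (fun n => \sum_(k < n) t k x) @ \oo --> g x) ->
  measurable_fun setT g -> (forall k, isint D (t k) (I k)) ->
  (fun n => \sum_(k < n) I k) @ \oo --> J -> isint D g J.
Proof.
move=> mD t0 H mg Ht HJ; apply: isint_ge0 => //.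
  move=> x Dx; rewrite -(cvg_lim _ (H x Dx))//; apply: limr_ge; first exact: cvgP (H x Dx).
  by apply: nearW => n; apply: sumr_ge0.
rewrite (int_series mD _ t0 H); last by move=> k; have [] := Ht k.
apply/cvg_lim => //.
have -> : (fun n => \sum_(0 <= k < n) \int[mu]_(x in D) (t k x)%:E)%E = (fun n => (\sum_(k < n) I k)%:E).
  apply/funext => n; rewrite big_mkord -sumEFin; apply: eq_bigr => k _; by have [] := Ht k.
by apply: cvg_EFin HJ; apply: nearW.
Qed.

Lemma isint_dominated D (t : nat -> T -> R) g (G : T -> R) (I : nat -> R) B : measurable D ->
  (forall x, D x -> (fun n => \sum_(k < n) t k x) @ \oo --> g x) ->
  measurable_fun setT g -> (forall k, isint D (t k) (I k)) -> isint D G B ->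
  (forall x n, D x -> `|\sum_(k < n) t k x| <= G x) ->
  exists2 J, isint D g J & (fun n => \sum_(k < n) I k) @ \oo --> J.
Proof.
move=> mD H mg Ht [mG iG _] HG.
have S n := isint_sum n mD Ht.
have [|||||ig _ cv] := @dominated_convergence _ _ _ mu D mD
  (fun n x => (\sum_(k < n) t k x)%:E) (EFin \o g) (EFin \o G).
- by move=> n; have [m _ _] := S n; exact: meas_E.
- exact: meas_E.
- by apply: aeW => x Dx; apply: cvg_EFin (H x Dx); apply: nearW.
- exact: iG.
- by apply: aeW => x n Dx; rewrite /= lee_fin HG.
exists (fine (\int[mu]_(x in D) (g x)%:E)%E); first split=> //.
  by rewrite fineK//; apply: integrable_fin_num.
suff cv' : (fun n => (\sum_(k < n) I k)%:E) @ \oo --> (fine (\int[mu]_(x in D) (g x)%:E)%E)%:E.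
  exact: (fine_cvg cv').
rewrite fineK; last by apply: integrable_fin_num.
suff -> : (fun n => (\sum_(k < n) I k)%:E) = (fun n => \int[mu]_(x in D) (\sum_(k < n) t k x)%:E)%E by exact: cv.
by apply/funext => n; have [_ _ ->] := S n.
Qed.

Lemma decay (F : R -> R) (C : R) : (forall x, 0 < x -> `|F x| * x <= C) -> F x @[x --> +oo] --> (0 : R).
Proof.
move=> H; apply/cvgrPdist_le => e e0; near=> x; rewrite sub0r normrN.
have x0 : 0 < x by near: x; apply: nbhs_pinfty_gt; exact: num_real.
have xC : C / e <= x by near: x; apply: nbhs_pinfty_ge; exact: num_real.
rewrite -(ler_pM2r x0); apply: le_trans (H x x0) _.
by rewrite mulrC -ler_pdivrMr.
Unshelve. all: by end_near.
Qed.

Lemma ftc_decay (f F : R -> R) (a C : R) : continuous f -> (forall x, a <= x -> 0 <= f x) ->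
  (forall x, is_derive x (1 : R) F (f x)) -> (forall x, 0 < x -> `|F x| * x <= C) ->
  isint `[a, +oo[ f (- F a).
Proof.
move=> fc f0 dF HC; apply: isint_ge0 => //.
- exact: continuous_measurable_fun.
- by move=> x; rewrite /= in_itv /= andbT; exact: f0.
have Fc : continuous F.
  by move=> x; apply: differentiable_continuous; apply/derivable1_diffP; have [] := dF x.
have dd x : a < x -> derivable F x 1 by move=> _; have [] := dF x.
have de : {in `]a, +oo[, derive1 F =1 f} by move=> x _; rewrite derive1E; have [] := dF x.
have fw : {within `[a, +oo[, continuous f} by exact: continuous_subspaceT.
rewrite (ge0_continuous_FTC2y f0 fw (decay HC) dd _ de); last exact: cvg_at_right_filter (Fc a).
by rewrite -EFinB sub0r.
Qed.

Lemma exp_mul_le (b x : R) : 0 < b -> 0 < x -> expR (- b * x) * x <= b^-1.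
Proof.
move=> b0 x0; rewrite mulNr expRN mulrC ler_pdivrMr ?expR_gt0// mulrC ler_pdivlMr//.
by apply: le_trans (expR_ge1Dx _); rewrite mulrC lerDr.
Qed.

Lemma exp_mul2_le (b x : R) : 0 < b -> 0 < x -> expR (- b * x) * x * x <= 4 / b ^+ 2.
Proof.
move=> b0 x0; have b2 : 0 < b / 2 by rewrite divr_gt0.
have -> : expR (- b * x) * x * x = (expR (- (b / 2) * x) * x) * (expR (- (b / 2) * x) * x).
  have -> : - b * x = - (b / 2) * x + - (b / 2) * x by field.
  by rewrite expRD; ring.
have h := exp_mul_le b2 x0; have e0 : 0 <= expR (- (b / 2) * x) * x by rewrite mulr_ge0 ?expR_ge0 ?ltW.
apply: le_trans (ler_pM e0 e0 h h) _; rewrite le_eqVlt; apply/orP; left; apply/eqP.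
by field; rewrite gt_eqF.
Qed.

Lemma cont_exp (b : R) : continuous (fun x : R => expR (b * x)).
Proof.
move=> x; apply: (@continuous_comp _ _ _ (fun x : R => b * x) (@expR R)); last exact: continuous_expR.
by apply: cvgM; [exact: cvg_cst|exact: cvg_id].
Qed.

Lemma isint_exp (b l : R) : 0 < b -> isint `[l, +oo[ (fun x => expR (- b * x)) (expR (- b * l) / b).
Proof.
move=> b0; have := @ftc_decay (fun x => expR (- b * x)) (fun x => - (b^-1 * expR (- b * x))) l (b^-1 * b^-1).
have -> : - - (b^-1 * expR (- b * l)) = expR (- b * l) / b by rewrite opprK mulrC.
apply.
- exact: cont_exp.
- by move=> x _; exact: expR_ge0.
- move=> x; apply: is_derive_eq; rewrite /GRing.scale /=; field; exact: lt0r_neq0.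
move=> x x0; rewrite normrN normrM (ger0_norm (expR_ge0 _)) ger0_norm ?invr_ge0 ?(ltW b0)//.
by rewrite -mulrA ler_pM2l ?invr_gt0//; exact: exp_mul_le.
Qed.

Lemma isint_expN (b l : R) : 0 < b -> isint `]-oo, l] (fun x => expR (b * x)) (expR (b * l) / b).
Proof.
move=> b0; have [_ _ e] := isint_exp (- l) b0.
apply: isint_ge0 => //.
  by apply: continuous_measurable_fun; exact: cont_exp.
have := @ge0_integration_by_substitutionNy R (fun x => expR (b * x)) (- l).
rewrite opprK => ->; last 2 first.
- by apply: continuous_subspaceT; exact: cont_exp.
- by move=> x _; exact: expR_ge0.
move: e; rewrite mulrNN => <-; apply: eq_integral => x _ /=.
by rewrite mulrN mulNr.
Qed.

Lemma isint_linexp (s l : R) : 0 < s ->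
  isint `[l, +oo[ (fun x => (x - l) * expR (- s * x)) (expR (- s * l) / s ^+ 2).
Proof.
move=> s0.
have := @ftc_decay (fun x => (x - l) * expR (- s * x))
  (fun x => - (((x - l) / s + s^-1 ^+ 2) * expR (- s * x))) l
  (4 / s ^+ 2 / s + (`|l| / s + s^-1 ^+ 2) * s^-1).
have -> : - - (((l - l) / s + s^-1 ^+ 2) * expR (- s * l)) = expR (- s * l) / s ^+ 2.
  by field; exact: lt0r_neq0.
apply.
- move=> x; apply: cvgM; last exact: cont_exp.
  by apply: cvgB; [exact: cvg_id|exact: cvg_cst].
- by move=> x h; rewrite mulr_ge0 ?expR_ge0// subr_ge0.
- move=> x; apply: is_derive_eq; rewrite /GRing.scale /=; field; exact: lt0r_neq0.
move=> x x0; rewrite normrN normrM (ger0_norm (expR_ge0 _)).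
have si : 0 < s^-1 by rewrite invr_gt0.
have h1 := exp_mul_le s0 x0; have h2 := exp_mul2_le s0 x0; have e0 := expR_gt0 (- s * x).
have n1 : `|(x - l) / s + s^-1 ^+ 2| <= x / s + (`|l| / s + s^-1 ^+ 2).
  apply: le_trans (ler_normD _ _) _; rewrite addrA lerD//; last by rewrite ger0_norm// exprn_ge0// ltW.
  rewrite normrM (gtr0_norm si) -mulrDl ler_pM2r//.
  by apply: le_trans (ler_normB _ _) _; rewrite gtr0_norm.
apply: le_trans (ler_wpM2r (ltW x0) (ler_wpM2r (ltW e0) n1)) _.
rewrite mulrDl mulrDl lerD//.
  rewrite (_ : x / s * _ * x = (expR (- s * x) * x * x) / s); last by ring.
  by rewrite ler_pM2r.
rewrite -mulrA ler_wpM2l// addr_ge0 ?exprn_ge0 ?divr_ge0 ?(ltW s0) ?(ltW si)//.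
Qed.

Lemma int_shift (f : R -> R) (L : R) : continuous f -> (forall x, 0 <= f x) ->
  (\int[mu]_(x in `[L, +oo[) (f x)%:E = \int[mu]_(x in `[0%R, +oo[) (f (x + L))%:E)%E.
Proof.
move=> fc f0; have dF (x : R) : is_derive x (1 : R) (fun y : R => y + L) (1 : R).
  by apply: is_derive_eq; rewrite addr0.
have dE : derive1 (fun y : R => y + L) = cst 1.
  by apply/funext => x; rewrite derive1E; have [_ ->] := dF x.
have := @increasing_ge0_integration_by_substitutiony R (fun y : R => y + L) f 0.
rewrite add0r dE => ->.
- by apply: eq_integral => x _ /=; rewrite mulr1.
- by move=> x y _ _ xy; rewrite ltrD2r.
- by move=> x _; exact: cvg_cst.
- exact: is_cvg_cst.
- exact: is_cvg_cst.
- split=> [x _|]; first by have [] := dF x.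
  apply: cvg_at_right_filter; apply: cvgD; [exact: cvg_id|exact: cvg_cst].
- by apply: cvg_addrr.
- exact: continuous_subspaceT.
by move=> x _.
Qed.
End Integrals.

(** * The Mellin transform of the logarithm of the determinant *)

Section LogSeries.
Variable R : realType.
Notation mu := (@lebesgue_measure R).

Definition aln j : R := (-1) ^+ j / j.+1%:R.

(** The derivative of the difference is (- x)^n / (1 + x), at most x^n.  The
    factor 1 / (n + 1) is what gives convergence at z = 1. *)
Lemma ln_series n (z : R) : 0 <= z <= 1 ->
  `|ln (1 + z) - \sum_(j < n) aln j * z ^+ j.+1| <= z ^+ n.+1 / n.+1%:R.
Proof.
move=> /andP[z0 z1].
have dX m (x : R) : is_derive x (1 : R) (fun y : R => y ^+ m.+1) (m.+1%:R * x ^+ m).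
  apply: DeriveDef; first exact: exprn_derivable.
  by rewrite exp_derive /= /GRing.scale /= mulr1.
have dS m (x : R) : is_derive x (1 : R) (fun x => \sum_(j < m) aln j * x ^+ j.+1) (\sum_(j < m) (- x) ^+ j).
  elim: m => [|m IH].
    by rewrite big_ord0; under eq_fun do rewrite big_ord0; exact: is_derive_cst.
  rewrite big_ord_recr /=; under eq_fun do rewrite big_ord_recr /=.
  have d2 := is_deriveZ (aln m) (dX m x).
  apply: (is_derive_eq (is_deriveD IH d2)).
  congr (_ + _); rewrite /GRing.scale /= /aln [(- x) ^+ m]exprNn; field.
  by rewrite gt_eqF// ltr0n.
have geo (x : R) : 0 <= x -> (1 + x)^-1 - \sum_(j < n) (- x) ^+ j = (- x) ^+ n / (1 + x).
  move=> x0; have h : 1 + x != 0 by rewrite gt_eqF//; lra.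
  apply: (mulIf h); rewrite mulrBl mulVf// mulfVK//.
  have := subrX1 (- x) n; set S := \sum_(i < n) _ => e; have -> : (- x) ^+ n = (- x - 1) * S + 1 by rewrite -e subrK.
  ring.
have key (sg : R) : sg = 1 \/ sg = -1 ->
    0 <= z ^+ n.+1 / n.+1%:R + sg * (ln (1 + z) - \sum_(j < n) aln j * z ^+ j.+1).
  move=> hsg; pose g x := n.+1%:R^-1 * x ^+ n.+1 + sg * (ln (1 + x) - \sum_(j < n) aln j * x ^+ j.+1).
  have dg (x : R) : -1 < x -> is_derive x (1 : R) g (x ^+ n + sg * ((1 + x)^-1 - \sum_(j < n) (- x) ^+ j)).
    move=> x1; have x1' : 0 < 1 + x by lra.
    have dl : is_derive x (1 : R) (fun y : R => ln (1 + y)) (1 + x)^-1.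
      have d1 : is_derive x (1 : R) (fun y : R => 1 + y) (1 : R).
        apply: (is_derive_eq (is_deriveD (is_derive_cst (1 : R) x (1 : R)) (is_derive_id x (1 : R)))).
        by rewrite add0r.
      apply: (is_derive_eq (is_derive1_comp (is_derive1_ln x1') d1)).
      by rewrite /GRing.scale /= ?mulr1 ?mul1r.
    have d3 := is_deriveD (is_deriveZ n.+1%:R^-1 (dX n x)) (is_deriveZ sg (is_deriveB dl (dS n x))).
    apply: (is_derive_eq d3); rewrite /GRing.scale /=; congr (_ + _).
    by rewrite mulrA mulVf ?mul1r// pnatr_eq0.
  have gc : {within `[0, 1], continuous g}.
    apply: derivable_within_continuous => x; rewrite in_itv /= => /andP[x0 _].
    by have [] := dg x (lt_le_trans (ltrN10 _) x0).
  have g0 : g 0 = 0.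
    rewrite /g exprS mul0r mulr0 add0r addr0 ln1 big1 ?subr0 ?mulr0// => j _.
    by rewrite exprS mul0r mulr0.
  have -> : z ^+ n.+1 / n.+1%:R + sg * (ln (1 + z) - \sum_(j < n) aln j * z ^+ j.+1) = g z.
    by rewrite /g [n.+1%:R^-1 * _]mulrC.
  have d01 x : x \in `]0, 1[%R -> derivable g x 1.
    by rewrite in_itv /= => /andP[x0 _]; have [] := dg x (lt_trans (ltrN10 _) x0).
  suff d02 x : x \in `]0, 1[%R -> 0 <= derive1 g x.
    have in0 : (0 : R) \in `[0, 1]%R by rewrite in_itv /= lexx ler01.
    have inz : z \in `[0, 1]%R by rewrite in_itv /= z0 z1.
    by rewrite -g0; exact: (ger0_derive1_le_cc d01 d02 gc in0 inz z0).
  rewrite in_itv /= => /andP[x0 _].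
  rewrite derive1E; have [_ ->] := dg x (lt_trans (ltrN10 _) x0).
  rewrite geo ?(ltW x0)// exprNn -mulrA.
  have xn : 0 <= x ^+ n by rewrite exprn_ge0// ltW.
  have hx : `|sg * ((-1) ^+ n * (x ^+ n / (1 + x)))| <= x ^+ n.
    rewrite !normrM normrX normrN normr1 expr1n mul1r normfV (ger0_norm xn) (ger0_norm (_ : 0 <= 1 + x)); last lra.
    have -> : `|sg| = 1 by case: hsg => ->; rewrite ?normrN normr1.
    by rewrite mul1r ler_pdivrMr ?ler_peMr//; lra.
  by move: hx; rewrite ler_norml => /andP[h _]; lra.
have k1 := key 1 (or_introl erefl); have k2 := key (-1) (or_intror erefl).
rewrite ler_norml; move: k1 k2; move: (\sum_(_ < n) _) (ln _) (_ / _) => S y x k1 k2.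
by apply/andP; split; lra.
Qed.

Lemma ln_series_cvg (z : R) : 0 <= z <= 1 -> (fun n => \sum_(j < n) aln j * z ^+ j.+1) @ \oo --> ln (1 + z).
Proof.
move=> hz; have [z0 z1] := andP hz; apply/cvgrPdist_le => e e0.
exists (Num.truncn e^-1).+1 => // n /= hn; apply: le_trans (ln_series n hz) _.
apply: (@le_trans _ _ n.+1%:R^-1).
  by rewrite ler_piMl ?invr_ge0// exprn_ile1.
rewrite invf_ple ?posrE ?ltr0n//; apply: ltW; apply: lt_le_trans (Num.Theory.truncnS_gt _) _.
by rewrite ler_nat ltnW.
Qed.

Lemma ln_series_le n (z : R) : 0 <= z <= 1 -> `|\sum_(j < n) aln j * z ^+ j.+1| <= 2 * z.
Proof.
move=> hz; have [z0 z1] := andP hz; have h := ln_series n hz.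
have l1 : ln (1 + z) <= z by rewrite le_ln1Dx//; lra.
have l0 : 0 <= ln (1 + z) by rewrite ln_ge0// lerDl.
have h2 : z ^+ n.+1 / n.+1%:R <= z.
  apply: (@le_trans _ _ (z ^+ n.+1)).
    by rewrite ler_pdivrMr ?ltr0n// ler_peMr ?exprn_ge0// ler1n.
  by rewrite exprS ler_piMr// exprn_ile1.
move: h l1 l0 h2; rewrite !ler_norml; move: (\sum_(_ < n) _) (ln _) (_ / _) => S y x.
by move=> /andP[a b] l1 l0 h2; apply/andP; split; lra.
Qed.

Lemma meas_ln1 (l : R) : measurable_fun setT (fun u : R => ln (1 + expR (u - l))).
Proof.
apply: (@measurableT_comp _ _ _ _ _ _ (@ln R)); first exact: measurable_ln.
apply: measurable_funD; first exact: measurable_cst.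
apply: (@measurableT_comp _ _ _ _ _ _ (@expR R)); first exact: measurable_expR.
exact: measurable_funB.
Qed.

Lemma meas_exp (s : R) : measurable_fun setT (fun u : R => expR (s * u)).
Proof. by apply: continuous_measurable_fun; exact: cont_exp. Qed.

(** Left of l the logarithm is expanded in powers of e^(u - l) and
    integrated term by term; the partial sums are dominated by twice the
    first power. *)
Lemma left_integral (s c l : R) : s < 1 -> c <= l ->
  exists2 J, isint `]-oo, c] (fun u => expR (- s * u) * ln (1 + expR (u - l))) J &
  (fun n => \sum_(j < n) aln j * expR (- j.+1%:R * l) * (expR ((j.+1%:R - s) * c) / (j.+1%:R - s))) @ \oo --> J.
Proof.
move=> s1 cl.
have js j : 0 < j.+1%:R - s by have := ler0n R j; rewrite -natr1; lra.
have mc : measurable (`]-oo, c] : set (measurableTypeR R)) by exact: measurable_itv.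
have z1 u : u <= c -> 0 <= expR (u - l) <= 1.
  by move=> uc; rewrite expR_ge0/= -[leRHS]expR0 ler_expR; lra.
have E n u : \sum_(k < n) aln k * expR (- k.+1%:R * l) * expR ((k.+1%:R - s) * u) =
    expR (- s * u) * \sum_(k < n) aln k * expR (u - l) ^+ k.+1.
  rewrite mulr_sumr; apply: eq_bigr => k _; rewrite -expRM_natl mulrCA -mulrA -!expRD; congr (_ * expR _); ring.
have [|||||J HJ cJ] := (@isint_dominated R _ (fun j (u : R) => aln j * expR (- j.+1%:R * l) * expR ((j.+1%:R - s) * u))
   (fun u : R => expR (- s * u) * ln (1 + expR (u - l))) (fun u : R => (2 * expR (- l)) * expR ((1 - s) * u))
   (fun j => aln j * expR (- j.+1%:R * l) * (expR ((j.+1%:R - s) * c) / (j.+1%:R - s)))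
   ((2 * expR (- l)) * (expR ((1 - s) * c) / (1 - s))) mc).
- move=> u; rewrite /= in_itv /= => /z1 hz; under eq_fun do rewrite E.
  by apply: cvgM; [exact: cvg_cst|exact: ln_series_cvg].
- by apply: measurable_funM; [exact: meas_exp|exact: meas_ln1].
- by move=> k; apply: isintZ => //; exact: isint_expN.
- by apply: isintZ => //; apply: isint_expN; rewrite subr_gt0.
- move=> u n; rewrite /= in_itv /= => /z1 hz; rewrite E normrM ger0_norm ?expR_ge0//.
  have -> : 2 * expR (- l) * expR ((1 - s) * u) = expR (- s * u) * (2 * expR (u - l)).
    have -> : (1 - s) * u = - s * u + u by ring.
    by rewrite !expRD; ring.
  by rewrite ler_wpM2l ?expR_ge0// ln_series_le.
by exists J.
Qed.

(** Right of l the linear part u - l splits off and the rest is expanded in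
    powers of e^(l - u). *)
Lemma right_integral (s l : R) : 0 < s ->
  exists2 J, isint `[l, +oo[ (fun u => expR (- s * u) * ln (1 + expR (u - l))) (expR (- s * l) / s ^+ 2 + J) &
  (fun n => \sum_(j < n) aln j * expR (j.+1%:R * l) * (expR (- (j.+1%:R + s) * l) / (j.+1%:R + s))) @ \oo --> J.
Proof.
move=> s0.
have js j : 0 < j.+1%:R + s by rewrite addr_gt0// ltr0n.
have mc : measurable (`[l, +oo[ : set (measurableTypeR R)) by exact: measurable_itv.
have z1 u : l <= u -> 0 <= expR (l - u) <= 1.
  by move=> uc; rewrite expR_ge0/= -[leRHS]expR0 ler_expR; lra.
have E n u : \sum_(k < n) aln k * expR (k.+1%:R * l) * expR (- (k.+1%:R + s) * u) =
    expR (- s * u) * \sum_(k < n) aln k * expR (l - u) ^+ k.+1.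
  rewrite mulr_sumr; apply: eq_bigr => k _; rewrite -expRM_natl mulrCA -mulrA -!expRD; congr (_ * expR _); ring.
have mN : measurable_fun setT (fun u : R => expR (- s * u) * ln (1 + expR (l - u))).
  apply: measurable_funM; first exact: meas_exp.
  apply: (@measurableT_comp _ _ _ _ _ _ (@ln R)); first exact: measurable_ln.
  apply: measurable_funD; first exact: measurable_cst.
  apply: (@measurableT_comp _ _ _ _ _ _ (@expR R)); first exact: measurable_expR.
  exact: measurable_funB.
have [||||J HJ cJ] := (@isint_dominated R _ (fun j u => aln j * expR (j.+1%:R * l) * expR (- (j.+1%:R + s) * u))
   (fun u : R => expR (- s * u) * ln (1 + expR (l - u)))
   (fun u => (2 * expR l) * expR (- (1 + s) * u))
   (fun j => aln j * expR (j.+1%:R * l) * (expR (- (j.+1%:R + s) * l) / (j.+1%:R + s)))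
   (2 * expR l * (expR (- (1 + s) * l) / (1 + s))) mc _ mN).
- move=> u; rewrite /= in_itv /= andbT => /z1 hz; under eq_fun do rewrite E.
  by apply: cvgM; [exact: cvg_cst|exact: ln_series_cvg].
- by move=> k; apply: isintZ => //; exact: isint_exp.
- by apply: isintZ => //; apply: isint_exp; rewrite addr_gt0.
- move=> u n; rewrite /= in_itv /= andbT => /z1 hz; rewrite E normrM ger0_norm ?expR_ge0//.
  have -> : 2 * expR l * expR (- (1 + s) * u) = expR (- s * u) * (2 * expR (l - u)).
    have -> : - (1 + s) * u = - s * u - u by ring.
    by rewrite !expRD; ring.
  by rewrite ler_wpM2l ?expR_ge0// ln_series_le.
exists J => //; apply: isint_ext (isintD mc (isint_linexp l s0) HJ) => //.
  by apply: measurable_funM; [exact: meas_exp|exact: meas_ln1].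
move=> u _; rewrite mulrC -mulrDr; congr (_ * _).
have -> : 1 + expR (u - l) = expR (u - l) * (1 + expR (l - u)).
  by rewrite mulrDr mulr1 -expRD addrC (_ : u - l + (l - u) = 0) ?expR0//; ring.
by rewrite lnM ?posrE ?expR_gt0 ?expRK// addr_gt0// expR_gt0.
Qed.

(** The Laplace transform of a rapidly decreasing function is entire; its
    coefficients are the moments. *)
Lemma moments (D : set (measurableTypeR R)) (g : R -> R) : measurable D ->
  D `<=` `[0, +oo[ -> measurable_fun setT g -> (forall u, D u -> 0 <= g u) ->
  (forall r, 0 <= r -> exists C, forall u, D u -> expR (r * u) * g u <= C * expR (- 1 * u)) ->
  exists m : nat -> R, (forall r, 0 < r -> exists B, forall n, \sum_(j < n) `|m j| * r ^+ j <= B) /\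
  forall s, 0 <= s -> exists2 J, isint D (fun u => expR (- s * u) * g u) J &
    (fun n => \sum_(j < n) (-1) ^+ j * m j * s ^+ j) @ \oo --> J.
Proof.
move=> mD D0 mg g0 HC.
have m0 : measurable (`[0, +oo[ : set (measurableTypeR R)) by exact: measurable_itv.
have Dge u : D u -> 0 <= u by move/D0; rewrite /= in_itv /= andbT.
have [I0 HI0] := isint_sub m0 mD D0 (isint_exp 0 (ltr01 : 0 < 1 :> R)).
have dom (f : R -> R) r : 0 <= r -> measurable_fun setT f -> (forall u, D u -> `|f u| <= expR (r * u) * g u) ->
    exists I, isint D f I.
  move=> r0 mf hf; have [C C1] := HC r r0.
  apply: (isint_le mD mf _ (isintZ C mD HI0)) => u Du.
  exact: le_trans (hf u Du) (C1 u Du).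
have mX j : measurable_fun setT (fun u : R => u ^+ j / j`!%:R).
  by apply: measurable_funM => //; exact: measurable_funX.
have pow_le (x : R) j : 0 <= x -> x ^+ j / j`!%:R <= expR x.
  move=> x0; apply: le_trans (exp_partial j.+1 x0); rewrite big_ord_recr /= lerDr.
  by apply: sumr_ge0 => i _; rewrite divr_ge0// exprn_ge0.
have exm j : exists m, isint D (fun u => u ^+ j / j`!%:R * g u) m.
  apply: (@dom _ 1) => //; first exact: measurable_funM.
  move=> u Du; have u0 := Dge u Du; have gu := g0 u Du.
  by rewrite ger0_norm ?mulr_ge0 ?divr_ge0 ?exprn_ge0// ler_wpM2r// mul1r pow_le.
have [m Hm] := choice exm.
have m_ge0 j : 0 <= m j.
  rewrite -lee_fin; have [_ _ <-] := Hm j; apply: integral_ge0 => u Du.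
  by rewrite lee_fin mulr_ge0 ?g0// divr_ge0// exprn_ge0// Dge.
have expI r : exists I, isint D (fun u => expR (r * u) * g u) I.
  apply: (@dom _ `|r|) => //; first by apply: measurable_funM => //; exact: meas_exp.
  move=> u Du; rewrite ger0_norm ?mulr_ge0 ?expR_ge0 ?g0// ler_wpM2r ?g0// ler_expR.
  by rewrite ler_wpM2r ?Dge// ler_norm.
exists m; split.
  move=> r r0; have [B HB] := expI r; exists B => n.
  have S := isint_sum n mD (fun j => isintZ (r ^+ j) mD (Hm j)).
  have le u : D u -> \sum_(k < n) r ^+ k * (u ^+ k / k`!%:R * g u) <= expR (r * u) * g u.
    move=> Du; under eq_bigr do rewrite mulrA; rewrite -mulr_suml ler_wpM2r ?g0//.
    apply: le_trans (exp_partial n _); last by rewrite mulr_ge0 ?(ltW r0)// Dge.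
    by apply: ler_sum => j _; rewrite exprMn mulrA.
  have := isint_mono mD le S HB; congr (_ <= _).
  by apply: eq_bigr => j _; rewrite ger0_norm// mulrC.
move=> s s0; have [B HB] := expI s.
have [||||J HJ cJ] := @isint_dominated R D (fun j u => ((- s) ^+ j) * (u ^+ j / j`!%:R * g u))
  (fun u => expR (- s * u) * g u) (fun u => expR (s * u) * g u) (fun j => (- s) ^+ j * m j) B mD _ _ _ HB.
- move=> u Du; under eq_fun do (under eq_bigr do rewrite !mulrA -exprMn); under eq_fun do rewrite -mulr_suml.
  apply: cvgM; last exact: cvg_cst.
  have c := is_cvg_series_exp_coeff (- s * u).
  suff -> : (fun n => \sum_(k < n) (- s * u) ^+ k / k`!%:R) = series (exp_coeff (- s * u)) by exact: c.
  by apply/funext => n; rewrite /series /= big_mkord.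
- by apply: measurable_funM => //; exact: meas_exp.
- by move=> j; exact: isintZ.
- move=> u n Du; have u0 := Dge u Du; apply: le_trans (ler_norm_sum _ _ _) _.
  apply: (@le_trans _ _ ((\sum_(k < n) (s * u) ^+ k / k`!%:R) * g u)); last first.
    by rewrite ler_wpM2r ?g0// exp_partial// mulr_ge0.
  rewrite mulr_suml; apply: ler_sum => j _.
  rewrite normrM normrX normrN (ger0_norm s0) ger0_norm; last by rewrite mulr_ge0 ?g0// divr_ge0// exprn_ge0.
  by rewrite exprMn !mulrA.
exists J => //; suff -> : (fun n => \sum_(j < n) (-1) ^+ j * m j * s ^+ j) = (fun n => \sum_(j < n) (- s) ^+ j * m j) by [].
by apply/funext => n; apply: eq_bigr => j _; rewrite [in RHS]exprNn mulrAC.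
Qed.
End LogSeries.

Section Mellin.
Variable R : realType.
Variables p q : R.
Hypothesis hp : 0 < p < 1.
Hypothesis hq : q = 1 - p.
Let LL : R := ln (lambda p q).
Let KK : R := LL + 2 * ln (p * q).
Notation mu := (@lebesgue_measure R).

Definition logs k : R := ln (nu p q k.+1).
Definition phi (u : R) := logdet p q (expR u).
Let T k (u : R) : R := ln (1 + expR (u - logs k)).
Let g s (u : R) : R := expR (- s * u) * phi u.

Lemma expR_logs k : expR (logs k) = nu p q k.+1.
Proof. by rewrite lnK ?posrE// nuS_gt0. Qed.

Lemma logs_ge k : ln 4 <= logs k.
Proof. by rewrite ler_ln ?posrE ?nuS_gt0//; exact: nu_ge4. Qed.

Lemma logs_ge0 k : 0 <= logs k.
Proof. by apply: le_trans (logs_ge k); rewrite ln_ge0// ler1n. Qed.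

Let LL0 : 0 < LL.
Proof. by rewrite ln_gt0//; have := lam9 hp hq; lra. Qed.

Let T_ge0 k u : 0 <= T k u.
Proof. by rewrite ln_ge0// lerDl expR_ge0. Qed.

Let phi_cvg u : (fun n => \sum_(k < n) T k u) @ \oo --> phi u.
Proof.
have := logdet_cvg hp hq (expR_ge0 u).
suff -> : (fun n => \sum_(k < n) ln (1 + expR u / nu p q k.+1)) = (fun n => \sum_(k < n) T k u) by [].
by apply/funext => n; apply: eq_bigr => k _; rewrite /T expRB expR_logs.
Qed.

Let gT_cvg s u : (fun n => \sum_(k < n) expR (- s * u) * T k u) @ \oo --> g s u.
Proof. by under eq_fun do rewrite -mulr_sumr; apply: cvgM; [exact: cvg_cst|exact: phi_cvg]. Qed.

Let meas_phi : measurable_fun setT phi.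
Proof.
apply: (@measurable_realfun.measurable_fun_cvg _ _ _ _ (fun n (u : R) => \sum_(k < n) T k u)).
  by move=> n; apply: measurable_sum => k; exact: meas_ln1.
by move=> u _; exact: phi_cvg.
Qed.

Let phi_ge0 u : 0 <= phi u.
Proof.
rewrite -(cvg_lim _ (@phi_cvg u))//; apply: limr_ge; first exact: cvgP (@phi_cvg u).
by apply: nearW => n; apply: sumr_ge0.
Qed.

Let meas_g s : measurable_fun setT (g s).
Proof. by apply: measurable_funM; [exact: meas_exp|exact: meas_phi]. Qed.

Let g_ge0 s u : 0 <= g s u.
Proof. by rewrite /g mulr_ge0 ?expR_ge0 ?phi_ge0. Qed.

Let gT_ge0 s k u : 0 <= expR (- s * u) * T k u.
Proof. by rewrite mulr_ge0 ?expR_ge0. Qed.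

Definition poles s := fun n => \sum_(j < n) aln R j / (j.+1%:R - s).

Let poles_cvg (s : R) : s < 1 -> cvgn (poles s).
Proof.
move=> s1; have [J _] := left_integral s1 (lexx 0).
suff -> : (fun n => \sum_(j < n) aln R j * expR (- j.+1%:R * 0) * (expR ((j.+1%:R - s) * 0) / (j.+1%:R - s))) = poles s.
  exact: cvgP.
by apply/funext => n; apply: eq_bigr => j _; rewrite !mulr0 expR0 mulr1 mul1r.
Qed.

Let Ps s : R := limn (poles s).

Let T_integral (s : R) k : 0 < s < 1 ->
  isint `]-oo, +oo[ (fun u => expR (- s * u) * T k u) (expR (- s * logs k) * (s^-1 ^+ 2 + (Ps s + Ps (- s)))).
Proof.
move=> /andP[s0 s1]; set l := logs k; have ns1 : - s < 1 by lra.
have js j : 0 < j.+1%:R - s by have := ler0n R j; rewrite -natr1; lra.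
have js' j : 0 < j.+1%:R + s by have := ler0n R j; rewrite -natr1; lra.
have [J1 H1 c1] := left_integral s1 (lexx l).
have [J2 H2 c2] := right_integral l s0.
have sc s' : s' < 1 -> (fun n => expR (- s * l) * poles s' n) @ \oo --> expR (- s * l) * Ps s'.
  by move=> h; apply: cvgM; [exact: cvg_cst|exact: poles_cvg].
have e1 : J1 = expR (- s * l) * Ps s.
  apply: (cvg_unique _ c1); first exact: Rhausdorff.
  suff -> : (fun n => \sum_(j < n) aln R j * expR (- j.+1%:R * l) * (expR ((j.+1%:R - s) * l) / (j.+1%:R - s))) =
    (fun n => expR (- s * l) * poles s n) by exact: sc.
  apply/funext => n; rewrite mulr_sumr; apply: eq_bigr => j _.
  have -> : expR (- s * l) = expR (- j.+1%:R * l) * expR ((j.+1%:R - s) * l).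
    by rewrite -expRD; congr expR; ring.
  by ring.
have e2 : J2 = expR (- s * l) * Ps (- s).
  apply: (cvg_unique _ c2); first exact: Rhausdorff.
  suff -> : (fun n => \sum_(j < n) aln R j * expR (j.+1%:R * l) * (expR (- (j.+1%:R + s) * l) / (j.+1%:R + s))) =
    (fun n => expR (- s * l) * poles (- s) n) by exact: sc.
  apply/funext => n; rewrite mulr_sumr; apply: eq_bigr => j _.
  have -> : expR (- s * l) = expR (j.+1%:R * l) * expR (- (j.+1%:R + s) * l).
    by rewrite -expRD; congr expR; ring.
  by rewrite opprK; ring.
have -> : expR (- s * l) * (s^-1 ^+ 2 + (Ps s + Ps (- s))) = J1 + (expR (- s * l) / s ^+ 2 + J2).
  by rewrite e1 e2 exprVn; ring.
apply: (isint_split _ _ _ _ H1 H2) => //.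
  by apply: measurable_funM; [exact: meas_exp|exact: meas_ln1].
by move=> u; exact: gT_ge0.
Qed.

Let zeta_cvg (s : R) : 2^-1 < s -> cvgn (fun n => \sum_(k < n) expR (- s * logs k)).
Proof.
move=> hs; have [B HB] := nu_dirichlet hp hq hs.
apply: (@abs_series_cvg R (fun k => expR (- s * logs k)) B) => n; apply: le_trans (HB n).
by apply: ler_sum => k _; rewrite ger0_norm ?expR_ge0.
Qed.

Let zet s : R := limn (fun n => \sum_(k < n) expR (- s * logs k)).

Let phi_integral (s : R) : 2^-1 < s < 1 ->
  isint `]-oo, +oo[ (g s) (zet s * (s^-1 ^+ 2 + (Ps s + Ps (- s)))).
Proof.
move=> /andP[s0 s1]; have s01 : 0 < s < 1 by lra.
have mT : measurable (`]-oo, +oo[ : set (measurableTypeR R)) by exact: measurable_itv.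
apply: (isint_series mT (fun k u => gT_ge0 s k u) (fun u _ => @gT_cvg s u) (meas_g s) (fun k => T_integral k s01)).
by under eq_fun do rewrite -mulr_suml; apply: cvgM; [exact: zeta_cvg|exact: cvg_cst].
Qed.

Definition hcoef j : R := aln R j * limn (fun n => \sum_(k < n) expR (- j.+1%:R * logs k)).

Let B0_ex : exists B, 0 <= B /\ forall n, \sum_(k < n) expR (- logs k) <= B.
Proof.
have [B HB] := nu_inv hp hq; exists B; split; first by have := HB 0%N; rewrite big_ord0.
by move=> n; apply: le_trans (HB n); apply: ler_sum => k _; rewrite expRN expR_logs.
Qed.

Let exp_geo j k : expR (- j.+1%:R * logs k) <= expR (- logs k) * 4^-1 ^+ j.
Proof.
have -> : (4^-1 : R) ^+ j = expR (- (j%:R * ln 4)) by rewrite expRN expRM_natl lnK ?posrE// exprVn.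
rewrite -expRD ler_expR -natr1; have := ler_wpM2l (ler0n R j) (logs_ge k).
by rewrite mulNr mulrDl mul1r; lra.
Qed.

Let aln_le j : `|aln R j| <= 1.
Proof.
rewrite /aln normrM normrX normrN normr1 expr1n mul1r ger0_norm ?invr_ge0//.
by rewrite invf_le1 ?ltr0n// ler1n.
Qed.

Let geo4 n : \sum_(j < n) (4^-1 : R) ^+ j <= 2.
Proof.
have h : 0 <= (4^-1 : R) < 1 by lra.
apply: le_trans (geom_le n h) _; have -> : (1 - 4^-1)^-1 = 4 / 3 :> R by field.
by lra.
Qed.

Lemma csumR (r : nat -> R) (x : R) : (fun n => \sum_(k < n) r k) @ \oo --> x -> csum (fun k => (r k)%:C) = x%:C.
Proof.
move=> rx; rewrite /csum /=; apply/eqP; rewrite eq_complex /=; apply/andP; split; apply/eqP.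
  exact: cvg_lim rx.
by under eq_fun do rewrite big1//; apply: lim_cst.
Qed.

(** Expanding in powers of e^u and summing over the eigenvalues first yields
    a sum of simple poles in s. *)
Let left_half (s X : R) : 0 < s < 1 -> isint `]-oo, 0] (g s) X -> pole_sum hcoef s%:C = X%:C.
Proof.
move=> /andP[s0 s1] HX.
have js j : 0 < j.+1%:R - s by have := ler0n R j; rewrite -natr1; lra.
have js1 j : (j.+1%:R - s)^-1 <= (1 - s)^-1.
  by rewrite lef_pV2 ?posrE// ?subr_gt0// lerD2r ler1n.
have s1' : 0 <= (1 - s)^-1 by rewrite invr_ge0; lra.
have [B [B0 HB]] := B0_ex.
have [J HJ] := choice (fun k => let: ex_intro2 J a b := left_integral s1 (logs_ge0 k) in ex_intro _ J (conj a b)).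
pose x k j : R := aln R j * expR (- j.+1%:R * logs k) / (j.+1%:R - s).
have cJ k : (fun n => \sum_(j < n) x k j) @ \oo --> J k.
  have [_] := HJ k; suff -> : (fun n => \sum_(j < n) aln R j * expR (- j.+1%:R * logs k) *
     (expR ((j.+1%:R - s) * 0) / (j.+1%:R - s))) = (fun n => \sum_(j < n) x k j) by [].
  by apply/funext => n; apply: eq_bigr => j _; rewrite mulr0 expR0 mul1r.
have bnd n m : \sum_(k < n) \sum_(j < m) cabs (x k j)%:C <= B * 2 * (1 - s)^-1.
  apply: (@le_trans _ _ (\sum_(k < n) expR (- logs k) * (2 * (1 - s)^-1))); last first.
    by rewrite -mulr_suml -mulrA; apply: ler_wpM2r => //; rewrite mulr_ge0.
  apply: ler_sum => k _; apply: (@le_trans _ _ (\sum_(j < m) expR (- logs k) * 4^-1 ^+ j * (1 - s)^-1)).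
    apply: ler_sum => j _; rewrite cabsR normrM [`|(_ - _)^-1|]ger0_norm ?invr_ge0 ?(ltW (js j))//.
    apply: ler_pM => //; first by rewrite invr_ge0 ltW.
    rewrite normrM (ger0_norm (expR_ge0 _)); apply: le_trans (exp_geo j k).
    by rewrite ler_piMl ?expR_ge0.
  by rewrite -mulr_suml -mulr_sumr mulrA ler_wpM2r// ler_wpM2l ?expR_ge0.
have [_ _ ab1 _ swap] := @fubini_csum R (fun k j => (x k j)%:C) _ bnd.
have JE : (fun k => csum (fun j => (x k j)%:C)) = (fun k => (J k)%:C).
  by apply/funext => k; exact: csumR.
rewrite JE in ab1 swap; have [BJ HBJ] := ab1.
have cvJ : cvgn (fun n => \sum_(k < n) J k).
  by apply: (@abs_series_cvg R J BJ) => n; apply: le_trans (HBJ n); apply: ler_sum => k _; rewrite cabsR.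
have XE : X = limn (fun n => \sum_(k < n) J k).
  have m1 : measurable (`]-oo, 0] : set (measurableTypeR R)) by exact: measurable_itv.
  apply: isint_uniq HX _.
  exact: (isint_series m1 (fun k u => gT_ge0 s k u) (fun u _ => @gT_cvg s u) (meas_g s) (fun k => (HJ k).1) cvJ).
rewrite XE -(csumR cvJ) swap /pole_sum; congr csum; apply/funext => j.
have cj : cvgn (fun n => \sum_(k < n) expR (- j.+1%:R * logs k)).
  have j1 : (1 : R) <= j.+1%:R by rewrite ler1n.
  by apply: zeta_cvg; lra.
have c3 : (fun n => \sum_(k < n) x k j) @ \oo --> hcoef j / (j.+1%:R - s).
  have -> : hcoef j / (j.+1%:R - s) =
    (aln R j / (j.+1%:R - s)) * limn (fun n => \sum_(k < n) expR (- j.+1%:R * logs k)).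
    by rewrite /hcoef mulrAC.
  suff -> : (fun n => \sum_(k < n) x k j) =
      (fun n => aln R j / (j.+1%:R - s) * \sum_(k < n) expR (- j.+1%:R * logs k)).
    by apply: cvgM; [exact: cvg_cst|exact: cj].
  by apply/funext => n; rewrite mulr_sumr; apply: eq_bigr => k _; rewrite /x mulrAC.
apply/esym; apply: etrans (csumR c3) _; rewrite rmorphM fmorphV rmorphB.
by rewrite (rmorph_nat (real_complex R)).
Qed.

Let hcoef_sum : exists B, forall n, \sum_(j < n) `|hcoef j| / j.+1%:R <= B.
Proof.
have [B [B0 HB]] := B0_ex; exists (B * 2) => n.
apply: (@le_trans _ _ (\sum_(j < n) B * 4^-1 ^+ j)); last by rewrite -mulr_sumr ler_wpM2l.
apply: ler_sum => j _.
have cj : cvgn (fun n => \sum_(k < n) expR (- j.+1%:R * logs k)).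
  have j1 : (1 : R) <= j.+1%:R by rewrite ler1n.
  by apply: zeta_cvg; lra.
have l0 : 0 <= limn (fun n => \sum_(k < n) expR (- j.+1%:R * logs k)).
  by apply: limr_ge => //; apply: nearW => m; apply: sumr_ge0 => k _; exact: expR_ge0.
apply: (@le_trans _ _ `|hcoef j|).
  by rewrite ler_pdivrMr ?ltr0n// ler_peMr// ler1n.
rewrite /hcoef normrM (ger0_norm l0); apply: (@le_trans _ _ (limn (fun n => \sum_(k < n) expR (- j.+1%:R * logs k)))).
  by rewrite ler_piMl.
apply: limr_le => //; apply: nearW => m.
apply: (@le_trans _ _ (\sum_(k < m) expR (- logs k) * 4^-1 ^+ j)); first exact: ler_sum.
by rewrite -mulr_suml ler_wpM2r// exprn_ge0.
Qed.

Let aln_sum n : \sum_(j < n) `|aln R j| / j.+1%:R <= 2.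
Proof.
suff : \sum_(j < n) `|aln R j| / j.+1%:R <= 2 * (1 - n.+1%:R^-1).
  move=> h; apply: le_trans h _; have : 0 <= n.+1%:R^-1 :> R by rewrite invr_ge0.
  by move: (n.+1%:R^-1 : R) => y; lra.
elim: n => [|n IH]; first by rewrite big_ord0 invr1 subrr mulr0.
rewrite big_ord_recr /=; have n0 : 0 < n.+1%:R :> R by rewrite ltr0n.
have n2 : (n.+2%:R : R) = n.+1%:R + 1 by rewrite -natr1.
have -> : `|aln R n| = n.+1%:R^-1.
  by rewrite /aln normrM normrX normrN normr1 expr1n mul1r gtr0_norm ?invr_gt0.
rewrite n2; have n1 : 1 <= n.+1%:R :> R by rewrite ler1n.
move: (n.+1%:R : R) n0 n1 IH => x x0 x1 IH; apply: le_trans (lerD IH (lexx _)) _.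
rewrite -subr_ge0; have -> : 2 * (1 - (x + 1)^-1) - (2 * (1 - x^-1) + x^-1 / x) = (x - 1) / (x ^+ 2 * (x + 1)).
  by field; rewrite !gt_eqF//; lra.
by rewrite divr_ge0 ?mulr_ge0 ?exprn_ge0//; lra.
Qed.

Let itv0 : measurable (`[0, +oo[ : set (measurableTypeR R)). Proof. exact: measurable_itv. Qed.

Let A_ex : exists m : nat -> R, (forall r, 0 < r -> exists B, forall n, \sum_(j < n) `|m j| * r ^+ j <= B) /\
  forall s, 0 <= s -> exists2 J, isint `[0, LL] (g s) J &
    (fun n => \sum_(j < n) (-1) ^+ j * m j * s ^+ j) @ \oo --> J.
Proof.
have [B [B0 HB]] := B0_ex.
apply: moments => // [u|r r0]; first by rewrite /= !in_itv /= andbT => /andP[].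
exists (B * expR ((r + 2) * LL)) => u; rewrite /= in_itv /= => /andP[u0 uL].
have pB : phi u <= expR u * B.
  rewrite -(cvg_lim _ (@phi_cvg u))//; apply: limr_le; first exact: cvgP (@phi_cvg u).
  apply: nearW => n; apply: le_trans (ler_wpM2l (expR_ge0 u) (HB n)); rewrite mulr_sumr.
  apply: ler_sum => k _; rewrite -expRD; exact: (andP (ln1_le (expR_ge0 _))).2.
apply: le_trans (ler_wpM2l (expR_ge0 _) pB) _.
rewrite mulrA -expRD mulrC -mulrA -expRD ler_wpM2l// ler_expR.
have : (r + 2) * u <= (r + 2) * LL by rewrite ler_wpM2l// addr_ge0.
by rewrite mulrDl; lra.
Qed.

Let eps := epsilon p q.

Let E_ex : exists m : nat -> R, (forall r, 0 < r -> exists B, forall n, \sum_(j < n) `|m j| * r ^+ j <= B) /\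
  forall s, 0 <= s -> exists2 J, isint `[0, +oo[ (fun u => expR (- s * u) * eps u) J &
    (fun n => \sum_(j < n) (-1) ^+ j * m j * s ^+ j) @ \oo --> J.
Proof.
apply: moments => //.
- have mid : measurable_fun setT (fun u : R => u) by exact: measurable_id.
  have mL : measurable_fun setT (fun u : R => phi (u + LL)).
    by apply: (measurableT_comp meas_phi); exact: measurable_funD.
  apply: measurable_funD; last exact: measurable_cst.
  apply: measurable_funB; last by apply: measurable_funM.
  by apply: measurable_funB; [exact: mL|apply: measurable_funM; [exact: measurable_cst|exact: meas_phi]].
- by move=> u _; have /andP[] := epsilon_range hp hq 0 u.
move=> r r0; pose K := (Num.truncn r).+1.
exists (2 * expR (\sum_(k < K) ln (nu p q k.+1))) => u; rewrite /= in_itv /= andbT => u0.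
have /andP[_ h] := epsilon_range hp hq K u; apply: le_trans (ler_wpM2l (expR_ge0 _) h) _.
rewrite mulrCA -mulrA ler_pM2l// -!expRD ler_expR.
have rK : r * u <= K%:R * u by rewrite ler_wpM2r// ltW// Num.Theory.truncnS_gt.
by rewrite -natr1 mulrDl mul1r; lra.
Qed.

(** The identity zeta M = N on the real interval: the transform of phi over the
    line is zeta M term by term, and the functional equation of phi determines
    its part over the positive half-line. *)
Lemma mellin_identity : exists A E : nat -> R[i],
  [/\ forall r, 0 < r -> exists B, norm_le A r B, forall r, 0 < r -> exists B, norm_le E r B &
   forall s : R, 2^-1 < s < 1 ->
     zetaC logs s%:C * mellinM (aln R) s%:C = mellinN hcoef A E LL KK s%:C].
Proof.
have [ma [Ha Ia]] := A_ex; have [me [He Ie]] := E_ex.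
pose cf (m : nat -> R) j := ((-1) ^+ j * m j)%:C.
have ent (m : nat -> R) : (forall r : R, 0 < r -> exists B, forall n, \sum_(j < n) `|m j| * r ^+ j <= B) ->
    forall r, 0 < r -> exists B, norm_le (cf m) r B.
  move=> H r /H[B HB]; exists B => n; apply: le_trans (HB n); apply: ler_sum => j _.
  by rewrite cabsR normrM normrX normrN normr1 expr1n mul1r.
have ps (m : nat -> R) (s J : R) : (fun n => \sum_(j < n) (-1) ^+ j * m j * s ^+ j) @ \oo --> J -> psum (cf m) s%:C = J%:C.
  move=> c; apply: etrans (csumR c); rewrite /psum; congr csum; apply/funext => j.
  by rewrite /cf -rmorphXn -rmorphM.
exists (cf ma), (cf me); split; [exact: ent|exact: ent|].
move=> s hs; have [s0 s1] := andP hs; have s00 : 0 < s by lra.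
have [Av HA cA] := Ia s (ltW s00); have [Ev HE cE] := Ie s (ltW s00).
have HZ := phi_integral hs.
have mT : measurable (`]-oo, +oo[ : set (measurableTypeR R)) by exact: measurable_itv.
have m1 : measurable (`]-oo, 0] : set (measurableTypeR R)) by exact: measurable_itv.
have m2 : measurable (`[LL, +oo[ : set (measurableTypeR R)) by exact: measurable_itv.
have [X HX] := isint_sub mT m1 (fun u _ => isT) HZ.
have [J HJ] := isint_sub mT itv0 (fun u _ => isT) HZ.
have [J2 HJ2] : exists I, isint `[LL, +oo[ (g s) I.
  by apply: isint_sub HJ => // u; rewrite /= !in_itv /= !andbT; apply: le_trans; exact: ltW.
have ZE : zet s * (s^-1 ^+ 2 + (Ps s + Ps (- s))) = X + J.
  by apply: isint_uniq HZ _; apply: (isint_split (meas_g s) (g_ge0 s) _ _ HX HJ).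
have JE : J = Av + J2.
  by apply: isint_uniq HJ _; apply: (isint_split (meas_g s) (g_ge0 s) _ _ HA HJ2) => //; rewrite bnd_simp ltW.
pose rr := expR (- LL * s).
have HS : isint `[0, +oo[ (fun u => g s (u + LL)) J2.
  apply: isint_ge0 => //.
    by apply: (measurableT_comp (meas_g s)); apply: measurable_funD => //; exact: measurable_id.
  have [_ _ e0] := HJ2.
  have mt k : measurable_fun setT (fun u : R => expR (- s * u) * T k u).
    by apply: measurable_funM; [exact: meas_exp|exact: meas_ln1].
  have mt' k : measurable_fun setT (fun u : R => expR (- s * (u + LL)) * T k (u + LL)).
    apply: (measurableT_comp (mt k)).
    by apply: measurable_funD; [exact: measurable_id|exact: measurable_cst].
  have e1 := int_series m2 mt (fun k u => gT_ge0 s k u) (fun u _ => @gT_cvg s u).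
  have e2 := int_series itv0 mt' (fun k u => gT_ge0 s k (u + LL)) (fun u _ => @gT_cvg s (u + LL)).
  apply: etrans e2 _; apply: etrans _ (etrans (esym e1) e0).
  apply: eq_eseriesr => k _; apply/esym/(@int_shift R (fun u => expR (- s * u) * T k u)); last first.
    by move=> u; exact: gT_ge0.
  move=> u; apply: cvgM; first exact: cont_exp.
  apply: (@continuous_comp _ _ _ (fun u : R => 1 + expR (u - logs k)) (@ln R)).
    apply: cvgD; first exact: cvg_cst.
    apply: (@continuous_comp _ _ _ (fun u : R => u - logs k) (@expR R)); last exact: continuous_expR.
    by apply: cvgB; [exact: cvg_id|exact: cvg_cst].
  by apply: continuous_ln; rewrite addr_gt0// expR_gt0.
have HS' := isintZ rr itv0 (isintD itv0 (isintZ 3 itv0 HJ) (isintD itv0 (isintZ 2 itv0 (isint_linexp 0 s00))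
   (isintD itv0 (isintZ (- KK) itv0 (isint_exp 0 s00)) HE))).
have J2E : J2 = rr * (3 * J + (2 * (expR (- s * 0) / s ^+ 2) + (- KK * (expR (- s * 0) / s) + Ev))).
  apply: isint_uniq HS _; apply: isint_ext HS' => //.
    by apply: (measurableT_comp (meas_g s)); apply: measurable_funD => //; exact: measurable_id.
  move=> u _; rewrite /g /eps /epsilon -/(phi (u + _)) -/(phi u) -/LL /rr.
  have -> : - s * (u + LL) = - LL * s + - s * u by ring.
  by rewrite expRD /KK; ring.
have rr3 : 3 * rr < 1.
  have [B HB] := nu_dirichlet hp hq s0.
  have e3 : expR (ln 3) = 3 :> R by rewrite lnK ?posrE.
  have l9 : 2 * ln 3 <= LL.
    have e9 : (2 * ln 3 : R) = ln 9.
      have -> : 9 = 3 * 3 :> R by ring.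
      by rewrite lnM ?posrE//; ring.
    by rewrite e9 ler_ln ?posrE//; [exact: lam9|exact: lam_gt0].
  rewrite -[X in X * rr]e3 /rr -expRD -[ltRHS]expR0 ltr_expR.
  have : 0 < (s - 2^-1) * LL by rewrite mulr_gt0 ?subr_gt0.
  by rewrite mulrBl; lra.
have zC : zetaC logs s%:C = (zet s)%:C.
  transitivity (csum (fun k => (expR (- s * logs k))%:C)); last exact: csumR (zeta_cvg s0).
  rewrite /zetaC; congr csum; apply/funext => k.
  by rewrite -rmorphN -rmorphM cexpR.
have pC s' : s' < 1 -> pole_sum (aln R) s'%:C = (Ps s')%:C.
  move=> h; transitivity (csum (fun j => (aln R j / (j.+1%:R - s'))%:C)); last exact: csumR (poles_cvg h).
  rewrite /pole_sum; congr csum; apply/funext => j.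
  by rewrite [in RHS]rmorphM [in RHS]fmorphV [in RHS]rmorphB (rmorph_nat (real_complex R)).
have sc : scaleC LL s%:C = rr%:C by rewrite /scaleC -rmorphN -rmorphM cexpR.
have hC : pole_sum hcoef s%:C = X%:C by apply: left_half => //; lra.
have ns1 : - s < 1 by lra.
rewrite /mellinM /mellinN zC hC sc (ps _ _ _ cA) (ps _ _ _ cE) -[in pole_sum _ (- _)]rmorphN !pC//.
rewrite -fmorphV -!rmorphXn -!rmorphD -rmorphM.
rewrite (_ : 2 = (2 : R)%:C); last by rewrite rmorph_nat.
rewrite (_ : 3 = (3 : R)%:C); last by rewrite rmorph_nat.
rewrite -(rmorph1 (real_complex R)) -!rmorphM -!rmorphB -!rmorphD -!rmorphM -!rmorphD -fmorphV -rmorphM -rmorphD.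
congr (_%:C); rewrite ZE; congr (_ + _).
have d0 : 1 - 3 * rr != 0 by rewrite gt_eqF// subr_gt0.
apply: (mulIf d0); rewrite mulfVK//.
rewrite mulr0 expR0 in J2E.
have -> : J * (1 - 3 * rr) = J - rr * (3 * J) by ring.
have e : J - rr * (3 * J) = Av + (J2 - rr * (3 * J)) by rewrite {1}JE; ring.
by rewrite e J2E !div1r exprVn; ring.
Qed.

Theorem zeta_continuation : exists Z : R[i] -> R[i],
  [/\ meromorphic (Z : R[i]^o -> R[i]^o),
   forall s, 3 / 4 < complex.Re s -> Z s = zetaC logs s
   & jet Z 0 (-1) ((ln (p * q))%:C)].
Proof.
have [A [E [HA HE id]]] := mellin_identity; have [B HB] := hcoef_sum.
have B1 n : \sum_(j < n) `|aln R j| / j.+1%:R <= Num.max 2 B by rewrite le_max aln_sum.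
have B2 n : \sum_(j < n) `|hcoef j| / j.+1%:R <= Num.max 2 B by rewrite le_max HB orbT.
have [Z [mZ ZE jZ]] := continuation logs_ge0 (@nu_dirichlet R p q hp hq) B1 B2 HA HE id.
exists Z; split=> //; suff -> : ln (p * q) = (KK - LL) / 2 by [].
by rewrite /KK; field.
Qed.
End Mellin.

(** * The regularized determinant *)

Section RegularizedDet.
Variable R : realType.
Variables p q : R.
Hypothesis hp : 0 < p < 1.
Hypothesis hq : q = 1 - p.

(** The first eigenvalue is 0 and contributes nothing, which shifts the
    index by one. *)
Lemma zeta_series (s : R[i]) : 2^-1 < complex.Re s ->
  series (fun k => if nu p q k == 0 then 0 else cpow (nu p q k) (- s)) @ \oo -->
    (zetaC (logs p q) s : R[i]^o).
Proof.
move=> hs; have [ab _] := zetaC_ana (logs_ge0 hp hq) (@nu_dirichlet R p q hp hq) hs.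
apply/cvgC_ccvg => e /(csumP ab)[N HN]; exists N.+1 => -[//|n] /HN.
congr (cabs (_ - _) <= _); rewrite /series /= big_mkord big_ord_recl nu0// eqxx add0r.
apply: eq_bigr => k _; have n0 := nuS_gt0 hp hq k.
by rewrite /= gt_eqF.
Qed.

(** Every spectral zeta function is the same near 0: it is determined on a
    half-plane by the spectrum, which is unique. *)
Lemma regularized_detE (D : R) : is_regularized_det p q D <-> D = (p * q)^-1.
Proof.
have a0 := pq0 hp hq; have [Z [mZ ZE jZ]] := zeta_continuation hp hq.
have val : cexp (- (ln (p * q))%:C) = ((p * q)^-1)%:C.
  by rewrite -rmorphN cexpR expRN lnK ?posrE.
split=> [[Z' [d [[mZ' [mu' smu' [sigma Hs]]] dZ'] De]]|->]; last first.
  exists Z, (ln (p * q))%:C; last by rewrite val.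
  split; last exact: jet_is_derive jZ.
  split=> //; exists (nu p q); first exact: is_spectrum_nu.
  exists (3 / 4) => s hs; rewrite ZE//; apply: zeta_series; lra.
have mu'E : mu' = nu p q.
  by apply/funext; exact: spectrum_unique smu' (is_spectrum_nu hp hq).
rewrite mu'E in Hs.
pose M := Num.max sigma 1.
have eqM s : M < complex.Re s -> Z' s = Z s.
  rewrite gt_max => /andP[h1 h2]; have h3 : 3 / 4 < complex.Re s by lra.
  have h4 : 2^-1 < complex.Re s by lra.
  rewrite ZE//; apply: ccvg_unique (_ : ccvg _ (Z' s)) _; first exact/cvgC_ccvg/Hs.
  exact/cvgC_ccvg/zeta_series.
have near_a : pnearC (M + 1)%:C (fun s => Z' s - Z s = 0).
  exists 1; split=> // s _ hs; rewrite eqM ?subrr//.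
  have := le_lt_trans (cabs_Re _) hs; rewrite ltr_norml => /andP[h _].
  by move: h; case: (s) => x y /=; lra.
have near0 : pnearC 0 (fun s => Z' s = Z s).
  have := @identity_theorem R (fun s => Z' s - Z s) (M + 1)%:C 0 _ near_a.
  move=> /(_ (fun t _ => lauB (meromorphic_lau mZ' _) (meromorphic_lau mZ _))).
  by apply: pnearC_imp => s _ /eqP; rewrite subr_eq0 => /eqP.
have dE := is_derive_jet dZ' jZ near0.
by move: De; rewrite dE val => /(congr1 (@complex.Re R)).
Qed.
End RegularizedDet.

Theorem corollary5p3 (R : realType) (p q : R) (hp : 0 < p < 1) (hq : q = 1 - p) :
  (exists detL : R, is_regularized_det p q detL) /\
  forall detL : R, is_regularized_det p q detL ->
    forall n : nat,
      ln (det_laplacian p q n) =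
        (nverts n)%:R * (ln 2 + ln (p * q) / 2)
        + n%:R * ln ((1 - q ^+ 2) * (1 - p ^+ 2) / (p * q) ^+ 2)
        + ln detL.
Proof.
have a0 := pq0 hp hq; split=> [|D /(regularized_detE hp hq) -> n].
  by exists (p * q)^-1; apply/(regularized_detE hp hq).
have l0 : 0 < lambda p q := lam_gt0 hp hq.
rewrite det_laplacianE// lnM ?posrE ?mulr_gt0 ?exprn_gt0// lnM ?posrE ?exprn_gt0//.
rewrite !lnXn ?ltr0n// lnV ?posrE//.
have -> : (1 - q ^+ 2) * (1 - p ^+ 2) / (p * q) ^+ 2 = lambda p q.
  by rewrite lamE// hq; field; have := p0 hp; have := p1 hp; lra.
(* the vertices number twice 3^n, so that the exponent 3^n - 1 of pq supplies
   half of |V_n| and the constant - ln (p q) *)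
have e3 : ((3 ^ n).-1)%:R = (nverts n)%:R / 2 - 1 :> R.
  rewrite /nverts natrM mulrAC mulfV ?mul1r ?pnatr_eq0//.
  by rewrite -[in RHS](prednK (n := 3 ^ n)) ?expn_gt0// -natr1 addrK.
have -> : nv n = nverts n by [].
rewrite -[ln 2 *+ _]mulr_natl -[ln (lambda p q) *+ _]mulr_natl -[ln (p * q) *+ _]mulr_natl e3.
by move: ((nverts n)%:R : R) (ln 2) (ln (lambda p q)) (ln (p * q)) => N a b c; field.
Qed.
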